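(* Let $\Omega\subseteq\mathbb{R}^2$ be open and bounded, $0<\alpha\leq\beta$, and let $(a_n)_{n\in\mathbb{N}}$ be a sequence in $M(\alpha,\beta;\Omega)$ such that there exist $(\alpha_n)_{n\in\mathbb{N}}$, $\alpha_{\mathrm h}$, $\alpha_{\mathrm m}$ in $L_\infty(\Omega^{(1)})$ with $a_n(x)=\alpha_n(x_1)\,1_{2\times2}$ for $n\in\mathbb{N}$ and $x=(x_1,x_2)\in\Omega$. Then the following conditions are equivalent: (i) $(a_n)_{n\in\mathbb{N}}$ $\mathrm{H}$-converges to $\operatorname{diag}(\alpha_{\mathrm h},\alpha_{\mathrm m})$ (that is, to the matrix-valued function $x\mapsto\operatorname{diag}(\alpha_{\mathrm h}(x_1),\alpha_{\mathrm m}(x_1))$ on $\Omega$). (ii) $\alpha_n^{-1}\to\alpha_{\mathrm h}^{-1}$ and $\alpha_n\to\alpha_{\mathrm m}$ in $\sigma(L_\infty(\Omega^{(1)}),L_1(\Omega^{(1)}))$ (i.e. weak-* ) as $n\to\infty$.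
   Context: $\mathbb{K}\in\{\mathbb{R},\mathbb{C}\}$ is the scalar field; inner products are antilinear in the first and linear in the second argument. $\Omega^{(1)}\subseteq\mathbb{R}$ denotes the image of $\Omega$ under the projection onto the first coordinate. $\alpha_n^{-1},\alpha_{\mathrm h}^{-1}$ are pointwise reciprocals (condition (ii) includes that $\alpha_{\mathrm h}^{-1}\in L_\infty(\Omega^{(1)})$). For $\Omega\subseteq\mathbb{R}^d$ open and bounded and $0<\alpha\leq\beta$, $M(\alpha,\beta;\Omega)$ is the set of $a\in L_\infty(\Omega)^{d\times d}$ with $\operatorname{Re}a\geq\alpha$ and $\operatorname{Re}a^{-1}\geq1/\beta$ (a.e. as matrices, equivalently as multiplication operators on $L_2(\Omega)^d$), where $\operatorname{Re}T=(T+T^* )/2$ and $\operatorname{Re}T\geq c$ means $\operatorname{Re}\langle\phi,T\phi\rangle\geq c\|\phi\|^2$ for all $\phi$. $H_0^1(\Omega)$ is the closure of $C_c^\infty(\Omega)$ in $H^1(\Omega)$, $\operatorname{grad}_0$ is the weak gradient with domain $H_0^1(\Omega)$, and $H^{-1}(\Omega)=H_0^1(\Omega)'$. $\mathrm{H}$-convergence: $(a_n)_n$ in $M(\alpha,\beta;\Omega)$ $\mathrm{H}$-converges to $a\in M(\alpha,\beta;\Omega)$ if for all $f\in H^{-1}(\Omega)$ and the (unique) $u_n\in H_0^1(\Omega)$ satisfying $\langle a_n\operatorname{grad}_0u_n,\operatorname{grad}_0\phi\rangle_{L_2(\Omega)^d}=f(\phi)$ for all $\phi\in H_0^1(\Omega)$,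 one has $u_n\rightharpoonup u$ weakly in $H_0^1(\Omega)$ and $a_n\operatorname{grad}_0u_n\rightharpoonup a\operatorname{grad}_0u$ weakly in $L_2(\Omega)^d$, where $u\in H_0^1(\Omega)$ is the (unique) solution of $\langle a\operatorname{grad}_0u,\operatorname{grad}_0\phi\rangle_{L_2(\Omega)^d}=f(\phi)$ for all $\phi\in H_0^1(\Omega)$. (Saying that a sequence $\mathrm{H}$-converges to a function includes that this function lies in $M(\alpha,\beta;\Omega)$.) *)

(* Defs.v *)
(* All functions are Borel representatives of their
   classes modulo null sets, defined on the whole ambient space: the values
   outside the domain D (or Omega) are irrelevant, except for test functions,
   which are extended by 0. *)
From HB Require Import structures.
From mathcomp Require Import all_boot all_order all_algebra.
From mathcomp Require Import complex.
From mathcomp Require Import all_classical all_reals all_analysis.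
Set Implicit Arguments.
Unset Strict Implicit.
Unset Printing Implicit Defensive.
Import Order.TTheory GRing.Theory Num.Theory.
Import numFieldNormedType.Exports.
Local Open Scope classical_set_scope.
Local Open Scope ring_scope.

(* Common interface for the two scalar fields; mkK x y plays the role of
   x + i y (and of x in the real case).  Only the two instances below are
   ever meant. *)
Record scalar_field (R : realType) := ScalarField {
  scalar_sort :> numFieldType;
  reK : scalar_sort -> R;
  imK : scalar_sort -> R;
  mkK : R -> R -> scalar_sort }.

Definition real_scalars (R : realType) : scalar_field R :=
  @ScalarField R R (fun x => x) (fun=> 0) (fun x _ => x).

Definition complex_scalars (R : realType) : scalar_field R :=
  @ScalarField R R[i] (@complex.Re R) (@complex.Im R) (@Complex R).

Definition conjK (R : realType) (K : scalar_field R) (z : K) : K :=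
  mkK K (reK z) (- imK z).

(* The norm of a numFieldType takes its values in that field. *)
Definition absK (R : realType) (K : scalar_field R) (z : K) : R := reK `|z|.

Definition dotK (R : realType) (K : scalar_field R) (n : nat)
    (u v : 'cV[K]_n) : K :=
  \sum_(i < n) conjK (u i 0) * v i 0.

Definition measurableK (R : realType) (K : scalar_field R)
    (d : measure_display) (T : measurableType d) (D : set T) (f : T -> K) :=
  measurable_fun D (fun x => reK (f x)) /\
  measurable_fun D (fun x => imK (f x)).

Definition integralK (R : realType) (K : scalar_field R)
    (d : measure_display) (T : measurableType d)
    (mu : {measure set T -> \bar R}) (D : set T) (f : T -> K) : K :=
  mkK K (\int[mu]_(x in D) reK (f x)) (\int[mu]_(x in D) imK (f x)).

Definition L1 (R : realType) (K : scalar_field R)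
    (d : measure_display) (T : measurableType d)
    (mu : {measure set T -> \bar R}) (D : set T) : set (T -> K) :=
  [set f | measurableK D f /\ mu.-integrable D (fun x => (absK (f x))%:E)].

Definition Linfty (R : realType) (K : scalar_field R)
    (d : measure_display) (T : measurableType d)
    (mu : {measure set T -> \bar R}) (D : set T) : set (T -> K) :=
  [set f | measurableK D f /\
    exists C : R, {ae mu, forall x, D x -> absK (f x) <= C}].

Definition L2 (R : realType) (K : scalar_field R)
    (d : measure_display) (T : measurableType d)
    (mu : {measure set T -> \bar R}) (D : set T) : set (T -> K) :=
  [set f | measurableK D f /\
    mu.-integrable D (fun x => (absK (f x) ^+ 2)%:E)].

Definition L2norm (R : realType) (K : scalar_field R)
    (d : measure_display) (T : measurableType d)
    (mu : {measure set T -> \bar R}) (D : set T) (f : T -> K) : R :=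
  Num.sqrt (\int[mu]_(x in D) absK (f x) ^+ 2).

Definition L2v (R : realType) (K : scalar_field R) (n : nat)
    (d : measure_display) (T : measurableType d)
    (mu : {measure set T -> \bar R}) (D : set T) : set (T -> 'cV[K]_n) :=
  [set F | forall i : 'I_n, @L2 R K d T mu D (fun x => F x i 0)].

Definition L2v_dot (R : realType) (K : scalar_field R) (n : nat)
    (d : measure_display) (T : measurableType d)
    (mu : {measure set T -> \bar R}) (D : set T) (F G : T -> 'cV[K]_n) : K :=
  integralK mu D (fun x => dotK (F x) (G x)).

Definition L2v_norm (R : realType) (K : scalar_field R) (n : nat)
    (d : measure_display) (T : measurableType d)
    (mu : {measure set T -> \bar R}) (D : set T) (F : T -> 'cV[K]_n) : R :=
  Num.sqrt (reK (L2v_dot mu D F F)).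

(* f_ --> f in sigma(L_infty(D), L_1(D)). *)
Definition weak_star_cvg (R : realType) (K : scalar_field R)
    (d : measure_display) (T : measurableType d)
    (mu : {measure set T -> \bar R}) (D : set T)
    (f_ : nat -> T -> K) (f : T -> K) : Prop :=
  [/\ forall n, Linfty mu D (f_ n),
      Linfty mu D f
    & forall g : T -> K, L1 mu D g ->
        integralK mu D (fun x => f_ n x * g x) @[n --> \oo] -->
        integralK mu D (fun x => f x * g x)].

(* The dual of a space S of W-valued functions with (semi)norm nrm.  A bounded
   linear functional automatically identifies functions at distance 0, i.e.
   those equal almost everywhere on the domain. *)
Definition dual (R : realType) (K : scalar_field R) (T : Type) (W : lmodType K)
    (S : set (T -> W)) (nrm : (T -> W) -> R) : set ((T -> W) -> K) :=
  [set f | (forall (c : K) (u v : T -> W), S u -> S v ->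
              f (fun x => c *: u x + v x) = c * f u + f v) /\
           exists C : R, forall u, S u -> absK (f u) <= C * nrm u].

Definition weak_cvg (R : realType) (K : scalar_field R) (T : Type)
    (W : lmodType K) (S : set (T -> W)) (nrm : (T -> W) -> R)
    (u_ : nat -> T -> W) (u : T -> W) : Prop :=
  forall f : (T -> W) -> K, dual S nrm f -> f (u_ n) @[n --> \oo] --> f u.

Definition lebesgue2 (R : realType) :
    {measure set (measurableTypeR R * measurableTypeR R)%type -> \bar R} :=
  (@lebesgue_measure R \x @lebesgue_measure R)%E.

Definition unit_vec (R : realType) (i : 'I_2) : R * R :=
  if i == 0 then (1, 0) else (0, 1).

(* C^infty: all iterated partial derivatives exist and are differentiable. *)
Definition smooth (R : realType) (f : R * R -> R) : Prop :=
  forall (s : seq 'I_2) (x : R * R),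
    differentiable
      (foldr (fun i (g : R * R -> R) y => 'D_(unit_vec R i) g y) f s) x.

(* C_c^infty(Omega), extended by 0 to the plane. *)
Definition test_function (R : realType) (K : scalar_field R)
    (Omega : set (R * R)) : set (R * R -> K) :=
  [set phi | [/\ smooth (fun x => reK (phi x)), smooth (fun x => imK (phi x)),
    compact (closure [set x | phi x != 0])
    & closure [set x | phi x != 0] `<=` Omega]].

Definition partialK (R : realType) (K : scalar_field R) (i : 'I_2)
    (phi : R * R -> K) (x : R * R) : K :=
  mkK K ('D_(unit_vec R i) (fun y => reK (phi y)) x)
        ('D_(unit_vec R i) (fun y => imK (phi y)) x).

Definition is_weak_grad (R : realType) (K : scalar_field R)
    (Omega : set (R * R)) (u : R * R -> K) (G : R * R -> 'cV[K]_2) : Prop :=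
  L2v (lebesgue2 R) Omega G /\
  forall (i : 'I_2) (phi : R * R -> K), test_function Omega phi ->
    integralK (lebesgue2 R) Omega (fun x => u x * partialK i phi x) =
    - integralK (lebesgue2 R) Omega (fun x => G x i 0 * phi x).

(* A representative of the weak gradient (0 if u has none in L_2). *)
Definition wgrad (R : realType) (K : scalar_field R) (Omega : set (R * R))
    (u : R * R -> K) : R * R -> 'cV[K]_2 :=
  xget (fun=> 0) [set G | is_weak_grad Omega u G].

Definition H1 (R : realType) (K : scalar_field R) (Omega : set (R * R)) :
    set (R * R -> K) :=
  [set u | L2 (lebesgue2 R) Omega u /\ exists G, is_weak_grad Omega u G].

Definition H1norm (R : realType) (K : scalar_field R) (Omega : set (R * R))
    (u : R * R -> K) : R :=
  Num.sqrt (L2norm (lebesgue2 R) Omega u ^+ 2 +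
            L2v_norm (lebesgue2 R) Omega (wgrad Omega u) ^+ 2).

(* Closure of C_c^infty(Omega) in H^1(Omega). *)
Definition H10 (R : realType) (K : scalar_field R) (Omega : set (R * R)) :
    set (R * R -> K^o) :=
  [set u | @H1 R K Omega u /\
    forall e : R, 0 < e -> exists phi : R * R -> K,
      test_function Omega phi /\ H1norm Omega (fun x => u x - phi x) < e].

Definition Hm1 (R : realType) (K : scalar_field R) (Omega : set (R * R)) :
    set ((R * R -> K^o) -> K) :=
  dual (@H10 R K Omega) (@H1norm R K Omega).

(* Re A >= c *)
Definition re_ge (R : realType) (K : scalar_field R) (n : nat) (A : 'M[K]_n)
    (c : R) : Prop :=
  forall v : 'cV[K]_n, c * reK (dotK v v) <= reK (dotK v (A *m v)).

(* M(alpha, beta; Omega) *)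
Definition coef_class (R : realType) (K : scalar_field R) (alpha beta : R)
    (Omega : set (R * R)) : set (R * R -> 'M[K]_2) :=
  [set a : R * R -> 'M[K]_2 |
    [/\ forall i j : 'I_2, Linfty (lebesgue2 R) Omega (fun x => a x i j),
    {ae lebesgue2 R, forall x, Omega x -> re_ge (a x) alpha}
    & {ae lebesgue2 R, forall x, Omega x ->
         a x \in unitmx /\ re_ge (invmx (a x)) beta^-1}]].

(* a grad_0 u *)
Definition flux (R : realType) (K : scalar_field R) (Omega : set (R * R))
    (a : R * R -> 'M[K]_2) (u : R * R -> K) (x : R * R) : 'cV[K]_2 :=
  a x *m wgrad Omega u x.

Definition solves (R : realType) (K : scalar_field R) (Omega : set (R * R))
    (a : R * R -> 'M[K]_2) (f : (R * R -> K^o) -> K) (u : R * R -> K^o) : Prop :=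
  H10 Omega u /\
  forall phi : R * R -> K^o, H10 Omega phi ->
    L2v_dot (lebesgue2 R) Omega (flux Omega a u) (wgrad Omega phi) = f phi.

(* For coefficients in coef_class the variational problems are uniquely
   solvable by Lax-Milgram, uniqueness being up to equality almost everywhere
   on Omega; u_ and u below range over the representatives of the solutions. *)
Definition H_converges (R : realType) (K : scalar_field R) (alpha beta : R)
    (Omega : set (R * R)) (a_ : nat -> R * R -> 'M[K]_2)
    (a : R * R -> 'M[K]_2) : Prop :=
  [/\ forall n, coef_class alpha beta Omega (a_ n),
      coef_class alpha beta Omega a
    & forall f : (R * R -> K^o) -> K, Hm1 Omega f ->
      forall (u_ : nat -> R * R -> K^o) (u : R * R -> K^o),
        (forall n, solves Omega (a_ n) f (u_ n)) -> solves Omega a f u ->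
        weak_cvg (@H10 R K Omega) (@H1norm R K Omega) u_ u /\
        weak_cvg (@L2v R K 2 _ _ (lebesgue2 R) Omega)
          (@L2v_norm R K 2 _ _ (lebesgue2 R) Omega)
          (fun n => flux Omega (a_ n) (u_ n)) (flux Omega a u)].

(* Main.v *)
(* Write q_n = a_n grad u_n.  Stratification gives q_n^2 = alpha_n d_2 u_n and
   d_1 u_n = alpha_n^-1 q_n^1, so only products of a function theta of x_1 with
   d_2 u_n or with q_n^1 have to be passed to the limit.  Both behave well:
   theta d_2 u_n = d_2 (theta u_n), and if U d_1 psi + Z d_2 psi = W psi in the
   integrated sense for all test functions psi, then psi = Theta(x_1) e k with
   Theta' = theta turns the integral of U theta e k into one of Theta against
   U, Z and W.  This applies to U = u_n and to the divergence-free difference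
   of two fluxes, and one weak limit, of theta or of (U, Z, W), is enough.
   (ii) => (i): with theta = alpha_n - alpha_m and theta = 1 - alpha_h / alpha_n
   one gets q_n - a grad u_n -> 0 weakly; representing functionals by the adjoint
   Lax-Milgram problem for a yields u_n -> u weakly.
   (i) => (ii): choose the right-hand side for which the H-limit has the solution
   v1(x_1) v2(x_2).  The integrals of (alpha_n - alpha_m) v1 e against x_1 times
   v2' k against x_2 tend to 0, as do those of (alpha_h / alpha_n - 1) v1' e
   times v2 k; the identity (t psi)' psi - psi' (t psi) = psi^2 turns them into
   enough weak-star tests. *)
Require Import Defs.
From HB Require Import structures.
From mathcomp Require Import all_boot all_order all_algebra.
From mathcomp Require Import complex.
From mathcomp Require Import all_classical all_reals all_analysis.
From mathcomp Require Import measurable_realfun.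
From mathcomp Require Import ring lra.
Set Implicit Arguments.
Unset Strict Implicit.
Unset Printing Implicit Defensive.
Import Order.TTheory GRing.Theory Num.Theory.
Import numFieldNormedType.Exports.
Local Open Scope classical_set_scope.
Local Open Scope ring_scope.

(** * The scalar fields *)

(** All factors that have to be passed to the limit converge only weakly. In place of a compact
    embedding there is the fact that one factor depends on x_1 alone: the primitives of a bounded
    weakly null sequence tend to 0 pointwise and boundedly, hence in norm, and dually so do the
    integrals over {x_1 >= s} of a bounded weakly null sequence in the plane. Omega is no product,
    so everything is localised by bumps on rectangles contained in Omega, and identities are
    extended from bumps to square-integrable functions of x_1 by density. In (ii) => (i) the limit
    must also be shown to lie in the class. For diagonal matrices this means that the entries
    satisfy Re z >= alpha and |z|^2 <= beta Re z. The condition is convex, hence stable under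
    weak-star limits, and inversion turns it into one of the same kind, which settles alpha_h. Both
    scalar fields are treated at once by working with real and imaginary parts and with Hilbert
    spaces over R; i times a function recovers what real parts lose. *)

Section Scalars.
Variables (R : realType) (K : scalar_field R).
Hypothesis hK : K = real_scalars R \/ K = complex_scalars R.
Implicit Types (x y z : K) (a b : R).

Lemma mkK_ReIm z : mkK K (reK z) (imK z) = z.
Proof. by move: z; case: hK => -> // -[]. Qed.

Lemma reK_mk a b : reK (mkK K a b) = a.
Proof. by case: hK => ->. Qed.

Lemma imK_mk0 a : imK (mkK K a 0) = 0.
Proof. by case: hK => ->. Qed.

Lemma imK_mk a b : imK (mkK K a b) = 0 \/ imK (mkK K a b) = b.
Proof. by case: hK => ->; [left|right]. Qed.

Lemma reK_D x y : reK (x + y) = reK x + reK y.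
Proof. by move: x y; case: hK => -> // -[? ?] []. Qed.

Lemma imK_D x y : imK (x + y) = imK x + imK y.
Proof.
move: x y; case: hK => -> => [? ?|]; first by rewrite /= addr0.
by case=> [? ?] [].
Qed.

Lemma reK_N x : reK (- x) = - reK x.
Proof. by move: x; case: hK => -> // -[]. Qed.

Lemma imK_N x : imK (- x) = - imK x.
Proof. by move: x; case: hK => ->; [rewrite /= oppr0|case]. Qed.

Lemma reK_B x y : reK (x - y) = reK x - reK y.
Proof. by rewrite reK_D reK_N. Qed.

Lemma imK_B x y : imK (x - y) = imK x - imK y.
Proof. by rewrite imK_D imK_N. Qed.

Lemma reK_M x y : reK (x * y) = reK x * reK y - imK x * imK y.
Proof.
move: x y; case: hK => ->; first by move=> x y /=; rewrite mulr0 subr0.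
by case=> [? ?] [].
Qed.

Lemma imK_M x y : imK (x * y) = reK x * imK y + imK x * reK y.
Proof.
move: x y; case: hK => ->; first by move=> x y /=; rewrite mulr0 mul0r addr0.
by case=> [? ?] [? ?] /=; rewrite addrC.
Qed.

Lemma reK0 : reK (0 : K) = 0. Proof. by case: hK => ->. Qed.
Lemma imK0 : imK (0 : K) = 0. Proof. by case: hK => ->. Qed.
Lemma reK1 : reK (1 : K) = 1. Proof. by case: hK => ->. Qed.
Lemma imK1 : imK (1 : K) = 0. Proof. by case: hK => ->. Qed.

Lemma K_eqP x y : reK x = reK y -> imK x = imK y -> x = y.
Proof. by move=> r i; rewrite -(mkK_ReIm x) -(mkK_ReIm y) r i. Qed.

Lemma reK_conj z : reK (conjK z) = reK z.
Proof. by rewrite /conjK reK_mk. Qed.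

Lemma imK_conj z : imK (conjK z) = - imK z.
Proof.
by rewrite /conjK; move: z; case: hK => -> //= z; rewrite oppr0.
Qed.

Lemma absK_sqr z : absK z ^+ 2 = reK z ^+ 2 + imK z ^+ 2.
Proof.
rewrite /absK; move: z; case: hK => -> /=.
  by move=> z; rewrite real_normK ?num_real// [0 ^+ 2]expr0n addr0.
by case=> a b /=; rewrite sqr_sqrtr// addr_ge0// sqr_ge0.
Qed.

Lemma absK_ge0 z : 0 <= absK z.
Proof.
by rewrite /absK; move: z; case: hK => -> //= -[a b] /=; rewrite sqrtr_ge0.
Qed.

Lemma absKE z : absK z = Num.sqrt (reK z ^+ 2 + imK z ^+ 2).
Proof. by rewrite -absK_sqr sqrtr_sqr ger0_norm// absK_ge0. Qed.

Lemma absK_re z : `|reK z| <= absK z.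
Proof. by rewrite absKE -sqrtr_sqr ler_wsqrtr// lerDl sqr_ge0. Qed.

Lemma absK_im z : `|imK z| <= absK z.
Proof. by rewrite absKE -sqrtr_sqr ler_wsqrtr// lerDr sqr_ge0. Qed.

Lemma absK_le z : absK z <= `|reK z| + `|imK z|.
Proof.
rewrite -(@ler_pXn2r _ 2)// ?nnegrE ?absK_ge0// ?addr_ge0// absK_sqr.
rewrite -(real_normK (num_real (reK z))) -(real_normK (num_real (imK z))).
rewrite sqrrD -addrA (addrC (_ *+ 2)) addrA lerDl mulrn_wge0// mulr_ge0//.
Qed.

Lemma reK_V z : reK z^-1 = reK z / (reK z ^+ 2 + imK z ^+ 2).
Proof.
move: z; case: hK => -> /=.
  move=> z; rewrite [0 ^+ 2]expr0n addr0.
  have [->|z0] := eqVneq z 0; first by rewrite invr0 mul0r.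
  by field.
by case=> a b /=.
Qed.

Lemma imK_V z : imK z^-1 = - imK z / (reK z ^+ 2 + imK z ^+ 2).
Proof.
move: z; case: hK => -> /=; first by move=> z; rewrite oppr0 mul0r.
by case=> a b /=; rewrite mulNr.
Qed.

Lemma reK_sum (I : Type) (r : seq I) (P : pred I) (F : I -> K) :
  reK (\sum_(i <- r | P i) F i) = \sum_(i <- r | P i) reK (F i).
Proof.
by elim/big_rec2: _ => [|i a b _ <-]; rewrite ?reK0// reK_D.
Qed.

Lemma imK_sum (I : Type) (r : seq I) (P : pred I) (F : I -> K) :
  imK (\sum_(i <- r | P i) F i) = \sum_(i <- r | P i) imK (F i).
Proof.
by elim/big_rec2: _ => [|i a b _ <-]; rewrite ?imK0// imK_D.
Qed.

(** In [R[i]] the condition 0 < e says that e is real and positive, so the topology of K only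
    involves real radii; this brings convergence in K down to convergence in R. *)
Lemma cvgK_abs (f : nat -> K) (l : K) :
  (f n @[n --> \oo] --> l) <->
  (forall e : R, 0 < e -> \forall n \near \oo, absK (l - f n) < e).
Proof.
have -> : (f n @[n --> \oo] --> l) <->
    (forall e : K, 0 < e -> \forall n \near \oo, `|l - f n| < e).
  by split=> [/cvgrPdist_lt|h]; [|apply/cvgrPdist_lt].
rewrite /absK; move: f l; case: hK => -> /= f l; split.
- by [].
- by [].
- move=> h e e0.
  have /h : (0 : R[i]) < (e%:C)%C by rewrite ltcR.
  by apply: filterS => n; rewrite ltcE /= => /andP[].
- move=> h [e e'].
  rewrite ltcE /= => /andP[/eqP -> e0].
  apply: filterS (h e e0) => n.
  by rewrite ltcE /= eqxx.
Qed.

Lemma cvgK (f : nat -> K) (l : K) :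
  (f n @[n --> \oo] --> l) <->
  (reK (f n) @[n --> \oo] --> reK l) /\ (imK (f n) @[n --> \oo] --> imK l).
Proof.
rewrite cvgK_abs; split=> [h|[/cvgrPdist_lt h1 /cvgrPdist_lt h2] e e0].
  split; apply/cvgrPdist_lt => e e0; apply: filterS (h e e0) => n.
    by apply: le_lt_trans; rewrite -reK_B absK_re.
  by apply: le_lt_trans; rewrite -imK_B absK_im.
have e20 : 0 < e / 2 by rewrite divr_gt0.
near=> n; apply: le_lt_trans (absK_le _) _.
rewrite reK_B imK_B [ltRHS]splitr ltrD//; near: n; [exact: h1|exact: h2].
Unshelve. all: by end_near. Qed.

Lemma reK_int d (T : measurableType d) (mu : {measure set T -> \bar R})
  (D : set T) (f : T -> K) :
  reK (integralK mu D f) = \int[mu]_(x in D) reK (f x).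
Proof. by rewrite /integralK reK_mk. Qed.

Lemma imK_int d (T : measurableType d) (mu : {measure set T -> \bar R})
  (D : set T) (f : T -> K) :
  imK (integralK mu D f) = \int[mu]_(x in D) imK (f x).
Proof.
rewrite /integralK; move: f; case: hK => -> //= f.
by rewrite /Rintegral integral0.
Qed.

End Scalars.

Lemma quadratic_ge0 (R : realFieldType) (a b c : R) :
  (forall t, 0 <= t ^+ 2 * a + 2 * t * b + c) -> b ^+ 2 <= a * c.
Proof.
move=> h.
have c0 : 0 <= c by have := h 0; rewrite expr0n /= mul0r mulr0 mul0r !add0r.
have a0 : 0 <= a.
  rewrite leNgt; apply/negP => a0.
  have /ltW ia : 0 < - a^-1 by rewrite oppr_gt0 invr_lt0.
  (* If a < 0, this t is at least 1 and makes a t equal to a - (2 |b| + c), so that the polynomial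
     is negative at t. *)
  set t := 1 + (- a^-1) * (2 * `|b| + c).
  have t1 : 1 <= t by rewrite lerDl mulr_ge0// addr_ge0// mulr_ge0.
  have at_ : a * t = a - (2 * `|b| + c).
    by rewrite /t mulrDr mulr1 mulrA mulrN divff ?mulN1r// lt_eqF.
  have := h t; rewrite expr2 -mulrA (mulrC _ a) at_.
  have bb : b <= `|b| := ler_norm b.
  have : t * b <= t * `|b| by rewrite ler_wpM2l// (le_trans _ t1).
  have : c <= t * c by rewrite ler_peMl.
  have : t * a < 0 by rewrite nmulr_llt0// (lt_le_trans _ t1).
  by rewrite mulrBr mulrDr; lra.
have [a00|an0] := eqVneq a 0.
  rewrite a00 mul0r; have [->|b0] := eqVneq b 0; first by rewrite expr0n.
  (* With a = 0 and b nonzero the polynomial is affine and takes the value -1 at this point. *)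
  have := h (- (c + 1) / (2 * b)); rewrite a00 mulr0 add0r.
  have -> : 2 * (- (c + 1) / (2 * b)) * b = - (c + 1).
    by field; rewrite b0.
  by rewrite opprD addrAC addNr add0r oppr_ge0 ler10.
have {}a0 : 0 < a by rewrite lt_neqAle eq_sym an0.
have := h (- b / a).
have -> : (- b / a) ^+ 2 * a + 2 * (- b / a) * b + c = c - b ^+ 2 / a by field.
by rewrite subr_ge0 ler_pdivrMr// (mulrC a).
Qed.

(** The form in which Cauchy-Schwarz is used throughout: semidefinite forms bound squares, and the
    square root is taken once, here. *)
Lemma cvg_sqr_le (R : realType) (x_ : nat -> R) (x C : R) (e_ : nat -> R) :
  (forall n, (x_ n - x) ^+ 2 <= C * e_ n) -> e_ n @[n --> \oo] --> 0 ->
  x_ n @[n --> \oo] --> x.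
Proof.
move=> h e0.
have Ce : C * e_ n @[n --> \oo] --> 0.
  by rewrite -[X in _ --> X](mulr0 C); apply: cvgM => //; exact: cvg_cst.
have h2 : (x_ n - x) ^+ 2 @[n --> \oo] --> 0.
  apply: (@squeeze_cvgr _ _ _ _ (fun=> 0) (fun n => C * e_ n)) => //.
    by apply: nearW => n; rewrite sqr_ge0 h.
  exact: cvg_cst.
apply/subr_cvg0; apply/norm_cvg0P.
have -> : (fun n => `|x_ n - x|) = (fun n => Num.sqrt ((x_ n - x) ^+ 2)).
  by apply/funext => n; rewrite sqrtr_sqr.
rewrite -[X in _ --> X](@sqrtr0 R).
by apply: continuous_cvg => //; exact: sqrt_continuous.
Qed.

(** * Hilbert spaces given by semidefinite forms *)

Section SemiHilbert.
Variables (R : realType) (V : zmodType) (sc : R -> V -> V).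
Variable (dot : V -> V -> R).

(* A subspace which is complete for a positive semidefinite form: the Hilbert
   space is its quotient by the null vectors. *)
Record semi_hilbert (S : set V) : Prop := SemiHilbert {
  sh0 : S 0;
  shD : forall u v, S u -> S v -> S (u + v);
  shN : forall u, S u -> S (- u);
  shZ : forall c u, S u -> S (sc c u);
  shC : forall u v, S u -> S v -> dot u v = dot v u;
  shDl : forall u v w, S u -> S v -> S w -> dot (u + v) w = dot u w + dot v w;
  shZl : forall c u w, S u -> S w -> dot (sc c u) w = c * dot u w;
  sh_ge0 : forall u, S u -> 0 <= dot u u;
  sh_complete : forall u_ : nat -> V, (forall n, S (u_ n)) ->
    (forall e : R, 0 < e -> exists N, forall m n, (N <= m)%N -> (N <= n)%N ->
       dot (u_ m - u_ n) (u_ m - u_ n) < e) ->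
    exists2 u, S u & dot (u_ n - u) (u_ n - u) @[n --> \oo] --> 0 }.

Definition linear_on (S : set V) (l : V -> R) : Prop :=
  (forall u v, S u -> S v -> l (u + v) = l u + l v) /\
  (forall c u, S u -> l (sc c u) = c * l u).

Section Facts.
Variables (S : set V) (H : semi_hilbert S).

Lemma linear_on0 l : linear_on S l -> l 0 = 0.
Proof.
move=> [lD _]; have := lD 0 0 (sh0 H) (sh0 H); rewrite addr0 => /eqP.
by rewrite -subr_eq0 opprD addNKr oppr_eq0 => /eqP.
Qed.

Lemma linear_onN l u : linear_on S l -> S u -> l (- u) = - l u.
Proof.
move=> ll Su; have := ll.1 u (- u) Su (shN H Su); rewrite subrr linear_on0//.
by move=> /eqP; rewrite eq_sym addrC addr_eq0 => /eqP.
Qed.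

Lemma linear_onB l u v : linear_on S l -> S u -> S v -> l (u - v) = l u - l v.
Proof. by move=> ll Su Sv; rewrite ll.1// ?linear_onN//; exact: shN. Qed.

Lemma shB u v : S u -> S v -> S (u - v).
Proof. by move=> Su Sv; apply: (shD H) => //; apply: (shN H). Qed.

Lemma dot_linl w : S w -> linear_on S (dot^~ w).
Proof. by move=> Sw; split=> *; [apply: (shDl H)|apply: (shZl H)]. Qed.

Lemma dot_linr w : S w -> linear_on S (dot w).
Proof.
move=> Sw; split=> [u v Su Sv|c u Su].
  rewrite (shC H) ?(shDl H) ?(shC H Sw)//; exact: shD.
by rewrite (shC H) ?(shZl H) ?(shC H Sw)//; exact: shZ.
Qed.

Lemma dotZD t u v : S u -> S v ->
  dot (sc t u + v) (sc t u + v) = t ^+ 2 * dot u u + 2 * t * dot u v + dot v v.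
Proof.
move=> Su Sv; have Stu := shZ H t Su; have Sw := shD H Stu Sv.
rewrite (shDl H)// !(dot_linr _).1// (shZl H)// (shC H Sv Stu).
by rewrite (dot_linr Su).2// !(shZl H)//; ring.
Qed.

Lemma dot_CS u v : S u -> S v -> (dot u v) ^+ 2 <= dot u u * dot v v.
Proof.
move=> Su Sv; apply: quadratic_ge0 => t; rewrite -dotZD//.
by apply: (sh_ge0 H); apply: shD => //; apply: shZ.
Qed.

Lemma dotBB u v : S u -> S v ->
  dot (u - v) (u - v) = dot u u - 2 * dot u v + dot v v.
Proof.
move=> Su Sv; have SB := shB Su Sv.
rewrite (linear_onB (dot_linl SB))// !(linear_onB (dot_linr _))//.
by rewrite (shC H Sv Su); ring.
Qed.

Lemma bounded_cvg l C (u_ : nat -> V) u : linear_on S l ->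
  (forall v, S v -> l v ^+ 2 <= C * dot v v) -> (forall n, S (u_ n)) -> S u ->
  dot (u_ n - u) (u_ n - u) @[n --> \oo] --> 0 -> l (u_ n) @[n --> \oo] --> l u.
Proof.
move=> ll lC Su_ Su u_u; apply: (@cvg_sqr_le _ _ _ C _ _ u_u) => n.
by rewrite -linear_onB// lC//; exact: shB.
Qed.

(** Direct method: the representative minimises J u = <u, u> - 2 l u. A minimising sequence is
    Cauchy by the parallelogram law, and its members satisfy the Euler equation <w, u> = l w up to
    an error that vanishes in the limit. C may have any sign, whence |C| in the lower bound of J. *)
Lemma riesz l C : linear_on S l -> (forall u, S u -> l u ^+ 2 <= C * dot u u) ->
  exists2 g, S g & forall u, S u -> dot g u = l u.
Proof.
move=> ll lC; pose J u := dot u u - 2 * l u.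
have J_ge u : S u -> - `|C| <= J u.
  move=> Su; have N0 := sh_ge0 H Su.
  have C0 : 0 <= `|C| := normr_ge0 C.
  have lu : l u ^+ 2 <= `|C| * dot u u.
    by apply: le_trans (lC _ Su) _; rewrite ler_wpM2r ?ler_norm.
  suff : 2 * l u <= dot u u + `|C| by rewrite /J; lra.
  have [l0|l0] := leP (l u) 0; first by lra.
  (* Arithmetic-geometric mean: (2 l u)^2 <= 4 |C| <u, u> <= (<u, u> + |C|)^2. *)
  rewrite -(@ler_pXn2r _ 2)// ?nnegrE; [|lra|lra].
  by have := sqr_ge0 (dot u u - `|C|); nra.
pose A := J @` S.
have A0 : A !=set0 by exists (J 0), 0 => //; exact: sh0 H.
have Ainf : has_inf A.
  by split=> //; exists (- `|C|) => _ [u Su <-]; exact: J_ge.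
pose d := inf A.
have dJ u : S u -> d <= J u.
  by move=> Su; apply: ge_inf; [exact: Ainf.2|exists u].
have /choice[u_ u_P] n : exists u, S u /\ J u < d + n.+1%:R^-1.
  have e0 : 0 < n.+1%:R^-1 :> R by rewrite invr_gt0.
  by have [_ [u Su <-] Jud] := inf_adherent e0 Ainf; exists u.
have Su_ n : S (u_ n) := (u_P n).1.
have Jle n : J (u_ n) <= d + n.+1%:R^-1 by exact/ltW/(u_P n).2.
(* [u_ n] is within 1/(n + 1) of the infimum, so no perturbation t w lowers J by more. The
   discriminant then bounds (<w, u_n> - l w)^2 by <w, w>/(n + 1). *)
have quad n w t : S w ->
    0 <= t ^+ 2 * dot w w + 2 * t * (dot w (u_ n) - l w) + n.+1%:R^-1.
  move=> Sw; have := dJ (sc t w + u_ n) (shD H (shZ H t Sw) (Su_ n)).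
  rewrite /J dotZD// ll.1// ?ll.2//; last exact: (shZ H).
  have := Jle n; rewrite /J.
  rewrite {dJ Jle u_P}; move: (n.+1%:R^-1) (dot w w) (dot w _) (dot _ _) (l w) (l _) d.
  by move=> e a b x y z d' h1 h2; nra.
have inv0 : (n.+1%:R^-1 : R) @[n --> \oo] --> (0 : R).
  exact: (@cvg_harmonic R).
have lim w : S w -> dot w (u_ n) @[n --> \oo] --> l w.
  move=> Sw; apply: (@cvg_sqr_le _ _ _ (dot w w) _ _ inv0) => n.
  by apply: quadratic_ge0 => t; exact: quad.
have [u Su u_u] : exists2 u, S u & dot (u_ n - u) (u_ n - u) @[n --> \oo] --> 0.
  apply: (sh_complete H) => // e e0.
  (* J is at least d at the midpoint of u_m and u_n, so the parallelogram law gives <u_m - u_n, u_m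
     - u_n> <= 2/(m + 1) + 2/(n + 1); hence e / 4. *)
  have e4 : 0 < e / 4 by rewrite divr_gt0.
  have /cvgrPdist_lt/(_ _ e4)[N _ NP] := inv0.
  have {}NP n : (N <= n)%N -> n.+1%:R^-1 < e / 4.
    by move=> /NP /=; rewrite sub0r normrN ger0_norm ?invr_ge0.
  exists N => m n /NP Nm /NP Nn.
  have Sw := shZ H (2^-1) (shD H (Su_ m) (Su_ n)).
  have := dJ _ Sw; rewrite /J (dot_linr Sw).2 ?(shZl H)//; try exact: (shD H).
  rewrite ll.2 ?ll.1 ?dotBB//; last exact: (shD H).
  have Smn := shD H (Su_ m) (Su_ n).
  rewrite (dot_linr Smn).1// !(shDl H)// (shC H (Su_ n) (Su_ m)).
  have := Jle m; have := Jle n; rewrite /J.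
  move: Nm Nn; rewrite {dJ Jle u_P quad NP inv0 e4}.
  move: (m.+1%:R^-1) (n.+1%:R^-1) (dot (u_ m) (u_ m)) (dot (u_ m) (u_ n)).
  move: (dot (u_ n) (u_ n)) (l (u_ m)) (l (u_ n)) d.
  by move=> c x y d' p q a b; lra.
exists u => // w Sw; rewrite (shC H Su Sw).
have h1 := @bounded_cvg _ (dot w w) u_ u (dot_linr Sw) (fun v Sv => dot_CS Sw Sv) Su_ Su u_u.
by apply: (cvg_unique (@norm_hausdorff R R) h1 (lim w Sw)).
Qed.

End Facts.

(* The Riesz representative in P of the functional <., x> is the orthogonal
   projection of x onto P. *)
Lemma orthogonal_dense (S P : set V) : semi_hilbert S -> semi_hilbert P ->
  P `<=` S ->
  (forall z, S z -> (forall p, P p -> dot z p = 0) -> dot z z = 0) ->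
  forall x, S x -> exists2 p, P p & dot (x - p) (x - p) = 0.
Proof.
move=> HS HP PS ortho x Sx.
have lx : linear_on P (dot x).
  by split=> [u v Pu Pv|c u Pu]; [apply: (dot_linr HS Sx).1|apply: (dot_linr HS Sx).2]; exact: PS.
have [p Pp pP] := @riesz P HP (dot x) (dot x x) lx
  (fun u Pu => dot_CS HS Sx (PS _ Pu)).
exists p => //; apply: ortho; first exact: (shB HS) (PS _ Pp).
move=> q Pq; rewrite (linear_onB HS (dot_linl HS (PS _ Pq))) ?pP ?subrr//.
exact: PS.
Qed.

(** P collects the vectors that represent a functional B u. Coercivity makes P complete and leaves
    only null vectors in its orthogonal complement, so P contains, up to a null vector, the Riesz
    representative of l. *)
Lemma lax_milgram (S : set V) (B : V -> V -> R) (C c : R) (l : V -> R) (D : R) :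
  semi_hilbert S ->
  (forall v, S v -> linear_on S (B^~ v)) -> (forall u, S u -> linear_on S (B u)) ->
  (forall u v, S u -> S v -> B u v ^+ 2 <= C * (dot u u * dot v v)) ->
  0 < c -> (forall u, S u -> c * dot u u <= B u u) ->
  linear_on S l -> (forall u, S u -> l u ^+ 2 <= D * dot u u) ->
  exists2 u, S u & forall v, S v -> B u v = l v.
Proof.
move=> H Bl Br BC c0 Bc ll lD.
pose P := [set p | S p /\ exists2 u, S u & forall v, S v -> dot p v = B u v].
have PS : P `<=` S by move=> p [].
have HP : semi_hilbert P.
  split; try by move=> *; first [apply: (shC H)|apply: (sh_ge0 H)]; exact: PS.
  - split; first exact: sh0 H.
    exists 0; first exact: sh0 H.
    by move=> v Sv; rewrite (linear_on0 H (dot_linl H Sv)) (linear_on0 H (Bl v Sv)).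
  - move=> p q [Sp [u Su pu]] [Sq [v Sv qv]]; split; first exact: (shD H).
    exists (u + v); first exact: (shD H).
    by move=> w Sw; rewrite (shDl H)// pu// qv// (Bl w Sw).1.
  - move=> p [Sp [u Su pu]]; split; first exact: (shN H).
    exists (- u); first exact: (shN H).
    move=> w Sw.
    by rewrite (linear_onN H (dot_linl H Sw))// pu// (linear_onN H (Bl w Sw)).
  - move=> k p [Sp [u Su pu]]; split; first exact: (shZ H).
    exists (sc k u); first exact: (shZ H).
    by move=> w Sw; rewrite (shZl H)// pu// (Bl w Sw).2.
  - by move=> p q r /PS ? /PS ? /PS ?; exact: (shDl H).
  - by move=> k q r /PS ? /PS ?; exact: (shZl H).
  - move=> p_ Pp_ cau; have Sp_ n := PS _ (Pp_ n).
    have [p Sp p_p] := sh_complete H Sp_ cau.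
    have /choice[u_ u_P] n : exists u, S u /\
        forall v, S v -> dot (p_ n) v = B u v.
      by have [_ [u Su uP]] := Pp_ n; exists u.
    have Su_ n := (u_P n).1.
    (* For w = u_m - u_n and q = p_m - p_n one has c <w, w> <= B w w = <q, w>, whence c |w| <= |q|
       by Cauchy-Schwarz. *)
    have key m n : c ^+ 2 * dot (u_ m - u_ n) (u_ m - u_ n) <=
        dot (p_ m - p_ n) (p_ m - p_ n).
      have SW := shB H (Su_ m) (Su_ n); have SQ := shB H (Sp_ m) (Sp_ n).
      set w := u_ m - u_ n in SW *; set q := p_ m - p_ n in SQ *.
      have qw : dot q w = B w w.
        rewrite /q (linear_onB H (dot_linl H SW))// !(u_P _).2//.
        by rewrite -(linear_onB H (Bl w SW)).
      have := dot_CS H SQ SW; rewrite qw.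
      have := Bc w SW; have := sh_ge0 H SW; have := sh_ge0 H SQ.
      move: (dot w w) (dot q q) (B w w) => x y z y0 x0 cxz.
      have : (c * x) ^+ 2 <= z ^+ 2.
        by rewrite ler_pXn2r ?nnegrE ?(le_trans _ cxz)// mulr_ge0// ltW.
      move=> h1 h2; have := le_trans h1 h2.
      have [->|xn0] := eqVneq x 0; first by rewrite !mulr0.
      have {xn0}x0' : 0 < x by rewrite lt_neqAle eq_sym xn0.
      by rewrite exprMn expr2 (expr2 x) !mulrA ler_pM2r.
    have [u Su u_u] : exists2 u, S u & dot (u_ n - u) (u_ n - u) @[n --> \oo] --> 0.
      apply: (sh_complete H) => // e e0.
      have [|N NP] := cau (c ^+ 2 * e); first by rewrite mulr_gt0// exprn_gt0.
      exists N => m n Nm Nn.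
      have := le_lt_trans (key m n) (NP m n Nm Nn).
      by rewrite ltr_pM2l// exprn_gt0.
    exists p => //; split=> //; exists u => // v Sv.
    have h1 : dot (p_ n) v @[n --> \oo] --> dot p v.
      apply: (@bounded_cvg _ H (dot^~ v) (dot v v)) => //; first exact: dot_linl H _ Sv.
      by move=> w Sw; rewrite mulrC (dot_CS H).
    have h2 : B (u_ n) v @[n --> \oo] --> B u v.
      apply: (@bounded_cvg _ H (B^~ v) (C * dot v v)) => //; first exact: Bl.
      by move=> w Sw; apply: le_trans (BC _ _ Sw Sv) _; rewrite -mulrA (mulrC (dot v v)).
    have hT := @norm_hausdorff R R.
    apply: (cvg_unique hT h1).
    suff -> : (fun n => dot (p_ n) v) = (fun n => B (u_ n) v) by [].
    by apply/funext => n; rewrite (u_P n).2.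
have [g Sg gP] := riesz H ll lD.
have [p [Sp [u Su pu]] gp0] : exists2 p, P p & dot (g - p) (g - p) = 0.
  apply: (orthogonal_dense H HP PS) => // z Sz zP.
  have lz : linear_on S (B z) := Br z Sz.
  have [a Sa aP] := @riesz S H (B z) (C * dot z z) lz
     (fun v Sv => le_trans (BC _ _ Sz Sv) (eq_ind _ (fun t => _ <= t) (lexx _) _ (mulrA _ _ _))).
  (* The representative a of B z is itself in P, so z is orthogonal to it and B z z = <a, z> = 0. *)
  have Pa : P a by split=> //; exists z.
  have := Bc z Sz; rewrite -(aP z Sz) (shC H)// (zP a Pa) => h.
  apply/eqP; rewrite eq_le (sh_ge0 H)// andbT.
  by rewrite -(ler_pM2l c0) mulr0.
exists u => // v Sv; rewrite -pu// -gP//.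
have SB := shB H Sg Sp.
have := dot_CS H SB Sv; rewrite gp0 mul0r => h.
have : dot (g - p) v = 0 by apply/eqP; rewrite -sqrf_eq0 eq_le h sqr_ge0.
by rewrite (linear_onB H (dot_linl H Sv))// => /eqP; rewrite subr_eq0 => /eqP.
Qed.

End SemiHilbert.

(** * Real square-integrable functions *)

Section RealIntegrals.
Context d (T : measurableType d) (R : realType).
Variables (mu : {measure set T -> \bar R}) (D : set T) (mD : measurable D).
Implicit Types f g h b : T -> R.

Definition intg f := mu.-integrable D (fun x => (f x)%:E).

Lemma intg_meas f : intg f -> measurable_fun D f.
Proof. by move=> /measurable_int/measurable_EFinP. Qed.

Lemma eq_intg f g : {in D, f =1 g} -> intg f -> intg g.
Proof. by move=> fg; apply: eq_integrable => // x xD; rewrite fg. Qed.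

Lemma le_intg f g : measurable_fun D f -> (forall x, D x -> `|f x| <= `|g x|) ->
  intg g -> intg f.
Proof.
move=> mf fg; apply: le_integrable => //; first exact/measurable_EFinP.
Qed.

Lemma intg0 : intg (fun=> 0).
Proof. exact: integrable0. Qed.

Lemma intgD f g : intg f -> intg g -> intg (fun x => f x + g x).
Proof. by move=> f1 g1; have := integrableD mD f1 g1. Qed.

Lemma intgN f : intg f -> intg (fun x => - f x).
Proof. by move=> f1; have := integrableN f1. Qed.

Lemma intgB f g : intg f -> intg g -> intg (fun x => f x - g x).
Proof. by move=> f1 g1; apply: intgD => //; exact: intgN. Qed.

Lemma intgZ k f : intg f -> intg (fun x => k * f x).
Proof. by move=> f1; have := integrableZl mD k f1. Qed.

(** The measure need not be complete, so measurability does not pass to g by almost everywhere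
    equality and is assumed separately. *)
Lemma ae_intg f g : {ae mu, forall x, D x -> f x = g x} ->
  measurable_fun D g -> intg f -> intg g.
Proof.
move=> fg mg fi; apply/integrableP; split; first exact/measurable_EFinP.
move/integrableP: fi => [/measurable_EFinP mf].
rewrite (@ae_eq_integral _ _ _ mu D (fun x => `|(g x)%:E|%E) (fun x => `|(f x)%:E|%E))//.
- by apply: measurableT_comp => //; exact/measurable_EFinP.
- by apply: measurableT_comp => //; exact/measurable_EFinP.
- by move: fg; apply: filterS => x fg Dx; rewrite fg.
Qed.

Lemma ae_Rint f g : {ae mu, forall x, D x -> f x = g x} ->
  measurable_fun D f -> measurable_fun D g ->
  \int[mu]_(x in D) f x = \int[mu]_(x in D) g x.
Proof.
move=> fg mf mg; congr fine; apply: ae_eq_integral => //; try exact/measurable_EFinP.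
by move: fg; apply: filterS => x fg Dx; rewrite fg.
Qed.

Lemma Rintegral0 : \int[mu]_(x in D) (0 : R) = 0.
Proof. by rewrite /Rintegral integral0. Qed.

Lemma RintN f : intg f -> \int[mu]_(x in D) (- f x) = - \int[mu]_(x in D) f x.
Proof.
move=> fi; rewrite -[RHS]mulN1r -RintegralZl//.
by apply: eq_Rintegral => x _; rewrite mulN1r.
Qed.

Lemma Rint_eq0 f : intg f -> (forall x, D x -> 0 <= f x) ->
  \int[mu]_(x in D) f x = 0 -> {ae mu, forall x, D x -> f x = 0}.
Proof.
move=> fi f0 If.
have : (\int[mu]_(x in D) `|(f x)%:E| = 0)%E.
  have fin := integrable_fin_num mD fi.
  transitivity (\int[mu]_(x in D) (f x)%:E)%E.
    by apply: eq_integral => x /set_mem Dx; rewrite gee0_abs ?lee_fin ?f0.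
  by rewrite -(fineK fin) -[X in X%:E]/(\int[mu]_(x in D) f x) If.
move/(ae_eq_integral_abs mu mD (measurable_int _ fi)).
by apply: filterS => x h /h /= [].
Qed.

Lemma Rint_sub_eq0 f : intg f ->
  (forall E, E `<=` D -> measurable E -> \int[mu]_(x in E) f x = 0) ->
  {ae mu, forall x, D x -> f x = 0}.
Proof.
move=> fi h.
have : ae_eq mu D (fun x => (f x)%:E) (cst 0%E).
  apply: integral_ae_eq => // E ED mE; rewrite integral0.
  have fin := integrable_fin_num mE (integrableS mD mE ED fi).
  by rewrite -(fineK fin) -[X in X%:E]/(\int[mu]_(x in E) f x) h.
by apply: filterS => x h' /h' /= [].
Qed.

Lemma Rint_dominated (f_ : nat -> T -> R) f g :
  (forall n, measurable_fun D (f_ n)) -> measurable_fun D f ->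
  {ae mu, forall x, D x -> f_ n x @[n --> \oo] --> f x} -> intg g ->
  {ae mu, forall x, D x -> forall n, `|f_ n x| <= g x} ->
  intg f /\ \int[mu]_(x in D) f_ n x @[n --> \oo] --> \int[mu]_(x in D) f x.
Proof.
move=> mf_ mf ff gi fg.
have h1 n : measurable_fun D (fun x => (f_ n x)%:E) by exact/measurable_EFinP.
have h2 : measurable_fun D (fun x => (f x)%:E) by exact/measurable_EFinP.
have h3 : {ae mu, forall x, D x -> (f_ n x)%:E @[n --> \oo] --> (f x)%:E}.
  by move: ff; apply: filterS => x h /h; apply: cvg_EFin; apply: nearW.
have h4 : {ae mu, forall x n, D x -> (`|(f_ n x)%:E| <= (g x)%:E)%E}.
  by move: fg; apply: filterS => x h n /h; rewrite lee_fin.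
have [fi _ cv] := dominated_convergence mD h1 h2 h3 gi h4.
split=> //; have fin := integrable_fin_num mD fi.
by apply: fine_cvg; rewrite fineK.
Qed.

Definition sqint f := measurable_fun D f /\ intg (fun x => f x ^+ 2).

Lemma sqint_meas f : sqint f -> measurable_fun D f. Proof. by case. Qed.

Lemma sqintM f g : sqint f -> sqint g -> intg (fun x => f x * g x).
Proof.
move=> [mf f2] [mg g2].
apply: (le_intg _ _ (intgD f2 g2)); first exact: measurable_funM.
move=> x Dx; rewrite normrM [leRHS]ger0_norm ?addr_ge0 ?sqr_ge0//.
rewrite -(real_normK (num_real (f x))) -(real_normK (num_real (g x))).
move: (normr_ge0 (f x)) (normr_ge0 (g x)).
by move: `|f x| `|g x| => a b a0 b0; have := sqr_ge0 (a - b); nra.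
Qed.

Lemma sqint0 : sqint (fun=> 0).
Proof. by split=> //; rewrite expr0n; exact: intg0. Qed.

Lemma sqintD f g : sqint f -> sqint g -> sqint (fun x => f x + g x).
Proof.
move=> sf sg; split; first exact: measurable_funD sf.1 sg.1.
have := intgD (intgD sf.2 (intgZ 2 (sqintM sf sg))) sg.2.
by apply: eq_intg => x _; rewrite sqrrD mulr_natl.
Qed.

Lemma sqint_bM b f (C : R) : measurable_fun D b -> (forall x, D x -> `|b x| <= C) ->
  sqint f -> sqint (fun x => b x * f x).
Proof.
move=> mb bC [mf f2]; split; first exact: measurable_funM.
apply: (le_intg _ _ (intgZ (C ^+ 2) f2)).
  by apply: measurable_funX; exact: measurable_funM.
move=> x Dx; rewrite -exprMn !normrX !normrM lerXn2r ?nnegrE ?mulr_ge0// ler_wpM2r//.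
have C0 := le_trans (normr_ge0 _) (bC x Dx).
by rewrite (ger0_norm C0) bC.
Qed.

Lemma sqintZ k f : sqint f -> sqint (fun x => k * f x).
Proof. by move=> sf; apply: (@sqint_bM (fun=> k) _ `|k|). Qed.

Lemma sqintN f : sqint f -> sqint (fun x => - f x).
Proof.
by move=> /(sqintZ (-1)); congr sqint; apply/funext => x; rewrite mulN1r.
Qed.

Lemma sqintB f g : sqint f -> sqint g -> sqint (fun x => f x - g x).
Proof. by move=> sf sg; apply: sqintD => //; exact: sqintN. Qed.

Lemma ae_sqint f g : {ae mu, forall x, D x -> f x = g x} ->
  measurable_fun D g -> sqint f -> sqint g.
Proof.
move=> fg mg [mf f2]; split=> //; apply: ae_intg f2.
  by move: fg; apply: filterS => x h /h ->.
exact: measurable_funX.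
Qed.

Lemma sqint_aeM b f (C : R) : measurable_fun D b ->
  {ae mu, forall x, D x -> `|b x| <= C} ->
  sqint f -> sqint (fun x => b x * f x).
Proof.
move=> mb bC sf.
(* b clamped to [-|C|, |C|]: the bound now holds everywhere, and on D the function changes only on a
   null set. *)
pose b' x := Order.max (- `|C|) (Order.min `|C| (b x)).
have mb' : measurable_fun D b'.
  by apply: measurable_maxr => //; exact: measurable_minr.
have b'C x : D x -> `|b' x| <= `|C|.
  move=> _; rewrite ler_norml /b' le_max lexx /= ge_max ge_min lexx /= andbT.
  by rewrite lerNl (le_trans _ (normr_ge0 _))// oppr_le0.
apply: ae_sqint (sqint_bM mb' b'C sf); last exact: measurable_funM sf.1.
move: bC; apply: filterS => x h /h; rewrite ler_norml => /andP[h1 h2].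
congr (_ * _); rewrite /b'; have CC := ler_norm C.
rewrite (min_idPr _) ?(le_trans h2)//; apply/max_idPr.
by rewrite (le_trans _ h1)// lerN2.
Qed.

Definition ip f g := \int[mu]_(x in D) (f x * g x).

Lemma ipE f g : ip f g = \int[mu]_(x in D) (f x * g x). Proof. by []. Qed.

Lemma ipC f g : ip f g = ip g f.
Proof. by apply: eq_Rintegral => x _; rewrite mulrC. Qed.

Lemma ipDl f g h : sqint f -> sqint g -> sqint h ->
  ip (fun x => f x + g x) h = ip f h + ip g h.
Proof.
move=> sf sg sh; rewrite -RintegralD//; [|exact: sqintM|exact: sqintM].
by apply: eq_Rintegral => x _; rewrite mulrDl.
Qed.

Lemma ipZl k f h : sqint f -> sqint h -> ip (fun x => k * f x) h = k * ip f h.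
Proof.
move=> sf sh; rewrite -RintegralZl//; last exact: sqintM.
by apply: eq_Rintegral => x _; rewrite mulrA.
Qed.

Lemma ipBl f g h : sqint f -> sqint g -> sqint h ->
  ip (fun x => f x - g x) h = ip f h - ip g h.
Proof.
move=> sf sg sh; rewrite -RintegralB//; [|exact: sqintM|exact: sqintM].
by apply: eq_Rintegral => x _; rewrite mulrBl.
Qed.

Lemma ip_ge0 f : 0 <= ip f f.
Proof. by apply: Rintegral_ge0 => x _; rewrite -expr2 sqr_ge0. Qed.

Lemma ae_ip f f' g g' : {ae mu, forall x, D x -> f x = f' x} ->
  {ae mu, forall x, D x -> g x = g' x} -> measurable_fun D f ->
  measurable_fun D f' -> measurable_fun D g -> measurable_fun D g' ->
  ip f g = ip f' g'.
Proof.
move=> ff gg *; apply: ae_Rint; [|exact: measurable_funM|exact: measurable_funM].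
by move: ff gg; apply: filterS2 => x h1 h2 Dx; rewrite h1// h2.
Qed.

End RealIntegrals.

Lemma sqr_div2X (R : realFieldType) (a : R) k :
  (a / 2 ^+ k) ^+ 2 = a ^+ 2 * 4^-1 ^+ k.
Proof.
rewrite exprMn; congr (_ * _); rewrite -exprVn -exprM mulnC exprM.
by congr (_ ^+ _); field.
Qed.

(* The limit lies between the nondecreasing sequence a_k - 2 s / 2 ^ k and the
   nonincreasing sequence a_k + 2 s / 2 ^ k. *)
Lemma geometric_cauchy (R : realType) (a : nat -> R) (s : R) :
  (forall k, `|a k.+1 - a k| <= s / 2 ^+ k) ->
  exists l, forall k, `|l - a k| <= 2 * s / 2 ^+ k.
Proof.
move=> h; pose b k := a k - 2 * s / 2 ^+ k; pose c k := a k + 2 * s / 2 ^+ k.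
have s0 : 0 <= s by have := le_trans (normr_ge0 _) (h 0); rewrite expr0 divr1.
have st k : 2 * s / 2 ^+ k.+1 = s / 2 ^+ k.
  by rewrite exprS; field; rewrite expf_neq0.
have dbl k : 2 * s / 2 ^+ k = s / 2 ^+ k + s / 2 ^+ k by field; rewrite expf_neq0.
have bc k : b k <= c k.
  have : 0 <= s / 2 ^+ k by rewrite divr_ge0// exprn_ge0.
  by rewrite /b /c dbl; lra.
have hb k j : b k <= b (k + j)%N.
  elim: j => [|j ih]; first by rewrite addn0.
  apply: le_trans ih _; rewrite addnS /b st dbl.
  by have := h (k + j)%N; rewrite ler_norml => /andP[]; lra.
have hc k j : c (k + j)%N <= c k.
  elim: j => [|j ih]; first by rewrite addn0.
  apply: le_trans ih; rewrite addnS /c st dbl.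
  by have := h (k + j)%N; rewrite ler_norml => /andP[]; lra.
have hbc i j : b i <= c j.
  apply: le_trans (hb i j) _; apply: le_trans (bc _) _.
  by rewrite addnC; exact: hc.
have B0 : has_sup (range b).
  by split; [exists (b 0%N), 0%N|exists (c 0%N) => _ [i _ <-]].
exists (sup (range b)) => k.
have : b k <= sup (range b) by apply: sup_upper_bound => //; exists k.
have : sup (range b) <= c k by apply: ge_sup; [exact: B0.1|move=> _ [i _ <-]].
by rewrite ler_norml /b /c; lra.
Qed.

(** * Completeness of L2 and density arguments *)

Section RieszFischer.

Context d (T : measurableType d) (R : realType).
Variables (mu : {measure set T -> \bar R}) (D : set T) (mD : measurable D).
Implicit Types f g h : T -> R.
Local Notation sqint := (sqint mu D).
Local Notation ip := (ip mu D).

Lemma sqint_le f g (C : R) : sqint f -> measurable_fun D g -> 0 <= C ->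
  {ae mu, forall x, D x -> g x ^+ 2 <= C * f x ^+ 2} ->
  sqint g /\ ip g g <= C * ip f f.
Proof.
move=> sf mg C0 gf.
(* g is cut to 0 where the pointwise bound fails, on D a null set, so that domination holds
   everywhere. *)
pose g' x := if g x ^+ 2 <= C * f x ^+ 2 then g x else 0.
have gg' : {ae mu, forall x, D x -> g' x = g x}.
  by move: gf; apply: filterS => x h /h; rewrite /g' => ->.
have mg' : measurable_fun D g'.
  apply: measurable_fun_if => //.
  - apply: measurable_fun_ler; first exact: measurable_funX.
    by apply: measurable_funM => //; apply: measurable_funX; exact: sf.1.
  - by apply: measurable_funS mg => //; exact: subIsetl.
have g'f x : g' x ^+ 2 <= C * f x ^+ 2.
  by rewrite /g'; case: ifP => // _; rewrite expr0n mulr_ge0 ?sqr_ge0.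
have sg' : sqint g'.
  split=> //; apply: le_intg (intgZ mD C sf.2) => //; first exact: measurable_funX.
  by move=> x _; rewrite !ger0_norm ?sqr_ge0// mulr_ge0// sqr_ge0.
split; first exact: ae_sqint sg'.
have -> : ip g g = ip g' g'.
  by apply: ae_ip => //; move: gg'; apply: filterS => x h /h.
rewrite !ipE -(RintegralZl _ mD (sqintM mD sf sf)).
apply: le_Rintegral => //; first exact (sqintM mD sg' sg').
  exact (intgZ mD C (sqintM mD sf sf)).
by move=> x _; rewrite -!expr2.
Qed.

(** Weighted by 4^k, the squared increments still have a sum H of integral at most 1, because the
    hypothesis brings an extra factor 1/2^(k+1). Where H is finite, h = sqrt H bounds the k-th
    increment by h/2^k, so the values converge geometrically, and the same h controls the distance
    to the limit. *)
Lemma rapidly_cauchy_limit (f_ : nat -> T -> R) : (forall n, sqint (f_ n)) ->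
  (forall k, ip (fun x => f_ k.+1 x - f_ k x) (fun x => f_ k.+1 x - f_ k x)
     <= (4 ^+ k)^-1 / (2 ^ k.+1)%:R) ->
  exists f h, [/\ measurable_fun D f, sqint h &
    forall k, {ae mu, forall x, D x -> (f x - f_ k x) ^+ 2 <=
                                     (2 / 2 ^+ k) ^+ 2 * h x ^+ 2}].
Proof.
move=> sf df; pose e k x := 4 ^+ k * (f_ k.+1 x - f_ k x) ^+ 2.
have se k : sqint (fun x => f_ k.+1 x - f_ k x) by exact: sqintB.
have e0 k x : 0 <= e k x by apply: mulr_ge0; [rewrite exprn_ge0|rewrite sqr_ge0].
have me k : measurable_fun D (e k).
  by apply: measurable_funM => //; apply: measurable_funX; exact: (se k).1.
pose H x : \bar R := (\sum_(0 <= k <oo | k \in xpredT) (e k x)%:E)%E.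
have mH : measurable_fun D H.
  apply: ge0_emeasurable_sum => [k x _ _|k _]; first by rewrite lee_fin.
  exact/measurable_EFinP.
have H0 x : (0 <= H x)%E by apply: nneseries_ge0 => k _ _; rewrite lee_fin.
have IH : (\int[mu]_(x in D) H x <= 1%:E)%E.
  rewrite /H (_ : (fun x => _) = (fun x => \sum_(0 <= k <oo) (e k x)%:E)%E)//.
  rewrite integral_nneseries//; last 2 first.
  - by move=> k; exact/measurable_EFinP.
  - by move=> k x _; rewrite lee_fin.
  have h1 := @epsilon_trick0 R 1 xpredT ler01.
  apply: le_trans h1.
  apply: lee_nneseries => [k _ _|k _].
    by apply: integral_ge0 => x _; rewrite lee_fin.
  have ie : intg mu D (e k) by apply: intgZ => //; exact: (se k).2.
  rewrite -(fineK (integrable_fin_num mD ie)) lee_fin.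
  rewrite -[X in X <= _]/(\int[mu]_(x in D) e k x) RintegralZl//; last exact: (se k).2.
  have := df k; rewrite /ip => dfk.
  under eq_Rintegral do rewrite expr2.
  by rewrite -ler_pdivlMl ?exprn_gt0// div1r.
have iH : mu.-integrable D H.
  apply/integrableP; split=> //.
  under eq_integral => x _ do rewrite gee0_abs//.
  by rewrite (le_lt_trans IH)// ltry.
pose E := D `&` [set x | H x \is a fin_num].
have mE : measurable E by exact: emeasurable_fin_num.
have aeE : {ae mu, forall x, D x -> E x}.
  by have := integrable_ae mD iH; apply: filterS => x h Dx; split=> //; exact: h.
have Hk x k : E x -> e k x <= fine (H x).
  move=> [Dx Hx]; rewrite -lee_fin fineK//.
  apply: le_trans (nneseries_lim_ge k.+1 _) => //; last by move=> i _ _; rewrite lee_fin.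
  rewrite big_mkord big_ord_recr /= leeDr// sume_ge0// => i _.
  by rewrite lee_fin.
pose h x := Num.sqrt (fine (H x)).
have mh : measurable_fun D h.
  apply: measurableT_comp => //; first exact: continuous_measurable_fun (@sqrt_continuous R).
  exact: measurableT_comp.
have h2 x : h x ^+ 2 = fine (H x) by rewrite sqr_sqrtr// fine_ge0.
have sh : sqint h.
  split=> //.
  have : intg mu D (fun x => fine (H x)).
    apply/integrableP; split; first by apply/measurable_EFinP; exact: measurableT_comp.
    move/integrableP : iH => [_]; apply: le_lt_trans.
    apply: ge0_le_integral => //.
    - by apply: measurableT_comp => //; apply/measurable_EFinP; exact: measurableT_comp.
    - exact: measurableT_comp.
    - by move=> x Dx; move: (H0 x); case: (H x) => //= _; rewrite normr0 leey.
  by apply: (eq_intg mD) => x _; rewrite h2.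
have /choice[f fP] x : exists l, (E x -> forall k, `|l - f_ k x| <= 2 * h x / 2 ^+ k) /\
    (~ E x -> l = 0).
  have [Ex|nEx] := pselect (E x); last by exists 0.
  have [k|l lP] := @geometric_cauchy R (f_ ^~ x) (h x).
    rewrite -(@ler_pXn2r _ 2) ?nnegrE ?divr_ge0 ?sqrtr_ge0 ?exprn_ge0//.
    rewrite real_normK ?num_real// sqr_div2X h2 exprVn.
    by rewrite ler_pdivlMr ?exprn_gt0// mulrC; exact: Hk.
  by exists l.
exists f, h; split=> //.
(* The limit was set to 0 off E, so on D it is the pointwise limit of f_k 1_E. *)
- apply: (@measurable_fun_cvg _ _ _ D (fun k x => f_ k x * \1_E x) f).
    move=> k; apply: measurable_funM; first exact: (sf k).1.
    by apply: measurable_funTS; exact: measurable_indic.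
  move=> x Dx; rewrite indicE; have [Ex|nEx] := pselect (E x); last first.
    rewrite memNset// (fP x).2//; under eq_fun do rewrite mulr0.
    exact: cvg_cst.
  rewrite mem_set//; under eq_fun do rewrite mulr1.
  apply: (@cvg_sqr_le _ _ _ ((2 * h x) ^+ 2) (fun k => (4^-1) ^+ k)) => [k|]; last first.
    by apply: cvg_expr; rewrite ger0_norm// invf_lt1// ltr1n.
  have := (fP x).1 Ex k; rewrite distrC => hk.
  rewrite -(real_normK (num_real (f_ k x - f x))).
  apply: (@le_trans _ _ ((2 * h x / 2 ^+ k) ^+ 2)).
    by rewrite ler_pXn2r ?nnegrE ?divr_ge0 ?mulr_ge0 ?sqrtr_ge0 ?exprn_ge0.
  by rewrite sqr_div2X.
- move=> k; move: aeE; apply: filterS => x /[apply] Ex.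
  have hk := (fP x).1 Ex k.
  rewrite -(real_normK (num_real (f x - f_ k x))) -exprMn mulrAC.
  by rewrite ler_pXn2r ?nnegrE ?divr_ge0 ?mulr_ge0 ?sqrtr_ge0 ?exprn_ge0.
Qed.

Lemma ip_add_le f g : sqint f -> sqint g ->
  ip (fun x => f x + g x) (fun x => f x + g x) <= 2 * ip f f + 2 * ip g g.
Proof.
move=> sf sg; have sfg := sqintD mD sf sg.
have i1 := intgZ mD 2 (sqintM mD sf sf); have i2 := intgZ mD 2 (sqintM mD sg sg).
rewrite !ipE -(RintegralZl _ mD (sqintM mD sf sf)).
rewrite -(RintegralZl _ mD (sqintM mD sg sg)) -(RintegralD mD i1 i2).
apply: le_Rintegral => //.
- exact (sqintM mD sfg sfg).
- exact (intgD mD i1 i2).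
- by move=> x _; have := sqr_ge0 (f x - g x); nra.
Qed.

Lemma sqint_complete (f_ : nat -> T -> R) : (forall n, sqint (f_ n)) ->
  (forall e : R, 0 < e -> exists N, forall m n, (N <= m)%N -> (N <= n)%N ->
     ip (fun x => f_ m x - f_ n x) (fun x => f_ m x - f_ n x) < e) ->
  exists2 f, sqint f &
    ip (fun x => f_ n x - f x) (fun x => f_ n x - f x) @[n --> \oo] --> 0.
Proof.
move=> sf cau; pose q k : R := (4 ^+ k)^-1 / (2 ^ k.+1)%:R.
have q0 k : 0 < q k by rewrite divr_gt0 ?invr_gt0 ?exprn_gt0 ?ltr0n ?expn_gt0.
have /choice[N NP] k := cau _ (q0 k).
(* Maxima instead of N itself, to have a nondecreasing sequence of indices. *)
pose n_ k := (\max_(i < k.+1) N i)%N.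
have Nn k : (N k <= n_ k)%N by exact: (@leq_bigmax _ (fun i : 'I_k.+1 => N i) ord_max).
have nS k : (n_ k <= n_ k.+1)%N by rewrite /n_ [leqRHS]big_ord_recr leq_maxl.
have [k|f [h [mf sh fh]]] := rapidly_cauchy_limit (fun k => sf (n_ k)).
  by apply/ltW/NP => //; exact: leq_trans (nS k).
have mB k : measurable_fun D (fun x => f x - f_ (n_ k) x).
  by apply: measurable_funB => //; exact: (sf _).1.
have le k := sqint_le sh (mB k) (sqr_ge0 _) (fh k).
have sff : sqint f.
  have := sqintD mD (le 0).1 (sf (n_ 0)); congr (sqint _).
  by apply/funext => x; rewrite subrK.
(* |f_m - f|^2 <= 2 |f_m - f_(n_k)|^2 + 2 |f_(n_k) - f|^2, and the two terms are at most 2/4^k and 2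
   (2/2^k)^2 |h|^2 = 8 |h|^2/4^k. *)
exists f => //; pose C := 2 + 8 * ip h h.
have C0 : 0 < C by rewrite ltr_pwDl// mulr_ge0// ip_ge0.
have main k m : (n_ k <= m)%N ->
    ip (fun x => f_ m x - f x) (fun x => f_ m x - f x) <= C * 4^-1 ^+ k.
  move=> km; have s1 := sqintB mD (sf m) (sf (n_ k)).
  have s2 := sqintB mD (sf (n_ k)) sff.
  have := ip_add_le s1 s2.
  have -> : (fun x => f_ m x - f_ (n_ k) x + (f_ (n_ k) x - f x)) =
            (fun x => f_ m x - f x) by apply/funext => x; rewrite addrA subrK.
  move=> h1; apply: le_trans h1 _; rewrite [C * _]mulrDl; apply: lerD.
    rewrite ler_pM2l//; apply: (@le_trans _ _ (q k)); first exact: (ltW (NP k m (n_ k) (leq_trans (Nn k) km) (Nn k))).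
    rewrite /q exprVn ler_piMr ?invr_ge0 ?exprn_ge0// invf_le1 ?ltr0n ?expn_gt0//.
    by rewrite ler1n expn_gt0.
  have := (le k).2.
  have -> : ip (fun x => f x - f_ (n_ k) x) (fun x => f x - f_ (n_ k) x) =
            ip (fun x => f_ (n_ k) x - f x) (fun x => f_ (n_ k) x - f x).
    by apply: eq_Rintegral => x _; rewrite -(opprB (f x)) mulrNN.
  by rewrite sqr_div2X; move: (4^-1 ^+ k) (ip h h) (ip _ _) => a b c; nra.
apply/cvgrPdist_lt => e e0.
have g0 : C * 4^-1 ^+ k @[k --> \oo] --> 0.
  rewrite -[X in _ --> X](mulr0 C); apply: cvgM; first exact: cvg_cst.
  by apply: cvg_expr; rewrite ger0_norm// invf_lt1// ltr1n.
have /cvgrPdist_lt/(_ _ e0)[k _ /(_ k (leqnn k)) /= ke] := g0.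
exists (n_ k) => // m /= km; rewrite sub0r normrN ger0_norm ?ip_ge0//.
apply: le_lt_trans (main _ _ km) _; apply: le_lt_trans ke.
by rewrite sub0r normrN ler_norm.
Qed.

Lemma sqint_hilbert : semi_hilbert (fun (c : R) (f : T -> R) x => c * f x) ip
  [set f | sqint f].
Proof.
split=> /=.
- exact: sqint0.
- by move=> u v su sv; exact (sqintD mD su sv).
- by move=> u su; exact (sqintN mD su).
- by move=> c u su; exact (sqintZ mD c su).
- by move=> u v _ _; exact: ipC.
- by move=> u v w su sv sw; exact (ipDl mD su sv sw).
- by move=> c u w su sw; exact (ipZl mD c su sw).
- by move=> u _; exact: ip_ge0.
- by move=> u_ su cau; have [f sf fP] := sqint_complete su cau; exists f.
Qed.

(** An induction principle: P will be the set of functions satisfying some property that is linear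
    and closed under limits in norm, and it is then enough that only null functions are orthogonal
    to P. *)
Lemma sqint_dense (P : set (T -> R)) : P `<=` [set f | sqint f] ->
  P (fun=> 0) ->
  (forall f g, P f -> P g -> P (fun x => f x + g x)) ->
  (forall c f, P f -> P (fun x => c * f x)) ->
  (forall (f_ : nat -> T -> R) f, (forall n, P (f_ n)) -> sqint f ->
    ip (fun x => f_ n x - f x) (fun x => f_ n x - f x) @[n --> \oo] --> 0 -> P f) ->
  (forall g, sqint g -> (forall p, P p -> ip g p = 0) ->
    {ae mu, forall x, D x -> g x = 0}) ->
  [set f | sqint f] `<=` P.
Proof.
move=> PS P0 PD PZ Pcl Po f /= sf.
have HP : semi_hilbert (fun (c : R) (f : T -> R) x => c * f x) ip P.
  have H := sqint_hilbert; split=> //.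
  - move=> u Pu; have := PZ (-1) u Pu; congr P.
    by apply/funext => x; rewrite mulN1r.
  - by move=> u v /PS su /PS sv; exact (shC H su sv).
  - by move=> u v w /PS su /PS sv /PS sw; exact (shDl H su sv sw).
  - by move=> c u w /PS su /PS sw; exact (shZl H c su sw).
  - by move=> u /PS su; exact (sh_ge0 H su).
  - move=> u_ Pu cau; have [g sg gP] := sqint_complete (fun n => PS _ (Pu n)) cau.
    by exists g => //; exact: Pcl sg gP.
have [|p Pp] := orthogonal_dense sqint_hilbert HP PS _ sf.
  move=> z sz zP; have z0 := Po z sz zP.
  have -> : ip z z = \int[mu]_(x in D) 0; last by rewrite Rintegral0.
  have mz : measurable_fun D (z : T -> R) := sz.1.
  apply: (@ae_Rint _ _ _ mu D mD (fun x => z x * z x)) => //.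
    by move: z0; apply: filterS => x h /h ->; rewrite mulr0.
  exact (measurable_funM mz mz).
(* f is only known to be at distance 0 from a member p of P; it is the L2 limit of the constant
   sequence p. *)
move=> fp0; apply: (Pcl (fun=> p)) => //.
have -> : ip (fun x => p x - f x) (fun x => p x - f x) = 0.
  rewrite -fp0; apply: eq_Rintegral => x _ /=.
  by rewrite -(opprB (f x)) mulrNN.
exact: cvg_cst.
Qed.

Lemma sqint_riesz (l : (T -> R) -> R) (C : R) :
  (forall f g, sqint f -> sqint g -> l (fun x => f x + g x) = l f + l g) ->
  (forall c f, sqint f -> l (fun x => c * f x) = c * l f) ->
  (forall f, sqint f -> l f ^+ 2 <= C * ip f f) ->
  exists2 g, sqint g & forall f, sqint f -> ip g f = l f.
Proof.
by move=> lD lZ lC; apply: (riesz sqint_hilbert (l := l) (C := C)).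
Qed.

End RieszFischer.

(** * Smooth functions and bumps *)

Section Smooth1.
Variable R : realType.
Implicit Types f g : R -> R.

(* Impredicative coinduction: f lies in some class stable by derivation. *)
Definition smooth1 f := exists2 C : set (R -> R), C f &
  forall g, C g -> exists2 g', C g' & forall x : R, is_derive x 1 g (g' x).

Lemma smooth1_is_derive f : smooth1 f ->
  exists2 f', smooth1 f' & forall x : R, is_derive x 1 f (f' x).
Proof.
by move=> [C Cf CP]; have [f' Cf' h] := CP f Cf; exists f' => //; exists C.
Qed.

Lemma smooth1_derivable f (x : R) : smooth1 f -> derivable f x 1.
Proof. by move=> /smooth1_is_derive[f' _ h]; have [] := h x. Qed.

Lemma smooth1_derive f : smooth1 f -> smooth1 (derive1 f).
Proof.
move=> /smooth1_is_derive[f' sf' h].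
suff -> : derive1 f = f' by [].
by apply/funext => x; rewrite derive1E; have [_ ->] := h x.
Qed.

Lemma smooth1_is_derive1 f (x : R) : smooth1 f -> is_derive x 1 f (derive1 f x).
Proof.
by move=> sf; rewrite derive1E; apply/derivableP; exact: smooth1_derivable.
Qed.

Lemma smooth1_continuous f : smooth1 f -> continuous f.
Proof.
move=> sf x; apply: differentiable_continuous; apply/derivable1_diffP.
exact: smooth1_derivable.
Qed.

(** The class that witnesses the smoothness of sums, products and affine substitutions: the
    derivative of each constructor is again built from the constructors. *)
Inductive smooth1_closure : (R -> R) -> Prop :=
| Sc_base f : smooth1 f -> smooth1_closure f
| Sc_cst (c : R) : smooth1_closure (fun=> c)
| Sc_id : smooth1_closure id
| Sc_add f g : smooth1_closure f -> smooth1_closure g ->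
    smooth1_closure (fun t => f t + g t)
| Sc_mul f g : smooth1_closure f -> smooth1_closure g ->
    smooth1_closure (fun t => f t * g t)
| Sc_affine f (k c : R) : smooth1_closure f ->
    smooth1_closure (fun t => f (k * t + c)).

Lemma smooth1_closureP f : smooth1_closure f -> smooth1 f.
Proof.
move=> cf; exists smooth1_closure => // {f cf}g.
elim=> {g} [f /smooth1_is_derive[f' sf' h]|c||f g _ [f' cf' df] _ [g' cg' dg]
   |f g cf [f' cf' df] cg [g' cg' dg]|f k c _ [f' cf' df]].
- by exists f' => //; exact: Sc_base.
- by exists (fun=> 0) => [|x]; [exact: Sc_cst|exact: is_derive_cst].
- by exists (fun=> 1) => [|x]; [exact: Sc_cst|exact: is_derive_id].
- exists (fun t => f' t + g' t) => [|x]; first exact: Sc_add.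
  by have ? := df x; have ? := dg x; exact: is_deriveD.
- exists (fun t => f t * g' t + f' t * g t) => [|x].
    by apply: Sc_add; exact: Sc_mul.
  have ? := df x; have ? := dg x.
  apply: (@is_derive_eq _ _ _ (fun t => f t * g t) x 1 _ _ (is_deriveM _ _)).
  by rewrite /GRing.scale /= (mulrC (g x)).
- exists (fun t => f' (k * t + c) * k) => [|x].
    by apply: Sc_mul; [exact: Sc_affine|exact: Sc_cst].
  apply: (@is_derive1_comp _ f (fun t => k * t + c)) => //.
  have d1 : is_derive x 1 (fun t : R => k * t + c) (k *: 1 + x *: 0 + 0).
    exact (is_deriveD (is_deriveM (is_derive_cst k x 1) (is_derive_id x 1))
             (is_derive_cst c x 1)).
  by apply: (@is_derive_eq _ _ _ _ x 1 _ _ d1); rewrite scaler0 !addr0 /GRing.scale /= mulr1.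
Qed.

Lemma smooth1_id : smooth1 id.
Proof. exact/smooth1_closureP/Sc_id. Qed.

Lemma smooth1_mul f g : smooth1 f -> smooth1 g -> smooth1 (fun t => f t * g t).
Proof. by move=> *; apply/smooth1_closureP/Sc_mul; exact: Sc_base. Qed.

Lemma smooth1_affine f (k c : R) : smooth1 f -> smooth1 (fun t => f (k * t + c)).
Proof. by move=> *; apply/smooth1_closureP/Sc_affine; exact: Sc_base. Qed.

Lemma smooth1_antiderivative f g : smooth1 f ->
  (forall x : R, is_derive x 1 g (f x)) -> smooth1 g.
Proof.
move=> [C Cf CP] h; exists [set u | u = g \/ C u]; first by left.
move=> u [->|/CP[u' Cu' du]]; first by exists f => //; right.
by exists u' => //; right.
Qed.

(** The function exp(-1/t) extended by 0, with a polynomial factor in 1/t: derivation replaces P by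
    X^2 (P - P'), so the family is stable by derivation. *)
Definition flat (P : {poly R}) (t : R) : R :=
  if 0 < t then P.[t^-1] * expR (- t^-1) else 0.

(** The exponential series gives e^y >= y^(m+2)/(m+2)! with m = [size P], two powers more than
    |P(y)| <= A y^m requires. With y = 1/t these make the flat functions O(t^2) at 0, hence of
    derivative 0 there. *)
Lemma horner_expRN_le (P : {poly R}) :
  exists2 C : R, 0 <= C & forall y : R, 1 <= y -> `|P.[y]| * expR (- y) <= C / y ^+ 2.
Proof.
pose m := size P; pose A : R := \sum_(i < m) `|P`_i|.
have A0 : 0 <= A by apply: sumr_ge0.
exists (A * (m.+2)`!%:R) => [|y y1]; first by rewrite mulr_ge0.
have y0 : 0 < y by exact: lt_le_trans y1.
have PA : `|P.[y]| <= A * y ^+ m.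
  rewrite horner_coef (le_trans (ler_norm_sum _ _ _))// mulr_suml ler_sum// => i _.
  rewrite normrM ler_wpM2l// normrX ger0_norm ?(ltW y0)//.
  by rewrite ler_weXn2l// ltnW.
have ey : y ^+ m.+2 / (m.+2)`!%:R <= expR y.
  apply: le_trans (expR_ge1Dxn m.+1 (ltW y0)).
  by rewrite lerDr.
have f0 : 0 < (m.+2)`!%:R :> R by rewrite ltr0n fact_gt0.
rewrite expRN ler_pdivlMr ?exprn_gt0// mulrAC ler_pdivrMr ?expR_gt0//.
apply: (@le_trans _ _ (A * y ^+ m * y ^+ 2)).
  by rewrite ler_wpM2r// sqr_ge0.
rewrite -mulrA -exprD addn2 -mulrA ler_wpM2l// mulrC -ler_pdivrMr//.
Qed.

Lemma flat_derive (P : {poly R}) (t : R) :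
  is_derive t 1 (flat P) (flat ('X ^+ 2 * (P - P^`())) t).
Proof.
case: (ltgtP 0 t) => [t0|t0|<-].
- suff h : is_derive t 1 (fun s : R => P.[s^-1] * expR (- s^-1))
      (flat ('X ^+ 2 * (P - P^`())) t).
    apply: (near_eq_is_derive _ h).
    near=> s; rewrite /flat ifT//; near: s; exact: lt_nbhsr.
  have tn0 : t != 0 by rewrite gt_eqF.
  have dV : is_derive t 1 (fun s : R => s^-1) (- t ^- 2).
    by have := @is_deriveV _ id t 1 1 tn0 (is_derive_id t 1); rewrite /GRing.scale /= mulr1.
  have dP : is_derive t^-1 1 (horner P) (P^`()).[t^-1].
    by have := derivableP (@derivable_horner R P t^-1); rewrite -derive1E -derivE.
  have d1 : is_derive t 1 (fun s => P.[s^-1]) ((P^`()).[t^-1] * (- t ^- 2)).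
    exact: (@is_derive1_comp _ (horner P) (fun s => s^-1)).
  have d2 : is_derive t 1 (fun s => expR (- s^-1)) (expR (- t^-1) * t ^- 2).
    apply: (@is_derive1_comp _ expR (fun s => - s^-1)).
    by rewrite -[t ^- 2]opprK; exact: is_deriveN.
  have d3 := is_deriveM d1 d2.
  apply: (@is_derive_eq _ _ _ (fun s : R => P.[s^-1] * expR (- s^-1)) t 1 _ _ d3).
  rewrite /flat t0 !hornerE /GRing.scale /=.
  by rewrite exprVn; ring.
- suff h : is_derive t 1 (fun s : R => 0 : R) (flat ('X ^+ 2 * (P - P^`())) t).
    apply: (near_eq_is_derive _ h).
    near=> s; rewrite /flat ifF//; apply/negbTE; rewrite -leNgt ltW//.
    near: s; exact: lt_nbhsl.
  rewrite /flat ifF; last by apply/negbTE; rewrite -leNgt ltW.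
  exact: is_derive_cst.
- have [C C0 CP] := horner_expRN_le P.
  have F0 : flat P 0 = 0 by rewrite /flat ltxx.
  have bd (h : R) : `|h| <= 1 -> `|flat P h| <= C * h ^+ 2.
    move=> h1; rewrite /flat; case: ifPn => [h0|_]; last by rewrite normr0 mulr_ge0 ?sqr_ge0.
    rewrite normrM (ger0_norm (expR_ge0 _)).
    have := CP h^-1; rewrite invr_ge1 ?unitfE ?gt_eqF//.
    by move: h1; rewrite (gtr0_norm h0) => h1 /(_ h1); rewrite exprVn invrK.
  have lim : (fun h : R => h^-1 *: ((flat P \o shift 0) (h *: 1) - flat P 0)) @ 0^' --> (0 : R).
    apply/cvgrPdist_le => /= e e0.
    near=> h; rewrite F0 subr0 sub0r normrN addr0 /GRing.scale /= mulr1 normrM.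
    have h0 : h != 0 by near: h; exact: nbhs_dnbhs_neq.
    have h1 : `|h| <= 1 by near: h; exact: dnbhs0_le.
    have hC : `|h| <= e / (C + 1).
      by near: h; apply: dnbhs0_le; rewrite divr_gt0// ltr_wpDl.
    have hp : 0 < `|h| by rewrite normr_gt0.
    rewrite normfV ler_pdivrMl//; apply: le_trans (bd h h1) _.
    rewrite -(real_normK (num_real h)) expr2 mulrA mulrC ler_pM2l//.
    move: hC; rewrite ler_pdivlMr ?ltr_wpDl//; apply: le_trans.
    by rewrite mulrDr mulr1 mulrC lerDl.
  apply: DeriveDef; first by apply/cvg_ex; exists 0.
  by rewrite /flat ltxx; exact/cvg_lim.
Unshelve. all: by end_near. Qed.

Lemma smooth1_flat (P : {poly R}) : smooth1 (flat P).
Proof.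
exists [set f | exists P, f = flat P]; first by exists P.
move=> _ [Q ->]; exists (flat ('X ^+ 2 * (Q - Q^`()))); first by eexists.
by move=> x; exact: flat_derive.
Qed.

(* As c -> 0+ it increases to the indicator function of ]a, b[, and
   bumpf (2 c) is the square of bumpf c. *)
Definition bumpf (a b c t : R) : R := flat 1 ((t - a) / c) * flat 1 ((b - t) / c).

Lemma flat1E (t : R) : flat 1 t = if 0 < t then expR (- t^-1) else 0.
Proof. by rewrite /flat hornerC mul1r. Qed.

Lemma flat1_ge0 t : 0 <= flat 1 t.
Proof. by rewrite flat1E; case: ifP => // _; exact: expR_ge0. Qed.

Lemma flat1_le1 t : flat 1 t <= 1.
Proof.
by rewrite flat1E; case: ifP => // t0; rewrite -expR0 ler_expR oppr_le0 invr_ge0 ltW.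
Qed.

Lemma smooth1_bump a b c : smooth1 (bumpf a b c).
Proof.
apply: smooth1_mul.
  have := smooth1_affine c^-1 (- a / c) (smooth1_flat 1); congr smooth1.
  by apply/funext => t; rewrite mulrDl mulrC.
have := smooth1_affine (- c^-1) (b / c) (smooth1_flat 1); congr smooth1.
apply/funext => t; congr (flat _ _).
by rewrite mulrBl addrC mulNr (mulrC t).
Qed.

Lemma bump_ge0 a b c t : 0 <= bumpf a b c t.
Proof. by rewrite mulr_ge0// flat1_ge0. Qed.

Lemma bump_le1 a b c t : bumpf a b c t <= 1.
Proof. by rewrite mulr_ile1// ?flat1_ge0 ?flat1_le1. Qed.

Lemma bump_out a b c t : 0 < c -> ~~ (a < t < b) -> bumpf a b c t = 0.
Proof.
move=> c0; rewrite negb_and /bumpf !flat1E !pmulr_lgt0 ?invr_gt0// !subr_gt0.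
by move=> /orP[] /negbTE ->; rewrite ?mul0r ?mulr0.
Qed.

Lemma bump_gt0 a b c t : 0 < c -> a < t < b -> 0 < bumpf a b c t.
Proof.
move=> c0 /andP[at_ tb]; rewrite /bumpf !flat1E !pmulr_lgt0 ?invr_gt0// !subr_gt0.
  by rewrite at_ expR_gt0.
by rewrite tb expR_gt0.
Qed.

Lemma bump_sqr a b c t : 0 < c -> bumpf a b c t * bumpf a b c t = bumpf a b (2 * c) t.
Proof.
move=> c0; rewrite /bumpf mulrACA.
suff sq s : flat 1 (s / c) * flat 1 (s / c) = flat 1 (s / (2 * c)) by rewrite !sq.
rewrite !flat1E !pmulr_lgt0 ?invr_gt0 ?mulr_gt0//; case: ifP; rewrite ?mulr0// => s0.
by rewrite -expRD; congr expR; field; rewrite !gt_eqF.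
Qed.

Lemma bump_cvg a b t :
  bumpf a b (n.+1%:R^-1) t @[n --> \oo] --> (\1_(`]a, b[%classic) t : R).
Proof.
rewrite indicE; have [tab|tab] := boolP (a < t < b); last first.
  rewrite memNset; last by rewrite /= in_itv/=; apply/negP.
  by under eq_fun do rewrite bump_out//; exact: cvg_cst.
rewrite mem_set; last by rewrite /= in_itv.
move: tab => /andP[at_ tb].
have h s : 0 < s -> flat 1 (s / n.+1%:R^-1) @[n --> \oo] --> (1 : R).
  move=> s0; have -> : (fun n => flat 1 (s / n.+1%:R^-1)) =
      (fun n : nat => expR (- (s^-1 * n.+1%:R^-1))).
    apply/funext => n; rewrite flat1E pmulr_lgt0 ?s0 ?invr_gt0 ?invr_gt0//.
    by rewrite invfM !invrK.
  rewrite [X in _ --> X](_ : 1 = expR (- (s^-1 * 0))); last by rewrite mulr0 oppr0 expR0.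
  apply: continuous_cvg; first exact: continuous_expR.
  apply: cvgN; apply: cvgM; first exact: cvg_cst.
  exact: (@cvg_harmonic R).
rewrite -[X in _ --> X](mulr1 1).
by apply: cvgM; apply: h; rewrite subr_gt0.
Qed.

End Smooth1.

(** * Smooth functions of two variables and tensor products *)

Section Smooth2.
Variable R : realType.
Implicit Types f g : R * R -> R.

Lemma smooth_derive f i : smooth f -> smooth (fun y => 'D_(unit_vec R i) f y).
Proof. by move=> sf s x; have := sf (rcons s i) x; rewrite foldr_rcons. Qed.

Lemma smooth_differentiable f x : smooth f -> differentiable f x.
Proof. by move=> /(_ [::] x). Qed.

Lemma smooth_continuous f : smooth f -> continuous f.
Proof. by move=> sf x; apply: differentiable_continuous; exact: smooth_differentiable. Qed.

Let fst2 (x : R * R) : R := x.1.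
Let snd2 (x : R * R) : R := x.2.

Let fst2_linear : linear fst2. Proof. by []. Qed.
HB.instance Definition _ := GRing.isLinear.Build R (R * R)%type R _ fst2 fst2_linear.
Let snd2_linear : linear snd2. Proof. by []. Qed.
HB.instance Definition _ := GRing.isLinear.Build R (R * R)%type R _ snd2 snd2_linear.

Lemma differentiable_fst (x : R * R) : differentiable (fun y : R * R => y.1) x.
Proof. by apply: (@linear_differentiable R _ _ fst2) => y; exact: cvg_fst. Qed.

Lemma differentiable_snd (x : R * R) : differentiable (fun y : R * R => y.2) x.
Proof. by apply: (@linear_differentiable R _ _ snd2) => y; exact: cvg_snd. Qed.

Inductive smooth_closure : (R * R -> R) -> Prop :=
| Scl_base f : smooth f -> smooth_closure f
| Scl_cst (c : R) : smooth_closure (fun=> c)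
| Scl_fst (f : R -> R) : smooth1 f -> smooth_closure (fun x => f x.1)
| Scl_snd (f : R -> R) : smooth1 f -> smooth_closure (fun x => f x.2)
| Scl_add f g : smooth_closure f -> smooth_closure g ->
    smooth_closure (fun t => f t + g t)
| Scl_mul f g : smooth_closure f -> smooth_closure g ->
    smooth_closure (fun t => f t * g t).

Lemma derive_fst (f : R -> R) i (x : R * R) : smooth1 f ->
  'D_(unit_vec R i) (fun y : R * R => f y.1) x =
  if i == 0 then derive1 f x.1 else 0.
Proof.
move=> sf; rewrite /unit_vec; case: ifP => _; first by rewrite derive1E.
rewrite /derive; apply/cvg_lim => //.
have -> : (fun h : R => h^-1 *: (((fun y : R * R => f y.1) \o shift x) (h *: ((0, 1) : R * R)) - f x.1)) = fun=> 0.
  by apply/funext => h /=; rewrite /GRing.scale /= mulr0 add0r subrr mulr0.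
exact: cvg_cst.
Qed.

Lemma derive_snd (f : R -> R) i (x : R * R) : smooth1 f ->
  'D_(unit_vec R i) (fun y : R * R => f y.2) x =
  if i == 0 then 0 else derive1 f x.2.
Proof.
move=> sf; rewrite /unit_vec; case: ifP => _; last by rewrite derive1E.
rewrite /derive; apply/cvg_lim => //.
have -> : (fun h : R => h^-1 *: (((fun y : R * R => f y.2) \o shift x) (h *: ((1, 0) : R * R)) - f x.2)) = fun=> 0.
  by apply/funext => h /=; rewrite /GRing.scale /= mulr0 add0r subrr mulr0.
exact: cvg_cst.
Qed.

Lemma smooth_closure_step f : smooth_closure f ->
  (forall x, differentiable f x) /\
  forall i, smooth_closure (fun y => 'D_(unit_vec R i) f y).
Proof.
elim=> {f} [f sf|c|f sf|f sf|f g _ [df cf] _ [dg cg]|f g sf [df cf] sg [dg cg]].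
- split=> [x|i]; first exact: smooth_differentiable.
  by apply: Scl_base; exact: smooth_derive.
- split=> [x|i]; first exact: differentiable_cst.
  have -> : (fun y : R * R => 'D_(unit_vec R i) (fun=> c) y) = fun=> 0.
    by apply/funext => y; exact: derive_cst.
  exact: Scl_cst.
- split=> [x|i].
    apply: (@differentiable_comp _ _ _ _ (fun y : R * R => y.1) f) => //.
      exact: differentiable_fst.
    by apply/derivable1_diffP; exact: smooth1_derivable.
  have -> : (fun y : R * R => 'D_(unit_vec R i) (fun x : R * R => f x.1) y) =
            fun y => if i == 0 then derive1 f y.1 else 0.
    by apply/funext => y; exact: derive_fst.
  by case: (i == 0); [apply: Scl_fst; exact: smooth1_derive|exact: Scl_cst].
- split=> [x|i].
    apply: (@differentiable_comp _ _ _ _ (fun y : R * R => y.2) f) => //.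
      exact: differentiable_snd.
    by apply/derivable1_diffP; exact: smooth1_derivable.
  have -> : (fun y : R * R => 'D_(unit_vec R i) (fun x : R * R => f x.2) y) =
            fun y => if i == 0 then 0 else derive1 f y.2.
    by apply/funext => y; exact: derive_snd.
  by case: (i == 0); [exact: Scl_cst|apply: Scl_snd; exact: smooth1_derive].
- split=> [x|i]; first exact: differentiableD.
  have -> : (fun y : R * R => 'D_(unit_vec R i) (fun x => f x + g x) y) =
            fun y => 'D_(unit_vec R i) f y + 'D_(unit_vec R i) g y.
    by apply/funext => y; apply: deriveD; exact: diff_derivable.
  exact: Scl_add.
- split=> [x|i]; first exact: differentiableM.
  have -> : (fun y : R * R => 'D_(unit_vec R i) (fun x => f x * g x) y) =
            fun y => f y * 'D_(unit_vec R i) g y + g y * 'D_(unit_vec R i) f y.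
    by apply/funext => y; apply: deriveM; exact: diff_derivable.
  by apply: Scl_add; apply: Scl_mul.
Qed.

Lemma smooth_closureP f : smooth_closure f -> smooth f.
Proof.
move=> cf s x; have : smooth_closure
    (foldr (fun i (g : R * R -> R) y => 'D_(unit_vec R i) g y) f s).
  by elim: s => //= i s ih; exact: (smooth_closure_step ih).2.
by move=> /smooth_closure_step[].
Qed.

Lemma smooth_cst (c : R) : smooth (fun _ : R * R => c).
Proof. exact/smooth_closureP/Scl_cst. Qed.

Lemma smooth_add f g : smooth f -> smooth g -> smooth (fun x => f x + g x).
Proof. by move=> *; apply/smooth_closureP/Scl_add; exact: Scl_base. Qed.

Lemma smooth_mul f g : smooth f -> smooth g -> smooth (fun x => f x * g x).
Proof. by move=> *; apply/smooth_closureP/Scl_mul; exact: Scl_base. Qed.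

Lemma smooth_fst (f : R -> R) : smooth1 f -> smooth (fun x : R * R => f x.1).
Proof. by move=> *; exact/smooth_closureP/Scl_fst. Qed.

Lemma smooth_snd (f : R -> R) : smooth1 f -> smooth (fun x : R * R => f x.2).
Proof. by move=> *; exact/smooth_closureP/Scl_snd. Qed.

Definition tensor (f g : R -> R) (x : R * R) : R := f x.1 * g x.2.

Lemma smooth_tensor (f g : R -> R) : smooth1 f -> smooth1 g -> smooth (tensor f g).
Proof. by move=> sf sg; apply: smooth_mul; [exact: smooth_fst|exact: smooth_snd]. Qed.

Lemma smooth_deriveM f g i x : smooth f -> smooth g ->
  'D_(unit_vec R i) (fun y => f y * g y) x =
  f x * 'D_(unit_vec R i) g x + g x * 'D_(unit_vec R i) f x.
Proof.
by move=> sf sg; apply: deriveM; apply: diff_derivable; exact: smooth_differentiable.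
Qed.

Lemma smooth_deriveZ (c : R) f i x : smooth f ->
  'D_(unit_vec R i) (fun y => c * f y) x = c * 'D_(unit_vec R i) f x.
Proof.
move=> sf; rewrite smooth_deriveM//; last exact: smooth_cst.
by rewrite derive_cst mulr0 addr0.
Qed.

Lemma derive_tensor (f g : R -> R) i x : smooth1 f -> smooth1 g ->
  'D_(unit_vec R i) (tensor f g) x =
  if i == 0 then tensor (derive1 f) g x else tensor f (derive1 g) x.
Proof.
move=> sf sg; rewrite smooth_deriveM; [|exact: smooth_fst|exact: smooth_snd].
rewrite derive_fst// derive_snd// /tensor; case: ifP => _.
  by rewrite mulr0 add0r mulrC.
by rewrite mulr0 addr0.
Qed.

End Smooth2.

(** * Functions with vanishing integrals *)

Section IntegrabilityOnSubsets.
Context d (T : measurableType d) (R : realType).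
Variables (mu : {measure set T -> \bar R}).
Implicit Types (f g : T -> R) (D E : set T).

Lemma intg_mkcond D f : measurable D -> intg mu D f <-> intg mu setT (f \_ D).
Proof.
move=> mD; rewrite /intg (integrable_mkcond (fun x => (f x)%:E) mD).
by rewrite (_ : _ \_ D = EFin \o (f \_ D))// -restrict_EFin.
Qed.

Lemma intgS D E f : measurable D -> measurable E -> D `<=` E ->
  intg mu E f -> intg mu D f.
Proof. by move=> mD mE DE; exact: integrableS. Qed.

Lemma aeS (P Q : T -> Prop) : (forall x, P x -> Q x) ->
  {ae mu, forall x, P x} -> {ae mu, forall x, Q x}.
Proof. by move=> PQ; apply: filterS. Qed.

Lemma aeS2 (P Q P' : T -> Prop) : (forall x, P x -> Q x -> P' x) ->
  {ae mu, forall x, P x} -> {ae mu, forall x, Q x} -> {ae mu, forall x, P' x}.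
Proof. by move=> PQ; apply: filterS2. Qed.

Lemma intg_patch D f : measurable D -> intg mu setT f -> intg mu setT (f \_ D).
Proof. by move=> mD fi; apply/(intg_mkcond _ mD); exact: (intgS mD measurableT (@subsetT _ D) fi). Qed.

End IntegrabilityOnSubsets.

Section VanishingIntegrals.
Context d (T : measurableType d) (R : realType).
Variables (mu : {measure set T -> \bar R}) (f : T -> R).
Hypothesis fi : intg mu setT f.

Let fiA A : measurable A -> intg mu A f.
Proof. by move=> mA; exact: integrableS fi. Qed.

Let eint0 A : measurable A -> \int[mu]_(x in A) f x = 0 ->
  (\int[mu]_(x in A) (f x)%:E = 0)%E.
Proof.
move=> mA h; rewrite -(fineK (integrable_fin_num mA (fiA mA))).
by rewrite -[X in X%:E]/(\int[mu]_(x in A) f x) h.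
Qed.

(** Dynkin's theorem: once the total integral is 0, the sets whose preimage has integral 0 form a
    lambda-system. The map p stands for a coordinate or the identity, so that the plane can be
    treated one coordinate at a time. *)
Lemma Rint_preimage_eq0 d' (T' : measurableType d') (p : T -> T')
  (G : set (set T')) : measurable_fun setT p -> @measurable _ T' = <<s G >> ->
  setI_closed G -> \int[mu]_x f x = 0 ->
  (forall A, G A -> \int[mu]_(x in p @^-1` A) f x = 0) ->
  forall A, measurable A -> \int[mu]_(x in p @^-1` A) f x = 0.
Proof.
move=> mp mG GI f0 G0.
have mpA A : measurable A -> measurable (p @^-1` A).
  by move=> mA; rewrite -[X in measurable X]setTI; exact: mp.
move=> A0 mA0; have sA0 : <<s G >> A0 by rewrite -mG.
apply: (@dynkin_induction _ _ G (fun A => \int[mu]_(x in p @^-1` A) f x = 0) mG GI) sA0 => //.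
- by move=> A mA AA; have mpA' := mpA _ mA; have mC := measurableC mpA';
    have := @Rintegral_setU _ _ _ mu _ _ f mpA' mC;
    rewrite setUv f0 AA add0r preimage_setC => <- //; rewrite ?disj_set2E ?setICr//.
- move=> F mF tF F0; rewrite preimage_bigcup /Rintegral integral_bigcup.
  + by rewrite eseries0// => i _ _; apply: eint0 => //; exact: mpA.
  + by move=> i j _ _ [x [Fi Fj]]; apply: tF => //; exists (p x).
  + by move=> k; exact: mpA.
  + apply: (integrableS _ _ _ fi) => //.
    by apply: bigcup_measurable => k _; exact: mpA.
Qed.

Lemma Rint_itv_preimage_eq0 (p : T -> measurableTypeR R) : measurable_fun setT p ->
  (forall a b : R, \int[mu]_(x in p @^-1` `]a, b[%classic) f x = 0) ->
  forall A, measurable A -> \int[mu]_(x in p @^-1` A) f x = 0.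
Proof.
move=> mp h.
have mpA (A : set (measurableTypeR R)) : measurable A -> measurable (p @^-1` A).
  by move=> mA; rewrite -[X in measurable X]setTI; exact: mp.
apply: (@Rint_preimage_eq0 _ (measurableTypeR R) p (@RGenOpens.G R)) => //.
- exact: RGenOpens.measurableE.
- move=> _ _ [a [b ->]] [a' [b' ->]]; exists (Num.max a a'), (Num.min b b').
  by apply/seteqP; split=> x /=; rewrite !in_itv/= gt_max lt_min;
    [move=> [/andP[-> ->] /andP[-> ->]]|move=> /andP[/andP[-> ->] /andP[-> ->]]].
(* The total integral is the limit of the integrals over the preimages of ]-n, n[, which vanish. *)
- pose B (n : nat) := p @^-1` `](- n%:R : R), n%:R[%classic.
  have mB n : measurable (B n) by exact: mpA.
  have [|||_ cv] := @Rint_dominated _ _ _ mu setT measurableT (fun n => f \_ (B n)) f (fun x => `|f x|) _ (intg_meas fi) _ (integrable_norm fi).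
  + by move=> n; apply/(measurable_restrictT _ (mB n)); exact: measurable_funTS (intg_meas fi).
  + apply: aeW => x _; apply: cvg_near_cst.
    near=> n; rewrite patchE mem_set// /B /= in_itv/= -ltr_norml.
    by near: n; exact: nbhs_infty_gtr.
  + apply: aeW => x _ n; rewrite patchE; case: ifP => // _.
    by rewrite normr0.
  have {}cv : (fun=> 0 : R) @ \oo --> \int[mu]_x f x.
    by move: cv; under eq_fun do rewrite -Rintegral_mkcond h.
  by rewrite -(cvg_lim (@norm_hausdorff R R) cv); exact: lim_cst.
- by move=> _ [a [b ->]]; exact: h.
Unshelve. all: by end_near. Qed.

End VanishingIntegrals.

(** * Fubini's theorem for real-valued integrals *)

Section RealFubini.
Context d1 d2 (T1 : measurableType d1) (T2 : measurableType d2) (R : realType).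
Variables (m1 : {sigma_finite_measure set T1 -> \bar R}).
Variables (m2 : {sigma_finite_measure set T2 -> \bar R}).
Variable f : T1 * T2 -> R.
Hypothesis fi : intg (m1 \x m2)%E setT f.

Lemma Rfubini1 : intg m1 setT (fun x => \int[m2]_y f (x, y)) /\
  \int[(m1 \x m2)%E]_z f z = \int[m1]_x \int[m2]_y f (x, y).
Proof.
have Fi := integrable_fubini_F fi.
have mF : measurable_fun setT (fun x => \int[m2]_y f (x, y)).
  by apply: measurableT_comp => //; exact: measurable_fubini_F fi.
have mF' : measurable_fun setT (fun x => (\int[m2]_y f (x, y))%:E).
  exact/measurable_EFinP.
have E : ae_eq m1 setT (fubini_F m2 (EFin \o f)) (fun x => (\int[m2]_y f (x, y))%:E).
  have := integrable_ae measurableT Fi; apply: filterS => x /(_ I) fx _.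
  by rewrite /Rintegral fineK.
split.
  apply/integrableP; split=> //.
  move/integrableP : (Fi) => [mFi].
  suff -> : (\int[m1]_x `|(fubini_F m2 (EFin \o f)) x| = \int[m1]_x `|(\int[m2]_y f (x, y))%:E|)%E by [].
  apply: ae_eq_integral => //.
  - exact: measurableT_comp.
  - exact: measurableT_comp.
  - by move: E; apply: filterS => z h /h ->.
rewrite /Rintegral -(integral12_prod_meas1 fi); congr fine.
by apply: ae_eq_integral => //; exact: measurable_int Fi.
Qed.

Lemma Rfubini2 : intg m2 setT (fun y => \int[m1]_x f (x, y)) /\
  \int[(m1 \x m2)%E]_z f z = \int[m2]_y \int[m1]_x f (x, y).
Proof.
have Fi : m2.-integrable setT (fubini_G m1 (EFin \o f)).
  apply/integrableP; split; first exact: measurable_fubini_G fi.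
  have mf := measurable_int _ fi.
  have /(integrable21ltyP _ _ mf) : (m1 \x m2)%E.-integrable setT (EFin \o f) by [].
  apply: le_lt_trans; apply: ge0_le_integral => //.
  - by apply: measurableT_comp => //; exact: measurable_fubini_G fi.
  - have := @measurable_fun_fubini_tonelli_G _ _ T1 T2 R m1 (fun z => `|(f z)%:E|%E).
    by apply=> //; exact: measurableT_comp.
  - move=> y _; apply: le_abse_integral => //.
    by apply: measurableT_comp => //; exact: pair2_measurable.
have mF : measurable_fun setT (fun y => \int[m1]_x f (x, y)).
  by apply: measurableT_comp => //; exact: measurable_fubini_G fi.
have mF' : measurable_fun setT (fun y => (\int[m1]_x f (x, y))%:E).
  exact/measurable_EFinP.
have E : ae_eq m2 setT (fubini_G m1 (EFin \o f)) (fun y => (\int[m1]_x f (x, y))%:E).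
  have := integrable_ae measurableT Fi; apply: filterS => x /(_ I) fx _.
  by rewrite /Rintegral fineK.
split.
  apply/integrableP; split=> //.
  move/integrableP : (Fi) => [mFi].
  suff -> : (\int[m2]_y `|(fubini_G m1 (EFin \o f)) y| = \int[m2]_y `|(\int[m1]_x f (x, y))%:E|)%E by [].
  apply: ae_eq_integral => //.
  - exact: measurableT_comp.
  - exact: measurableT_comp.
  - by move: E; apply: filterS => z h /h ->.
rewrite /Rintegral -(integral21_prod_meas1 fi); congr fine.
by apply: ae_eq_integral => //; exact: measurable_int Fi.
Qed.

End RealFubini.

Section Plane.
Variable R : realType.
Local Notation lam := (@lebesgue_measure R).
Local Notation TR := (measurableTypeR R).
Local Notation mu2 := (lebesgue2 R).
Implicit Types (f g : R * R -> R).

Lemma measurable_fst2 : measurable_fun setT (fst : TR * TR -> TR).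
Proof. exact: measurable_fst. Qed.

Lemma measurable_snd2 : measurable_fun setT (snd : TR * TR -> TR).
Proof. exact: measurable_snd. Qed.

Let mI (a b : R) : @measurable _ TR `]a, b[%classic.
Proof. exact: measurable_itv. Qed.

Let mfst (A : set TR) : measurable A -> @measurable _ (TR * TR)%type (fst @^-1` A).
Proof. by move=> mA; rewrite -[X in measurable X]setTI; exact: measurable_fst2. Qed.

Let msnd (A : set TR) : measurable A -> @measurable _ (TR * TR)%type (snd @^-1` A).
Proof. by move=> mA; rewrite -[X in measurable X]setTI; exact: measurable_snd2. Qed.

(** Intervals are replaced by measurable sets in one coordinate after the other; measurable
    rectangles then generate the product sigma-algebra. *)
Lemma ae_eq0_rect f : intg mu2 setT f ->
  (forall a b a' b' : R, \int[mu2]_(x in `]a, b[ `*` `]a', b'[) f x = 0) ->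
  {ae mu2, forall x, f x = 0}.
Proof.
move=> fi h.
have step1 (A : set TR) a' b' : measurable A ->
    \int[mu2]_(x in A `*` `]a', b'[) f x = 0.
  move=> mA; have gi := intg_patch (msnd (mI a' b')) fi.
  have := Rint_itv_preimage_eq0 gi measurable_fst2 _ mA.
  rewrite -Rintegral_mkcondr; apply => a b.
  by rewrite -Rintegral_mkcondr; exact: h.
have step2 (A B : set TR) : measurable A -> measurable B ->
    \int[mu2]_(x in A `*` B) f x = 0.
  move=> mA mB; have gi := intg_patch (mfst mA) fi.
  have := Rint_itv_preimage_eq0 gi measurable_snd2 _ mB.
  rewrite -Rintegral_mkcondl; apply => a b.
  by rewrite -Rintegral_mkcondl; exact: step1.
have : {ae mu2, forall x, setT x -> f x = 0}.
  apply: Rint_sub_eq0 => // E _ mE.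
  pose G := [set A1 `*` A2 | A1 in @measurable _ TR & A2 in @measurable _ TR].
  apply: (@Rint_preimage_eq0 _ _ _ mu2 f fi _ (TR * TR)%type id G) => //.
  - exact: measurable_prod_measurableType.
  - move=> _ _ [A1 mA1 [A2 mA2 <-]] [B1 mB1 [B2 mB2 <-]].
    exists (A1 `&` B1); first exact: measurableI.
    by exists (A2 `&` B2); [exact: measurableI|rewrite setXI].
  - by have := step2 setT setT measurableT measurableT; rewrite setXTT.
  - by move=> _ [A1 mA1 [A2 mA2 <-]]; exact: step2.
by apply: aeS => x; apply.
Qed.

Lemma ae_eq0_itv (f : R -> R) : intg lam setT f ->
  (forall a b : R, \int[lam]_(x in `]a, b[) f x = 0) ->
  {ae lam, forall x, f x = 0}.
Proof.
move=> fi h.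
have : {ae lam, forall x, setT x -> f x = 0}.
  apply: Rint_sub_eq0 => // E _ mE.
  by apply: (@Rint_itv_preimage_eq0 _ TR R lam f fi id).
by apply: aeS => x; apply.
Qed.

(* Testing against the bumps is enough, since they converge boundedly to the
   indicator functions of the intervals. *)
Lemma Rint_itv_eq0 (f : R -> R) (a b : R) : intg lam setT f ->
  (forall c : R, 0 < c -> \int[lam]_x (f x * bumpf a b c x) = 0) ->
  \int[lam]_(x in `]a, b[) f x = 0.
Proof.
move=> fi h.
have mf := intg_meas fi.
have [||||_ cv] := @Rint_dominated _ _ _ lam setT measurableT
   (fun n x => f x * bumpf a b n.+1%:R^-1 x) (f \_ `]a, b[) (fun x => `|f x|)
   _ _ _ (integrable_norm fi).
- move=> n; apply: measurable_funM => //.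
  by apply: continuous_measurable_fun; exact: smooth1_continuous (smooth1_bump _ _ _).
- by apply: intg_meas (intg_patch _ fi); exact: mI.
- apply: aeW => x _; have := @bump_cvg R a b x; rewrite patchE indicE => bc.
  rewrite (_ : (if _ then _ else _) = f x * (x \in `]a, b[%classic)%:R).
    by apply: cvgM => //; exact: cvg_cst.
  by case: ifP; rewrite ?mulr1 ?mulr0.
- apply: aeW => x _ n; rewrite normrM ler_piMr// ger0_norm ?bump_ge0//.
  exact: bump_le1.
rewrite Rintegral_mkcond -(cvg_lim (@norm_hausdorff R R) cv).
under eq_fun do rewrite h//; exact: lim_cst.
Qed.

Lemma Rint_rect_eq0 f (a b a' b' : R) : intg mu2 setT f ->
  (forall c : R, 0 < c ->
    \int[mu2]_x (f x * tensor (bumpf a b c) (bumpf a' b' c) x) = 0) ->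
  \int[mu2]_(x in `]a, b[ `*` `]a', b'[) f x = 0.
Proof.
move=> fi h.
have mf := intg_meas fi.
have mb u v w : measurable_fun setT (bumpf u v w : TR -> R).
  by apply: continuous_measurable_fun; exact: smooth1_continuous (smooth1_bump _ _ _).
have mD : @measurable _ (TR * TR)%type (`]a, b[ `*` `]a', b'[) by exact: measurableX.
have [||||_ cv] := @Rint_dominated _ _ _ mu2 setT measurableT
   (fun n x => f x * tensor (bumpf a b n.+1%:R^-1) (bumpf a' b' n.+1%:R^-1) x)
   (f \_ (`]a, b[ `*` `]a', b'[)) (fun x => `|f x|) _ _ _ (integrable_norm fi).
- move=> n; apply: measurable_funM => //; apply: measurable_funM.
    exact: (measurableT_comp (mb _ _ _) measurable_fst2).
  exact: (measurableT_comp (mb _ _ _) measurable_snd2).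
- by apply: intg_meas (intg_patch _ fi).
- apply: aeW => x _; rewrite patchE.
  have bc := @bump_cvg R a b x.1; have bc' := @bump_cvg R a' b' x.2.
  rewrite (_ : (if _ then _ else _) = f x * (\1_(`]a, b[%classic) x.1 * \1_(`]a', b'[%classic) x.2)).
    by apply: cvgM => //; [exact: cvg_cst|exact: cvgM].
  rewrite !indicE in_setX.
  by case: (x.1 \in _); case: (x.2 \in _); rewrite /= ?mulr1 ?mulr0.
- apply: aeW => x _ n; rewrite normrM ler_piMr// ger0_norm /tensor.
    by rewrite mulr_ile1 ?bump_ge0 ?bump_le1.
  by rewrite mulr_ge0// bump_ge0.
rewrite Rintegral_mkcond -(cvg_lim (@norm_hausdorff R R) cv).
under eq_fun do rewrite h//; exact: lim_cst.
Qed.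

End Plane.

(** * Open sets of the plane, null sets and projections *)

Section PlaneTopology.
Variable R : realType.
Local Notation lam := (@lebesgue_measure R).
Local Notation TR := (measurableTypeR R).
Local Notation mu2 := (lebesgue2 R).
Implicit Types (U : set (R * R)).

Lemma open2_rect U (x : R * R) : open U -> U x ->
  exists q : rat * rat * (rat * rat),
    [/\ ratr q.1.1 < x.1 < ratr q.1.2, ratr q.2.1 < x.2 < ratr q.2.2 &
        `[ratr q.1.1 : R, ratr q.1.2] `*` `[ratr q.2.1 : R, ratr q.2.2] `<=` U].
Proof.
move=> oU Ux; have /nbhs_ballP[e e0 eU] := open_nbhs_nbhs (conj oU Ux).
have lt1 (t : R) : t - e < t by rewrite ltrBlDr ltrDl.
have lt2 (t : R) : t < t + e by rewrite ltrDl.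
have [a] := rat_in_itvoo (lt1 x.1); rewrite in_itv/= => /andP[ea ax].
have [b] := rat_in_itvoo (lt2 x.1); rewrite in_itv/= => /andP[xb be].
have [c] := rat_in_itvoo (lt1 x.2); rewrite in_itv/= => /andP[ec cx].
have [d] := rat_in_itvoo (lt2 x.2); rewrite in_itv/= => /andP[xd de].
exists ((a, b), (c, d)); split; rewrite /= ?ax ?cx//.
move=> y [/=]; rewrite !in_itv/= => /andP[ay yb] /andP[cy yd]; apply: eU.
by split; rewrite /ball /= ltr_norml; apply/andP; split; lra.
Qed.

(** The n-th rational open rectangle if the closed one is contained in U, and the empty set
    otherwise: a countable cover of U by rectangles that can carry test functions of U. *)
Definition rat_rect U n : set (R * R) :=
  if unpickle n is Some q then
    [set x | `[ratr q.1.1 : R, ratr q.1.2] `*` `[ratr q.2.1 : R, ratr q.2.2] `<=` U /\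
      (`]ratr q.1.1 : R, ratr q.1.2[ `*` `]ratr q.2.1 : R, ratr q.2.2[) x]
  else set0 (T := R * R).

Lemma open2_bigcup U : open U -> U = \bigcup_n rat_rect U n.
Proof.
move=> oU; apply/seteqP; split => [x /(open2_rect oU)[q [q1 q2 qU]]|x [n _]].
  apply: (@bigcup_sup _ _ (pickle q)); first by [].
  rewrite /rat_rect pickleK; split; first exact: qU.
  by split; rewrite /= in_itv.
rewrite /rat_rect; case: unpickle; last by [].
move=> q [qU [/=]]; rewrite !in_itv/= => /andP[a b] /andP[c d]; apply: qU.
by split; rewrite /= in_itv/= !ltW.
Qed.

(** Measurability refers to the product sigma-algebra, so an open set has to be exhibited as a
    countable union of rectangles. *)
Lemma open2_measurable U : open U -> @measurable _ (TR * TR)%type U.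
Proof.
move=> /open2_bigcup ->; apply: bigcupT_measurable => n.
rewrite /rat_rect; case: unpickle; last exact: measurable0.
move=> q; pose C := `[ratr q.1.1 : R, ratr q.1.2] `*` `[ratr q.2.1 : R, ratr q.2.2] `<=` U.
have [CU|nCU] := pselect C.
  rewrite (_ : mkset _ = `]ratr q.1.1 : R, ratr q.1.2[ `*` `]ratr q.2.1 : R, ratr q.2.2[).
    by apply: measurableX; exact: measurable_itv.
  by apply/seteqP; split=> x // [].
rewrite (_ : mkset _ = set0); first exact: measurable0.
by apply/seteqP; split=> x // [].
Qed.

Lemma continuous2_measurable (f : R * R -> R) : continuous f ->
  measurable_fun setT (f : TR * TR -> TR).
Proof.
move=> cf; apply: (measurability _ (RGenOInfty.measurableE R)).
move=> _ [_ [a ->] <-]; rewrite setTI; apply: open2_measurable.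
by apply: open_comp => // ? _; exact: cf.
Qed.

(** Countably many rational rectangles suffice, so the exceptional null sets can be united. *)
Lemma ae_open2 U (P : R * R -> Prop) : open U ->
  (forall a b c d : R, `[a, b] `*` `[c, d] `<=` U ->
    {ae mu2, forall x, (`]a, b[ `*` `]c, d[) x -> P x}) ->
  {ae mu2, forall x, U x -> P x}.
Proof.
move=> oU h.
have : {ae mu2, forall x n, rat_rect U n x -> P x}.
  apply: ae_foralln => n; rewrite /rat_rect.
  case: unpickle; last by apply: aeW.
  move=> q; pose C := `[ratr q.1.1 : R, ratr q.1.2] `*` `[ratr q.2.1 : R, ratr q.2.2] `<=` U.
  have [CU|nCU] := pselect C; last by apply: aeW => x [].
  by apply: aeS (h _ _ _ _ CU) => x hx [_]; exact: hx.
by apply: aeS => x hx; rewrite (open2_bigcup oU) => -[n _]; exact: hx.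
Qed.

Lemma bounded2 U : bounded_set U -> exists2 M : R, 0 < M &
  forall x, U x -> (- M < x.1 < M) /\ (- M < x.2 < M).
Proof.
move=> [M [_ MU]]; exists (`|M| + 2) => [|x Ux]; first by rewrite ltr_wpDl.
have M1 : M < `|M| + 1 by rewrite (le_lt_trans (ler_norm M))// ltrDl.
have := MU _ M1 x Ux; rewrite /= /Num.norm /= => h.
have h1 : `|x.1| < `|M| + 2.
  by apply: (@le_lt_trans _ _ (`|M| + 1)); [apply: le_trans h; rewrite le_max lexx|lra].
have h2 : `|x.2| < `|M| + 2.
  by apply: (@le_lt_trans _ _ (`|M| + 1)); [apply: le_trans h; rewrite le_max lexx orbT|lra].
by rewrite -!ltr_norml.
Qed.

Lemma lebesgue2_rect (A B : set TR) : measurable A -> measurable B ->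
  mu2 (A `*` B) = (lam A * lam B)%E.
Proof. exact: product_measure1E. Qed.

Lemma bounded2_finite U : bounded_set U -> open U -> (mu2 U < +oo)%E.
Proof.
move=> /bounded2[M M0 UM] oU.
have mI : @measurable _ TR `](- M), M[%classic by exact: measurable_itv.
apply: (@le_lt_trans _ _ (mu2 (`](- M), M[ `*` `](- M), M[))).
  apply: le_measure; rewrite ?inE; [exact: open2_measurable|exact: measurableX|].
  by move=> x /UM[h1 h2]; split; rewrite /= in_itv.
rewrite lebesgue2_rect// lebesgue_measure_itv /=.
by case: ifP => _; rewrite ?mule0 ?lte_mul_pinfty ?lee_fin// -?EFinB ?lee_fin ?ltry//; lra.
Qed.

(** By Fubini's theorem almost every vertical section of the exceptional null set is null. If P
    failed at such a t in the projection, the section at t would contain an interval, because U is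
    open. *)
Lemma ae_fst U (P : R -> Prop) : open U ->
  {ae mu2, forall x, U x -> P x.1} -> {ae lam, forall t, (fst @` U) t -> P t}.
Proof.
move=> oU [N [mN N0 NP]].
have mF : measurable_fun setT (lam \o xsection N).
  exact: measurable_fun_xsection.
have : {ae lam, forall t, setT t -> lam (xsection N t) = 0}.
  have h := (ae_eq_integral_abs lam measurableT mF).
  have : ae_eq lam setT (lam \o xsection N) (cst 0%E).
    apply/h; rewrite -[RHS]N0; apply: eq_integral => t _.
    by rewrite /= gee0_abs.
  by [].
apply: aeS => t /(_ I) Nt [[t' y] Uty /= tt]; rewrite {}tt in Uty *.
apply: contrapT => nP.
have [q [q1 q2 qU]] := open2_rect oU Uty.
have : (lam `]ratr q.2.1 : R, ratr q.2.2[%classic <= lam (xsection N t))%E.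
  apply: le_measure; rewrite ?inE.
  - exact: measurable_itv.
  - exact: measurable_xsection.
  - move=> z /=; rewrite in_itv/= => /andP[z1 z2]; rewrite /xsection /= inE.
    apply: NP => /=; apply/not_implyP; split=> //; apply: qU.
    by move/andP: q1 => [? ?]; split; rewrite /= in_itv/= !ltW.
rewrite Nt lebesgue_measure_itv /= lte_fin.
have q12 : (ratr q.2.1 : R) < ratr q.2.2 by move/andP: q2 => [/lt_trans]; apply.
by rewrite q12 -EFinB lee_fin; apply/negP; rewrite -ltNge subr_gt0.
Qed.

Lemma ae_fst_comp (P : R -> Prop) : {ae lam, forall t, P t} ->
  {ae mu2, forall x, P x.1}.
Proof.
move=> [N [mN N0 NP]]; exists (N `*` setT); split.
- exact: measurableX.
- by rewrite lebesgue2_rect// [X in (X * _)%E]N0 mul0e.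
- by move=> x /NP.
Qed.

End PlaneTopology.

(** * Test functions on the plane *)

Section RealTestFunctions.
Variable R : realType.
Local Notation lam := (@lebesgue_measure R).
Local Notation TR := (measurableTypeR R).
Local Notation mu2 := (lebesgue2 R).
Local Notation "'dd' i f" := (fun x => 'D_(unit_vec R i) f x) (at level 10, i, f at level 9).
Variable Om : set (R * R).
Hypotheses (Om_open : open Om) (Om_bounded : bounded_set Om).

Definition rtest (f : R * R -> R) := [/\ smooth f,
  compact (closure [set x | f x != 0]) & closure [set x | f x != 0] `<=` Om].

Let mOm : @measurable _ (TR * TR)%type Om.
Proof. exact: open2_measurable. Qed.

Lemma rtest_smooth f : rtest f -> smooth f. Proof. by case. Qed.

Lemma rtest_out f x : rtest f -> ~ Om x -> f x = 0.
Proof.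
move=> [_ _ fO] nOx; apply/eqP; apply: contra_notT nOx => fx.
exact/fO/subset_closure.
Qed.

Lemma rtest_sub f g : rtest f -> smooth g ->
  [set x | g x != 0] `<=` closure [set x | f x != 0] -> rtest g.
Proof.
move=> [sf cf fO] sg gf.
have clgf : closure [set x | g x != 0] `<=` closure [set x | f x != 0].
  by apply: (subset_trans (closureS gf)); rewrite -(closure_id _).1//; exact: closed_closure.
split=> //; last exact: subset_trans fO.
by apply: subclosed_compact cf clgf; exact: closed_closure.
Qed.

Lemma rtest_mul f g : rtest f -> smooth g -> rtest (fun x => f x * g x).
Proof.
move=> tf sg; apply: (rtest_sub tf); first exact: smooth_mul (rtest_smooth tf) sg.
by apply: subset_trans (@subset_closure _ _) => x /=; rewrite mulf_eq0 negb_or => /andP[].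
Qed.

Lemma rtest_scale (c : R) f : rtest f -> rtest (fun x => c * f x).
Proof.
move=> tf; have := rtest_mul tf (@smooth_cst R c); congr rtest.
by apply/funext => x; rewrite mulrC.
Qed.

Lemma rtest_add f g : rtest f -> rtest g -> rtest (fun x => f x + g x).
Proof.
move=> [sf cf fO] [sg cg gO].
have sub : closure [set x | f x + g x != 0] `<=`
    closure [set x | f x != 0] `|` closure [set x | g x != 0].
  rewrite -closureU; apply: closureS => x /= fg.
  have [f0|] := eqVneq (f x) 0; last by left.
  by right; move: fg; rewrite f0 add0r.
split; first exact: smooth_add.
- by apply: subclosed_compact sub; [exact: closed_closure|exact: compactU].
- by apply: subset_trans sub _ => x [/fO|/gO].
Qed.

Lemma rtest_0 : rtest (fun=> 0).
Proof.
have E : closure [set x : R * R | (0 : R) != 0] = set0.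
  by rewrite (_ : mkset _ = set0) ?closure0// -subset0 => x /=; rewrite eqxx.
split; [exact: smooth_cst|rewrite E; exact: compact0|by rewrite E].
Qed.

Lemma rtest_derive f i : rtest f -> rtest (dd i f).
Proof.
move=> tf; apply: (rtest_sub tf); first exact: smooth_derive (rtest_smooth tf).
move=> x /= Df; apply: contrapT => nx; move/eqP: Df; apply.
have : nbhs x (~` closure [set x | f x != 0]).
  apply: open_nbhs_nbhs; split=> //; rewrite openC; exact: closed_closure.
move=> nb; transitivity ('D_(unit_vec R i) (fun _ : R * R => 0 : R) x); last exact: derive_cst.
apply: near_eq_derive; apply: filterS nb => y ny; apply/eqP.
by apply: contra_notT ny => fy; exact: subset_closure.
Qed.

Lemma smooth_meas f : smooth f -> measurable_fun setT (f : TR * TR -> TR).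
Proof. by move=> sf; apply: continuous2_measurable; exact: smooth_continuous. Qed.

Lemma rtest_bounded f : rtest f -> exists2 C : R, 0 <= C & forall x, `|f x| <= C.
Proof.
move=> [sf cf _]; have cc : {within closure [set x | f x != 0], continuous f}.
  by apply: continuous_subspaceT; exact: smooth_continuous.
have [M [_ Mf]] := compact_bounded (continuous_compact cc cf).
exists (`|M| + 1) => [|x]; first by rewrite addr_ge0.
have [->|fx] := eqVneq (f x) 0; first by rewrite normr0 addr_ge0.
apply: Mf; first by rewrite (le_lt_trans (ler_norm _))// ltrDl.
by exists x => //; exact: subset_closure.
Qed.

Lemma bounded_sqint f (C : R) : measurable_fun Om (f : TR * TR -> TR) ->
  (forall x, Om x -> `|f x| <= C) -> sqint mu2 Om f.
Proof.
move=> mf fC; split=> //.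
have muO : (mu2 Om < +oo)%E by exact: bounded2_finite.
apply: measurable_bounded_integrable => //; first exact: measurable_funX.
exists (C ^+ 2); split; first exact: num_real.
move=> M CM x Ox /=; apply: le_trans (ltW CM); rewrite normrX lerXn2r ?nnegrE ?fC//.
exact: le_trans (fC x Ox).
Qed.

Lemma rtest_sqint f : rtest f -> sqint mu2 Om f.
Proof.
move=> tf; have [C _ fC] := rtest_bounded tf.
apply: (@bounded_sqint _ C) => //.
by apply: measurable_funTS; exact: smooth_meas (rtest_smooth tf).
Qed.

Lemma sqint1 : sqint mu2 Om (fun=> 1).
Proof. by apply: (@bounded_sqint _ 1) => // x _; rewrite normr1. Qed.

Lemma rtest_intg f : rtest f -> intg mu2 Om f.
Proof.
move=> tf; have := sqintM mOm (rtest_sqint tf) sqint1.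
by apply: eq_intg => // x _; rewrite mulr1.
Qed.

Lemma patch_out (f : R * R -> R) : (forall x, ~ Om x -> f x = 0) -> f \_ Om = f.
Proof.
move=> fO; apply/funext => x; rewrite patchE; case: ifPn => // xO.
by rewrite fO// => Ox; rewrite mem_set in xO.
Qed.

Lemma Rint_out (f : R * R -> R) : (forall x, ~ Om x -> f x = 0) ->
  \int[mu2]_(x in Om) f x = \int[mu2]_x f x.
Proof. by move=> fO; rewrite Rintegral_mkcond patch_out. Qed.

Lemma rtest_intgT f : rtest f -> intg mu2 setT f.
Proof.
move=> tf; have := (intg_mkcond mu2 f mOm).1 (rtest_intg tf).
by rewrite patch_out// => x; exact: rtest_out tf.
Qed.

(** The fundamental theorem of calculus on [-M, M]; the strict bounds in the hypothesis make g
    vanish at both end points. *)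
Lemma Rint_derive_eq0 (g g' : R -> R) (M : R) : 0 < M ->
  (forall x : R, is_derive x 1 g (g' x)) -> continuous g' ->
  (forall x, ~~ (- M < x < M) -> g x = 0) -> (forall x, ~~ (- M < x < M) -> g' x = 0) ->
  \int[lam]_x g' x = 0.
Proof.
move=> M0 dg cg' g0 g'0.
have cg : continuous g.
  by move=> x; apply: differentiable_continuous; apply/derivable1_diffP; have [] := dg x.
have -> : \int[lam]_x g' x = \int[lam]_(x in `[(- M), M]) g' x.
  rewrite [RHS]Rintegral_mkcond; congr (Rintegral _ _ _); apply/funext => x.
  rewrite patchE; case: ifPn => // /negP xM; apply: g'0; apply/negP => /andP[a b].
  by apply: xM; rewrite inE /= in_itv/= !ltW.
rewrite /Rintegral (@continuous_FTC2 _ g' g).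
- by rewrite (g0 M) ?ltxx ?andbF// (g0 (- M)) ?ltxx//= subrr.
- by rewrite ltrNl; lra.
- exact: continuous_subspaceT.
- split=> [x _||]; first by have [] := dg x.
    by apply: cvg_at_right_filter; exact: cg.
  by apply: cvg_at_left_filter; exact: cg.
- by move=> x _; rewrite derive1E; have [_ ->] := dg x.
Qed.

Lemma slice1_derive f (x y : R) : smooth f ->
  is_derive x 1 (fun s => f (s, y)) ('D_(unit_vec R 0) f (x, y)).
Proof.
move=> sf; have := derivableP (@diff_derivable _ _ _ f (x, y) (unit_vec R 0) (smooth_differentiable (x, y) sf)).
have E : (fun h : R => h^-1 *: ((f \o shift (x, y)) (h *: unit_vec R 0) - f (x, y))) =
         (fun h : R => h^-1 *: (((fun s => f (s, y)) \o shift x) (h *: (1 : R)) - f (x, y))).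
  apply/funext => h; rewrite /unit_vec eqxx /=; congr (_ *: (f _ - _)).
  by congr (_, _); rewrite /= scaler0 add0r.
by move=> [d1 d2]; split; move: d1 d2; rewrite /derivable /derive E.
Qed.

Lemma slice2_derive f (x y : R) : smooth f ->
  is_derive y 1 (fun s => f (x, s)) ('D_(unit_vec R 1) f (x, y)).
Proof.
move=> sf; have := derivableP (@diff_derivable _ _ _ f (x, y) (unit_vec R 1) (smooth_differentiable (x, y) sf)).
have E : (fun h : R => h^-1 *: ((f \o shift (x, y)) (h *: unit_vec R 1) - f (x, y))) =
         (fun h : R => h^-1 *: (((fun s => f (x, s)) \o shift y) (h *: (1 : R)) - f (x, y))).
  apply/funext => h; rewrite /unit_vec /=; congr (_ *: (f _ - _)).
  by congr (_, _); rewrite /= scaler0 add0r.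
by move=> [d1 d2]; split; move: d1 d2; rewrite /derivable /derive E.
Qed.

Lemma Rint_rtest_derive f i : rtest f -> \int[mu2]_(x in Om) 'D_(unit_vec R i) f x = 0.
Proof.
move=> tf; have tdf := rtest_derive i tf; have sf := rtest_smooth tf.
have cdf := smooth_continuous (rtest_smooth tdf).
rewrite Rint_out; last exact (fun x => @rtest_out _ x tdf).
have [M M0 OM] := bounded2 Om_bounded.
have [i0|i1] : i = 0 \/ i = 1.
  by case: i {tdf cdf} => -[|[|//]] ?; [left|right]; exact/val_inj.
- subst i; rewrite (Rfubini2 (rtest_intgT tdf)).2 -[RHS](Rintegral0 lam setT).
  apply: eq_Rintegral => y _; apply: (@Rint_derive_eq0 (fun s => f (s, y)) _ M) => //.
  + by move=> x; exact: slice1_derive.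
  + by move=> x; apply: differentiable_continuous; apply/derivable1_diffP;
      have [] := @slice1_derive _ x y (rtest_smooth tdf).
  + by move=> x xM; apply: (rtest_out tf) => /OM[/= h]; rewrite h in xM.
  + by move=> x xM; apply: (rtest_out tdf) => /OM[/= h]; rewrite h in xM.
- subst i; rewrite (Rfubini1 (rtest_intgT tdf)).2 -[RHS](Rintegral0 lam setT).
  apply: eq_Rintegral => x _; apply: (@Rint_derive_eq0 (fun s => f (x, s)) _ M) => //.
  + by move=> y; exact: slice2_derive.
  + by move=> y; apply: differentiable_continuous; apply/derivable1_diffP;
      have [] := @slice2_derive _ x y (rtest_smooth tdf).
  + by move=> y yM; apply: (rtest_out tf) => /OM[/= _ h]; rewrite h in yM.
  + by move=> y yM; apply: (rtest_out tdf) => /OM[/= _ h]; rewrite h in yM.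
Qed.

Lemma rtest_ibp f g i : rtest f -> smooth g ->
  \int[mu2]_(x in Om) (f x * 'D_(unit_vec R i) g x) =
  - \int[mu2]_(x in Om) ('D_(unit_vec R i) f x * g x).
Proof.
move=> tf sg; have sf := rtest_smooth tf.
have i1 := rtest_intg (rtest_mul tf (smooth_derive i sg)).
have i2 := rtest_intg (rtest_mul (rtest_derive i tf) sg).
apply/eqP; rewrite -addr_eq0 -RintegralD//; apply/eqP.
rewrite -[RHS](Rint_rtest_derive i (rtest_mul tf sg)).
by apply: eq_Rintegral => x _; rewrite smooth_deriveM// [X in _ + X]mulrC.
Qed.

(* Integrate the derivative of x_1 f^2. *)
Lemma rtest_poincare : exists2 C : R, 0 < C & forall f, rtest f ->
  \int[mu2]_(x in Om) (f x ^+ 2) <= C * \int[mu2]_(x in Om) ('D_(unit_vec R 0) f x ^+ 2).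
Proof.
have [M M0 OM] := bounded2 Om_bounded; exists (4 * M ^+ 2); first by rewrite mulr_gt0// exprn_gt0.
move=> f tf; have sf := rtest_smooth tf; have tdf := rtest_derive 0 tf.
have s1 : smooth (fun x : R * R => x.1 * f x).
  by apply: smooth_mul => //; exact: (@smooth_fst R id (@smooth1_id R)).
have t2 := rtest_mul tf s1.
have := Rint_rtest_derive 0 t2.
have If := sqintM mOm (rtest_sqint tf) (rtest_sqint tf).
have Idf := sqintM mOm (rtest_sqint tdf) (rtest_sqint tdf).
have E x : 'D_(unit_vec R 0) (fun x => f x * (x.1 * f x)) x =
    f x * f x + 2 * x.1 * f x * 'D_(unit_vec R 0) f x.
  rewrite smooth_deriveM// smooth_deriveM//; last exact: (@smooth_fst R id (@smooth1_id R)).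
  rewrite (@derive_fst R id 0 x (@smooth1_id R)) eqxx derive1_id; ring.
under eq_Rintegral do rewrite E.
have I2 : intg mu2 Om (fun x => 2 * x.1 * f x * 'D_(unit_vec R 0) f x).
  have := intgB mOm (rtest_intg (rtest_derive 0 t2)) If.
  by apply: eq_intg => // x _; rewrite E addrAC subrr add0r.
rewrite RintegralD// => /eqP; rewrite addr_eq0 => /eqP Ef.
(* Since -2 x_1 f d_1 f <= f^2/2 + 2 x_1^2 (d_1 f)^2 and |x_1| <= M, half of the left-hand side is
   absorbed; this yields the constant 4 M^2. *)
rewrite -(ler_pM2l (_ : 0 < 2^-1 :> R)) ?invr_gt0//.
suff : \int[mu2]_(x in Om) (f x * f x) <= 2^-1 * \int[mu2]_(x in Om) (f x * f x) +
    2 * M ^+ 2 * \int[mu2]_(x in Om) ('D_(unit_vec R 0) f x * 'D_(unit_vec R 0) f x).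
  under [X in _ -> 2^-1 * X <= _]eq_Rintegral do rewrite expr2.
  under [X in _ -> _ <= 2^-1 * (_ * X)]eq_Rintegral do rewrite expr2.
  by move: (Rintegral _ _ _) (Rintegral _ _ _) => a b; lra.
rewrite -!RintegralZl// {1}Ef -RintN// -RintegralD//; [|exact: intgZ|exact: intgZ].
apply: le_Rintegral => //; [exact: intgN|by apply: intgD => //; exact: intgZ|].
move=> x /OM[/andP[x1 x2] _]; move: (f x) ('D_(unit_vec R 0) f x) => u v.
have := sqr_ge0 (u + 2 * x.1 * v).
have : x.1 ^+ 2 * v ^+ 2 <= M ^+ 2 * v ^+ 2.
  by rewrite ler_wpM2r ?sqr_ge0//; nra.
by nra.
Qed.

End RealTestFunctions.

(** * Bumps on rectangles as test functions *)

Section TensorTestFunctions.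
Variable R : realType.
Local Notation lam := (@lebesgue_measure R).
Local Notation TR := (measurableTypeR R).
Local Notation mu2 := (lebesgue2 R).
Variable Om : set (R * R).
Hypotheses (Om_open : open Om) (Om_bounded : bounded_set Om).

Let mOm : @measurable _ (TR * TR)%type Om.
Proof. exact: open2_measurable. Qed.

Definition supported (a b : R) (f : R -> R) :=
  smooth1 f /\ forall t, ~~ (a <= t <= b) -> f t = 0.

Lemma bump_supported a b c : 0 < c -> supported a b (bumpf a b c).
Proof.
move=> c0; split; first exact: smooth1_bump.
move=> t tab; apply: bump_out => //; apply: contra tab => /andP[x y].
by rewrite !ltW.
Qed.

Lemma supported_mul a b f g : supported a b f -> smooth1 g ->
  supported a b (fun t => g t * f t).
Proof.
move=> [sf f0] sg; split; first exact: smooth1_mul.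
by move=> t /f0 ->; rewrite mulr0.
Qed.

Lemma supported_derive a b f : supported a b f -> supported a b (derive1 f).
Proof.
move=> [sf f0]; split; first exact: smooth1_derive.
move=> t tab; rewrite derive1E.
transitivity ('D_1 (fun _ : R => 0 : R) t); last exact: derive_cst.
apply: near_eq_derive.
have : nbhs t (~` `[a, b]%classic).
  apply: open_nbhs_nbhs; split; last by rewrite /= in_itv/=; exact/negP.
  by rewrite openC; exact: itv_closed.
by apply: filterS => s /= sab; apply: f0; apply/negP => h; apply: sab; rewrite in_itv.
Qed.

Lemma rtest_tensor a b c d f g : `[a, b] `*` `[c, d] `<=` Om ->
  supported a b f -> supported c d g -> rtest Om (tensor f g).
Proof.
move=> rO [sf f0] [sg g0].
have cr : compact (`[a, b] `*` `[c, d]) by apply: compact_setX; exact: segment_compact.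
have clr : closed (`[a, b] `*` `[c, d]).
  by apply: compact_closed => //; exact: (@norm_hausdorff R (R * R)%type).
have sub : closure [set x | tensor f g x != 0] `<=` `[a, b] `*` `[c, d].
  rewrite [X in _ `<=` X](closure_id _).1//; apply: closureS => x /=.
  rewrite /tensor mulf_eq0 negb_or => /andP[fx gx]; split; rewrite /= in_itv/=.
    by apply: contraNT fx => /f0 ->.
  by apply: contraNT gx => /g0 ->.
split; first exact: smooth_tensor.
- by apply: subclosed_compact cr sub; exact: closed_closure.
- exact: subset_trans sub rO.
Qed.

(** The rectangles to be tested are intersected with one contained in [Om], so that the bumps on
    them are test functions. *)
Lemma ae_eq0_test (G : R * R -> R) : intg mu2 Om G ->
  (forall a b c d k : R, `[a, b] `*` `[c, d] `<=` Om -> 0 < k ->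
     \int[mu2]_(x in Om) (G x * tensor (bumpf a b k) (bumpf c d k) x) = 0) ->
  {ae mu2, forall x, Om x -> G x = 0}.
Proof.
move=> Gi h; apply: ae_open2 => // a b c d rO.
have GOi : intg mu2 setT (G \_ Om) by apply/(intg_mkcond mu2 G mOm).
have mQ : @measurable _ (TR * TR)%type (`]a, b[ `*` `]c, d[).
  by apply: measurableX; exact: measurable_itv.
have fi := intg_patch mQ GOi.
have : {ae mu2, forall x, ((G \_ Om) \_ (`]a, b[ `*` `]c, d[)) x = 0}.
  apply: ae_eq0_rect => // a' b' c' d'; rewrite -Rintegral_mkcondr.
  have -> : (`]a', b'[ `*` `]c', d'[) `&` (`]a, b[ `*` `]c, d[) =
     `](Num.max a a'), (Num.min b b')[ `*` `](Num.max c c'), (Num.min d d')[.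
    apply/seteqP; split=> x /=; rewrite !in_itv/= !gt_max !lt_min.
      by move=> [[/andP[-> ->] /andP[-> ->]] [/andP[-> ->] /andP[-> ->]]].
    by move=> [/andP[/andP[-> ->] /andP[-> ->]] /andP[/andP[-> ->] /andP[-> ->]]].
  apply: Rint_rect_eq0 => // k k0.
  rewrite -(h (Num.max a a') (Num.min b b') (Num.max c c') (Num.min d d') k)//; last first.
    move=> x [] /=; rewrite !in_itv/= !ge_max !le_min.
    move=> /andP[/andP[ax _] /andP[xb _]] /andP[/andP[cx _] /andP[xd _]].
    by apply: rO; split; rewrite /= in_itv/= ?ax ?cx.
  rewrite [RHS]Rintegral_mkcond; apply: eq_Rintegral => x _.
  by rewrite !patchE; case: ifP => // _; rewrite mul0r.
apply: aeS => x + Qx; rewrite patchE mem_set// patchE mem_set//.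
by move: Qx => [/= ]; rewrite !in_itv/= => /andP[? ?] /andP[? ?]; apply: rO; split; rewrite /= in_itv/= !ltW.
Qed.

Lemma test_dense (P : set (R * R -> R)) : P `<=` [set f | sqint mu2 Om f] ->
  P (fun=> 0) ->
  (forall f g, P f -> P g -> P (fun x => f x + g x)) ->
  (forall c f, P f -> P (fun x => c * f x)) ->
  (forall (f_ : nat -> R * R -> R) f, (forall n, P (f_ n)) -> sqint mu2 Om f ->
    ip mu2 Om (fun x => f_ n x - f x) (fun x => f_ n x - f x) @[n --> \oo] --> 0 -> P f) ->
  (forall a b c d k : R, `[a, b] `*` `[c, d] `<=` Om -> 0 < k ->
    P (tensor (bumpf a b k) (bumpf c d k))) ->
  [set f | sqint mu2 Om f] `<=` P.
Proof.
move=> PS P0 PD PZ Pcl Pb; apply: sqint_dense => // g sg gP.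
apply: ae_eq0_test => [|a b c d k rO k0]; last exact/gP/Pb.
have := sqintM mOm sg (sqint1 Om_open Om_bounded).
by apply: eq_intg => // x _; rewrite mulr1.
Qed.

Let D := fst @` Om.

Lemma open_fst : open D.
Proof.
rewrite openE => t [[t' y] Oty /= <-].
have [q [q1 q2 qU]] := open2_rect Om_open Oty.
have : nbhs t' (`]ratr q.1.1 : R, ratr q.1.2[%classic).
  by apply: open_nbhs_nbhs; split; [exact: itv_open|rewrite /= in_itv].
apply: filterS => s /=; rewrite in_itv/= => /andP[s1 s2].
exists (s, y) => //; apply: qU; split; rewrite /= in_itv/= ?ltW//.
  by move/andP: q2 => [].
by move/andP: q2 => [].
Qed.

Lemma measurable_fstD : @measurable _ TR D.
Proof. by apply: open_measurable; exact: open_fst. Qed.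

Lemma bounded_fstD : (lam D < +oo)%E.
Proof.
have [M M0 OM] := bounded2 Om_bounded.
apply: (@le_lt_trans _ _ (lam `](- M), M[%classic)).
  apply: le_measure; rewrite ?inE; [exact: measurable_fstD|exact: measurable_itv|].
  by move=> t [x /OM[h _] <-]; rewrite /= in_itv.
by rewrite lebesgue_measure_itv /=; case: ifP => _; rewrite -?EFinB ltry.
Qed.

Lemma bounded_sqint1 f (C : R) : measurable_fun D (f : TR -> TR) ->
  (forall x, D x -> `|f x| <= C) -> sqint lam D f.
Proof.
move=> mf fC; split=> //; have mD := measurable_fstD.
apply: measurable_bounded_integrable => //; [exact: bounded_fstD|exact: measurable_funX|].
exists (C ^+ 2); split; first exact: num_real.
move=> M CM x Ox /=; apply: le_trans (ltW CM); rewrite normrX lerXn2r ?nnegrE ?fC//.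
exact: le_trans (fC x Ox).
Qed.

Lemma sqint_intg1 f : sqint lam D f -> intg lam D f.
Proof.
move=> sf; have s1 : sqint lam D (fun=> 1) by apply: (@bounded_sqint1 _ 1) => // x _; rewrite normr1.
have := sqintM measurable_fstD sf s1.
by apply: eq_intg => [|x _]; [exact: measurable_fstD|rewrite mulr1].
Qed.

(** Only bumps on the base of a rectangle contained in [Om] are required, as these are the ones that
    extend to test functions in the plane. The condition c < d excludes degenerate and empty
    rectangles; an empty one would put no restriction on [a, b]. In the proof the claim on the
    projection is lifted to the plane, where such rectangles cover [Om]. *)
Lemma test_dense1 (P : set (R -> R)) : P `<=` [set f | sqint lam D f] ->
  P (fun=> 0) ->
  (forall f g, P f -> P g -> P (fun x => f x + g x)) ->
  (forall c f, P f -> P (fun x => c * f x)) ->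
  (forall (f_ : nat -> R -> R) f, (forall n, P (f_ n)) -> sqint lam D f ->
    ip lam D (fun x => f_ n x - f x) (fun x => f_ n x - f x) @[n --> \oo] --> 0 -> P f) ->
  (forall a b c d k : R, c < d -> `[a, b] `*` `[c, d] `<=` Om -> 0 < k ->
    P (bumpf a b k)) ->
  [set f | sqint lam D f] `<=` P.
Proof.
move=> PS P0 PD PZ Pcl Pb; have mD := measurable_fstD.
apply: sqint_dense => // g sg gP; apply: ae_fst => //.
apply: ae_open2 => // a b c d rO.
have [cd|dc] := ltP c d; last first.
  apply: aeW => x [_] /=; rewrite in_itv/= => /andP[cx xd].
  by have := lt_trans cx xd; rewrite ltNge dc.
have GOi : intg lam setT (g \_ D).
  by apply/(intg_mkcond lam g mD); exact: sqint_intg1.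
have mQ : @measurable _ TR `]a, b[%classic by exact: measurable_itv.
have fi := intg_patch mQ GOi.
have : {ae lam, forall x, ((g \_ D) \_ `]a, b[) x = 0}.
  apply: ae_eq0_itv => // a' b'; rewrite -Rintegral_mkcondr.
  have -> : `]a', b'[ `&` `]a, b[ = `](Num.max a a'), (Num.min b b')[%classic.
    apply/seteqP; split=> x /=; rewrite !in_itv/= !gt_max !lt_min.
      by move=> [/andP[-> ->] /andP[-> ->]].
    by move=> /andP[/andP[-> ->] /andP[-> ->]].
  apply: Rint_itv_eq0 => // k k0.
  have rO' : `[Num.max a a', Num.min b b'] `*` `[c, d] `<=` Om.
    move=> x [] /=; rewrite !in_itv/= !ge_max !le_min.
    move=> /andP[/andP[ax _] /andP[xb _]] /andP[cx xd].
    by apply: rO; split; rewrite /= in_itv/= ?ax ?cx.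
  rewrite -(gP _ (Pb _ _ _ _ _ cd rO' k0)).
  rewrite /ip [RHS]Rintegral_mkcond; apply: eq_Rintegral => x _.
  by rewrite !patchE; case: ifP => // _; rewrite mul0r.
move=> /ae_fst_comp; apply: aeS => x + Qx; rewrite patchE mem_set//; last by case: Qx.
rewrite patchE mem_set//; exists x => //.
by move: Qx => [/= ]; rewrite !in_itv/= => /andP[? ?] /andP[? ?]; apply: rO; split; rewrite /= in_itv/= !ltW.
Qed.

End TensorTestFunctions.

(** * Sobolev spaces by real components *)

Section RealWeakDerivatives.
Variable R : realType.
Local Notation TR := (measurableTypeR R).
Local Notation mu2 := (lebesgue2 R).
Variable Om : set (R * R).
Hypotheses (Om_open : open Om) (Om_bounded : bounded_set Om).
Implicit Types (u v g h : R * R -> R).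
Local Notation sq := (sqint mu2 Om).

Let mOm : @measurable _ (TR * TR)%type Om.
Proof. exact: open2_measurable. Qed.

Lemma sq_intg g : sq g -> intg mu2 Om g.
Proof.
move=> sg; have := sqintM mOm sg (sqint1 Om_open Om_bounded).
by apply: eq_intg => // x _; rewrite mulr1.
Qed.

Definition weak_d i u g := forall psi, rtest Om psi ->
  \int[mu2]_(x in Om) (u x * 'D_(unit_vec R i) psi x) =
  - \int[mu2]_(x in Om) (g x * psi x).

Lemma weak_d_unique i u g h : sq g -> sq h -> weak_d i u g -> weak_d i u h ->
  {ae mu2, forall x, Om x -> g x = h x}.
Proof.
move=> sg sh ug uh.
have : {ae mu2, forall x, Om x -> g x - h x = 0}.
  apply: ae_eq0_test => //; first exact: sq_intg (sqintB mOm sg sh).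
  move=> a b c d k rO k0; set psi := tensor _ _.
  have tp : rtest Om psi by apply: rtest_tensor rO _ _; exact: bump_supported.
  have sp := rtest_sqint Om_open Om_bounded tp.
  rewrite -[LHS]/(ip mu2 Om (fun x => g x - h x) psi) ipBl// /ip.
  by rewrite -[X in X - _]opprK -(ug _ tp) (uh _ tp) opprK subrr.
by apply: aeS => x hx Ox; apply/eqP; rewrite -subr_eq0 hx.
Qed.

Let sd i psi : rtest Om psi -> sq (fun x => 'D_(unit_vec R i) psi x).
Proof. by move=> tp; apply: rtest_sqint => //; exact: rtest_derive. Qed.

Let sp psi : rtest Om psi -> sq psi.
Proof. exact: rtest_sqint. Qed.

Lemma weak_dD i u v g h : sq u -> sq v -> sq g -> sq h ->
  weak_d i u g -> weak_d i v h ->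
  weak_d i (fun x => u x + v x) (fun x => g x + h x).
Proof.
move=> su sv sg sh ug vh psi tp.
rewrite -[LHS]/(ip mu2 Om (fun x => u x + v x) (fun x => 'D_(unit_vec R i) psi x)).
rewrite -[X in - X]/(ip mu2 Om (fun x => g x + h x) psi).
by rewrite !ipDl ?opprD//; [congr (_ + _); [exact: ug|exact: vh]|exact: sp|exact: sd].
Qed.

Lemma weak_dZ i u g (c : R) : sq u -> sq g ->
  weak_d i u g -> weak_d i (fun x => c * u x) (fun x => c * g x).
Proof.
move=> su sg ug psi tp.
rewrite -[LHS]/(ip mu2 Om (fun x => c * u x) (fun x => 'D_(unit_vec R i) psi x)).
rewrite -[X in - X]/(ip mu2 Om (fun x => c * g x) psi).
by rewrite !ipZl//; [rewrite -mulrN; congr (_ * _); exact: ug|exact: sp|exact: sd].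
Qed.

Lemma ip_cvg (f_ : nat -> R * R -> R) f h : (forall n, sq (f_ n)) -> sq f -> sq h ->
  ip mu2 Om (fun x => f_ n x - f x) (fun x => f_ n x - f x) @[n --> \oo] --> 0 ->
  ip mu2 Om (f_ n) h @[n --> \oo] --> ip mu2 Om f h.
Proof.
move=> sf_ sf sh; have H := sqint_hilbert mu2 mOm.
apply: (@bounded_cvg R _ _ _ _ H (fun f => ip mu2 Om f h) (ip mu2 Om h h)) => //.
- exact: (dot_linl H sh).
- by move=> v sv; rewrite mulrC; exact: (dot_CS H sv sh).
Qed.

Lemma weak_d_lim i (u_ g_ : nat -> R * R -> R) u g :
  (forall n, sq (u_ n)) -> (forall n, sq (g_ n)) -> sq u -> sq g ->
  (forall n, weak_d i (u_ n) (g_ n)) ->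
  ip mu2 Om (fun x => u_ n x - u x) (fun x => u_ n x - u x) @[n --> \oo] --> 0 ->
  ip mu2 Om (fun x => g_ n x - g x) (fun x => g_ n x - g x) @[n --> \oo] --> 0 ->
  weak_d i u g.
Proof.
move=> su_ sg_ su sg ug uu gg psi tp.
have c1 := ip_cvg su_ su (sd i tp) uu.
have c2 := cvgN (ip_cvg sg_ sg (sp tp) gg).
rewrite -[LHS]/(ip mu2 Om u (fun x => 'D_(unit_vec R i) psi x)).
apply: (cvg_unique (@norm_hausdorff R R) c1).
suff -> : (fun n => ip mu2 Om (u_ n) (fun x => 'D_(unit_vec R i) psi x)) =
          (fun n => - ip mu2 Om (g_ n) psi) by exact: c2.
by apply/funext => n; exact: ug.
Qed.

Lemma weak_d_rtest i psi : rtest Om psi ->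
  weak_d i psi (fun x => 'D_(unit_vec R i) psi x).
Proof. by move=> tp phi tf; apply: rtest_ibp => //; exact: rtest_smooth tf. Qed.

End RealWeakDerivatives.

(** * Reduction of K-valued functions to real and imaginary parts *)

Section Components.
Variables (R : realType) (K : scalar_field R).
Hypothesis hK : K = real_scalars R \/ K = complex_scalars R.
Local Notation TR := (measurableTypeR R).
Local Notation mu2 := (lebesgue2 R).
Variable Om : set (R * R).
Hypotheses (Om_open : open Om) (Om_bounded : bounded_set Om).
Local Notation sq := (sqint mu2 Om).
Implicit Types (u v : R * R -> K^o).

Let mOm : @measurable _ (TR * TR)%type Om.
Proof. exact: open2_measurable. Qed.

Definition part (p : bool) (z : K) : R := if p then reK z else imK z.

(* 0 for the real scalars and 1 for the complex ones. *)
Definition chiK : R := imK (mkK K 0 1).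

Lemma imK_chi (z : K) : imK z = chiK * imK z.
Proof.
by rewrite /chiK; move: z; case: hK => -> //= z; rewrite ?mulr0 ?mul1r.
Qed.

Lemma imK_mkE (a b : R) : imK (mkK K a b) = chiK * b.
Proof. by rewrite /chiK; case: hK => -> /=; rewrite ?mul0r ?mul1r. Qed.

Lemma partD p (x y : K) : part p (x + y) = part p x + part p y.
Proof. by case: p; rewrite /= (reK_D, imK_D). Qed.

Lemma partB p (x y : K) : part p (x - y) = part p x - part p y.
Proof. by case: p; rewrite /= (reK_B, imK_B). Qed.

Lemma part_eq (x y : K) : (forall p, part p x = part p y) -> x = y.
Proof. by move=> h; apply: K_eqP => //; [exact: (h true)|exact: (h false)]. Qed.

Lemma part_mk0 p (a : R) : part p (mkK K a 0) = if p then a else 0.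
Proof. by case: p; rewrite /= ?reK_mk// imK_mk0. Qed.

Lemma part_Mr p (a : R) (z : K) : part p (mkK K a 0 * z) = a * part p z.
Proof.
by case: p; rewrite /= (reK_M, imK_M)// reK_mk// imK_mk0// mul0r ?subr0 ?addr0.
Qed.

Lemma L2P d (T : measurableType d) (mu : {measure set T -> \bar R}) (D : set T)
  (f : T -> K) : measurable D ->
  L2 mu D f <-> forall p, sqint mu D (fun x => part p (f x)).
Proof.
move=> mD; split=> [[[mr mi] i2]|h].
  have i2' : intg mu D (fun x => absK (f x) ^+ 2) by [].
  case; split=> //; apply: (le_intg mD _ _ i2'); try exact: measurable_funX.
    move=> x _; rewrite !ger0_norm ?sqr_ge0// absK_sqr// lerDl sqr_ge0//.
  by move=> x _; rewrite !ger0_norm ?sqr_ge0// absK_sqr// lerDr sqr_ge0.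
have [mr ir] := h true; have [mi ii] := h false; split; first by split.
have := intgD mD ir ii; apply: eq_intg => // x _.
by rewrite absK_sqr.
Qed.

Lemma test_functionP (phi : R * R -> K) : test_function Om phi ->
  forall p, rtest Om (fun x => part p (phi x)).
Proof.
move=> [sr si cp sO] p.
have sub : closure [set x | part p (phi x) != 0] `<=` closure [set x | phi x != 0].
  by apply: closureS => x /=; apply: contra => /eqP ->; case: p; rewrite /= (reK0, imK0).
split; first by case: p {sub}.
- by apply: subclosed_compact cp sub; exact: closed_closure.
- exact: subset_trans sO.
Qed.

Lemma mk_test_function (f g : R * R -> R) : rtest Om f -> rtest Om g ->
  test_function Om (fun x => mkK K (f x) (g x)).
Proof.
move=> tf tg; have tcg : rtest Om (fun x => chiK * g x) by exact: rtest_scale.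
have [sf cf fO] := tf; have [sg cg gO] := tcg.
have Er : (fun x => reK (mkK K (f x) (g x))) = f.
  by apply/funext => x; rewrite reK_mk.
have Ei : (fun x => imK (mkK K (f x) (g x))) = (fun x => chiK * g x).
  by apply/funext => x; rewrite imK_mkE.
have sub : closure [set x | mkK K (f x) (g x) != 0] `<=`
    closure [set x | f x != 0] `|` closure [set x | chiK * g x != 0].
  rewrite -closureU; apply: closureS => x /= fg.
  have [f0|] := eqVneq (f x) 0; last by left.
  right; apply: contra fg => /eqP g0; apply/eqP; apply: K_eqP => //.
    by rewrite reK_mk// f0 reK0.
  by rewrite imK_mkE g0 imK0.
split; rewrite ?Er ?Ei//.
- by apply: subclosed_compact sub; [exact: closed_closure|exact: compactU].
- by apply: subset_trans sub _ => x [/fO|/gO].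
Qed.

Lemma part_partialK p i (phi : R * R -> K) x :
  part p (partialK i phi x) = 'D_(unit_vec R i) (fun y => part p (phi y)) x.
Proof.
case: p; rewrite /= /partialK ?reK_mk// imK_mkE /chiK.
move: phi; case: hK => -> /= phi; last by rewrite mul1r.
by rewrite mul0r derive_cst.
Qed.

Lemma part_int p d (T : measurableType d) (mu : {measure set T -> \bar R}) (D : set T)
  (f : T -> K) : part p (integralK mu D f) = \int[mu]_(x in D) part p (f x).
Proof. by case: p; rewrite /= (reK_int, imK_int). Qed.

(** From left to right it is enough to test with real functions; from right to left the real and
    imaginary parts of phi are used separately and the products recombined. *)
Lemma is_weak_gradP u (G : R * R -> 'cV[K]_2) :
  (forall p, sq (fun x => part p (u x))) ->
  is_weak_grad Om u G <->
  (forall p i, sq (fun x => part p (G x i 0))) /\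
  (forall p i, weak_d Om i (fun x => part p (u x)) (fun x => part p (G x i 0))).
Proof.
move=> su; split=> [[LG ibp]|[sG wG]].
  have sG p i : sq (fun x => part p (G x i 0)).
    exact ((L2P mu2 (fun x => G x i 0) mOm).1 (LG i) p).
  split=> // p i psi tp.
  have tK := mk_test_function tp (rtest_0 Om).
  have := congr1 (part p) (ibp i _ tK).
  rewrite (_ : part p (- _) = - part p (integralK mu2 Om (fun x => G x i 0 * mkK K (psi x) 0))); last first.
    by case: p; rewrite /= (reK_N, imK_N).
  rewrite !part_int => h.
  transitivity (\int[mu2]_(x in Om) part p (u x * partialK i (fun y => mkK K (psi y) 0) x)).
    apply: eq_Rintegral => x _.
    have -> : partialK i (fun y => mkK K (psi y) 0) x = mkK K ('D_(unit_vec R i) psi x) 0.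
      apply: part_eq => q; rewrite part_partialK part_mk0.
      case: q => /=; first by congr ('D_ _ _ _); apply/funext => y; rewrite reK_mk.
      transitivity ('D_(unit_vec R i) (fun _ : R * R => 0 : R) x); last exact: derive_cst.
      by congr ('D_ _ _ _); apply/funext => y; rewrite imK_mk0.
    by rewrite (mulrC (u x)) part_Mr mulrC.
  rewrite h; congr (- _); apply: eq_Rintegral => x _.
  by rewrite (mulrC (G x i 0)) part_Mr mulrC.
split=> [i|i phi tphi]; first by apply/(L2P mu2 (fun x => G x i 0) mOm) => p; exact: sG.
have tr := test_functionP tphi true; have ti := test_functionP tphi false.
have str := rtest_sqint Om_open Om_bounded tr; have sti := rtest_sqint Om_open Om_bounded ti.
have dtr := rtest_sqint Om_open Om_bounded (rtest_derive i tr).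
have dti := rtest_sqint Om_open Om_bounded (rtest_derive i ti).
apply: K_eqP => //.
  rewrite reK_N// !reK_int//.
  transitivity (\int[mu2]_(x in Om) (reK (u x) * 'D_(unit_vec R i) (fun y => reK (phi y)) x -
      imK (u x) * 'D_(unit_vec R i) (fun y => imK (phi y)) x)).
    apply: eq_Rintegral => x _; rewrite reK_M//.
    by rewrite -[imK (partialK _ _ _)]/(part false _) -[reK (partialK _ _ _)]/(part true _) !part_partialK.
  rewrite RintegralB//; [|exact: sqintM (su true) dtr|exact: sqintM (su false) dti].
  rewrite (wG true i _ tr) (wG false i _ ti).
  under [in RHS]eq_Rintegral do rewrite reK_M//.
  rewrite RintegralB//; [by rewrite opprD|exact: sqintM (sG true i) str|exact: sqintM (sG false i) sti].
rewrite imK_N// !imK_int//.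
transitivity (\int[mu2]_(x in Om) (reK (u x) * 'D_(unit_vec R i) (fun y => imK (phi y)) x +
    imK (u x) * 'D_(unit_vec R i) (fun y => reK (phi y)) x)).
  apply: eq_Rintegral => x _; rewrite imK_M//.
  by rewrite -[imK (partialK _ _ _)]/(part false _) -[reK (partialK _ _ _)]/(part true _) !part_partialK.
rewrite RintegralD//; [|exact: sqintM (su true) dti|exact: sqintM (su false) dtr].
rewrite (wG true i _ ti) (wG false i _ tr).
under [in RHS]eq_Rintegral do rewrite imK_M//.
rewrite RintegralD//; [by rewrite opprD|exact: sqintM (sG true i) sti|exact: sqintM (sG false i) str].
Qed.

Definition cu p u (x : R * R) : R := part p (u x).
Definition cg p i u (x : R * R) : R := part p (wgrad Om u x i 0).

Lemma H1_parts u : H1 Om u -> [/\ forall p, sq (cu p u), forall p i, sq (cg p i u) &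
  forall p i, weak_d Om i (cu p u) (cg p i u)].
Proof.
move=> [Lu [G uG]]; have su := (L2P mu2 u mOm).1 Lu.
have : is_weak_grad Om u (wgrad Om u) by exact: (xgetPex _ (ex_intro _ G uG)).
by move=> /(is_weak_gradP _ su)[].
Qed.

(** [wgrad] is a chosen representative, so a gradient is only ever known almost everywhere. The
    gradients of sums, multiples, test functions and limits are all obtained by naming candidates
    here. *)
Lemma H1_intro u (g : bool -> 'I_2 -> R * R -> R) : (forall p, sq (cu p u)) ->
  (forall p i, sq (g p i)) -> (forall p i, weak_d Om i (cu p u) (g p i)) ->
  H1 Om u /\ forall p i, {ae mu2, forall x, Om x -> cg p i u x = g p i x}.
Proof.
move=> su sg wg; pose G x : 'cV[K]_2 := \col_i mkK K (g true i x) (g false i x).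
(* For the real scalars the imaginary parts of G are exactly 0, while [g false i] is 0 only almost
   everywhere; the factor [chiK] covers both fields. *)
pose g' p i x := if p then g true i x else chiK * g false i x.
have GE p i : (fun x => part p (G x i 0)) = g' p i.
  by apply/funext => x; rewrite mxE; case: p; rewrite /= (reK_mk, imK_mkE).
have sg' p i : sq (g' p i) by case: p; [exact: sg|exact (sqintZ mOm chiK (sg false i))].
have wg' p i : weak_d Om i (cu p u) (g' p i).
  case: p; first exact: wg.
  have -> : cu false u = (fun x => chiK * cu false u x).
    by apply/funext => x; rewrite /cu /= -imK_chi.
  exact: weak_dZ.
have uG : is_weak_grad Om u G.
  by apply/(is_weak_gradP G su); split=> p i; move: (sg' p i) (wg' p i); rewrite -GE.
have Hu : H1 Om u by split; [exact/(L2P mu2 u mOm)|exists G].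
split=> // p i; have [_ sc wc] := H1_parts Hu.
exact (weak_d_unique Om_open Om_bounded (sc p i) (sg p i) (wc p i) (wg p i)).
Qed.

(** The coordinates of (u, grad u) over R: index 0 is the value, index i + 1 the derivative in
    direction i. *)
Definition vcomp p (k : 'I_3) u : R * R -> R :=
  if unlift ord0 k is Some i then cg p i u else cu p u.

(** The real part of the inner product of H^1, semidefinite on representatives. *)
Definition h1dot u v : R :=
  \sum_(p : bool) \sum_(k < 3) ip mu2 Om (vcomp p k u) (vcomp p k v).

Lemma h1dot_def u v : h1dot u v =
  \sum_(p : bool) \sum_(k < 3) ip mu2 Om (vcomp p k u) (vcomp p k v).
Proof. by []. Qed.

Definition energy u : R := \sum_(p : bool) \sum_(i < 2) ip mu2 Om (cg p i u) (cg p i u).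

Lemma h1dotE u v : h1dot u v = \sum_(p : bool) (ip mu2 Om (cu p u) (cu p v) +
    \sum_(i < 2) ip mu2 Om (cg p i u) (cg p i v)).
Proof.
apply: eq_bigr => p _; rewrite big_ord_recl /vcomp unlift_none; congr (_ + _).
by apply: eq_bigr => i _; rewrite liftK.
Qed.

Lemma h1dot_energy u :
  h1dot u u = \sum_(p : bool) ip mu2 Om (cu p u) (cu p u) + energy u.
Proof. by rewrite h1dotE big_split. Qed.

Lemma H1norm_sqr u : H1 Om u -> H1norm Om u ^+ 2 = h1dot u u.
Proof.
move=> Hu; have [su sg wg] := H1_parts Hu.
have IT : forall p i, intg mu2 Om (fun x => cg p i u x * cg p i u x).
  by move=> p i; exact: sqintM.
have IU : forall p, intg mu2 Om (fun x => cu p u x * cu p u x).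
  by move=> p; exact: sqintM.
have E1 : L2norm mu2 Om u ^+ 2 = \sum_(p : bool) ip mu2 Om (cu p u) (cu p u).
  rewrite sqr_sqrtr; last by apply: Rintegral_ge0 => x _; rewrite sqr_ge0.
  rewrite big_bool /=.
  rewrite /ip -(RintegralD mOm (IU true) (IU false)).
  apply: eq_Rintegral => x _.
  by rewrite absK_sqr// !expr2.
have E2 : L2v_norm mu2 Om (wgrad Om u) ^+ 2 =
    \sum_(p : bool) \sum_(i < 2) ip mu2 Om (cg p i u) (cg p i u).
  have E3 : reK (L2v_dot mu2 Om (wgrad Om u) (wgrad Om u)) =
      \sum_(p : bool) \sum_(i < 2) ip mu2 Om (cg p i u) (cg p i u).
    rewrite /L2v_dot reK_int// exchange_big /= big_ord_recl big_ord1 !big_bool /=.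
    have ID i := intgD mOm (IT true i) (IT false i).
    rewrite /ip -(RintegralD mOm (IT true _) (IT false _)) -(RintegralD mOm (IT true _) (IT false _)).
    rewrite -(RintegralD mOm (ID _) (ID _)).
    apply: eq_Rintegral => x _; rewrite /dotK reK_sum// big_ord_recl big_ord1.
    by rewrite !reK_M// !reK_conj// !imK_conj// !mulNr !opprK.
  rewrite /L2v_norm E3 sqr_sqrtr//.
  by apply: sumr_ge0 => p _; apply: sumr_ge0 => i _; exact: ip_ge0.
rewrite /H1norm sqr_sqrtr; last by rewrite addr_ge0 ?sqr_ge0.
by rewrite E1 E2 h1dot_energy.
Qed.

Lemma h1dot_ge0 u : 0 <= h1dot u u.
Proof.
by apply: sumr_ge0 => p _; apply: sumr_ge0 => i _; exact: ip_ge0.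
Qed.

Lemma energy_ge0 u : 0 <= energy u.
Proof.
by apply: sumr_ge0 => p _; apply: sumr_ge0 => i _; exact: ip_ge0.
Qed.

Lemma H1norm_ge0 u : 0 <= H1norm Om u.
Proof. exact: sqrtr_ge0. Qed.

Definition scK (c : K) u : R * R -> K^o := fun x => c * u x.

Lemma H1_0 : H1 (K := K) Om (fun=> 0).
Proof.
have E p : cu p (fun=> 0) = fun=> 0.
  by apply/funext => x; case: p; rewrite /cu /= (reK0, imK0).
have [|||//] := @H1_intro (fun=> 0) (fun _ _ _ => 0).
- by move=> p; rewrite E; exact: sqint0.
- by move=> p i; exact: sqint0.
- move=> p i psi _; rewrite E.
  under eq_Rintegral do rewrite mul0r; under [in RHS]eq_Rintegral do rewrite mul0r.
  by rewrite !Rintegral0 oppr0.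
Qed.

Lemma H1_D u v : H1 Om u -> H1 Om v -> H1 Om (fun x => u x + v x) /\
  forall p i, {ae mu2, forall x, Om x ->
    cg p i (fun x => u x + v x) x = cg p i u x + cg p i v x}.
Proof.
move=> /H1_parts[su sgu wu] /H1_parts[sv sgv wv].
have E p : cu p (fun x => u x + v x) = fun x => cu p u x + cu p v x.
  by apply/funext => x; rewrite /cu partD.
apply: (@H1_intro _ (fun p i x => cg p i u x + cg p i v x)) => p.
- by rewrite E; exact: sqintD.
- by move=> i; exact: sqintD.
- by move=> i; rewrite E; exact: weak_dD.
Qed.

Lemma part_M p (c z : K) : part p (c * z) =
  part true c * part p z + (if p then - imK c else imK c) * part (~~ p) z.
Proof. by case: p; rewrite /= (reK_M, imK_M)// ?mulNr. Qed.

Lemma H1_Z c u : H1 Om u -> H1 Om (scK c u) /\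
  forall p i, {ae mu2, forall x, Om x -> cg p i (scK c u) x =
    reK c * cg p i u x + (if p then - imK c else imK c) * cg (~~ p) i u x}.
Proof.
move=> /H1_parts[su sgu wu].
have E p : cu p (scK c u) = fun x => reK c * cu p u x +
    (if p then - imK c else imK c) * cu (~~ p) u x.
  by apply/funext => x; rewrite /cu /scK part_M.
apply: (@H1_intro _ (fun p i x => reK c * cg p i u x +
    (if p then - imK c else imK c) * cg (~~ p) i u x)) => p.
- by rewrite E; apply: sqintD => //; exact: sqintZ.
- by move=> i; apply: sqintD => //; exact: sqintZ.
- by move=> i; rewrite E; apply: weak_dD => //; try exact: sqintZ; exact: weak_dZ.
Qed.

Lemma vcomp_sqint p k u : H1 Om u -> sq (vcomp p k u).
Proof.
move=> /H1_parts[su sg _]; rewrite /vcomp.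
by case: unliftP => [i _|_]; [exact: sg|exact: su].
Qed.

Lemma vcomp_D p k u v : H1 Om u -> H1 Om v ->
  {ae mu2, forall x, Om x -> vcomp p k (fun x => u x + v x) x = vcomp p k u x + vcomp p k v x}.
Proof.
move=> Hu Hv; rewrite /vcomp; case: unliftP => [i _|_]; first exact: (H1_D Hu Hv).2.
by apply: aeW => x _; rewrite /cu partD.
Qed.

Lemma vcomp_Z p k c u : H1 Om u ->
  {ae mu2, forall x, Om x -> vcomp p k (scK c u) x =
    reK c * vcomp p k u x + (if p then - imK c else imK c) * vcomp (~~ p) k u x}.
Proof.
move=> Hu; rewrite /vcomp; case: unliftP => [i _|_]; first exact: (H1_Z c Hu).2.
by apply: aeW => x _; rewrite /cu /scK part_M.
Qed.

Lemma H1_rtest (phi : R * R -> K^o) : test_function Om phi -> H1 Om phi /\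
  forall p i, {ae mu2, forall x, Om x ->
    cg p i phi x = 'D_(unit_vec R i) (fun y => part p (phi y)) x}.
Proof.
move=> tphi; have tp := test_functionP tphi.
apply: (@H1_intro _ (fun p i x => 'D_(unit_vec R i) (fun y => part p (phi y)) x)) => p.
- exact: rtest_sqint (tp p).
- by move=> i; apply: rtest_sqint => //; exact: rtest_derive (tp p).
- by move=> i; apply: weak_d_rtest => //; exact: tp.
Qed.

End Components.

Lemma sh_add_le (R : realType) (V : zmodType) (sc : R -> V -> V)
  (dot : V -> V -> R) (S : set V) (H : semi_hilbert sc dot S) u v : S u -> S v ->
  dot (u + v) (u + v) <= 2 * dot u u + 2 * dot v v.
Proof.
move=> Su Sv; have := sh_ge0 H (shB H Su Sv); rewrite (dotBB H)//.
have Suv := shD H Su Sv.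
rewrite (shDl H)// !(dot_linr H _).1// (shC H Sv Su); lra.
Qed.

Lemma cvg_bigsum (R : realType) (I : Type) (r : seq I) (F : I -> nat -> R) (l : I -> R) :
  (forall i, F i n @[n --> \oo] --> l i) ->
  \sum_(i <- r) F i n @[n --> \oo] --> \sum_(i <- r) l i.
Proof.
move=> Fl; elim: r => [|i r ih].
  rewrite big_nil (_ : (fun n => _) = fun=> 0); first exact: cvg_cst.
  by apply/funext => n; rewrite big_nil.
rewrite big_cons (_ : (fun n => _) = fun n => F i n + \sum_(j <- r) F j n).
  by apply: cvgD; [exact: Fl|exact: ih].
by apply/funext => n; rewrite big_cons.
Qed.

Lemma sum_le2 (R : realDomainType) (I : finType) (F G H : I -> R) :
  (forall i, F i <= 2 * G i + 2 * H i) ->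
  \sum_i F i <= 2 * (\sum_i G i) + 2 * (\sum_i H i).
Proof.
by move=> h; rewrite !mulr_sumr -big_split; apply: ler_sum => i _ /=; exact: h.
Qed.

Lemma sum2_le (R : realDomainType) (I J : finType) (F G H : I -> J -> R) :
  (forall i j, F i j <= 2 * G i j + 2 * H i j) ->
  \sum_i \sum_j F i j <= 2 * (\sum_i \sum_j G i j) + 2 * (\sum_i \sum_j H i j).
Proof.
by move=> h; apply: sum_le2 => i; exact: sum_le2.
Qed.

(** * H^1 and H^1_0 as complete spaces over R *)

Section H1Hilbert.
Variables (R : realType) (K : scalar_field R).
Hypothesis hK : K = real_scalars R \/ K = complex_scalars R.
Local Notation TR := (measurableTypeR R).
Local Notation mu2 := (lebesgue2 R).
Variable Om : set (R * R).
Hypotheses (Om_open : open Om) (Om_bounded : bounded_set Om).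
Local Notation sq := (sqint mu2 Om).
Local Notation h1dot := (@h1dot R K Om).
Local Notation H1 := (@H1 R K Om).
Local Notation H10 := (@H10 R K Om).
Implicit Types (u v : R * R -> K^o).

Let mOm : @measurable _ (TR * TR)%type Om.
Proof. exact: open2_measurable. Qed.

Definition scR (c : R) u := scK (mkK K c 0) u.

Let csq p k u : H1 u -> sq (vcomp Om p k u).
Proof. exact: vcomp_sqint. Qed.

Lemma vcomp_scR p k c u : H1 u ->
  {ae mu2, forall x, Om x -> vcomp Om p k (scR c u) x = c * vcomp Om p k u x}.
Proof.
move=> Hu; apply: aeS (vcomp_Z hK Om_open Om_bounded p k (mkK K c 0) Hu) => x hx Ox.
by rewrite hx// reK_mk// imK_mk0// oppr0 if_same mul0r addr0.
Qed.

Lemma H1_add u v : H1 u -> H1 v -> H1 (u + v).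
Proof. by move=> Hu Hv; exact: (H1_D hK Om_open Om_bounded Hu Hv).1. Qed.

Lemma scR_N1 u : - u = scR (-1) u.
Proof.
apply/funext => x; rewrite /scR /scK; apply: (part_eq hK) => p.
by rewrite part_Mr//; case: p; rewrite /= (reK_N, imK_N)// mulN1r.
Qed.

Lemma H1_scR c u : H1 u -> H1 (scR c u).
Proof. by move=> Hu; exact: (H1_Z hK Om_open Om_bounded _ Hu).1. Qed.

Lemma H1_opp u : H1 u -> H1 (- u).
Proof. by rewrite scR_N1; exact: H1_scR. Qed.

Lemma vcomp_add p k u v : H1 u -> H1 v ->
  {ae mu2, forall x, Om x -> vcomp Om p k (u + v) x = vcomp Om p k u x + vcomp Om p k v x}.
Proof. exact: vcomp_D. Qed.

Lemma vcomp_sub p k u v : H1 u -> H1 v ->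
  {ae mu2, forall x, Om x -> vcomp Om p k (u - v) x = vcomp Om p k u x - vcomp Om p k v x}.
Proof.
move=> Hu Hv; have c1 := vcomp_add p k Hu (H1_opp Hv).
have c2 := vcomp_scR p k (-1) Hv; rewrite -scR_N1 in c2.
by apply: aeS2 c1 c2 => x h1 h2 Ox; rewrite h1// h2// mulN1r.
Qed.

Lemma h1dot_sub u v : H1 u -> H1 v -> h1dot (u - v) (u - v) =
  \sum_(p : bool) \sum_(k < 3) ip mu2 Om (fun x => vcomp Om p k u x - vcomp Om p k v x)
     (fun x => vcomp Om p k u x - vcomp Om p k v x).
Proof.
move=> Hu Hv; apply: eq_bigr => p _; apply: eq_bigr => k _.
have m1 := (csq p k (H1_add Hu (H1_opp Hv))).1.
have m2 := (sqintB mOm (csq p k Hu) (csq p k Hv)).1.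
by apply: (ae_ip mOm) => //; exact: vcomp_sub.
Qed.

(** The components of a Cauchy sequence converge in L2, and weak derivatives pass to such limits, so
    the limits of the derivative components are the derivatives of the limit of the values. *)
Lemma H1_complete (u_ : nat -> R * R -> K^o) : (forall n, H1 (u_ n)) ->
  (forall e : R, 0 < e -> exists N, forall m n, (N <= m)%N -> (N <= n)%N ->
     h1dot (u_ m - u_ n) (u_ m - u_ n) < e) ->
  exists2 u, H1 u & h1dot (u_ n - u) (u_ n - u) @[n --> \oo] --> 0.
Proof.
move=> Hu cau.
have lim p k : exists f, sq f /\
    ip mu2 Om (fun x => vcomp Om p k (u_ n) x - f x) (fun x => vcomp Om p k (u_ n) x - f x)
      @[n --> \oo] --> 0.
  have [n|e e0|f sf fl] := @sqint_complete _ _ _ mu2 Om mOm (fun n => vcomp Om p k (u_ n)).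
  - exact: csq.
  - have [N NP] := cau e e0; exists N => m n Nm Nn.
    apply: le_lt_trans (NP m n Nm Nn); rewrite h1dot_sub//.
    rewrite (bigD1 p)//= (bigD1 k)//= -addrA lerDl addr_ge0// ?sumr_ge0// => *.
      exact: ip_ge0.
    by apply: sumr_ge0 => *; exact: ip_ge0.
  - by exists f.
have /choice[F FP] (pk : bool * 'I_3) := lim pk.1 pk.2.
pose u x : K^o := mkK K (F (true, ord0) x) (F (false, ord0) x).
have cu0 p v : vcomp Om p ord0 v = cu p v by rewrite /vcomp unlift_none.
have cgS p i v : vcomp Om p (lift ord0 i) v = cg Om p i v by rewrite /vcomp liftK.
(* For the real scalars u has imaginary part exactly 0, which the limit [F (false, k)] is only
   almost everywhere; hence the factor [chiK]. *)
pose F' p k x := if p then F (true, k) x else chiK K * F (false, k) x.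
have sF p k : sq (F (p, k)) by have [] := FP (p, k).
have sF' p k : sq (F' p k) by case: p; [exact: sF|exact (sqintZ mOm (chiK K) (sF false k))].
have vcomp_chi k n : {ae mu2, forall x, Om x ->
    vcomp Om false k (u_ n) x = chiK K * vcomp Om false k (u_ n) x}.
  apply: aeW => x _; rewrite /vcomp; case: unliftP => [i _|_]; first by rewrite /cg /= -imK_chi.
  by rewrite /cu /= -imK_chi.
have FL p k : ip mu2 Om (fun x => vcomp Om p k (u_ n) x - F' p k x)
    (fun x => vcomp Om p k (u_ n) x - F' p k x) @[n --> \oo] --> 0.
  have [_] := FP (p, k); case: p => //= h.
  have E n : ip mu2 Om (fun x => vcomp Om false k (u_ n) x - F' false k x)
     (fun x => vcomp Om false k (u_ n) x - F' false k x) =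
     chiK K ^+ 2 * ip mu2 Om (fun x => vcomp Om false k (u_ n) x - F (false, k) x)
     (fun x => vcomp Om false k (u_ n) x - F (false, k) x).
    have sB := sqintB mOm (csq false k (Hu n)) (sF false k).
    rewrite expr2 -mulrA -(ipZl mOm _ sB sB) ipC -(ipZl mOm _ sB (sqintZ mOm _ sB)).
    have sB' := sqintB mOm (csq false k (Hu n)) (sF' false k).
    have mB' := (sqintZ mOm (chiK K) sB).1.
    apply: (ae_ip mOm) => //; try exact: sB'.1.
      by apply: aeS (vcomp_chi k n) => x hx Ox; rewrite {1}hx// mulrBr.
    by apply: aeS (vcomp_chi k n) => x hx Ox; rewrite {1}hx// mulrBr.
  have c0 := @cvgM _ _ _ _ _ _ (chiK K ^+ 2) 0 (cvg_cst (chiK K ^+ 2)) h.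
  by rewrite (funext E); move: c0; rewrite mulr0; apply.
have cuE p : cu p u = F' p ord0.
  apply/funext => x; rewrite /cu /u /F'; case: p => /=; first by rewrite reK_mk.
  by rewrite imK_mkE.
have [||p i|Hu' cgu] := @H1_intro _ _ hK _ Om_open Om_bounded u (fun p i => F' p (lift ord0 i)).
- by move=> p; rewrite cuE.
- by move=> p i; exact: sF'.
- rewrite cuE; have h0 := FL p ord0; have hi := FL p (lift ord0 i).
  apply: (@weak_d_lim _ _ Om_open Om_bounded i (fun n => vcomp Om p ord0 (u_ n))
    (fun n => vcomp Om p (lift ord0 i) (u_ n))) => //; try by move=> n; exact: csq.
  by move=> n; rewrite cu0 cgS; have [_ _] := H1_parts hK Om_open Om_bounded (Hu n); exact.
exists u => //.
have compu p k : {ae mu2, forall x, Om x -> vcomp Om p k u x = F' p k x}.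
  rewrite /vcomp; case: unliftP => [i ->|->]; first exact: cgu.
  by apply: aeW => x _; rewrite cuE.
have E n : h1dot (u_ n - u) (u_ n - u) = \sum_(p : bool) \sum_(k < 3)
    ip mu2 Om (fun x => vcomp Om p k (u_ n) x - F' p k x)
     (fun x => vcomp Om p k (u_ n) x - F' p k x).
  rewrite h1dot_sub//; apply: eq_bigr => p _; apply: eq_bigr => k _.
  have s1 := sqintB mOm (csq p k (Hu n)) (csq p k Hu').
  have s2 := sqintB mOm (csq p k (Hu n)) (sF' p k).
  apply: (ae_ip mOm); try exact: s1.1; try exact: s2.1.
    by apply: aeS (compu p k) => x hx Ox; rewrite hx.
  by apply: aeS (compu p k) => x hx Ox; rewrite hx.
rewrite (funext E).
rewrite [X in _ --> X](_ : 0 = \sum_(p : bool) \sum_(k < 3) (0 : R)); last first.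
  by rewrite big1// => p _; rewrite big1.
by apply: cvg_bigsum => p; apply: cvg_bigsum => k; exact: FL.
Qed.

Lemma H1_hilbert : semi_hilbert scR h1dot H1.
Proof.
split.
- exact: H1_0.
- exact: H1_add.
- exact: H1_opp.
- exact: H1_scR.
- by move=> u v _ _; apply: eq_bigr => p _; apply: eq_bigr => k _; exact: ipC.
- move=> u v w Hu Hv Hw; rewrite -big_split; apply: eq_bigr => p _.
  rewrite -big_split; apply: eq_bigr => k _ /=.
  rewrite -(ipDl mOm (csq p k Hu) (csq p k Hv) (csq p k Hw)).
  have m1 := (csq p k (H1_add Hu Hv)).1; have m2 := (csq p k Hw).1.
  have m3 := (sqintD mOm (csq p k Hu) (csq p k Hv)).1.
  apply: (ae_ip mOm) => //; first exact: vcomp_add.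
  exact: aeW.
- move=> c u w Hu Hw; rewrite mulr_sumr; apply: eq_bigr => p _.
  rewrite mulr_sumr; apply: eq_bigr => k _ /=.
  rewrite -(ipZl mOm c (csq p k Hu) (csq p k Hw)).
  have m1 := (csq p k (H1_scR c Hu)).1; have m2 := (csq p k Hw).1.
  have m3 := (sqintZ mOm c (csq p k Hu)).1.
  apply: (ae_ip mOm) => //; first exact: vcomp_scR.
  exact: aeW.
- by move=> u _; exact: h1dot_ge0.
- exact: H1_complete.
Qed.

Lemma test_functionD (f g : R * R -> K) : test_function Om f -> test_function Om g ->
  test_function Om (fun x => f x + g x).
Proof.
move=> /(test_functionP hK) tf /(test_functionP hK) tg.
have := mk_test_function hK (rtest_add (tf true) (tg true)) (rtest_add (tf false) (tg false)).
congr test_function; apply/funext => x; rewrite -!(partD hK).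
by rewrite -[RHS](mkK_ReIm hK).
Qed.

Lemma test_function_scK c (f : R * R -> K) : test_function Om f ->
  test_function Om (scK c f).
Proof.
move=> /(test_functionP hK) tf.
have t p : rtest Om (fun x => part p (scK c f x)).
  have := rtest_add (rtest_scale (part true c) (tf p))
    (rtest_scale (if p then - imK c else imK c) (tf (~~ p))).
  by congr rtest; apply/funext => x; rewrite /scK (part_M hK).
have := mk_test_function hK (t true) (t false).
by congr test_function; apply/funext => x; rewrite -[RHS](mkK_ReIm hK).
Qed.

Lemma test_H1 (f : R * R -> K) : test_function Om f -> H1 f.
Proof. by move=> tf; have [] := H1_rtest hK Om_open Om_bounded tf. Qed.

Lemma H10_H1 u : H10 u -> H1 u. Proof. by case. Qed.

Lemma H10P u : H10 u <-> H1 u /\ forall e : R, 0 < e ->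
  exists phi : R * R -> K^o, test_function Om phi /\ h1dot (u - phi) (u - phi) < e.
Proof.
split=> -[Hu h]; split=> // e e0.
  have se : 0 < Num.sqrt e by rewrite sqrtr_gt0.
  have [phi [tphi lt]] := h _ se; exists phi; split=> //.
  have HB : H1 (u - phi) by apply: H1_add => //; apply: H1_opp; exact: test_H1.
  rewrite -(H1norm_sqr hK Om_open Om_bounded HB) -(sqr_sqrtr (ltW e0)).
  by rewrite ltrXn2r// ?nnegrE ?sqrtr_ge0// H1norm_ge0.
have e20 : 0 < e ^+ 2 by rewrite exprn_gt0.
have [phi [tphi lt]] := h _ e20; exists phi; split=> //.
have HB : H1 (u - phi) by apply: H1_add => //; apply: H1_opp; exact: test_H1.
rewrite -(@ltr_pXn2r _ 2)// ?nnegrE ?H1norm_ge0 ?ltW//.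
by rewrite -[X in H1norm Om X ^+ 2]/(u - phi) (H1norm_sqr hK Om_open Om_bounded HB).
Qed.

Lemma test_H10 (f : R * R -> K^o) : test_function Om f -> H10 f.
Proof.
move=> tf; apply/H10P; split; first exact: test_H1.
move=> e e0; exists f; split=> //; rewrite subrr.
by rewrite (linear_on0 H1_hilbert (dot_linl H1_hilbert _))//; exact: (sh0 H1_hilbert).
Qed.

Lemma H10_0 : H10 0.
Proof.
apply: test_H10; have := mk_test_function hK (rtest_0 Om) (rtest_0 Om).
congr test_function; apply/funext => x; apply: (part_eq hK) => p.
by case: p; rewrite /= ?reK_mk ?imK_mk0 ?reK0 ?imK0.
Qed.

Lemma H10_add u v : H10 u -> H10 v -> H10 (u + v).
Proof.
move=> /H10P[Hu hu] /H10P[Hv hv]; apply/H10P; split; first exact: H1_add.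
move=> e e0; have e4 : 0 < e / 4 by rewrite divr_gt0.
have [f [tf fe]] := hu _ e4; have [g [tg ge]] := hv _ e4.
exists (f + g); split; first exact: test_functionD.
have -> : u + v - (f + g) = (u - f) + (v - g) by rewrite opprD addrACA.
apply: le_lt_trans (sh_add_le H1_hilbert _ _) _.
- by apply: (shB H1_hilbert) => //; exact: test_H1.
- by apply: (shB H1_hilbert) => //; exact: test_H1.
- lra.
Qed.

Lemma ip_scale c f : sq f ->
  ip mu2 Om (fun x => c * f x) (fun x => c * f x) = c ^+ 2 * ip mu2 Om f f.
Proof.
move=> sf; have scf := sqintZ mOm c sf.
by rewrite (ipZl mOm c sf scf) ipC (ipZl mOm c sf sf) mulrA.
Qed.

(** Multiplication by c mixes real and imaginary parts. The crude factor 2 comes from (a + b)^2 <= 2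
    a^2 + 2 b^2; only boundedness is wanted. *)
Lemma h1dot_scK_le c u : H1 u -> h1dot (scK c u) (scK c u) <=
  2 * (reK c ^+ 2 + imK c ^+ 2) * h1dot u u.
Proof.
move=> Hu; set s := imK c.
have key p k : ip mu2 Om (vcomp Om p k (scK c u)) (vcomp Om p k (scK c u)) <=
    2 * (reK c ^+ 2) * ip mu2 Om (vcomp Om p k u) (vcomp Om p k u) +
    2 * (s ^+ 2) * ip mu2 Om (vcomp Om (~~ p) k u) (vcomp Om (~~ p) k u).
  pose t := if p then - s else s.
  have s1 := sqintZ mOm (reK c) (csq p k Hu).
  have s2 := sqintZ mOm t (csq (~~ p) k Hu).
  have HZ : H1 (scK c u) := (H1_Z hK Om_open Om_bounded c Hu).1.
  have -> : ip mu2 Om (vcomp Om p k (scK c u)) (vcomp Om p k (scK c u)) =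
      ip mu2 Om (fun x => reK c * vcomp Om p k u x + t * vcomp Om (~~ p) k u x)
       (fun x => reK c * vcomp Om p k u x + t * vcomp Om (~~ p) k u x).
    have m1 := (csq p k HZ).1; have m2 := (sqintD mOm s1 s2).1.
    by apply: (ae_ip mOm) => //; exact: vcomp_Z.
  apply: le_trans (ip_add_le mOm s1 s2) _.
  rewrite (ip_scale _ (csq p k Hu)) (ip_scale _ (csq (~~ p) k Hu)).
  have -> : s ^+ 2 = t ^+ 2 by rewrite /t; case: (p); rewrite ?sqrrN.
  by rewrite !mulrA.
rewrite !h1dot_def !big_bool /=.
have := ler_sum (index_enum 'I_3) (fun k (_ : true) => key true k).
have := ler_sum (index_enum 'I_3) (fun k (_ : true) => key false k).
rewrite !big_split -!mulr_sumr /=.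
move: (\sum_(i < 3) _) (\sum_(i < 3) _) (\sum_(i < 3) _) (\sum_(i < 3) _) => a b c' d.
by nra.
Qed.

Lemma H10_scK c u : H10 u -> H10 (scK c u).
Proof.
move=> /H10P[Hu hu]; apply/H10P; split; first exact: (H1_Z hK Om_open Om_bounded c Hu).1.
move=> e e0; pose C := 2 * (reK c ^+ 2 + imK c ^+ 2).
have C0 : 0 <= C by rewrite mulr_ge0// addr_ge0// sqr_ge0.
have eC : 0 < e / (C + 1) by rewrite divr_gt0// ltr_wpDl.
have [f [tf fe]] := hu _ eC; exists (scK c f); split; first exact: test_function_scK.
have -> : scK c u - scK c f = scK c (u - f).
  by apply/funext => x; rewrite /scK mulrBr.
have HB : H1 (u - f) by apply: (shB H1_hilbert) => //; exact: test_H1.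
apply: le_lt_trans (h1dot_scK_le c HB) _.
move: fe; rewrite ltr_pdivlMr ?ltr_wpDl//; apply: le_lt_trans.
by rewrite mulrC ler_wpM2l ?h1dot_ge0// lerDl.
Qed.

Lemma H10_hilbert : semi_hilbert scR h1dot H10.
Proof.
have H := H1_hilbert; split.
- exact: H10_0.
- exact: H10_add.
- by move=> u Hu; rewrite scR_N1; exact: H10_scK.
- by move=> c u Hu; exact: H10_scK.
- by move=> u v /H10_H1 Hu /H10_H1 Hv; exact: (shC H Hu Hv).
- by move=> u v w /H10_H1 Hu /H10_H1 Hv /H10_H1 Hw; exact: (shDl H Hu Hv Hw).
- by move=> c u w /H10_H1 Hu /H10_H1 Hw; exact: (shZl H c Hu Hw).
- by move=> u /H10_H1 Hu; exact: (sh_ge0 H Hu).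
- move=> u_ Hu cau; have [u H1u ul] := sh_complete H (fun n => H10_H1 (Hu n)) cau.
  exists u => //; apply/H10P; split=> // e e0.
  have e4 : 0 < e / 4 by rewrite divr_gt0.
  have /cvgrPdist_lt/(_ _ e4)[n _ /(_ n (leqnn n)) /=] := ul.
  rewrite sub0r normrN ger0_norm ?h1dot_ge0// => ne.
  have /H10P[H1n /(_ _ e4)[f [tf fe]]] := Hu n.
  exists f; split=> //.
  have -> : u - f = (- (u_ n - u)) + (u_ n - f) by rewrite opprB addrA subrK.
  have HB : H1 (u_ n - u) by exact: (shB H).
  apply: le_lt_trans (sh_add_le H _ _) _.
  + exact: (shN H).
  + by apply: (shB H) => //; exact: test_H1.
  + rewrite (linear_onN H (dot_linl H (shN H HB)) HB).
    by rewrite (linear_onN H (dot_linr H HB) HB) opprK; lra.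
Qed.

Lemma energy_add_le u v : H1 u -> H1 v ->
  energy Om (u + v) <= 2 * energy Om u + 2 * energy Om v.
Proof.
move=> Hu Hv; have [su sgu _] := H1_parts hK Om_open Om_bounded Hu.
have [sv sgv _] := H1_parts hK Om_open Om_bounded Hv.
have [_ sgw _] := H1_parts hK Om_open Om_bounded (H1_add Hu Hv).
have key p i : ip mu2 Om (cg Om p i (u + v)) (cg Om p i (u + v)) <=
    2 * ip mu2 Om (cg Om p i u) (cg Om p i u) + 2 * ip mu2 Om (cg Om p i v) (cg Om p i v).
  apply: le_trans (ip_add_le mOm (sgu p i) (sgv p i)).
  have m1 := (sgw p i).1; have m2 := (sqintD mOm (sgu p i) (sgv p i)).1.
  by rewrite le_eqVlt; apply/orP; left; apply/eqP; apply: (ae_ip mOm) => //;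
    exact: (H1_D hK Om_open Om_bounded Hu Hv).2.
exact (sum2_le key).
Qed.

Lemma energyN u : H1 u -> energy Om (- u) = energy Om u.
Proof.
move=> Hu; have [_ sgu _] := H1_parts hK Om_open Om_bounded Hu.
have [_ sgw _] := H1_parts hK Om_open Om_bounded (H1_opp Hu).
apply: eq_bigr => p _; apply: eq_bigr => i _; apply: (ae_Rint mOm).
- have := vcomp_scR p (lift ord0 i) (-1) Hu; rewrite -scR_N1 /vcomp liftK.
  by apply: aeS => x h Ox; rewrite h// !mulN1r mulrNN.
- exact: (measurable_funM (sgw p i).1 (sgw p i).1).
- exact: (measurable_funM (sgu p i).1 (sgu p i).1).
Qed.

(** The inequality for test functions extends by density: going from u to a test function and back
    costs a factor 2 each time, whence 4 C, and 1 accounts for the energy contained in [h1dot]. *)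
Lemma H10_poincare : exists2 C : R, 0 < C &
  forall u, H10 u -> h1dot u u <= C * energy Om u.
Proof.
have [C C0 CP] := rtest_poincare Om_open Om_bounded.
exists (4 * C + 1); first by rewrite addr_gt0// mulr_gt0.
have testP (f : R * R -> K^o) : test_function Om f ->
    \sum_(p : bool) ip mu2 Om (cu p f) (cu p f) <= C * energy Om f.
  move=> tf; have tp := test_functionP hK tf.
  have [_ ae_g] := H1_rtest hK Om_open Om_bounded tf.
  have [_ sg _] := H1_parts hK Om_open Om_bounded (test_H1 tf).
  rewrite mulr_sumr; apply: ler_sum => p _.
  apply: (@le_trans _ _ (C * ip mu2 Om (cg Om p 0 f) (cg Om p 0 f))); last first.
    rewrite ler_pM2l// (bigD1 0)//= lerDl; apply: sumr_ge0 => *; exact: ip_ge0.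
  have := CP _ (tp p); congr (_ <= _ * _).
  apply: (ae_Rint mOm).
  - by apply: aeS (ae_g p 0) => x h Ox; rewrite h// expr2.
  - apply: measurable_funX; have := rtest_sqint Om_open Om_bounded (rtest_derive 0 (tp p)).
    by case.
  - exact: (measurable_funM (sg p 0).1 (sg p 0).1).
move=> u /H10P[Hu hu]; rewrite h1dot_energy mulrDl mul1r lerD2r.
apply/ler_addgt0Pr => e e0.
(* The approximation errors are at most 2 d for the values and 4 C d for the energy. *)
pose d := e / (2 + 4 * C).
have d0 : 0 < d by rewrite divr_gt0// addr_gt0// mulr_gt0.
have [f [tf fe]] := hu d d0; have Hf := test_H1 tf.
have HB : H1 (u - f) by exact: (shB H1_hilbert).
have [suf _ _] := H1_parts hK Om_open Om_bounded HB.
have [sf _ _] := H1_parts hK Om_open Om_bounded Hf.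
pose n0 (w : R * R -> K^o) := \sum_(p : bool) ip mu2 Om (cu p w) (cu p w).
have N0 : n0 u <= 2 * n0 (u - f) + 2 * n0 f.
  apply: sum_le2 => p.
  apply: le_trans (ip_add_le mOm (suf p) (sf p)).
  rewrite le_eqVlt; apply/orP; left; apply/eqP; apply: eq_Rintegral => x _.
  by rewrite /cu -(partD hK) subrK.
have E1 : energy Om f <= 2 * energy Om u + 2 * energy Om (u - f).
  have -> : energy Om (u - f) = energy Om (f - u).
    by rewrite -(opprB f u) energyN//; exact: (shB H1_hilbert).
  have := energy_add_le Hu (shB H1_hilbert Hf Hu); rewrite addrC subrK; exact.
have tP : n0 f <= C * energy Om f := testP f tf.
have eb0 : 0 <= energy Om (u - f) := energy_ge0 Om (u - f).
have lt : n0 (u - f) + energy Om (u - f) < d by rewrite /n0 -h1dot_energy.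
have a0 : 0 <= n0 (u - f) by apply: sumr_ge0 => p _; exact: ip_ge0.
have dE : d * (2 + 4 * C) = e by rewrite divfK// gt_eqF// addr_gt0// mulr_gt0.
rewrite -dE -/(n0 u); move: (n0 u) (n0 f) (n0 (u - f)) (energy Om u) (energy Om f) (energy Om (u - f)) N0 E1 tP eb0 lt a0.
clear -C0 d0; move=> a b c' e1 e2 e3 N0 E1 tP eb0 lt a0.
have := ler_wpM2l (ltW C0) E1; nra.
Qed.

End H1Hilbert.

Lemma cvg_ext (R : realType) (f g : nat -> R) (l : R) : (forall n, f n = g n) ->
  f n @[n --> \oo] --> l -> g n @[n --> \oo] --> l.
Proof. by move=> /funext ->. Qed.

(** * Div-curl lemma for functions of the first coordinate *)

Section TensorIntegrals.
Context d1 d2 (T1 : measurableType d1) (T2 : measurableType d2) (R : realType).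
Variables (m1 : {sigma_finite_measure set T1 -> \bar R}).
Variables (m2 : {sigma_finite_measure set T2 -> \bar R}).

Lemma intg_tensor f g : intg m1 setT f -> intg m2 setT g ->
  intg (m1 \x m2)%E setT (fun x => f x.1 * g x.2).
Proof.
move=> fi gi.
have mfg : measurable_fun setT (fun x : T1 * T2 => f x.1 * g x.2).
  apply: measurable_funM.
    exact: (measurableT_comp (intg_meas fi) measurable_fst).
  exact: (measurableT_comp (intg_meas gi) measurable_snd).
have gfin : (\int[m2]_y `|(g y)%:E| < +oo)%E by have /integrableP[] := gi.
have ffin : (\int[m1]_y `|(f y)%:E| < +oo)%E by have /integrableP[] := fi.
apply/integrable12ltyP; first exact/measurable_EFinP.
have mg : measurable_fun setT (fun y => `|(g y)%:E|%E).
  by apply: measurableT_comp => //; exact/measurable_EFinP/(intg_meas gi).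
have mf : measurable_fun setT (fun y => `|(f y)%:E|%E).
  by apply: measurableT_comp => //; exact/measurable_EFinP/(intg_meas fi).
have E x : (\int[m2]_y `|(f x * g y)%:E| = `|(f x)%:E| * \int[m2]_y `|(g y)%:E|)%E.
  under eq_integral do rewrite EFinM abseM.
  by rewrite ge0_integralZl.
under eq_integral => x _ do rewrite /= E.
rewrite ge0_integralZr//; last exact: integral_ge0.
by rewrite lte_mul_pinfty ?integral_ge0// ge0_fin_numE// integral_ge0.
Qed.

Lemma Rint_tensor f g : intg m1 setT f -> intg m2 setT g ->
  \int[(m1 \x m2)%E]_x (f x.1 * g x.2) = \int[m1]_x f x * \int[m2]_y g y.
Proof.
move=> fi gi; have [_ ->] := Rfubini1 (intg_tensor fi gi).
under eq_Rintegral do rewrite /= RintegralZl//.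
by rewrite RintegralZr.
Qed.

End TensorIntegrals.

Section SigmaFinitePlane.
Variable R : realType.
Local Notation TR := (measurableTypeR R).

(* The library's sigma-finite instance on products is only inferred for
   subprobability factors. *)
Definition plane : set (TR * TR)%type -> \bar R := lebesgue2 R.

HB.instance Definition _ := Measure.copy plane (lebesgue2 R).

Lemma plane_sigma_finite : sigma_finite setT plane.
Proof.
pose I n : set TR := `](- n%:R), n%:R[%classic.
have mI n : measurable (I n) by exact: measurable_itv.
have If n : (@lebesgue_measure R (I n) < +oo)%E.
  by rewrite lebesgue_measure_itv /=; case: ifP => _; rewrite -?EFinB ltry.
exists (fun n => I n `*` I n) => [|n].
  apply/seteqP; split=> // -[x y] _.
  exists (Num.truncn (`|x| + `|y|)).+1 => //; rewrite /I; split; rewrite /= in_itv/= -ltr_norml.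
    by apply: le_lt_trans (truncnS_gt _); rewrite lerDl.
  by apply: le_lt_trans (truncnS_gt _); rewrite lerDr.
split; first exact: measurableX.
rewrite /plane lebesgue2_rect// lte_mul_pinfty// ge0_fin_numE//.
Qed.

HB.instance Definition _ := Measure_isSigmaFinite.Build _ _ _ plane plane_sigma_finite.

End SigmaFinitePlane.

Lemma measurable_le_step d (T : measurableType d) (R : realType) (p q : T -> measurableTypeR R) :
  measurable_fun setT p -> measurable_fun setT q ->
  measurable_fun setT (fun x => (p x <= q x)%R%:R : R).
Proof.
move=> mp mq; have -> : (fun x => (p x <= q x)%R%:R : R) = \1_[set x | p x <= q x].
  apply/funext => x; rewrite indicE; congr (_ %:R); congr nat_of_bool.
  by apply/idP/idP => [h|/set_mem//]; rewrite mem_set.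
apply: measurable_indic; have := measurable_fun_ler mp mq.
by move=> /(_ measurableT [set true]); rewrite setTI; exact.
Qed.

(** * Primitives in the first coordinate *)

Section CumulativeIntegral.
Variable R : realType.
Local Notation lam := (@lebesgue_measure R).
Local Notation TR := (measurableTypeR R).
Local Notation mu2 := (lebesgue2 R).
Variable Om : set (R * R).
Hypotheses (Om_open : open Om) (Om_bounded : bounded_set Om).
Local Notation D := (fst @` Om).
Local Notation sq := (sqint mu2 Om).
Local Notation sq1 := (sqint lam D).
Implicit Types (th : R -> R).

Let mOm : @measurable _ (TR * TR)%type Om.
Proof. exact: open2_measurable. Qed.

Let mD : @measurable _ TR D.
Proof. exact: measurable_fstD. Qed.

Lemma meas_fst th : measurable_fun D (th : TR -> TR) ->
  measurable_fun Om (fun x : TR * TR => th x.1).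
Proof.
move=> mth; apply: (@measurable_comp _ _ _ _ _ _ D th Om fst) => //.
by apply: measurable_funTS; exact: measurable_fst2.
Qed.

Lemma intgT_patch1 th : sq1 th -> intg lam setT (th \_ D).
Proof. by move=> sth; apply/(intg_mkcond lam th mD); exact: sqint_intg1. Qed.

Lemma intg_indic_itv (a b : R) : intg lam setT (\1_(`]a, b[%classic) : R -> R).
Proof.
have mI : @measurable _ TR `]a, b[%classic by exact: measurable_itv.
have fin : (lam `]a, b[%classic < +oo)%E.
  by rewrite lebesgue_measure_itv /=; case: ifP => _; rewrite -?EFinB ltry.
have := (intg_mkcond lam (fun=> 1 : R) mI).1.
have -> : (fun=> 1 : R) \_ `]a, b[%classic = \1_(`]a, b[%classic) :> (R -> R).
  by apply/funext => x; rewrite patchE indicE; case: ifP.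
apply; apply: (@measurable_bounded_integrable _ _ _ lam) => //.
by exists 1; split=> [|M M1 x _ /=]; [exact: num_real|rewrite normr1 ltW].
Qed.

Lemma Rint_indic_itv (a b : R) : a < b ->
  \int[lam]_t (\1_(`]a, b[%classic) t : R) = b - a.
Proof.
move=> ab; have mI : @measurable _ TR `]a, b[%classic by exact: measurable_itv.
have fin : lam `]a, b[%classic = (b - a)%:E.
  by rewrite lebesgue_measure_itv /= lte_fin ab -EFinB.
have := integral_indic lam measurableT mI; rewrite setIT /Rintegral => ->.
exact: (congr1 fine fin).
Qed.

(** [Om] lies in the square ]-M, M[^2, so its vertical sections have length at most 2 M. *)
Lemma sqint_fst : exists2 C : R, 0 < C & forall th, sq1 th ->
  sq (fun x => th x.1) /\
  ip mu2 Om (fun x => th x.1) (fun x => th x.1) <= C * ip lam D th th.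
Proof.
have [M M0 OM] := bounded2 Om_bounded; exists (2 * M); first by rewrite mulr_gt0.
move=> th sth; pose g := (fun t => th t * th t) \_ D.
pose I : R -> R := \1_(`](- M), M[%classic).
have gi : intg lam setT g by apply/(intg_mkcond lam _ mD); exact: sqintM.
have ti := intg_tensor gi (intg_indic_itv (- M) M).
have E x : Om x -> g x.1 * I x.2 = th x.1 * th x.1.
  move=> Ox; rewrite /g patchE mem_set; last by exists x.
  by rewrite /I indicE mem_set ?mulr1//= in_itv/=; have [_] := OM x Ox.
have i2 : intg mu2 Om (fun x => th x.1 * th x.1).
  have := intgS mOm measurableT (@subsetT _ Om) ti.
  by apply: eq_intg => // x /set_mem; exact: E.
split.
  split; first exact: meas_fst sth.1.
  by move: i2; apply: eq_intg => // x _; rewrite expr2.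
have -> : ip mu2 Om (fun x => th x.1) (fun x => th x.1) =
    \int[mu2]_x ((fun x => g x.1 * I x.2) \_ Om) x.
  by rewrite -Rintegral_mkcond; apply: eq_Rintegral => x /set_mem Ox; rewrite E.
have -> : 2 * M * ip lam D th th = \int[mu2]_x (g x.1 * I x.2).
  have -> : ip lam D th th = \int[lam]_x g x by rewrite -Rintegral_mkcond.
  rewrite [RHS](Rint_tensor gi (intg_indic_itv (- M) M)) mulrC; congr (_ * _).
  rewrite Rint_indic_itv; lra.
apply: le_Rintegral => //.
- by apply/(intg_mkcond mu2 _ mOm); apply: intgS ti.
- move=> x _; rewrite patchE; case: ifP => // _; rewrite mulr_ge0//.
    by rewrite /g patchE; case: ifP => // _; rewrite -expr2 sqr_ge0.
Qed.

Lemma ip_fst_cvg h (th_ : nat -> R -> R) th : sq h ->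
  (forall n, sq1 (th_ n)) -> sq1 th ->
  ip lam D (fun x => th_ n x - th x) (fun x => th_ n x - th x) @[n --> \oo] --> 0 ->
  ip mu2 Om h (fun x => th_ n x.1) @[n --> \oo] --> ip mu2 Om h (fun x => th x.1).
Proof.
move=> sh sth_ sth; have [C C0 CP] := sqint_fst.
have H := sqint_hilbert mu2 mOm.
apply: (@cvg_sqr_le _ _ _ (ip mu2 Om h h * C)) => n.
have sB := sqintB mD (sth_ n) sth; have [sB2 le2] := CP _ sB.
have s1 := (CP _ (sth_ n)).1; have s2 := (CP _ sth).1.
rewrite ipC (ipC _ _ h) -(ipBl mOm s1 s2 sh).
apply: le_trans (dot_CS H sB2 sh) _; rewrite mulrC -mulrA ler_wpM2l//.
exact: ip_ge0.
Qed.

Lemma supported_intg a b f : supported a b f -> intg lam setT f.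
Proof.
move=> [sf f0].
have fi : intg lam `[a, b]%classic f.
  apply: continuous_compact_integrable; first exact: segment_compact.
  by apply: continuous_subspaceT; exact: smooth1_continuous.
have mI : @measurable _ TR `[a, b]%classic by exact: measurable_itv.
have := (intg_mkcond lam f mI).1 fi; congr intg; apply/funext => t.
rewrite patchE; case: ifPn => // h; rewrite f0//; apply: contra h => h.
by rewrite mem_set//= in_itv.
Qed.

Lemma supported_meas a b f : supported a b f -> measurable_fun setT (f : TR -> TR).
Proof. by move=> /supported_intg/intg_meas. Qed.

Lemma rect_fst a b c d (t : R) : `[a, b] `*` `[c, d] `<=` Om -> c <= d ->
  a <= t <= b -> D t.
Proof.
move=> rO cd tab; exists (t, c) => //; apply: rO.
by split; rewrite /= in_itv/= ?lexx.
Qed.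

Lemma supported_bounded a b f : supported a b f ->
  exists2 C : R, 0 <= C & forall t, `|f t| <= C.
Proof.
move=> [sf f0]; have cc : {within `[a, b]%classic, continuous f}.
  by apply: continuous_subspaceT; exact: smooth1_continuous.
have [M [_ Mf]] := compact_bounded (continuous_compact cc (@segment_compact R a b)).
exists (`|M| + 1) => [|t]; first by rewrite addr_ge0.
have [tab|tab] := boolP (a <= t <= b); last by rewrite f0// normr0 addr_ge0.
apply: Mf; first by rewrite (le_lt_trans (ler_norm M))// ltrDl.
by exists t => //=; rewrite in_itv.
Qed.

Lemma supported_sqint1 a b f : supported a b f -> sq1 f.
Proof.
move=> sf; have [C _ fC] := supported_bounded sf.
apply: (@bounded_sqint1 R Om Om_open Om_bounded f C) => //.
by apply: measurable_funTS; exact: supported_meas sf.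
Qed.

(** [Om] need not be a product; the integral factorises because e and k live on a rectangle inside
    [Om], which allows integration over the whole plane. *)
Lemma Rint_fst_tensor a b c d e k th : `[a, b] `*` `[c, d] `<=` Om ->
  supported a b e -> supported c d k -> sq1 th ->
  ip mu2 Om (tensor e k) (fun x => th x.1) = ip lam D e th * \int[lam]_y k y.
Proof.
move=> rO se sk sth; have te := rtest_tensor rO se sk.
have ie : intg lam setT ((fun t => e t * th t) \_ D).
  by apply/(intg_mkcond lam _ mD); exact: (sqintM mD (supported_sqint1 se) sth).
rewrite [X in _ = X * _]/ip [X in _ = X * _]Rintegral_mkcond.
rewrite -[RHS](Rint_tensor ie (supported_intg sk)).
rewrite -[RHS](@Rint_out R Om).
  apply: eq_Rintegral => x /set_mem Ox; rewrite patchE mem_set; last by exists x.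
  by rewrite /tensor mulrAC.
move=> x nO; rewrite patchE; case: ifP; rewrite ?mul0r// => _.
by rewrite mulrAC -[e _ * k _]/(tensor e k x) (rtest_out te nO) mul0r.
Qed.

(** The primitive of th 1_D that vanishes at -oo, written as a pairing with a step function so that
    weak convergence of th gives pointwise convergence of the primitives. *)
Definition cum th (t : R) : R := ip lam D (fun s => (s <= t)%R%:R) th.

Lemma step_sqint1 t : sq1 (fun s => (s <= t)%R%:R).
Proof.
apply: (@bounded_sqint1 R Om Om_open Om_bounded _ 1) => [|s _].
  by apply: measurable_funTS; apply: measurable_le_step.
by case: (s <= t); rewrite ?normr1 ?normr0.
Qed.

Lemma step_sqint s : sq (fun x => (s <= x.1)%R%:R).
Proof.
apply: (@bounded_sqint R Om Om_open Om_bounded _ 1) => [|x _].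
  by apply: measurable_funTS; apply: measurable_le_step => //; exact: measurable_fst2.
by case: (s <= _); rewrite ?normr1 ?normr0.
Qed.

Lemma ip_step_le d (T : measurableType d) (mu : {measure set T -> \bar R}) (A : set T)
  (p : T -> bool) : measurable A ->
  sqint mu A (fun x => (p x)%:R) -> sqint mu A (fun=> 1) ->
  ip mu A (fun x => (p x)%:R) (fun x => (p x)%:R) <= ip mu A (fun=> 1) (fun=> 1).
Proof.
move=> mA s1 s2; apply: le_Rintegral => //; try exact: sqintM.
by move=> x _; case: (p x); rewrite ?mulr1// mul0r.
Qed.

Let H1d : semi_hilbert (fun (c : R) (f : R -> R) x => c * f x) (ip lam D) [set f | sq1 f].
Proof. exact: (sqint_hilbert lam mD). Qed.

Let H2d : semi_hilbert (fun (c : R) (f : R * R -> R) x => c * f x) (ip mu2 Om) [set f | sq f].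
Proof. exact: (sqint_hilbert mu2 mOm). Qed.

Let one1 : sq1 (fun=> 1).
Proof. by apply: (@bounded_sqint1 R Om Om_open Om_bounded _ 1) => // t _; rewrite normr1. Qed.

Lemma cum_sqr_le th t : sq1 th ->
  cum th t ^+ 2 <= ip lam D (fun=> 1) (fun=> 1) * ip lam D th th.
Proof.
move=> sth; apply: le_trans (dot_CS H1d (step_sqint1 t) sth) _.
rewrite ler_wpM2r ?ip_ge0//.
exact: (@ip_step_le _ _ lam D (fun s => s <= t) mD (step_sqint1 t) one1).
Qed.

(** Measurability in t is read off Fubini's theorem for a function of two variables; the indicator
    function of ]-M, M[ makes that function integrable. *)
Lemma cum_meas th : sq1 th -> measurable_fun D (cum th : TR -> TR).
Proof.
move=> sth; have [M M0 OM] := bounded2 Om_bounded.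
pose I : R -> R := \1_(`](- M), M[%classic).
pose F (x : R * R) := I x.1 * (th \_ D) x.2 * (x.2 <= x.1)%R%:R.
have ti := intg_tensor (intg_indic_itv (- M) M) (intgT_patch1 sth).
have iF : intg mu2 setT F.
  apply: (le_intg measurableT _ _ ti).
    apply: measurable_funM; first exact (intg_meas ti).
    by apply: measurable_le_step; [exact: measurable_snd2|exact: measurable_fst2].
  by move=> x _; rewrite /F; case: (x.2 <= x.1); rewrite ?mulr1// mulr0 normr0.
have [/intg_meas mF _] := Rfubini1 iF.
apply: (@eq_measurable_fun _ _ _ _ D (fun x => \int[lam]_y F (x, y))).
  move=> t /set_mem [x Ox xt]; rewrite /cum /ip [RHS]Rintegral_mkcond.
  apply: eq_Rintegral => s _; rewrite /F /= !patchE.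
  have -> : I t = 1 by rewrite /I indicE mem_set//= in_itv/= -xt; have [] := OM x Ox.
  by rewrite mul1r; case: ifP => _; rewrite ?mul0r// mulrC.
exact: measurable_funTS.
Qed.

(** The rectangle guarantees that [a, b] is contained in D, so that cutting off at D leaves the bump
    unchanged and the fundamental theorem of calculus applies. *)
Lemma cum_bump_derive (a b c d k t : R) : `[a, b] `*` `[c, d] `<=` Om -> c < d -> 0 < k ->
  is_derive t 1 (cum (bumpf a b k)) (bumpf a b k t).
Proof.
move=> rO cd k0; have sb := bump_supported a b k0; have ib := supported_intg sb.
have tt : t < t + 1 by rewrite ltrDl.
have ibt : intg lam [set` `]-oo, (t + 1)]] (bumpf a b k).
  by apply: intgS ib => //; exact: measurable_itv.
have [dF FE] := @continuous_FTC1 R (bumpf a b k) -oo%O t (t + 1) tt ibt (ltNyr t)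
  (@smooth1_continuous R _ sb.1 t).
have E : cum (bumpf a b k) = fun x => \int[lam]_(s in [set` `]-oo, x]]) bumpf a b k s.
  apply/funext => x; rewrite /cum /ip [LHS]Rintegral_mkcond [RHS]Rintegral_mkcond.
  apply: eq_Rintegral => s _; rewrite !patchE.
  have -> : (s \in [set` `]-oo, x]]) = (s <= x).
    by apply/idP/idP => [/set_mem/=|h]; rewrite ?in_itv//= mem_set//= in_itv.
  case: ifPn => sD; first by case: (s <= x); rewrite ?mul1r ?mul0r.
  rewrite bump_out ?if_same//; apply: contra sD => /andP[sa sb'].
  by rewrite mem_set//; apply: (rect_fst rO (ltW cd)); rewrite !ltW.
by rewrite E; apply: DeriveDef; [exact: dF|rewrite -derive1E FE].
Qed.

(** The adjoint of th |-> Theta(x_1), where Theta is the primitive [cum th]: integration over the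
    part of [Om] to the right of s. *)
Definition tail_int (h : R * R -> R) (s : R) : R := ip mu2 Om (fun x => (s <= x.1)%R%:R) h.

Lemma tail_sqr_le h s : sq h ->
  tail_int h s ^+ 2 <= ip mu2 Om (fun=> 1) (fun=> 1) * ip mu2 Om h h.
Proof.
move=> sh; apply: le_trans (dot_CS H2d (step_sqint s) sh) _.
rewrite ler_wpM2r ?ip_ge0//.
exact: (@ip_step_le _ _ mu2 Om (fun x => s <= x.1) mOm (step_sqint s) (sqint1 Om_open Om_bounded)).
Qed.

(* Fubini's theorem on {s <= x_1}. *)
Lemma ip_cum h th : sq h -> sq1 th ->
  sq1 (tail_int h) /\ ip mu2 Om h (fun x => cum th x.1) = ip lam D (tail_int h) th.
Proof.
move=> sh; pose m2 : {sigma_finite_measure set (TR * TR)%type -> \bar R} := @plane R.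
have ih : intg m2 setT (h \_ Om).
  by apply/(intg_mkcond mu2 h mOm); exact: (sq_intg Om_open Om_bounded sh).
pose F ph (x : (R * R) * R) := (h \_ Om) x.1 * (ph \_ D) x.2 * (x.2 <= x.1.1)%R%:R.
have iF ph : sq1 ph -> intg (m2 \x lam)%E setT (F ph).
  move=> sph; have ti := intg_tensor ih (intgT_patch1 sph).
  apply: (le_intg measurableT _ _ ti).
    apply: measurable_funM; first exact (intg_meas ti).
    apply: measurable_le_step; first exact: measurable_snd.
    apply: measurableT_comp; [exact: measurable_fst2|exact: measurable_fst].
  by move=> x _; rewrite /F; case: (x.2 <= x.1.1); rewrite ?mulr1// mulr0 normr0.
have E2 ph s : \int[m2]_x F ph (x, s) = (ph \_ D) s * tail_int h s.
  rewrite /tail_int /ip [X in _ = _ * X]Rintegral_mkcond -RintegralZl//; last first.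
    by apply/(intg_mkcond mu2 _ mOm); apply: sqintM => //; exact: step_sqint.
  apply: eq_Rintegral => x _; rewrite /F /= !patchE.
  case: (x \in Om); last by rewrite !mul0r mulr0.
  by rewrite (mulrC (h x)) -!mulrA (mulrC (h x)).
have E1 ph x : sq1 ph -> \int[lam]_s F ph (x, s) = (h \_ Om) x * cum ph x.1.
  move=> sph; rewrite patchE; case: ifPn => xO; last first.
    rewrite mul0r -[RHS](Rintegral0 lam setT); apply: eq_Rintegral => s _.
    by rewrite /F /= patchE (negbTE xO) !mul0r.
  rewrite /cum /ip [X in _ = _ * X]Rintegral_mkcond -RintegralZl//; last first.
    by apply/(intg_mkcond lam _ mD); apply: sqintM => //; exact: step_sqint1.
  apply: eq_Rintegral => s _; rewrite /F /= !patchE xO.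
  by case: (s \in D); rewrite ?mulr0 ?mul0r// -mulrA (mulrC (ph s)).
have mt : measurable_fun D (tail_int h : TR -> TR).
  (* With the density 1 the partial integral of F is on D the tail integral itself, which Fubini's
     theorem makes measurable. *)
  have [/intg_meas mF _] := Rfubini2 (iF _ one1).
  apply: (@eq_measurable_fun _ _ _ _ D (fun s => \int[m2]_x F (fun=> 1) (x, s))).
    by move=> s sD; rewrite E2 patchE sD mul1r.
  exact: measurable_funTS.
move=> sth; split.
  apply: (@bounded_sqint1 R Om Om_open Om_bounded _
    (Num.sqrt (ip mu2 Om (fun=> 1) (fun=> 1) * ip mu2 Om h h))) => // s _.
  by rewrite -sqrtr_sqr ler_wsqrtr// tail_sqr_le.
have [_ e1] := Rfubini1 (iF _ sth); have [_ e2] := Rfubini2 (iF _ sth).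
rewrite /ip [LHS]Rintegral_mkcond [RHS]Rintegral_mkcond.
transitivity (\int[(m2 \x lam)%E]_z F th z).
  rewrite e1; apply: eq_Rintegral => x _; rewrite E1// !patchE.
  by case: ifP => _; rewrite ?mul0r.
rewrite e2; apply: eq_Rintegral => s _; rewrite E2 !patchE.
by case: ifP => _; rewrite ?mul0r// mulrC.
Qed.

Lemma rtest_ip psi : rtest Om psi -> sq psi.
Proof. exact: rtest_sqint. Qed.

Lemma rtest_sqintM psi h : rtest Om psi -> sq h -> sq (fun x => h x * psi x).
Proof.
move=> tp sh; have [C _ pC] := rtest_bounded tp.
have := sqint_bM mOm (sqint_meas (rtest_ip tp)) (fun x _ => pC x) sh.
by congr sqint; apply/funext => x; rewrite mulrC.
Qed.

(** A factor theta(x_1) commutes with d_2, but theta is merely square integrable. For a bump, theta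
    e is again smooth and supported in [a, b], so the weak derivative can be tested with theta e k;
    both sides are continuous in theta. *)
Lemma fst_ibp a b c d e k (u g : R * R -> R) th : `[a, b] `*` `[c, d] `<=` Om ->
  supported a b e -> supported c d k -> sq u -> sq g -> weak_d Om 1 u g -> sq1 th ->
  ip mu2 Om (fun x => g x * tensor e k x) (fun x => th x.1) =
  - ip mu2 Om (fun x => u x * tensor e (derive1 k) x) (fun x => th x.1).
Proof.
move=> rO se sk su sg ug; have sk' := supported_derive sk.
have s1 := rtest_sqintM (rtest_tensor rO se sk) sg.
have s2 := rtest_sqintM (rtest_tensor rO se sk') su.
have [C C0 sF] := sqint_fst.
pose P := [set ph | sq1 ph /\ ip mu2 Om (fun x => g x * tensor e k x) (fun x => ph x.1) =
  - ip mu2 Om (fun x => u x * tensor e (derive1 k) x) (fun x => ph x.1)].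
have : [set f | sq1 f] `<=` P.
  apply: test_dense1 => //.
  - by move=> f [].
  - split; first exact: sqint0.
    by rewrite /ip; under eq_Rintegral do rewrite mulr0; under [in RHS]eq_Rintegral do rewrite mulr0;
      rewrite Rintegral0 oppr0.
  - move=> f f' [sf ef] [sf' ef']; split; first exact: (sqintD mD sf sf').
    have r := (sF _ sf).1; have r' := (sF _ sf').1.
    rewrite [LHS](dot_linr H2d s1).1// [X in - X](dot_linr H2d s2).1//.
    by rewrite ef ef' opprD.
  - move=> r f [sf ef]; split; first exact: (sqintZ mD r sf).
    have rf := (sF _ sf).1.
    by rewrite [LHS](dot_linr H2d s1).2// [X in - X](dot_linr H2d s2).2// ef mulrN.
  - move=> f_ f Pf sf ff; split=> //.
    have c1 := ip_fst_cvg s1 (fun n => (Pf n).1) sf ff.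
    have c2 := cvgN (ip_fst_cvg s2 (fun n => (Pf n).1) sf ff).
    apply: (cvg_unique (@norm_hausdorff R R) c1).
    rewrite (funext (fun n => (Pf n).2)); exact: c2.
  - move=> a' b' c' d' r cd' rO' r0; have sb := bump_supported a' b' r0.
    split; first exact: supported_sqint1 sb.
    have tp := rtest_tensor rO (supported_mul se sb.1) sk.
    have sbe := (supported_mul se sb.1).1.
    transitivity (\int[mu2]_(x in Om) (g x * tensor (fun t => bumpf a' b' r t * e t) k x)).
      by apply: eq_Rintegral => x _; rewrite /tensor; ring.
    rewrite -[LHS]opprK -(ug _ tp); congr (- _); apply: eq_Rintegral => x _.
    by rewrite derive_tensor//= /tensor; [ring|case: sk].
by move=> h /h[].
Qed.

(** The primitive Theta of a bump need not have compact support, but Theta e is supported in [a, b],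
    which makes Theta e k admissible. Moving the primitive to the other factor turns the right-hand
    side into a pairing with theta that is continuous in L2, so that bumps suffice. *)
Lemma fst_div a b c d e k (U Z W : R * R -> R) th : `[a, b] `*` `[c, d] `<=` Om ->
  supported a b e -> supported c d k -> sq U -> sq Z -> sq W ->
  (forall psi, rtest Om psi -> ip mu2 Om U (fun x => 'D_(unit_vec R 0) psi x) +
    ip mu2 Om Z (fun x => 'D_(unit_vec R 1) psi x) = ip mu2 Om W psi) -> sq1 th ->
  let h x := W x * tensor e k x - U x * tensor (derive1 e) k x -
             Z x * tensor e (derive1 k) x in
  sq h /\ ip mu2 Om (fun x => U x * tensor e k x) (fun x => th x.1) =
          ip lam D (tail_int h) th.
Proof.
move=> rO se sk sU sZ sW hdiv + h.
have se' := supported_derive se; have sk' := supported_derive sk.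
have s0 := rtest_sqintM (rtest_tensor rO se sk) sU.
have s1 := rtest_sqintM (rtest_tensor rO se sk) sW.
have s2 := rtest_sqintM (rtest_tensor rO se' sk) sU.
have s3 := rtest_sqintM (rtest_tensor rO se sk') sZ.
have sh : sq h := sqintB mOm (sqintB mOm s1 s2) s3.
have st := (ip_cum sh one1).1.
have [C C0 sF] := sqint_fst.
pose P := [set ph | sq1 ph /\ ip mu2 Om (fun x => U x * tensor e k x) (fun x => ph x.1) =
   ip lam D (tail_int h) ph].
have : [set f | sq1 f] `<=` P.
  apply: test_dense1 => //.
  - by move=> f [].
  - split; first exact: sqint0.
    by rewrite /ip; under eq_Rintegral do rewrite mulr0; under [in RHS]eq_Rintegral do rewrite mulr0;
      rewrite !Rintegral0.
  - move=> f f' [sf ef] [sf' ef']; split; first exact: (sqintD mD sf sf').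
    have r := (sF _ sf).1; have r' := (sF _ sf').1.
    rewrite [LHS](dot_linr H2d s0).1// [RHS](dot_linr H1d st).1//.
    by rewrite ef ef'.
  - move=> r f [sf ef]; split; first exact: (sqintZ mD r sf).
    have rf := (sF _ sf).1.
    by rewrite [LHS](dot_linr H2d s0).2// [RHS](dot_linr H1d st).2// ef.
  - move=> f_ f Pf sf ff; split=> //.
    have c1 := ip_fst_cvg s0 (fun n => (Pf n).1) sf ff.
    apply: (cvg_unique (@norm_hausdorff R R) c1).
    rewrite (funext (fun n => (Pf n).2)).
    apply: (@bounded_cvg R _ _ _ _ H1d (ip lam D (tail_int h)) (ip lam D (tail_int h) (tail_int h)) f_ f) => //.
    + exact: (dot_linr H1d st).
    + by move=> v sv; exact: (dot_CS H1d st sv).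
    + by move=> n; have [] := Pf n.
  - move=> a' b' c' d' r cd' rO' r0; have sb := bump_supported a' b' r0.
    have s1b := supported_sqint1 sb; split=> //.
    rewrite -(ip_cum sh s1b).2.
    have dG t := cum_bump_derive t rO' cd' r0.
    set G := cum _ in dG *.
    have sG : smooth1 G by apply: smooth1_antiderivative dG; exact: sb.1.
    have se1 := supported_mul se sG.
    have tp := rtest_tensor rO se1 sk.
    have dGe t : derive1 (fun t => G t * e t) t = bumpf a' b' r t * e t + G t * derive1 e t.
      have de := smooth1_is_derive1 t se.1; have dG' := dG t.
      by rewrite derive1E derive_val /GRing.scale /=; ring.
    have te1' := rtest_tensor rO (supported_mul se' sG) sk.
    have te1k := rtest_tensor rO se1 sk'.
    have tbe := rtest_tensor rO (supported_mul se sb.1) sk.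
    have i1 := sqintM mOm sW (rtest_ip tp); have i2 := sqintM mOm sU (rtest_ip te1').
    have i3 := sqintM mOm sZ (rtest_ip te1k); have i4 := sqintM mOm sU (rtest_ip tbe).
    have -> : ip mu2 Om h (fun x => G x.1) = \int[mu2]_(x in Om)
       (W x * tensor (fun t => G t * e t) k x - U x * tensor (fun t => G t * derive1 e t) k x -
        Z x * tensor (fun t => G t * e t) (derive1 k) x).
      by apply: eq_Rintegral => x _; rewrite /h /tensor; ring.
    rewrite (RintegralB mOm (intgB mOm i1 i2) i3) (RintegralB mOm i1 i2).
    have := hdiv _ tp; rewrite /ip => <-.
    have -> : \int[mu2]_(x in Om) (U x * 'D_(unit_vec R 0) (tensor (fun t => G t * e t) k) x) =
       \int[mu2]_(x in Om) (U x * tensor (fun t => bumpf a' b' r t * e t) k x) +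
       \int[mu2]_(x in Om) (U x * tensor (fun t => G t * derive1 e t) k x).
      rewrite -(RintegralD mOm i4 i2); apply: eq_Rintegral => x _.
      by rewrite derive_tensor//= ?/tensor ?dGe; [ring|exact: se1.1|case: sk].
    have -> : \int[mu2]_(x in Om) (Z x * 'D_(unit_vec R 1) (tensor (fun t => G t * e t) k) x) =
       \int[mu2]_(x in Om) (Z x * tensor (fun t => G t * e t) (derive1 k) x).
      by apply: eq_Rintegral => x _; rewrite derive_tensor//=; [exact: se1.1|case: sk].
    rewrite addrAC addrK addrK.
    by apply: eq_Rintegral => x _; rewrite /tensor; ring.
by move=> hP sth; split=> //; have [] := hP _ sth.
Qed.

Lemma ip_bounded_cvg0 d (T : measurableType d) (mu : {measure set T -> \bar R}) (A : set T)
  (f_ : nat -> T -> R) (C : R) : measurable A -> sqint mu A (fun=> 1) ->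
  (forall n, measurable_fun A (f_ n)) -> (forall n x, A x -> f_ n x ^+ 2 <= C) ->
  (forall x, A x -> f_ n x @[n --> \oo] --> 0) ->
  ip mu A (f_ n) (f_ n) @[n --> \oo] --> 0.
Proof.
move=> mA s1 mf fC f0.
have iC : intg mu A (fun=> C).
  by have := intgZ mA C (sqintM mA s1 s1); apply: eq_intg => // x _; rewrite !mulr1.
have [|||||_] := @Rint_dominated _ T R mu A mA (fun n x => f_ n x * f_ n x) (fun=> 0) (fun=> C).
- by move=> n; exact: measurable_funM.
- exact: measurable_cst.
- by apply: aeW => x Ax; rewrite -(mulr0 0); apply: cvgM; exact: f0.
- exact: iC.
- by apply: aeW => x Ax n; rewrite -expr2 ger0_norm ?sqr_ge0// fC.
by rewrite Rintegral0.
Qed.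

(** Weak convergence to 0 in L2. Boundedness in norm, which would follow from the uniform
    boundedness principle, is carried along separately as [bdd]. *)
Definition wk0 (f_ : nat -> R * R -> R) := forall g, sq g -> ip mu2 Om (f_ n) g @[n --> \oo] --> 0.

Definition bdd (f_ : nat -> R * R -> R) :=
  (forall n, sq (f_ n)) /\ exists B : R, forall n, ip mu2 Om (f_ n) (f_ n) <= B.

Lemma bdd_sub f_ g_ : bdd f_ -> bdd g_ -> bdd (fun n x => f_ n x - g_ n x).
Proof.
move=> [sf [B fB]] [sg [B' gB]]; split; first by move=> n; exact: (sqintB mOm (sf n) (sg n)).
exists (2 * B + 2 * B') => n.
have := sh_add_le H2d (sf n) (shN H2d (sg n)).
have -> : ip mu2 Om (- g_ n) (- g_ n) = ip mu2 Om (g_ n) (g_ n).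
  by apply: eq_Rintegral => x _; rewrite mulrNN.
have := fB n; have := gB n; rewrite -[ip mu2 Om (fun x => f_ n x - g_ n x) _]/(ip mu2 Om (f_ n - g_ n) (f_ n - g_ n)).
by move: (ip _ _ _ _) (ip _ _ _ _) (ip _ _ _ _) => x y z; lra.
Qed.

Lemma bdd_test psi f_ : rtest Om psi -> bdd f_ -> bdd (fun n x => f_ n x * psi x).
Proof.
move=> tp [sf [B fB]]; have [C C0 pC] := rtest_bounded tp; split.
  by move=> n; exact: rtest_sqintM.
exists (C ^+ 2 * B) => n; apply: (@le_trans _ _ (C ^+ 2 * ip mu2 Om (f_ n) (f_ n))); last first.
  by rewrite ler_wpM2l ?sqr_ge0.
have sfp := rtest_sqintM tp (sf n).
have [] // := sqint_le mOm (sf n) sfp.1 (sqr_ge0 C).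
apply: aeW => x _; rewrite exprMn mulrC ler_wpM2r ?sqr_ge0//.
by rewrite -real_normK ?num_real// lerXn2r ?nnegrE.
Qed.

Lemma wk0_sub f_ g_ : bdd f_ -> bdd g_ -> wk0 f_ -> wk0 g_ ->
  wk0 (fun n x => f_ n x - g_ n x).
Proof.
move=> [sf _] [sg _] f0 g0 h sh; rewrite -(subr0 0).
rewrite (_ : (fun n => ip _ _ _ _) = fun n => ip mu2 Om (f_ n) h - ip mu2 Om (g_ n) h).
  by apply: cvgB; [exact: f0|exact: g0].
by apply/funext => n; exact: (ipBl mOm (sf n) (sg n) sh).
Qed.

Lemma wk0_test psi f_ : rtest Om psi -> wk0 f_ -> wk0 (fun n x => f_ n x * psi x).
Proof.
move=> tp f0 h sh; have := f0 _ (rtest_sqintM tp sh).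
by apply: cvg_ext => n; apply: eq_Rintegral => x _; ring.
Qed.

(* A div-curl argument: by fst_div the pairing is an integral of a product in
   which one factor is compactly smoothed, so that one weak limit suffices. *)
Lemma fst_div_cvg a b c d e k (U Z W : nat -> R * R -> R) (th : nat -> R -> R) (B : R) :
  `[a, b] `*` `[c, d] `<=` Om -> supported a b e -> supported c d k ->
  bdd U -> bdd Z -> bdd W ->
  (forall n psi, rtest Om psi -> ip mu2 Om (U n) (fun x => 'D_(unit_vec R 0) psi x) +
    ip mu2 Om (Z n) (fun x => 'D_(unit_vec R 1) psi x) = ip mu2 Om (W n) psi) ->
  (forall n, sq1 (th n)) -> (forall n, ip lam D (th n) (th n) <= B) ->
  (forall g, sq1 g -> ip lam D (th n) g @[n --> \oo] --> 0) \/ [/\ wk0 U, wk0 Z & wk0 W] ->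
  ip mu2 Om (fun x => U n x * tensor e k x) (fun x => th n x.1) @[n --> \oo] --> 0.
Proof.
move=> rO se sk bU bZ bW hdiv sth thB.
have se' := supported_derive se; have sk' := supported_derive sk.
have t0 := rtest_tensor rO se sk.
have t1 := rtest_tensor rO se' sk; have t2 := rtest_tensor rO se sk'.
pose h n x := W n x * tensor e k x - U n x * tensor (derive1 e) k x -
             Z n x * tensor e (derive1 k) x.
have E n := (fst_div rO se sk (bU.1 n) (bZ.1 n) (bW.1 n) (hdiv n) (sth n)).2.
have bh : bdd h := bdd_sub (bdd_sub (bdd_test t0 bW) (bdd_test t1 bU)) (bdd_test t2 bZ).
rewrite (funext E) -/h; have [sh [C hC]] := bh.
have one2 := sqint1 Om_open Om_bounded.
have B0 : 0 <= B by apply: le_trans (ip_ge0 lam D _) (thB 0).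
have C0 : 0 <= C by apply: le_trans (ip_ge0 mu2 Om _) (hC 0).
case=> [th0|[U0 Z0 W0]].
  (* Case of th weakly null: the primitives tend to 0 pointwise and are uniformly bounded, hence
     tend to 0 in norm, while h is only bounded. *)
  apply: (@cvg_sqr_le _ _ _ C (fun n => ip mu2 Om (fun x => cum (th n) x.1) (fun x => cum (th n) x.1))).
    move=> n; rewrite subr0 -(ip_cum (sh n) (sth n)).2.
    have sc : sq (fun x => cum (th n) x.1).
      apply: (@bounded_sqint R Om Om_open Om_bounded _ (Num.sqrt (ip lam D (fun=> 1) (fun=> 1) * ip lam D (th n) (th n)))).
        by apply: meas_fst; exact: cum_meas.
      by move=> x _; rewrite -sqrtr_sqr ler_wsqrtr// cum_sqr_le.
    apply: le_trans (dot_CS H2d (sh n) sc) _.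
    by rewrite ler_wpM2r ?ip_ge0.
  apply: (@ip_bounded_cvg0 _ _ mu2 Om _ (ip lam D (fun=> 1) (fun=> 1) * B)) => //.
  - by move=> n; apply: meas_fst; exact: cum_meas.
  - by move=> n x _; apply: le_trans (cum_sqr_le _ (sth n)) _; rewrite ler_wpM2l ?ip_ge0.
  - move=> x _; have := th0 _ (step_sqint1 x.1).
    by apply: cvg_ext => n; rewrite /cum ipC.
(* Case of (U, Z, W) weakly null: then so is h, and its tail integrals, being pairings with step
   functions, tend to 0 pointwise and boundedly, while th is only bounded. *)
have h0 : wk0 h.
  apply: wk0_sub; [exact: bdd_sub (bdd_test t0 bW) (bdd_test t1 bU)|exact: bdd_test t2 bZ| |exact: wk0_test].
  by apply: wk0_sub; [exact: bdd_test|exact: bdd_test|exact: wk0_test|exact: wk0_test].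
have stail n := (ip_cum (sh n) one1).1.
apply: (@cvg_sqr_le _ _ _ B (fun n => ip lam D (tail_int (h n)) (tail_int (h n)))).
  move=> n; rewrite subr0 mulrC.
  apply: le_trans (dot_CS H1d (stail n) (sth n)) _.
  by rewrite ler_wpM2l ?ip_ge0.
apply: (@ip_bounded_cvg0 _ _ lam D _ (ip mu2 Om (fun=> 1) (fun=> 1) * C)) => //.
- by move=> n; exact: sqint_meas (stail n).
- by move=> n s _; apply: le_trans (tail_sqr_le _ (sh n)) _; rewrite ler_wpM2l ?ip_ge0.
- move=> s _; have := h0 _ (step_sqint s).
  by apply: cvg_ext => n; rewrite /tail_int ipC.
Qed.

End CumulativeIntegral.

Lemma cvg_ext2 (R : realType) (f g : nat -> R) (l l' : R) : (forall n, f n = g n) ->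
  l = l' -> f n @[n --> \oo] --> l -> g n @[n --> \oo] --> l'.
Proof. by move=> /funext -> ->. Qed.

Lemma Rint_ae_le d (T : measurableType d) (R : realType) (mu : {measure set T -> \bar R})
  (A : set T) (f g : T -> R) : measurable A -> intg mu A f -> intg mu A g ->
  {ae mu, forall x, A x -> f x <= g x} ->
  \int[mu]_(x in A) f x <= \int[mu]_(x in A) g x.
Proof.
move=> mA fi gi fg; rewrite -subr_ge0 -(RintegralB mA gi fi).
have gf := intgB mA gi fi.
have mgf := intg_meas gf.
have -> : \int[mu]_(x in A) (g x - f x) = \int[mu]_(x in A) `|g x - f x|.
  apply: (ae_Rint mA) => //; last exact: measurableT_comp.
  by apply: filterS fg => x h Ax; rewrite ger0_norm// subr_ge0 h.
exact: Rintegral_ge0.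
Qed.

Lemma Rint_sum d (T : measurableType d) (R : realType) (mu : {measure set T -> \bar R})
  (A : set T) (I : Type) (r : seq I) (f : I -> T -> R) : measurable A ->
  (forall i, intg mu A (f i)) ->
  intg mu A (fun x => \sum_(i <- r) f i x) /\
  \int[mu]_(x in A) (\sum_(i <- r) f i x) = \sum_(i <- r) \int[mu]_(x in A) f i x.
Proof.
move=> mA fi; elim: r => [|i r [ih1 ih2]].
  split; last by under eq_Rintegral do rewrite big_nil; rewrite Rintegral0 big_nil.
  by have := intg0 mu A; apply: eq_intg => // x _; rewrite big_nil.
split.
  by have := intgD mA (fi i) ih1; apply: eq_intg => // x _; rewrite big_cons.
under eq_Rintegral do rewrite big_cons.
by rewrite (RintegralD mA (fi i) ih1) [RHS]big_cons ih2.
Qed.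

Section PointwiseBounds.
Variables (R : realType) (K : scalar_field R).
Hypothesis hK : K = real_scalars R \/ K = complex_scalars R.

Lemma reK_dotK n (v w : 'cV[K]_n) :
  reK (dotK v w) = \sum_(p : bool) \sum_(i < n) part p (v i 0) * part p (w i 0).
Proof.
rewrite big_bool -big_split reK_sum//; apply: eq_bigr => i _ /=.
by rewrite reK_M// reK_conj// imK_conj// mulNr opprK.
Qed.

(** With w = A v the hypothesis on the inverse reads |w|^2 <= b Re <w, v>, and 0 <= |w - b v|^2 then
    gives the bound. *)
Lemma re_ge_inv_le n (A : 'M[K]_n) (b : R) (v : 'cV[K]_n) : 0 < b -> A \in unitmx ->
  re_ge (invmx A) b^-1 -> reK (dotK (A *m v) (A *m v)) <= b ^+ 2 * reK (dotK v v).
Proof.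
move=> b0 uA /(_ (A *m v)); rewrite mulKmx//; set w := A *m v => h.
have h2 : reK (dotK w w) <= b * reK (dotK w v).
  by rewrite -ler_pdivrMl.
have : 0 <= \sum_(p : bool) \sum_(i < n) (part p (w i 0) - b * part p (v i 0)) ^+ 2.
  by apply: sumr_ge0 => p _; apply: sumr_ge0 => i _; rewrite sqr_ge0.
have -> : \sum_(p : bool) \sum_(i < n) (part p (w i 0) - b * part p (v i 0)) ^+ 2 =
    reK (dotK w w) - 2 * b * reK (dotK w v) + b ^+ 2 * reK (dotK v v).
  rewrite !reK_dotK !mulr_sumr -sumrB -big_split; apply: eq_bigr => p _ /=.
  rewrite !mulr_sumr -sumrB -big_split; apply: eq_bigr => i _ /=; ring.
lra.
Qed.

End PointwiseBounds.

(** * The form of a coefficient *)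

Section Dot4.
Variable R : realType.
Context d (T : measurableType d) (mu : {measure set T -> \bar R}) (A : set T).
Hypothesis mA : measurable A.
Variables (I J : finType).
Implicit Types F G : I -> J -> T -> R.
Local Notation sq4 F := (forall p i, sqint mu A (F p i)).

Definition dot4 F G : R := \sum_p \sum_i ip mu A (F p i) (G p i).

Lemma dot4_int F G : sq4 F -> sq4 G ->
  intg mu A (fun x => \sum_p \sum_i F p i x * G p i x) /\
  dot4 F G = \int[mu]_(x in A) (\sum_p \sum_i F p i x * G p i x).
Proof.
move=> sF sG.
have h p := @Rint_sum _ _ _ mu A _ (index_enum J) (fun i x => F p i x * G p i x) mA
  (fun i => sqintM mA (sF p i) (sG p i)).
have [h1 h2] := @Rint_sum _ _ _ mu A _ (index_enum I) _ mA (fun p => (h p).1).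
split=> //; rewrite h2; apply: eq_bigr => p _; by rewrite (h p).2.
Qed.

Lemma dot4_ge0 F : 0 <= dot4 F F.
Proof. by apply: sumr_ge0 => p _; apply: sumr_ge0 => i _; exact: ip_ge0. Qed.

Lemma dot4_CS F G : sq4 F -> sq4 G -> dot4 F G ^+ 2 <= dot4 F F * dot4 G G.
Proof.
move=> sF sG; apply: quadratic_ge0 => t.
have H := sqint_hilbert mu mA.
rewrite /dot4 !mulr_sumr -!big_split /=; apply: sumr_ge0 => p _.
rewrite !mulr_sumr -!big_split /=; apply: sumr_ge0 => i _.
rewrite -(dotZD H t (sF p i) (sG p i)); exact: ip_ge0.
Qed.

Lemma dot4_comp_le F p i : ip mu A (F p i) (F p i) <= dot4 F F.
Proof.
rewrite /dot4 (bigD1 p)//= (bigD1 i)//= -addrA lerDl.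
by apply: addr_ge0; apply: sumr_ge0 => *; [exact: ip_ge0|apply: sumr_ge0 => *; exact: ip_ge0].
Qed.

End Dot4.

Section CoefficientForm.
Variables (R : realType) (K : scalar_field R).
Hypothesis hK : K = real_scalars R \/ K = complex_scalars R.
Local Notation TR := (measurableTypeR R).
Local Notation mu2 := (lebesgue2 R).
Variable Om : set (R * R).
Hypotheses (Om_open : open Om) (Om_bounded : bounded_set Om).
Local Notation sq := (sqint mu2 Om).
Local Notation h1dot := (@h1dot R K Om).
Local Notation H1 := (@H1 R K Om).
Local Notation H10 := (@H10 R K Om).
Implicit Types (u v : R * R -> K^o).

Let mOm : @measurable _ (TR * TR)%type Om.
Proof. exact: open2_measurable. Qed.

Lemma ae_all2 (P : bool -> 'I_2 -> R * R -> Prop) :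
  (forall p i, {ae mu2, forall x, Om x -> P p i x}) ->
  {ae mu2, forall x, Om x -> forall p i, P p i x}.
Proof.
move=> h; have hp p : {ae mu2, forall x, Om x -> forall i, P p i x}.
  apply: aeS2 (h p 0) (h p (lift ord0 ord0)) => x h0 h1 Ox i.
  by case: (unliftP ord0 i) => [j ->|->]; [rewrite (ord1 j); exact: h1|exact: h0].
by apply: aeS2 (hp true) (hp false) => x ht hf Ox []; [exact: ht|exact: hf].
Qed.

Lemma colK_eq (v w : 'cV[K]_2) : (forall p i, part p (v i 0) = part p (w i 0)) -> v = w.
Proof.
move=> h; apply/matrixP => i j; rewrite (ord1 j).
by apply: (part_eq hK) => p; exact: h.
Qed.

Lemma wgradD u v : H1 u -> H1 v ->
  {ae mu2, forall x, Om x -> wgrad Om (u + v) x = wgrad Om u x + wgrad Om v x}.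
Proof.
move=> Hu Hv; apply: aeS (ae_all2 (H1_D hK Om_open Om_bounded Hu Hv).2) => x h Ox.
by apply: colK_eq => p i; rewrite mxE (partD hK) -[LHS]/(cg Om p i (u + v) x) h.
Qed.

Lemma wgradZ c u : H1 u ->
  {ae mu2, forall x, Om x -> wgrad Om (scK c u) x = c *: wgrad Om u x}.
Proof.
move=> Hu; apply: aeS (ae_all2 (H1_Z hK Om_open Om_bounded c Hu).2) => x h Ox.
by apply: colK_eq => p i; rewrite mxE (part_M hK) -[LHS]/(cg Om p i (scK c u) x) h.
Qed.

Section Coefficient.
Variables (alpha beta : R) (a : R * R -> 'M[K]_2).
Hypotheses (alpha_gt0 : 0 < alpha) (beta_gt0 : 0 < beta).
Hypothesis aM : coef_class alpha beta Om a.

Definition fl (b : R * R -> 'M[K]_2) p i u (x : R * R) : R := part p (flux Om b u x i 0).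

Lemma Linfty_part d (T : measurableType d) (mu : {measure set T -> \bar R}) (A : set T)
  (f : T -> K) : Linfty mu A f -> forall p, measurable_fun A (fun x => part p (f x)) /\
   exists C : R, {ae mu, forall x, A x -> `|part p (f x)| <= C}.
Proof.
move=> [[mr mi] [C hC]] p; split; first by case: p.
exists C; apply: filterS hC => x h Ax; apply: le_trans (h Ax).
by case: p; [exact: absK_re|exact: absK_im].
Qed.

Lemma flE b p i u x : fl b p i u x = \sum_(j < 2) (part true (b x i j) * cg Om p j u x +
    (if p then - part false (b x i j) else part false (b x i j)) * cg Om (~~ p) j u x).
Proof.
rewrite /fl /flux mxE.
transitivity (\sum_j part p (b x i j * wgrad Om u x j 0)).
  by case: p; rewrite /= (reK_sum, imK_sum).
by apply: eq_bigr => j _; rewrite (part_M hK).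
Qed.

Lemma fl_sqint p i u : H1 u -> sq (fl a p i u).
Proof.
move=> Hu; have [_ sg _] := H1_parts hK Om_open Om_bounded Hu.
have [Linf _ _] := aM.
have sj (j : 'I_2) q q' : sq (fun x => part q (a x i j) * cg Om q' j u x).
  have [m [C hC]] := Linfty_part (Linf i j) q.
  exact: sqint_aeM m hC (sg q' j).
have sjN (j : 'I_2) q q' : sq (fun x => - part q (a x i j) * cg Om q' j u x).
  by have := sqintN mOm (sj j q q'); congr sqint; apply/funext => x; rewrite mulNr.
have sS (j : 'I_2) : sq (fun x => part true (a x i j) * cg Om p j u x +
    (if p then - part false (a x i j) else part false (a x i j)) * cg Om (~~ p) j u x).
  by apply: (sqintD mOm) => //; case: (p).
have := sqintD mOm (sS 0) (sS (lift ord0 ord0)); congr sqint; apply/funext => x.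
by rewrite flE big_ord_recl big_ord1.
Qed.

Lemma fl_D p i u v : H1 u -> H1 v ->
  {ae mu2, forall x, Om x -> fl a p i (u + v) x = fl a p i u x + fl a p i v x}.
Proof.
move=> Hu Hv; apply: aeS (wgradD Hu Hv) => x h Ox.
by rewrite /fl /flux h// mulmxDr mxE (partD hK).
Qed.

Lemma fl_scR p i c u : H1 u ->
  {ae mu2, forall x, Om x -> fl a p i (scR c u) x = c * fl a p i u x}.
Proof.
move=> Hu; apply: aeS (wgradZ (mkK K c 0) Hu) => x h Ox.
by rewrite /fl /flux h// -scalemxAr mxE (part_Mr hK).
Qed.

(** The real part of <b grad u, grad v>, a bilinear form over R to which the real Lax-Milgram lemma
    applies. *)
Definition Bform b u v : R := dot4 mu2 Om (fun p i => fl b p i u) (fun p i => cg Om p i v).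

Lemma flux_bound u : H1 u ->
  dot4 mu2 Om (fun p i => fl a p i u) (fun p i => fl a p i u) <= beta ^+ 2 * energy Om u.
Proof.
move=> Hu; have [_ sg _] := H1_parts hK Om_open Om_bounded Hu.
have sf p i := fl_sqint p i Hu.
have [i1 e1] := dot4_int mOm sf sf; have [i2 e2] := dot4_int mOm sg sg.
rewrite e1 -[energy Om u]/(dot4 mu2 Om (fun p i => cg Om p i u) (fun p i => cg Om p i u)) e2.
rewrite -(RintegralZl _ mOm i2).
apply: Rint_ae_le => //; first exact: (intgZ mOm _ i2).
have [_ _ ainv] := aM; apply: aeS ainv => x h Ox.
have [uA hA] := h Ox; have := re_ge_inv_le hK (wgrad Om u x) beta_gt0 uA hA.
by rewrite !(reK_dotK hK).
Qed.

Lemma Bform_coercive u : H1 u -> alpha * energy Om u <= Bform a u u.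
Proof.
move=> Hu; have [_ sg _] := H1_parts hK Om_open Om_bounded Hu.
have sf p i := fl_sqint p i Hu.
have [i1 e1] := dot4_int mOm sf sg; have [i2 e2] := dot4_int mOm sg sg.
rewrite /Bform e1 -[energy Om u]/(dot4 mu2 Om (fun p i => cg Om p i u) (fun p i => cg Om p i u)) e2.
rewrite -(RintegralZl _ mOm i2).
apply: Rint_ae_le => //; first exact: (intgZ mOm _ i2).
have [_ acoer _] := aM; apply: aeS acoer => x h Ox.
have := h Ox (wgrad Om u x); rewrite !(reK_dotK hK) => h2; apply: le_trans h2 _.
by rewrite le_eqVlt; apply/orP; left; apply/eqP; apply: eq_bigr => p _; apply: eq_bigr => i _; rewrite mulrC.
Qed.

Let cgs p i u : H1 u -> sq (cg Om p i u).
Proof. by move=> Hu; have [_ sg _] := H1_parts hK Om_open Om_bounded Hu. Qed.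

Lemma cg_D p i u v : H1 u -> H1 v ->
  {ae mu2, forall x, Om x -> cg Om p i (u + v) x = cg Om p i u x + cg Om p i v x}.
Proof. by move=> Hu Hv; exact: (H1_D hK Om_open Om_bounded Hu Hv).2. Qed.

Lemma cg_scR p i c u : H1 u ->
  {ae mu2, forall x, Om x -> cg Om p i (scR c u) x = c * cg Om p i u x}.
Proof.
move=> Hu; apply: aeS (wgradZ (mkK K c 0) Hu) => x h Ox.
by rewrite /cg h// mxE (part_Mr hK).
Qed.

Lemma ip_fl_lin p i g : sq g -> linear_on (@scR R K) H1 (fun u => ip mu2 Om (fl a p i u) g).
Proof.
move=> sg; split=> [u v Hu Hv|c u Hu].
  have su := fl_sqint p i Hu; have sv := fl_sqint p i Hv.
  rewrite -(ipDl mOm su sv sg).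
  have m1 := (fl_sqint p i (H1_add hK Om_open Om_bounded Hu Hv)).1.
  have m2 := (sqintD mOm su sv).1; have m3 := sg.1.
  by apply: (ae_ip mOm) => //; [exact: fl_D|exact: aeW].
have su := fl_sqint p i Hu; rewrite -(ipZl mOm c su sg).
have m1 := (fl_sqint p i (H1_scR hK Om_open Om_bounded c Hu)).1.
have m2 := (sqintZ mOm c su).1; have m3 := sg.1.
by apply: (ae_ip mOm) => //; [exact: fl_scR|exact: aeW].
Qed.

Lemma ip_cg_lin p i g : sq g -> linear_on (@scR R K) H1 (fun u => ip mu2 Om g (cg Om p i u)).
Proof.
move=> sg; split=> [u v Hu Hv|c u Hu].
  have su := cgs p i Hu; have sv := cgs p i Hv.
  rewrite !(ipC _ _ g) -(ipDl mOm su sv sg).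
  have m1 := (cgs p i (H1_add hK Om_open Om_bounded Hu Hv)).1.
  have m2 := (sqintD mOm su sv).1; have m3 := sg.1.
  by apply: (ae_ip mOm) => //; [exact: cg_D|exact: aeW].
have su := cgs p i Hu; rewrite !(ipC _ _ g) -(ipZl mOm c su sg).
have m1 := (cgs p i (H1_scR hK Om_open Om_bounded c Hu)).1.
have m2 := (sqintZ mOm c su).1; have m3 := sg.1.
by apply: (ae_ip mOm) => //; [exact: cg_scR|exact: aeW].
Qed.

Lemma linear_on_sum (I : Type) (r : seq I) (S : set (R * R -> K^o)) (l : I -> (R * R -> K^o) -> R) :
  (forall i, linear_on (@scR R K) S (l i)) -> linear_on (@scR R K) S (fun u => \sum_(i <- r) l i u).
Proof.
move=> h; split=> [u v Su Sv|c u Su].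
  by rewrite -big_split; apply: eq_bigr => i _; exact: (h i).1.
by rewrite mulr_sumr; apply: eq_bigr => i _; exact: (h i).2.
Qed.

Lemma linear_onS (S S' : set (R * R -> K^o)) l : S `<=` S' ->
  linear_on (@scR R K) S' l -> linear_on (@scR R K) S l.
Proof. by move=> SS [lD lZ]; split=> [u v /SS Su /SS Sv|c u /SS Su]; [exact: lD|exact: lZ]. Qed.

Lemma Bform_linl v : H1 v -> linear_on (@scR R K) H1 (Bform a ^~ v).
Proof.
move=> Hv; apply: linear_on_sum => p; apply: linear_on_sum => i.
by apply: ip_fl_lin; exact: cgs.
Qed.

Lemma Bform_linr u : H1 u -> linear_on (@scR R K) H1 (Bform a u).
Proof.
move=> Hu; apply: linear_on_sum => p; apply: linear_on_sum => i.
by apply: ip_cg_lin; exact: fl_sqint.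
Qed.

Lemma energy_le u : energy Om u <= h1dot u u.
Proof. by rewrite h1dot_energy lerDr; apply: sumr_ge0 => p _; exact: ip_ge0. Qed.

Lemma Bform_le u v : H1 u -> H1 v ->
  Bform a u v ^+ 2 <= beta ^+ 2 * (h1dot u u * h1dot v v).
Proof.
move=> Hu Hv; apply: le_trans (dot4_CS mOm (fun p i => fl_sqint p i Hu) (fun p i => cgs p i Hv)) _.
rewrite mulrA; apply: ler_pM; rewrite ?dot4_ge0//; last exact: energy_le.
by apply: le_trans (flux_bound Hu) _; rewrite ler_wpM2l ?sqr_ge0// energy_le.
Qed.

End Coefficient.

(** The constant comes from the Poincare inequality alone, so it is the same for all coefficients of
    a sequence. *)
Lemma H10_coercive : exists2 c : R, 0 < c & forall alpha beta a u, 0 < alpha ->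
  coef_class alpha beta Om a -> H10 u -> c * alpha * h1dot u u <= Bform a u u.
Proof.
have [C C0 CP] := H10_poincare hK Om_open Om_bounded.
exists C^-1; first by rewrite invr_gt0.
move=> alpha beta a u a0 aM Hu; apply: le_trans (Bform_coercive aM Hu.1).
by rewrite mulrAC mulrC ler_pM2l// ler_pdivrMl// CP.
Qed.

Section Solvability.
Variables (alpha beta : R) (a : R * R -> 'M[K]_2).
Hypotheses (alpha_gt0 : 0 < alpha) (beta_gt0 : 0 < beta).
Hypothesis aM : coef_class alpha beta Om a.

Let HH := H10_hilbert hK Om_open Om_bounded.
Let sub10 : H10 `<=` H1. Proof. by move=> u []. Qed.

Lemma Bform_solve l D : linear_on (@scR R K) H10 l -> (forall u, H10 u -> l u ^+ 2 <= D * h1dot u u) ->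
  exists2 u, H10 u & forall v, H10 v -> Bform a u v = l v.
Proof.
move=> ll lD; have [c c0 cP] := H10_coercive.
apply: (@lax_milgram R _ _ _ _ (Bform a) (beta ^+ 2) (c * alpha) l D HH _ _ _ _ _ ll lD).
- by move=> v Hv; apply: linear_onS sub10 _; exact: (Bform_linl aM (sub10 Hv)).
- by move=> u Hu; apply: linear_onS sub10 _; exact: (Bform_linr aM (sub10 Hu)).
- by move=> u v Hu Hv; exact: (Bform_le beta_gt0 aM (sub10 Hu) (sub10 Hv)).
- by rewrite mulr_gt0.
- by move=> u Hu; exact: cP aM Hu.
Qed.

Lemma Bform_solve_adjoint l D : linear_on (@scR R K) H10 l ->
  (forall u, H10 u -> l u ^+ 2 <= D * h1dot u u) ->
  exists2 u, H10 u & forall v, H10 v -> Bform a v u = l v.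
Proof.
move=> ll lD; have [c c0 cP] := H10_coercive.
apply: (@lax_milgram R _ _ _ _ (fun u v => Bform a v u) (beta ^+ 2) (c * alpha) l D HH _ _ _ _ _ ll lD).
- by move=> v Hv; apply: linear_onS sub10 _; exact: (Bform_linr aM (sub10 Hv)).
- by move=> u Hu; apply: linear_onS sub10 _; exact: (Bform_linl aM (sub10 Hu)).
- move=> u v Hu Hv; rewrite (mulrC (h1dot u u)).
  exact: (Bform_le beta_gt0 aM (sub10 Hv) (sub10 Hu)).
- by rewrite mulr_gt0.
- by move=> u Hu; exact: cP aM Hu.
Qed.

(* By the adjoint problem every bounded functional has the form B(., v). *)
Lemma Bform_weak_limit (u_ : nat -> R * R -> K^o) u l D :
  (forall n, H10 (u_ n)) -> H10 u ->
  (forall v, H10 v -> Bform a (u_ n) v @[n --> \oo] --> Bform a u v) ->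
  linear_on (@scR R K) H10 l -> (forall u, H10 u -> l u ^+ 2 <= D * h1dot u u) ->
  l (u_ n) @[n --> \oo] --> l u.
Proof.
move=> Hu_ Hu uu ll lD; have [v Hv lv] := Bform_solve_adjoint ll lD.
exact (cvg_ext2 (fun n => lv _ (Hu_ n)) (lv _ Hu) (uu v Hv)).
Qed.

End Solvability.

(** From c alpha |u|^2 <= B(u, u) = l and l^2 <= D |u|^2 one gets (c alpha)^2 |u|^2 <= D. As C
    depends on [Om] only, the estimate bounds the solutions uniformly along a sequence of
    coefficients. *)
Lemma apriori : exists2 C : R, 0 < C & forall alpha beta a u l D, 0 < alpha -> 0 <= D ->
  coef_class alpha beta Om a -> H10 u -> Bform a u u = l -> l ^+ 2 <= D * h1dot u u ->
  alpha ^+ 2 * h1dot u u <= C * D.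
Proof.
have [c c0 cP] := H10_coercive; exists (c ^- 2); first by rewrite invr_gt0 exprn_gt0.
move=> alpha beta a u l D a0 D0 aM Hu Bl lD; have := cP _ _ _ _ a0 aM Hu; rewrite Bl.
have := h1dot_ge0 Om u.
move: (h1dot u u) lD => h lD h0 chl.
have ca : 0 < c * alpha by rewrite mulr_gt0.
have chl2 : (c * alpha * h) ^+ 2 <= D * h.
  by apply: le_trans lD; rewrite ler_pXn2r// ?nnegrE ?(le_trans _ chl)// mulr_ge0// ltW.
rewrite ler_pdivlMl ?exprn_gt0//.
have [h00|hn] := eqVneq h 0.
  by rewrite h00 !mulr0.
have hp : 0 < h by rewrite lt_def hn.
rewrite -(ler_pM2r hp) (le_trans _ chl2)// le_eqVlt; apply/orP; left; apply/eqP; ring.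
Qed.

End CoefficientForm.

(** * Weak convergence of solutions and fluxes *)

Section ScalarInterface.
Variables (R : realType) (K : scalar_field R).
Hypothesis hK : K = real_scalars R \/ K = complex_scalars R.
Local Notation TR := (measurableTypeR R).
Local Notation mu2 := (lebesgue2 R).
Variable Om : set (R * R).
Hypotheses (Om_open : open Om) (Om_bounded : bounded_set Om).
Local Notation sq := (sqint mu2 Om).
Local Notation h1dot := (@h1dot R K Om).
Local Notation H1 := (@H1 R K Om).
Local Notation H10 := (@H10 R K Om).
Local Notation Hm1 := (@Hm1 R K Om).
Implicit Types (u v : R * R -> K^o).

Let mOm : @measurable _ (TR * TR)%type Om.
Proof. exact: open2_measurable. Qed.

Lemma L2vP (F : R * R -> 'cV[K]_2) : L2v mu2 Om F <->
  forall p i, sq (fun x => part p (F x i 0)).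
Proof.
split=> [h p i|h i]; first exact ((L2P hK mu2 (fun x => F x i 0) mOm).1 (h i) p).
by apply/(L2P hK mu2 (fun x => F x i 0) mOm) => p; exact: h.
Qed.

Lemma reK_L2v_dot (F G : R * R -> 'cV[K]_2) :
  (forall p i, sq (fun x => part p (F x i 0))) ->
  (forall p i, sq (fun x => part p (G x i 0))) ->
  reK (L2v_dot mu2 Om F G) =
  dot4 mu2 Om (fun p i x => part p (F x i 0)) (fun p i x => part p (G x i 0)).
Proof.
move=> sF sG; rewrite (dot4_int mOm sF sG).2 reK_int//.
by apply: eq_Rintegral => x _; rewrite (reK_dotK hK).
Qed.

(** i for the complex scalars and 0 for the real ones, where the identities about imaginary parts
    become trivial. *)
Definition imag_unit : K := mkK K 0 1.

Lemma reK_imag (z : K) : reK (imag_unit * z) = - imK z.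
Proof.
by rewrite reK_M// reK_mk// mul0r sub0r -[imK imag_unit]/(chiK K) -imK_chi.
Qed.

Section Equation.
Variables (alpha beta : R) (a : R * R -> 'M[K]_2).
Hypotheses (alpha_gt0 : 0 < alpha) (beta_gt0 : 0 < beta).
Hypothesis aM : coef_class alpha beta Om a.

Let fls p i u : H1 u -> sq (fl Om a p i u).
Proof. by move=> Hu; exact: (fl_sqint hK Om_open Om_bounded aM p i Hu). Qed.

Let cgs p i u : H1 u -> sq (cg Om p i u).
Proof. by move=> Hu; have [_ sg _] := H1_parts hK Om_open Om_bounded Hu. Qed.

Lemma reK_flux_dot u v : H1 u -> H1 v ->
  reK (L2v_dot mu2 Om (flux Om a u) (wgrad Om v)) = Bform Om a u v.
Proof. by move=> Hu Hv; apply: reK_L2v_dot => p i; [exact: fls|exact: cgs]. Qed.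

(** The inner product is linear in its second argument, so Im <F, G> = - Re <F, i G>. The imaginary
    part of the variational equation is therefore its real part tested with i v, and the equation
    over K amounts to the one for [Bform]. *)
Lemma imK_flux_dot u v : H1 u -> H1 v ->
  imK (L2v_dot mu2 Om (flux Om a u) (wgrad Om v)) = - Bform Om a u (scK imag_unit v).
Proof.
move=> Hu Hv; have [Hiv civ] := H1_Z hK Om_open Om_bounded imag_unit Hv.
rewrite imK_chi// imK_int//.
pose F i x := fl Om a true i u x * cg Om false i v x.
pose G i x := fl Om a false i u x * cg Om true i v x.
have iF i : intg mu2 Om (F i) := sqintM mOm (fls true i Hu) (cgs false i Hv).
have iG i : intg mu2 Om (G i) := sqintM mOm (fls false i Hu) (cgs true i Hv).
have E1 x : imK (dotK (flux Om a u x) (wgrad Om v x)) =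
    F 0 x - G 0 x + (F (lift ord0 ord0) x - G (lift ord0 ord0) x).
  rewrite /dotK imK_sum// big_ord_recl big_ord1.
  by rewrite !imK_M// !reK_conj// !imK_conj// !mulNr.
under eq_Rintegral do rewrite E1.
rewrite (RintegralD mOm (intgB mOm (iF 0) (iG 0)) (intgB mOm (iF _) (iG _))).
rewrite !(RintegralB mOm (iF _) (iG _)).
have E2 p i : ip mu2 Om (fl Om a p i u) (cg Om p i (scK imag_unit v)) =
    (if p then - chiK K else chiK K) * ip mu2 Om (fl Om a p i u) (cg Om (~~ p) i v).
  have sc := cgs (~~ p) i Hv; have sf := fls p i Hu.
  have m1 := (cgs p i Hiv).1; have m2 := (sqintZ mOm (if p then - chiK K else chiK K) sc).1.
  rewrite ipC [X in _ * X]ipC -(ipZl mOm _ sc sf).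
  apply: (ae_ip mOm) => //; try exact: sf.1; last exact: aeW.
  apply: aeS (civ p i) => x h Ox; rewrite h// reK_mk// mul0r add0r.
  by case: (p).
rewrite /Bform /dot4 big_bool !big_ord_recl !big_ord0 /= !E2 /= /ip.
rewrite -!/(F _) -!/(G _).
move: (\int[mu2]_(x in Om) _) (\int[mu2]_(x in Om) _) (\int[mu2]_(x in Om) _) (\int[mu2]_(x in Om) _).
by move=> *; ring.
Qed.

Lemma Hm1_scale f c v : Hm1 f -> H10 v -> f (scK c v) = c * f v.
Proof.
move=> [fl _] Hv; have H0 := H10_0 hK Om_open Om_bounded.
have := fl 1 0 0 H0 H0; rewrite mul1r.
have -> : (fun x : R * R => 1 *: (0 : R * R -> K^o) x + (0 : R * R -> K^o) x) = 0.
  by apply/funext => x; rewrite scaler0 addr0.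
move=> /eqP; rewrite addrC -subr_eq subrr eq_sym => /eqP f0.
have := fl c v 0 Hv H0; rewrite f0 addr0 => <-; congr f.
by apply/funext => x; rewrite addr0.
Qed.

Lemma solvesP f u : Hm1 f -> solves Om a f u <->
  H10 u /\ forall v, H10 v -> Bform Om a u v = reK (f v).
Proof.
move=> Hf; split=> -[Hu h]; split=> // v Hv.
  by rewrite -(h v Hv) reK_flux_dot//; [exact: (H10_H1 Hu)|exact: (H10_H1 Hv)].
apply: (K_eqP hK).
  by rewrite (reK_flux_dot (H10_H1 Hu) (H10_H1 Hv)); exact: h.
rewrite (imK_flux_dot (H10_H1 Hu) (H10_H1 Hv)) h; last exact: H10_scK.
by rewrite (Hm1_scale _ Hf Hv) reK_imag opprK.
Qed.

End Equation.

(** This is how functionals over K become accessible to the real Riesz and Lax-Milgram lemmas. *)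
Lemma dual_parts f p : Hm1 f -> linear_on (@scR R K) H10 (fun u => part p (f u)) /\
  exists2 D : R, 0 <= D & forall u, H10 u -> part p (f u) ^+ 2 <= D * h1dot u u.
Proof.
move=> Hf; have [flin [C fC]] := Hf; split.
  split=> [u v Hu Hv|c u Hu].
    have := flin 1 u v Hu Hv; rewrite mul1r => h.
    rewrite -(partD hK) -h; congr (part p (f _)).
    by apply/funext => x; rewrite scale1r.
  by rewrite (Hm1_scale _ Hf Hu) (part_Mr hK).
exists (C ^+ 2); first exact: sqr_ge0.
move=> u Hu; rewrite -(H1norm_sqr hK Om_open Om_bounded (H10_H1 Hu)) -exprMn.
have h1 : `|part p (f u)| <= C * H1norm Om u.
  by apply: le_trans (fC u Hu); case: p; [exact: absK_re|exact: absK_im].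
by rewrite -(real_normK (num_real (part p _))) lerXn2r// nnegrE ?(le_trans _ h1).
Qed.

Lemma weak_cvg_H10 (u_ : nat -> R * R -> K^o) u :
  (forall l D, linear_on (@scR R K) H10 l -> (forall u, H10 u -> l u ^+ 2 <= D * h1dot u u) ->
    l (u_ n) @[n --> \oo] --> l u) ->
  weak_cvg H10 (@H1norm R K Om) u_ u.
Proof.
move=> h f Hf; apply/(cvgK hK); split.
  by have [ll [D _ lD]] := dual_parts true Hf; exact (h _ D ll lD).
by have [ll [D _ lD]] := dual_parts false Hf; exact (h _ D ll lD).
Qed.

Lemma solvable alpha beta a f : 0 < alpha -> 0 < beta -> coef_class alpha beta Om a ->
  Hm1 f -> exists u, solves Om a f u.
Proof.
move=> a0 b0 aM Hf; have [ll [D _ lD]] := dual_parts true Hf.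
have [u Hu h] := Bform_solve hK Om_open Om_bounded a0 b0 aM ll lD.
by exists u; exact ((solvesP aM u Hf).2 (conj Hu h)).
Qed.

(** The field whose only component is the real or imaginary part, according to p, of coordinate i;
    for the real scalars and p = [false] it is 0. *)
Definition embed p (i : 'I_2) (g : R * R -> R) (x : R * R) : 'cV[K]_2 :=
  \col_j (if j == i then (if p then mkK K (g x) 0 else mkK K 0 (g x)) else 0).

Lemma part_embed p i g q j x : part q (embed p i g x j 0) =
  if (q == p) && (j == i) then (if p then g x else chiK K * g x) else 0.
Proof.
rewrite mxE andbC; case: (j == i) => /=; last by case: q; rewrite /= (reK0, imK0).
case: p => /=; first by rewrite (part_mk0 hK); case: q.
by case: q; rewrite /= ?reK_mk// imK_mkE.
Qed.

Lemma embed_sum (F : R * R -> 'cV[K]_2) :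
  F = fun x => \sum_(p : bool) \sum_(i < 2) embed p i (fun y => part p (F y i 0)) x.
Proof.
apply/funext => x; apply: (colK_eq hK) => q j.
have partS (I : finType) (G : I -> 'cV[K]_2) :
    part q ((\sum_i G i) j 0) = \sum_i part q (G i j 0).
  by rewrite summxE; case: (q); rewrite /= (reK_sum, imK_sum).
rewrite partS (bigD1 q)//= partS (bigD1 j)//= part_embed !eqxx /=.
rewrite big1 ?addr0; last by move=> i ij; rewrite part_embed eqxx/= eq_sym (negbTE ij).
rewrite big1 ?addr0; first by case: (q) => //=; rewrite -imK_chi.
move=> p pq; rewrite partS big1// => i _.
by rewrite part_embed eq_sym (negbTE pq).
Qed.

Lemma embed_L2v p i g : sq g -> L2v mu2 Om (embed p i g).
Proof.
move=> sg; apply/L2vP => q j.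
have [e|ne] := boolP ((q == p) && (j == i)).
  have := sqintZ mOm (if p then 1 else chiK K) sg; congr sqint; apply/funext => x.
  by rewrite part_embed e; case: p {e}; rewrite ?mul1r.
have := sqint0 mu2 Om; congr sqint; apply/funext => x.
by rewrite part_embed (negbTE ne).
Qed.

Lemma embed_norm p i g : sq g ->
  L2v_norm mu2 Om (embed p i g) ^+ 2 <= (1 + chiK K ^+ 2) * ip mu2 Om g g.
Proof.
move=> sg; have sF := (L2vP _).1 (embed_L2v p i sg).
rewrite /L2v_norm reK_L2v_dot// sqr_sqrtr ?dot4_ge0//.
rewrite /dot4 (bigD1 p)//= (bigD1 i)//= [X in _ + X + _]big1 ?addr0; last first.
  move=> j ji; rewrite -[RHS](Rintegral0 mu2 Om); apply: eq_Rintegral => x _.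
  by rewrite part_embed (negbTE ji) andbF mul0r.
rewrite [X in _ + X]big1 ?addr0; last first.
  move=> q qp; rewrite big1// => j _; rewrite -[RHS](Rintegral0 mu2 Om).
  by apply: eq_Rintegral => x _; rewrite part_embed (negbTE qp) mul0r.
have -> : ip mu2 Om (fun x => part p (embed p i g x i 0)) (fun x => part p (embed p i g x i 0)) =
    ip mu2 Om (fun x => (if p then 1 else chiK K) * g x) (fun x => (if p then 1 else chiK K) * g x).
  by apply: eq_Rintegral => x _; rewrite part_embed !eqxx; case: (p); rewrite ?mul1r.
rewrite (ip_scale Om_open _ sg) ler_wpM2r ?ip_ge0//.
by case: (p); rewrite ?expr1n ?lerDl ?lerDr ?sqr_ge0.
Qed.

(** A bounded functional is the sum of its restrictions to single real components, and each
    restriction is represented by a square-integrable function. *)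
Lemma weak_cvg_L2v (F_ : nat -> R * R -> 'cV[K]_2) F :
  (forall n, L2v mu2 Om (F_ n)) -> L2v mu2 Om F ->
  (forall p i g, sq g -> ip mu2 Om g (fun x => part p (F_ n x i 0)) @[n --> \oo] -->
    ip mu2 Om g (fun x => part p (F x i 0))) ->
  weak_cvg (@L2v R K 2 _ _ mu2 Om) (@L2v_norm R K 2 _ _ mu2 Om) F_ F.
Proof.
move=> LF_ LF cv f [flin [C fC]].
have Lemb := embed_L2v.
have LD (G G' : R * R -> 'cV[K]_2) : L2v mu2 Om G -> L2v mu2 Om G' -> L2v mu2 Om (fun x => G x + G' x).
  move=> LG LG'; apply: (L2vP _).2 => p i.
  have sG := (L2vP _).1 LG; have sG' := (L2vP _).1 LG'.
  have := sqintD mOm (sG p i) (sG' p i); congr sqint; apply/funext => x.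
  by rewrite mxE (partD hK).
have fD (G G' : R * R -> 'cV[K]_2) : L2v mu2 Om G -> L2v mu2 Om G' -> f (fun x => G x + G' x) = f G + f G'.
  move=> LG LG'; have := flin 1 G G' LG LG'; rewrite mul1r => <-; congr f.
  by apply/funext => x; rewrite scale1r.
have L0 : L2v mu2 Om (fun _ : R * R => 0 : 'cV[K]_2).
  apply/L2vP => p i; have := sqint0 mu2 Om; congr sqint; apply/funext => x.
  by rewrite mxE; case: p; rewrite /= (reK0, imK0).
have f0 : f (fun=> 0) = 0.
  have := fD _ _ L0 L0; rewrite (_ : (fun x => 0 + 0) = fun=> 0); last first.
    by apply/funext => x; rewrite addr0.
  by move=> /eqP; rewrite addrC -subr_eq subrr eq_sym => /eqP.
have fsum (I : finType) (G : I -> R * R -> 'cV[K]_2) : (forall i, L2v mu2 Om (G i)) ->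
    L2v mu2 Om (fun x => \sum_i G i x) /\ f (fun x => \sum_i G i x) = \sum_i f (G i).
  move=> LG; elim: (index_enum I) => [|i r [ih1 ih2]].
    have E : (fun x => \sum_(i <- [::]) G i x) = (fun=> 0 : 'cV[K]_2).
      by apply/funext => x; rewrite big_nil.
    by rewrite E big_nil.
  have E : (fun x => \sum_(j <- i :: r) G j x) = (fun x => G i x + \sum_(j <- r) G j x).
    by apply/funext => x; rewrite big_cons.
  by rewrite E big_cons -ih2; split; [exact: LD|exact: fD].
have key p i q : exists2 g, sq g & forall h, sq h -> part q (f (embed p i h)) = ip mu2 Om g h.
  have [|||g sg gP] := @sqint_riesz _ _ _ mu2 Om mOm (fun h => part q (f (embed p i h)))
     (C ^+ 2 * (1 + chiK K ^+ 2)).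
  - move=> h h' sh sh'; rewrite -(partD hK) -(fD _ _ (Lemb p i h sh) (Lemb p i h' sh')).
    congr (part q (f _)); apply/funext => x; apply: (colK_eq hK) => q' j.
    rewrite [X in _ = part _ X]mxE (partD hK) !part_embed; case: ifP => _; last by rewrite addr0.
    by case: (p); rewrite ?mulrDr.
  - move=> c h sh; have := flin (mkK K c 0) _ _ (Lemb p i h sh) L0.
    rewrite f0 addr0 => e; rewrite -(part_Mr hK) -e.
    congr (part q (f _)); apply/funext => x; apply: (colK_eq hK) => q' j.
    rewrite addr0 [X in _ = part _ X]mxE (part_Mr hK) !part_embed; case: ifP => _; last by rewrite mulr0.
    by case: (p); rewrite // mulrCA.
  - move=> h sh; rewrite -mulrA; apply: le_trans (ler_wpM2l (sqr_ge0 C) (embed_norm p i sh)).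
    have h1 : `|part q (f (embed p i h))| <= C * L2v_norm mu2 Om (embed p i h).
      by apply: le_trans (fC _ (Lemb p i h sh)); case: (q); [exact: absK_re|exact: absK_im].
    rewrite -exprMn -(real_normK (num_real (part q _))).
    by rewrite lerXn2r// nnegrE ?(le_trans _ h1).
  by exists g => // h sh; rewrite gP.
have fq q (G : R * R -> 'cV[K]_2) : L2v mu2 Om G -> part q (f G) =
    \sum_(p : bool) \sum_(i < 2) part q (f (embed p i (fun y => part p (G y i 0)))).
  move=> LG; have sG := (L2vP _).1 LG; rewrite {1}(embed_sum G).
  have Li p := fsum _ (fun i => embed p i (fun y => part p (G y i 0))) (fun i => Lemb p i _ (sG p i)).
  have Lp := fsum _ _ (fun p => (Li p).1).
  rewrite Lp.2; have partS (I : finType) (H : I -> K) : part q (\sum_i H i) = \sum_i part q (H i).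
    by case: (q); rewrite /= (reK_sum, imK_sum).
  rewrite partS; apply: eq_bigr => p _; by rewrite (Li p).2 partS.
have cvq q : part q (f (F_ n)) @[n --> \oo] --> part q (f F).
  rewrite fq// (funext (fun n => fq q _ (LF_ n))).
  apply: cvg_bigsum => p; apply: cvg_bigsum => i.
  have [g sg gP] := key p i q.
  have sF := (L2vP _).1 LF p i.
  have sF_ n := (L2vP _).1 (LF_ n) p i.
  exact (cvg_ext2 (fun n => esym (gP _ (sF_ n))) (esym (gP _ sF)) (cv p i g sg)).
by apply/(cvgK hK); split; [exact: (cvq true)|exact: (cvq false)].
Qed.

Lemma part_mk p (x y : R) : part p (mkK K x y) = if p then x else chiK K * y.
Proof. by case: p; rewrite /= ?reK_mk// imK_mkE. Qed.

Lemma absK_mk_le (x y B : R) : x ^+ 2 + y ^+ 2 <= B ^+ 2 -> 0 <= B -> absK (mkK K x y) <= B.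
Proof.
move=> xy B0; rewrite -(@ler_pXn2r _ 2)// ?nnegrE ?absK_ge0// absK_sqr//.
apply: le_trans xy; rewrite reK_mk// lerD2l.
by case: (imK_mk hK x y) => ->; rewrite // expr0n sqr_ge0.
Qed.

(** Weak convergence is expressed by functionals linear over K. Pairing the K-valued coordinate of
    (u, grad u) with the real function g is such a functional, and its parts are the pairings
    wanted. *)
Lemma weak_cvg_vcomp (u_ : nat -> R * R -> K^o) u p k g :
  weak_cvg H10 (@H1norm R K Om) u_ u -> (forall n, H10 (u_ n)) -> H10 u -> sq g ->
  ip mu2 Om (vcomp Om p k (u_ n)) g @[n --> \oo] --> ip mu2 Om (vcomp Om p k u) g.
Proof.
move=> cv Hu_ Hu sg.
have vs q v : H1 v -> sq (vcomp Om q k v) by move=> Hv; exact: vcomp_sqint.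
pose f v : K := mkK K (ip mu2 Om (vcomp Om true k v) g) (ip mu2 Om (vcomp Om false k v) g).
have chi_vc v : H1 v -> chiK K * ip mu2 Om (vcomp Om false k v) g = ip mu2 Om (vcomp Om false k v) g.
  move=> Hv; rewrite -(ipZl mOm _ (vs false v Hv) sg); apply: eq_Rintegral => x _.
  congr (_ * _); rewrite /vcomp; case: unliftP => [i _|_]; first by rewrite /cg /= -imK_chi.
  by rewrite /cu /= -imK_chi.
have fp q v : H1 v -> part q (f v) = ip mu2 Om (vcomp Om q k v) g.
  by move=> Hv; rewrite part_mk; case: q => //; exact: chi_vc.
have ipD q v w : H1 v -> H1 w -> ip mu2 Om (vcomp Om q k (v + w)) g =
    ip mu2 Om (vcomp Om q k v) g + ip mu2 Om (vcomp Om q k w) g.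
  move=> Hv Hw; rewrite -(ipDl mOm (vs q v Hv) (vs q w Hw) sg).
  have m1 := (vs q _ (H1_add hK Om_open Om_bounded Hv Hw)).1; have m2 := sg.1.
  have m3 := (sqintD mOm (vs q v Hv) (vs q w Hw)).1.
  by apply: (ae_ip mOm) => //; [exact: (vcomp_D hK Om_open Om_bounded q k Hv Hw)|exact: aeW].
have fdual : dual H10 (@H1norm R K Om) f.
  split=> [c v w Hv Hw|].
    have Hv1 := H10_H1 Hv; have Hw1 := H10_H1 Hw.
    have Hcv := (H1_Z hK Om_open Om_bounded c Hv1).1.
    apply: (part_eq hK) => q.
    rewrite [X in f X](_ : _ = scK c v + w); last by apply/funext.
    rewrite fp; last exact: H1_add.
    rewrite ipD// (partD hK) (part_M hK) !fp//; congr (_ + _).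
    have s1 := vs q v Hv1; have s2 := vs (~~ q) v Hv1.
    rewrite -(ipZl mOm _ s1 sg) -(ipZl mOm _ s2 sg).
    rewrite -(ipDl mOm (sqintZ mOm _ s1) (sqintZ mOm _ s2) sg).
    have m1 := (vs q _ Hcv).1; have m2 := sg.1.
    have m3 := (sqintD mOm (sqintZ mOm (reK c) s1) (sqintZ mOm (if q then - imK c else imK c) s2)).1.
    by apply: (ae_ip mOm) => //; [exact: (vcomp_Z hK Om_open Om_bounded q k c Hv1)|exact: aeW].
  exists (Num.sqrt (ip mu2 Om g g)) => v Hv; have Hv1 := H10_H1 Hv.
  apply: absK_mk_le; last by rewrite mulr_ge0// ?sqrtr_ge0// H1norm_ge0.
  rewrite exprMn sqr_sqrtr ?ip_ge0// (H1norm_sqr hK Om_open Om_bounded Hv1).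
  have H := sqint_hilbert mu2 mOm.
  have c1 := dot_CS H (vs true v Hv1) sg; have c2 := dot_CS H (vs false v Hv1) sg.
  apply: le_trans (lerD c1 c2) _; rewrite -mulrDl mulrC ler_wpM2l ?ip_ge0//.
  rewrite !h1dot_def big_bool /= lerD//.
    by rewrite (bigD1 k)//= lerDl; apply: sumr_ge0 => *; exact: ip_ge0.
  by rewrite (bigD1 k)//= lerDl; apply: sumr_ge0 => *; exact: ip_ge0.
have := (cvgK hK _ _).1 (cv f fdual).
have E q := cvg_ext2 (fun n => fp q _ (H10_H1 (Hu_ n))) (fp q _ (H10_H1 Hu)).
by case=> c1 c2; case: p; [exact: (E true)|exact: (E false)].
Qed.

Lemma weak_cvg_comp (F_ : nat -> R * R -> 'cV[K]_2) F p i g :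
  weak_cvg (@L2v R K 2 _ _ mu2 Om) (@L2v_norm R K 2 _ _ mu2 Om) F_ F ->
  (forall n, L2v mu2 Om (F_ n)) -> L2v mu2 Om F -> sq g ->
  ip mu2 Om (fun x => part p (F_ n x i 0)) g @[n --> \oo] --> ip mu2 Om (fun x => part p (F x i 0)) g.
Proof.
move=> cv LF_ LF sg.
pose c q (G : R * R -> 'cV[K]_2) x := part q (G x i 0).
have vs q G : L2v mu2 Om G -> sq (c q G) by move=> /(L2vP G).1; exact.
pose f G : K := mkK K (ip mu2 Om (c true G) g) (ip mu2 Om (c false G) g).
have fp q G : L2v mu2 Om G -> part q (f G) = ip mu2 Om (c q G) g.
  move=> LG; rewrite part_mk; case: q => //; rewrite -(ipZl mOm _ (vs false G LG) sg).
  by apply: eq_Rintegral => x _; rewrite /c /= -imK_chi.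
have fdual : dual (L2v mu2 Om) (@L2v_norm R K 2 _ _ mu2 Om) f.
  split=> [r G G' LG LG'|].
    have LrG : L2v mu2 Om (fun x => r *: G x + G' x).
      apply/L2vP => q j; have sG := (L2vP _).1 LG; have sG' := (L2vP _).1 LG'.
      have := sqintD mOm (sqintD mOm (sqintZ mOm (part true r) (sG q j))
        (sqintZ mOm (if q then - imK r else imK r) (sG (~~ q) j))) (sG' q j).
      by congr sqint; apply/funext => x; rewrite !mxE (partD hK) (part_M hK).
    apply: (part_eq hK) => q; rewrite fp// (partD hK) (part_M hK) !fp//.
    have s1 := vs q G LG; have s2 := vs (~~ q) G LG; have s3 := vs q G' LG'.
    rewrite -(ipZl mOm _ s1 sg) -(ipZl mOm _ s2 sg).
    rewrite -(ipDl mOm (sqintZ mOm _ s1) (sqintZ mOm _ s2) sg).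
    rewrite -(ipDl mOm (sqintD mOm (sqintZ mOm _ s1) (sqintZ mOm _ s2)) s3 sg).
    by apply: eq_Rintegral => x _; rewrite /c !mxE (partD hK) (part_M hK).
  exists (Num.sqrt (ip mu2 Om g g)) => G LG; have sG := (L2vP _).1 LG.
  apply: absK_mk_le; last by rewrite mulr_ge0// ?sqrtr_ge0.
  rewrite exprMn sqr_sqrtr ?ip_ge0// /L2v_norm reK_L2v_dot// sqr_sqrtr ?dot4_ge0//.
  have H := sqint_hilbert mu2 mOm.
  have c1 := dot_CS H (vs true G LG) sg; have c2 := dot_CS H (vs false G LG) sg.
  apply: le_trans (lerD c1 c2) _; rewrite -mulrDl mulrC ler_wpM2l ?ip_ge0//.
  rewrite /dot4 big_bool /= lerD//.
    by rewrite (bigD1 i)//= lerDl; apply: sumr_ge0 => *; exact: ip_ge0.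
  by rewrite (bigD1 i)//= lerDl; apply: sumr_ge0 => *; exact: ip_ge0.
have := (cvgK hK _ _).1 (cv f fdual).
have E q := cvg_ext2 (fun n => fp q _ (LF_ n)) (fp q _ LF).
by case=> c1 c2; case: p; [exact: (E true)|exact: (E false)].
Qed.

(* Test functions with values in one of the coordinate axes of K separate the
   real and the imaginary part of the divergence. *)
Lemma Bform_rtest p psi : rtest Om psi ->
  exists2 phi, H10 phi & forall alpha beta a u, coef_class alpha beta Om a -> H1 u ->
    Bform Om a u phi = \sum_(i < 2) ip mu2 Om (fl Om a p i u) (fun x => 'D_(unit_vec R i) psi x).
Proof.
move=> tp.
pose phi x : K^o := mkK K (if p then psi x else 0) (if p then 0 else psi x).
have tphi : test_function Om phi.
  rewrite /phi; case: p @phi => phi.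
    exact: (mk_test_function hK tp (rtest_0 Om)).
  exact: (mk_test_function hK (rtest_0 Om) tp).
exists phi; first exact: (test_H10 hK Om_open Om_bounded tphi).
move=> alpha beta a u aM Hu.
have [Hphi cphi] := H1_rtest hK Om_open Om_bounded tphi.
have sf q i := fl_sqint hK Om_open Om_bounded aM q i Hu.
have [_ sgp _] := H1_parts hK Om_open Om_bounded Hphi.
have sdp i : sq (fun x => 'D_(unit_vec R i) psi x).
  by apply: rtest_sqint => //; exact: rtest_derive.
pose c := if p then 1 else chiK K.
have E q i : {ae mu2, forall x, Om x -> cg Om q i phi x =
    if q == p then c * 'D_(unit_vec R i) psi x else 0}.
  apply: aeS (cphi q i) => x h Ox; rewrite h//.
  have -> : (fun y => part q (phi y)) = if q == p then (fun y => c * psi y) else (fun=> 0).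
    apply/funext => y; rewrite part_mk /c.
    by case: (q); case: (p); rewrite /= ?mul1r ?mulr0.
  case: ifP => _; last exact: derive_cst.
  by rewrite smooth_deriveZ//; exact: rtest_smooth tp.
have E2 q i : ip mu2 Om (fl Om a q i u) (cg Om q i phi) =
    if q == p then ip mu2 Om (fl Om a q i u) (fun x => 'D_(unit_vec R i) psi x) else 0.
  have m1 := (sf q i).1; have m2 := (sgp q i).1.
  case: ifP => qp.
    have m3 := (sqintZ mOm c (sdp i)).1.
    transitivity (ip mu2 Om (fl Om a q i u) (fun x => c * 'D_(unit_vec R i) psi x)).
      by apply: (ae_ip mOm) => //; [exact: aeW|move: (E q i); rewrite qp].
    apply: eq_Rintegral => x _; rewrite mulrCA mulrA; congr (_ * _).
    rewrite /c /fl; move/eqP: qp => ->; case: (p); first by rewrite mul1r.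
    by rewrite /= -imK_chi.
  rewrite -[RHS](Rintegral0 mu2 Om).
  transitivity (ip mu2 Om (fl Om a q i u) (fun=> 0)).
    by apply: (ae_ip mOm) => //; [exact: aeW|move: (E q i); rewrite qp].
  by apply: eq_Rintegral => x _; rewrite mulr0.
rewrite /Bform /dot4 (bigD1 p)//= [X in _ + X]big1 ?addr0; last first.
  by move=> q qp; rewrite big1// => i _; rewrite E2 (negbTE qp).
by apply: eq_bigr => i _; rewrite E2 eqxx.
Qed.

End ScalarInterface.

(** * Diagonal coefficients and weak-star convergence *)

Section DiagonalMatrices.
Variables (R : realType) (K : scalar_field R).
Hypothesis hK : K = real_scalars R \/ K = complex_scalars R.

Lemma reK_dot_diag n (d : 'rV[K]_n) (v : 'cV[K]_n) :
  reK (dotK v (diag_mx d *m v)) =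
  \sum_i reK (d 0 i) * (reK (v i 0) ^+ 2 + imK (v i 0) ^+ 2).
Proof.
rewrite /dotK (reK_sum hK); apply: eq_bigr => i _.
rewrite mul_diag_mx mxE reK_M// reK_conj// imK_conj// reK_M// imK_M//; ring.
Qed.

Lemma reK_dotv n (v : 'cV[K]_n) :
  reK (dotK v v) = \sum_i (reK (v i 0) ^+ 2 + imK (v i 0) ^+ 2).
Proof.
rewrite /dotK (reK_sum hK); apply: eq_bigr => i _.
by rewrite reK_M// reK_conj// imK_conj//; ring.
Qed.

Lemma re_ge_diag n (d : 'rV[K]_n) (c : R) :
  re_ge (diag_mx d) c <-> forall i, c <= reK (d 0 i).
Proof.
split=> [h i|h v].
  have := h (\col_j (j == i)%:R); rewrite reK_dot_diag reK_dotv.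
  have E j : reK ((\col_j (j == i)%:R : 'cV[K]_n) j 0) ^+ 2 +
      imK ((\col_j (j == i)%:R : 'cV[K]_n) j 0) ^+ 2 = (j == i)%:R.
    by rewrite mxE; case: (j == i); rewrite /= ?reK1 ?imK1 ?reK0 ?imK0// ?expr1n expr0n ?addr0.
  under eq_bigr do rewrite E; under [X in _ <= X]eq_bigr do rewrite E.
  rewrite (bigD1 i)//= big1 ?addr0; last by move=> j /negbTE ->.
  rewrite (bigD1 i)//= big1 ?addr0; last by move=> j /negbTE ->; rewrite mulr0.
  by rewrite eqxx !mulr1.
rewrite reK_dot_diag reK_dotv mulr_sumr; apply: ler_sum => i _.
by rewrite ler_wpM2r// addr_ge0// sqr_ge0.
Qed.

Lemma invmx_diag n (d : 'rV[K]_n) : (forall i, d 0 i != 0) ->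
  diag_mx d \in unitmx /\ invmx (diag_mx d) = diag_mx (\row_i (d 0 i)^-1).
Proof.
move=> d0; pose e : 'rV[K]_n := \row_i (d 0 i)^-1.
have de : diag_mx d *m diag_mx e = 1%:M.
  rewrite mulmx_diag -diag_const_mx; congr diag_mx; apply/rowP => i.
  by rewrite !mxE divff.
have [ud _] := mulmx1_unit de; split=> //.
by rewrite -[RHS](mulKmx ud) de mulmx1.
Qed.

Definition nsq (z : K) : R := reK z ^+ 2 + imK z ^+ 2.

Lemma nsq_ge0 z : 0 <= nsq z. Proof. by rewrite addr_ge0// sqr_ge0. Qed.

Lemma nsq_gt0 z : 0 < reK z -> 0 < nsq z.
Proof. by move=> z0; rewrite ltr_pwDl ?sqr_ge0// exprn_gt0. Qed.

Lemma reK_neq0 (z : K) : 0 < reK z -> z != 0.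
Proof. by apply: contraTneq => ->; rewrite reK0// ltxx. Qed.

(* z is in the disc Re z >= a, |z|^2 <= b Re z, which inversion maps to the
   corresponding disc for (1/b, 1/a). *)
Definition in_disc (a b : R) (z : K) := a <= reK z /\ nsq z <= b * reK z.

Lemma in_discP a b z : 0 < a -> 0 < b ->
  in_disc a b z <-> a <= reK z /\ b^-1 <= reK z^-1.
Proof.
move=> a0 b0; rewrite /in_disc reK_V//; split=> -[az h]; split=> //;
  have n0 := nsq_gt0 (lt_le_trans a0 az).
  by rewrite -/(nsq z) ler_pdivlMr// ler_pdivrMl.
by move: h; rewrite -/(nsq z) ler_pdivlMr// ler_pdivrMl.
Qed.

Lemma in_discV a b z : 0 < a -> 0 < b -> in_disc a b z -> in_disc b^-1 a^-1 z^-1.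
Proof.
move=> a0 b0 /(in_discP _ a0 b0)[h1 h2].
by apply/in_discP; rewrite ?invr_gt0// !invrK.
Qed.

Lemma in_disc_part a b z p : 0 < a -> 0 < b -> in_disc a b z -> `|part p z| <= b.
Proof.
move=> a0 b0 [h1 h2]; have r0 : 0 < reK z := lt_le_trans a0 h1.
have rb : reK z <= b.
  rewrite -(ler_pM2r r0); apply: le_trans h2.
  by rewrite /nsq -expr2 lerDl sqr_ge0.
rewrite -(@ler_pXn2r _ 2)// ?nnegrE ?(ltW b0)// real_normK ?num_real//.
apply: (@le_trans _ _ (nsq z)).
  by rewrite /nsq; case: p; rewrite /= ?lerDl ?lerDr ?sqr_ge0.
by apply: le_trans h2 _; rewrite expr2 ler_pM2l.
Qed.

End DiagonalMatrices.

(** * Weak-star convergence of bounded functions *)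

Section WeakStar.
Variables (R : realType) (K : scalar_field R).
Hypothesis hK : K = real_scalars R \/ K = complex_scalars R.
Local Notation lam := (@lebesgue_measure R).
Local Notation TR := (measurableTypeR R).
Variable Om : set (R * R).
Hypotheses (Om_open : open Om) (Om_bounded : bounded_set Om).
Local Notation D := (fst @` Om).
Local Notation sq1 := (sqint lam D).

Let mD : @measurable _ TR D.
Proof. exact: measurable_fstD. Qed.

Let one1 : sq1 (fun=> 1).
Proof. by apply: (@bounded_sqint1 R Om Om_open Om_bounded _ 1) => // t _; rewrite normr1. Qed.

Lemma Linfty_intro (f : R -> K) (C : R) : (forall p, measurable_fun D (fun t => part p (f t) : TR)) ->
  {ae lam, forall t, D t -> forall p, `|part p (f t)| <= C} -> Linfty lam D f.
Proof.
move=> mf fC; split; first by split; [exact: (mf true)|exact: (mf false)].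
exists (C + C); apply: aeS fC => t h Dt; apply: le_trans (absK_le hK _) _.
by apply: lerD; [exact: (h Dt true)|exact: (h Dt false)].
Qed.

Lemma bounded_part_sq1 (f : R -> R) (C : R) (g : R -> R) : measurable_fun D (f : TR -> TR) ->
  {ae lam, forall t, D t -> `|f t| <= C} -> sq1 g -> sq1 (fun t => f t * g t).
Proof. by move=> mf fC sg; exact: (sqint_aeM mD mf fC sg). Qed.

Lemma L1_intro d (T : measurableType d) (mu : {measure set T -> \bar R}) (A : set T) (f : T -> K) :
  measurable A -> (forall p, intg mu A (fun x => part p (f x))) -> L1 mu A f.
Proof.
move=> mA h; have ir := h true; have ii := h false.
have mr := intg_meas ir; have mi := intg_meas ii; split; first by split.
apply: (@le_intg _ _ _ mu A mA _ (fun x => `|reK (f x)| + `|imK (f x)|)).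
- rewrite (_ : (fun x => absK (f x)) = (fun x => Num.sqrt (reK (f x) ^+ 2 + imK (f x) ^+ 2))).
    have ms : measurable_fun setT (Num.sqrt : TR -> TR).
      by apply: continuous_measurable_fun; exact: sqrt_continuous.
    have mn := measurable_funD (measurable_funX 2 mr) (measurable_funX 2 mi).
    exact: (measurableT_comp ms mn).
  by apply/funext => x; rewrite absKE.
- move=> x _; rewrite ger0_norm ?absK_ge0// ger0_norm ?addr_ge0//; exact: absK_le.
- apply: (intgD mA); [have := integrable_norm ir|have := integrable_norm ii];
  by apply.
Qed.

Lemma L1_part d (T : measurableType d) (mu : {measure set T -> \bar R}) (A : set T) (f : T -> K) p :
  measurable A -> L1 mu A f -> intg mu A (fun x => part p (f x)).
Proof.
move=> mA [[mr mi] fi]; apply: (@le_intg _ _ _ mu A mA _ (fun x => absK (f x))) => //.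
  by case: p.
move=> x _; rewrite [leRHS]ger0_norm ?absK_ge0//.
by case: p; [exact: absK_re|exact: absK_im].
Qed.

(** The bounded factor h allows tests that involve the limit itself, such as its conjugate, as
    needed for quadratic inequalities. *)
Lemma weak_star_test (f_ : nat -> R -> K) f h p g : weak_star_cvg lam D f_ f ->
  Linfty lam D h -> sq1 g ->
  ip lam D (fun t => part p (f_ n t * h t)) g @[n --> \oo] -->
  ip lam D (fun t => part p (f t * h t)) g.
Proof.
move=> [Lf_ Lf cv] Lh sg.
have Lhg : L1 lam D (fun t => h t * mkK K (g t) 0).
  apply: L1_intro => // q; have [mh [C hC]] := Linfty_part hK Lh q.
  have := sqint_intg1 Om_open Om_bounded (bounded_part_sq1 mh hC sg).
  by apply: eq_intg => // t _; rewrite [in RHS]mulrC (part_Mr hK) mulrC.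
have := (cvgK hK _ _).1 (cv _ Lhg).
have E (k : R -> K) q : part q (integralK lam D (fun t => k t * (h t * mkK K (g t) 0))) =
    ip lam D (fun t => part q (k t * h t)) g.
  rewrite (part_int hK); apply: eq_Rintegral => t _.
  by rewrite mulrA [in LHS]mulrC (part_Mr hK) mulrC.
case=> c1 c2; case: p.
  exact (cvg_ext2 (fun n => E (f_ n) true) (E f true) c1).
exact (cvg_ext2 (fun n => E (f_ n) false) (E f false) c2).
Qed.

Lemma measurable_trunc (g : R -> R) (C : R) : measurable_fun D (g : TR -> TR) ->
  measurable_fun D ((fun t => g t * (`|g t| <= C)%R%:R) : TR -> TR).
Proof.
move=> mg; apply: measurable_funM => //.
have mb : measurable_fun D (fun t : TR => (`|g t| <= C)%R).
  by apply: measurable_fun_ler => //; apply: measurableT_comp.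
have mr : measurable_fun setT (fun b : bool => b%:R : TR) by move=> _ Y _.
exact: (measurableT_comp mr mb).
Qed.

Lemma Rint_abs_cvg0 (g : R -> R) : intg lam D g ->
  \int[lam]_(t in D) `|g t - g t * (`|g t| <= n%:R)%R%:R| @[n --> \oo] --> 0.
Proof.
move=> gi; have mg := intg_meas gi.
have mt (n : nat) : measurable_fun D ((fun t => g t * (`|g t| <= n%:R)%R%:R) : TR -> TR).
  exact: measurable_trunc.
have [|||||_] := @Rint_dominated _ TR R lam D mD
  (fun n t => `|g t - g t * (`|g t| <= n%:R)%R%:R|) (fun=> 0) (fun t => `|g t|).
- by move=> n; apply: measurableT_comp => //; exact: (measurable_funB mg (mt n)).
- exact: measurable_cst.
- apply: aeW => t _; apply: cvg_near_cst.
  near=> n; have -> : `|g t| <= n%:R by near: n; exact: nbhs_infty_ger.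
  by rewrite mulr1 subrr normr0.
- by have := integrable_norm gi.
- apply: aeW => t _ n; case: (_ <= n%:R); rewrite ?mulr1 ?mulr0 ?subrr ?normr0//.
  by rewrite subr0 normr_id.
by rewrite Rintegral0.
Unshelve. all: by end_near. Qed.

(* Bounded functions tested against L2, hence against the dense subset L2 of
   L1. *)
Lemma weak_L1_of_L2 (th : nat -> R -> R) (C : R) g :
  (forall n, measurable_fun D (th n : TR -> TR)) ->
  (forall n, {ae lam, forall t, D t -> `|th n t| <= C}) -> 0 <= C ->
  (forall h, sq1 h -> ip lam D (th n) h @[n --> \oo] --> 0) -> intg lam D g ->
  \int[lam]_(t in D) (th n t * g t) @[n --> \oo] --> 0.
Proof.
move=> mth thC C0 th0 gi; apply/cvgrPdist_lt => e e0.
have mg := intg_meas gi.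
have [k] : exists k : nat, \int[lam]_(t in D) `|g t - g t * (`|g t| <= k%:R)%R%:R| < e / (2 * (C + 1)).
  (* As th is bounded by C, replacing g by its truncation costs at most C times their L1 distance,
     which is then below e / 2; C + 1 avoids a division by 0. *)
  have e1 : 0 < e / (2 * (C + 1)) by rewrite divr_gt0// mulr_gt0// ltr_wpDl.
  have /cvgrPdist_lt/(_ _ e1)[k _ /(_ k (leqnn k)) /=] := Rint_abs_cvg0 gi.
  rewrite sub0r normrN ger0_norm; first by exists k.
  exact: Rintegral_ge0.
pose h t := g t * (`|g t| <= k%:R)%R%:R; rewrite -/(h _) => gh.
have mh : measurable_fun D (h : TR -> TR).
  exact: measurable_trunc.
have sh : sq1 h.
  apply: (@bounded_sqint1 R Om Om_open Om_bounded h k%:R) => // t _.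
  by rewrite /h; case: (boolP (`|g t| <= k%:R)); rewrite ?mulr1// mulr0 normr0.
have i1 := intgB mD gi (sqint_intg1 Om_open Om_bounded sh).
have ithg n q : intg lam D q -> intg lam D (fun t => th n t * q t).
  (* The bound C holds almost everywhere only, so [th n] is cut off to be dominated everywhere. *)
  move=> qi; pose b t := th n t * (`|th n t| <= C)%R%:R.
  have mb : measurable_fun D (b : TR -> TR).
    exact: measurable_trunc.
  have bi : intg lam D (fun t => b t * q t).
    apply: (le_intg mD _ _ (intgZ mD C qi)).
      by apply: measurable_funM => //; exact: intg_meas qi.
    move=> t _; rewrite !normrM ler_wpM2r// (ger0_norm C0) /b.
    by case: (boolP (`|th n t| <= C)); rewrite ?normr1 ?mulr1// normr0 mulr0.
  apply: (ae_intg mD _ _ bi); last exact: (measurable_funM (mth n) (intg_meas qi)).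
  by apply: aeS (thC n) => t hC Dt; rewrite /b hC// mulr1.
have /cvgrPdist_lt/(_ (e / 2)) := th0 h sh.
have e2 : 0 < e / 2 by rewrite divr_gt0.
move=> /(_ e2) [N _ NP]; exists N => // n /NP /=; rewrite !sub0r !normrN => hn.
have -> : \int[lam]_(t in D) (th n t * g t) = ip lam D (th n) h +
    \int[lam]_(t in D) (th n t * (g t - h t)).
  rewrite -(RintegralD mD (ithg n h (sqint_intg1 Om_open Om_bounded sh)) (ithg n _ i1)).
  by apply: eq_Rintegral => t _; rewrite mulrBr addrC subrK.
apply: le_lt_trans (ler_normD _ _) _.
have : `|\int[lam]_(t in D) (th n t * (g t - h t))| <= C * (\int[lam]_(t in D) `|g t - h t|).
  apply: le_trans (le_normr_Rintegral mD (ithg n _ i1)) _.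
  have i2 : intg lam D (fun t => `|g t - h t|) by have := integrable_norm i1.
  rewrite -(RintegralZl _ mD i2).
  apply: (Rint_ae_le mD).
  - by have := integrable_norm (ithg n _ i1).
  - exact: (intgZ mD C i2).
  - by apply: aeS (thC n) => t hC Dt; rewrite normrM ler_wpM2r// hC.
move: gh; rewrite ltr_pdivlMr ?mulr_gt0// ?ltr_wpDl//.
have := Rintegral_ge0 lam (fun t (_ : D t) => normr_ge0 (g t - h t)).
move: (\int[lam]_(t in D) `|g t - h t|) => I I0 hI hJ.
move: hn hJ; move: (`|_|) (`|_|) => x y hx hy.
have : 2 * (C * I) + 2 * I < e by lra.
lra.
Qed.

Lemma ae_ge0_of_Rint (F : R -> R) : intg lam D F ->
  (forall E : set TR, measurable E -> E `<=` D -> 0 <= \int[lam]_(t in E) F t) ->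
  {ae lam, forall t, D t -> 0 <= F t}.
Proof.
move=> Fi h; have mF := intg_meas Fi.
pose E : set TR := D `&` [set t | F t < 0].
have mE : measurable E.
  have := measurable_fun_ltr mF (@measurable_cst _ _ TR TR D 0).
  by move=> /(_ mD [set true]); exact.
have ED : E `<=` D by move=> t [].
have FiE : intg lam E F by exact: (intgS mE mD ED Fi).
have I0 : \int[lam]_(t in E) (- F t) = 0.
  have := Rintegral_ge0 lam (fun t (Et : E t) => ltW (etrans (oppr_gt0 (F t)) Et.2)).
  have := h E mE ED; rewrite (RintN mE FiE).
  by move: (\int[lam]_(t in E) F t) => x x0 nx0; apply/eqP; rewrite oppr_eq0 eq_le x0 -oppr_ge0 nx0.
have := Rint_eq0 mE (intgN FiE) (fun t (Et : E t) => ltW (etrans (oppr_gt0 (F t)) Et.2)) I0.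
apply: aeS => t ht Dt; rewrite leNgt; apply/negP => Ft.
by have /eqP := ht (conj Dt Ft); rewrite oppr_eq0 lt_eqF.
Qed.

Lemma Linfty_sq1 (f : R -> K) p : Linfty lam D f -> sq1 (fun t => part p (f t)).
Proof.
move=> /(Linfty_part hK)/(_ p)[m [C hC]].
have := bounded_part_sq1 m hC one1; congr sqint; apply/funext => t.
by rewrite mulr1.
Qed.

Lemma Linfty1 : Linfty lam D (fun=> 1 : K).
Proof.
apply: (@Linfty_intro _ 1) => [p|]; first exact: measurable_cst.
by apply: aeW => t _ []; rewrite /= ?reK1// ?imK1// ?normr1 ?normr0.
Qed.

Lemma step_set_sq1 (E : set TR) : measurable E -> sq1 (\1_E : R -> R).
Proof.
move=> mE; apply: (@bounded_sqint1 R Om Om_open Om_bounded _ 1) => [|t _].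
  by apply: measurable_funTS; exact: measurable_indic.
by rewrite indicE; case: (t \in E); rewrite ?normr1 ?normr0.
Qed.

Lemma weak_limit_ge0 (F_ : nat -> R -> R) F : (forall n, sq1 (F_ n)) -> sq1 F ->
  (forall g, sq1 g -> ip lam D (F_ n) g @[n --> \oo] --> ip lam D F g) ->
  (forall n, {ae lam, forall t, D t -> 0 <= F_ n t}) ->
  {ae lam, forall t, D t -> 0 <= F t}.
Proof.
move=> sF_ sF cv F0; apply: ae_ge0_of_Rint; first exact: (sqint_intg1 Om_open Om_bounded sF).
move=> E mE ED; have sE := step_set_sq1 mE.
have -> : \int[lam]_(t in E) F t = ip lam D F (\1_E : R -> R).
  rewrite /ip [LHS]Rintegral_mkcond [RHS]Rintegral_mkcond.
  apply: eq_Rintegral => t _; rewrite !patchE indicE.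
  have [tE|tE] := boolP (t \in E); first by rewrite mem_set ?mulr1//; exact/ED/set_mem.
  by rewrite mulr0 if_same.
have c := cv _ sE; rewrite -(cvg_lim (@norm_hausdorff R R) c).
apply: limr_ge; first by apply/cvg_ex; eexists; exact: c.
apply: nearW => n; rewrite -(Rintegral0 lam D).
apply: (Rint_ae_le mD); first exact: intg0.
  exact: (sqintM mD (sF_ n) sE).
apply: aeS (F0 n) => t h Dt; rewrite mulr_ge0// ?h//.
Qed.

(** |z|^2 is not continuous for weak-star convergence, but convex: |f_n|^2 >= 2 Re (f_n conj f) -
    |f|^2. Hence b Re f_n - 2 Re (f_n conj f) + |f|^2 >= 0, which is affine in f_n and becomes b Re
    f - |f|^2 >= 0 in the limit. *)
Lemma in_disc_weak_star a b (f_ : nat -> R -> K) f : weak_star_cvg lam D f_ f ->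
  (forall n, {ae lam, forall t, D t -> in_disc a b (f_ n t)}) ->
  {ae lam, forall t, D t -> in_disc a b (f t)}.
Proof.
move=> cv fd; have [Lf_ Lf _] := cv.
have sf p := Linfty_sq1 p Lf; have sf_ n p := Linfty_sq1 p (Lf_ n).
have Lc : Linfty lam D (fun t => conjK (f t)).
  have [[mr mi] [C hC]] := Lf.
  apply: (@Linfty_intro _ C) => [p|].
    case: p.
      by rewrite (_ : (fun t => _) = (fun t => reK (f t)))//; apply/funext => t; rewrite /= reK_conj.
    rewrite (_ : (fun t => _) = (fun t => - imK (f t))); first exact: measurable_funN.
    by apply/funext => t; rewrite /= imK_conj.
  apply: aeS hC => t h Dt p; apply: le_trans (h Dt).
  by case: p; rewrite /= ?reK_conj// ?imK_conj// ?normrN; [exact: absK_re|exact: absK_im].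
have lim1 g (sg : sq1 g) : ip lam D (fun t => reK (f_ n t)) g @[n --> \oo] -->
    ip lam D (fun t => reK (f t)) g.
  have e (h : R -> K) : ip lam D (fun t => part true (h t * 1)) g = ip lam D (fun t => reK (h t)) g.
    by apply: eq_Rintegral => t _; rewrite /= mulr1.
  exact (cvg_ext2 (fun n => e (f_ n)) (e f) (@weak_star_test _ _ _ true _ cv Linfty1 sg)).
pose c n t := reK (f_ n t) * reK (f t) + imK (f_ n t) * imK (f t).
have lim2 g (sg : sq1 g) : ip lam D (c n) g @[n --> \oo] --> ip lam D (fun t => nsq (f t)) g.
  have e (h : R -> K) : ip lam D (fun t => part true (h t * conjK (f t))) g =
      ip lam D (fun t => reK (h t) * reK (f t) + imK (h t) * imK (f t)) g.
    by apply: eq_Rintegral => t _; rewrite /= reK_M// reK_conj// imK_conj// mulrN opprK.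
  have e2 : ip lam D (fun t => part true (f t * conjK (f t))) g = ip lam D (fun t => nsq (f t)) g.
    by rewrite e; apply: eq_Rintegral => t _; rewrite /nsq !expr2.
  exact (cvg_ext2 (fun n => e (f_ n)) e2 (@weak_star_test _ _ _ true _ cv Lc sg)).
have sc n : sq1 (c n).
  have [mr [Cr hr]] := Linfty_part hK (Lf_ n) true.
  have [mi [Ci hi]] := Linfty_part hK (Lf_ n) false.
  exact: (sqintD mD (bounded_part_sq1 mr hr (sf true)) (bounded_part_sq1 mi hi (sf false))).
have sn : sq1 (fun t => nsq (f t)).
  have [mr [Cr hr]] := Linfty_part hK Lf true.
  have [mi [Ci hi]] := Linfty_part hK Lf false.
  have := sqintD mD (bounded_part_sq1 mr hr (sf true)) (bounded_part_sq1 mi hi (sf false)).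
  by congr sqint; apply/funext => t; rewrite /nsq !expr2.
have sa : sq1 (fun=> a) by have := sqintZ mD a one1; congr sqint; apply/funext => t; rewrite mulr1.
have A1 : {ae lam, forall t, D t -> 0 <= reK (f t) - a}.
  apply: (@weak_limit_ge0 (fun n t => reK (f_ n t) - a)).
  - by move=> n; exact: (sqintB mD (sf_ n true) sa).
  - exact: (sqintB mD (sf true) sa).
  - move=> g sg; apply: (cvg_ext2 _ _ (cvgB (lim1 g sg) (cvg_cst (ip lam D (fun=> a) g)))) => [n|].
      by rewrite (ipBl mD (sf_ n true) sa sg).
    by rewrite (ipBl mD (sf true) sa sg).
  - by move=> n; apply: aeS (fd n) => t h Dt; rewrite subr_ge0; have [] := h Dt.
have A2 : {ae lam, forall t, D t -> 0 <= b * reK (f t) - 2 * nsq (f t) + nsq (f t)}.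
  have s1 n := sqintZ mD b (sf_ n true); have s2 n := sqintZ mD 2 (sc n).
  have s1' := sqintZ mD b (sf true); have s2' := sqintZ mD 2 sn.
  apply: (@weak_limit_ge0 (fun n t => b * reK (f_ n t) - 2 * c n t + nsq (f t))).
  - by move=> n; exact: (sqintD mD (sqintB mD (s1 n) (s2 n)) sn).
  - exact: (sqintD mD (sqintB mD s1' s2') sn).
  - move=> g sg.
    have cc : b * ip lam D (fun t => reK (f_ n t)) g - 2 * ip lam D (c n) g +
        ip lam D (fun t => nsq (f t)) g @[n --> \oo] -->
      b * ip lam D (fun t => reK (f t)) g - 2 * ip lam D (fun t => nsq (f t)) g +
        ip lam D (fun t => nsq (f t)) g.
      apply: cvgD; last exact: cvg_cst.
      by apply: cvgB; apply: cvgM => //; (try exact: cvg_cst); [exact: lim1|exact: lim2].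
    apply: (cvg_ext2 _ _ cc) => [n|].
      rewrite (ipDl mD (sqintB mD (s1 n) (s2 n)) sn sg) (ipBl mD (s1 n) (s2 n) sg).
      by rewrite (ipZl mD _ (sf_ n true) sg) (ipZl mD _ (sc n) sg).
    rewrite (ipDl mD (sqintB mD s1' s2') sn sg) (ipBl mD s1' s2' sg).
    by rewrite (ipZl mD _ (sf true) sg) (ipZl mD _ sn sg).
  - move=> n; apply: aeS (fd n) => t h Dt; have [_ h2] := h Dt.
    have := sqr_ge0 (reK (f_ n t) - reK (f t)); have := sqr_ge0 (imK (f_ n t) - imK (f t)).
    move: h2; rewrite /nsq /c; move: (reK _) (imK _) (reK _) (imK _) => x y z w; nra.
apply: aeS2 A1 A2 => t h1 h2 Dt; split; first by rewrite -subr_ge0; exact: h1.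
by have := h2 Dt; move: (nsq _) (b * _) => x y; lra.
Qed.

Lemma in_disc_Linfty a b (f : R -> K) : 0 < a -> 0 < b -> (forall p, measurable_fun D (fun t => part p (f t) : TR)) ->
  {ae lam, forall t, D t -> in_disc a b (f t)} -> Linfty lam D f.
Proof.
move=> a0 b0 mf fd; apply: (@Linfty_intro _ b) => //.
by apply: aeS fd => t h Dt p; exact: (in_disc_part p a0 b0 (h Dt)).
Qed.

Lemma measurable_partV (f : R -> K) : (forall p, measurable_fun D (fun t => part p (f t) : TR)) ->
  forall p, measurable_fun D (fun t => part p (f t)^-1 : TR).
Proof.
move=> mf p.
have mn : measurable_fun D (fun t => nsq (f t) : TR).
  by apply: measurable_funD; apply: measurable_funX; [exact: (mf true)|exact: (mf false)].
have mnV : measurable_fun D (fun t => (nsq (f t))^-1 : TR).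
  have := measurableT_comp (@measurable_powR R (-1)) mn; congr measurable_fun.
  by apply/funext => t; rewrite /= powR_inv1// nsq_ge0.
case: p.
  have := measurable_funM (mf true) mnV; congr measurable_fun.
  by apply/funext => t; rewrite /= reK_V.
have := measurable_funM (measurable_funN (mf false)) mnV; congr measurable_fun.
by apply/funext => t; rewrite /= imK_V.
Qed.

(** The product with g is expanded into real integrals, each of which needs only the difference f_n
    - f, uniformly bounded and tested with square-integrable functions. *)
Lemma weak_star_intro (f_ : nat -> R -> K) f (C : R) :
  (forall n, Linfty lam D (f_ n)) -> Linfty lam D f ->
  (forall n, {ae lam, forall t, D t -> forall p, `|part p (f_ n t - f t)| <= C}) -> 0 <= C ->
  (forall p g, sq1 g -> ip lam D (fun t => part p (f_ n t - f t)) g @[n --> \oo] --> 0) ->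
  weak_star_cvg lam D f_ f.
Proof.
move=> Lf_ Lf fC C0 cv; split=> // g Lg.
have ig p := L1_part p mD Lg.
have mf_ n p := (Linfty_part hK (Lf_ n) p).1; have mf p := (Linfty_part hK Lf p).1.
have md n p : measurable_fun D ((fun t => part p (f_ n t - f t)) : TR -> TR).
  have := measurable_funB (mf_ n p) (mf p); congr measurable_fun.
  by apply/funext => t; rewrite /= (partB hK).
have key p q : \int[lam]_(t in D) (part p (f_ n t - f t) * part q (g t)) @[n --> \oo] --> 0.
  apply: (@weak_L1_of_L2 (fun n t => part p (f_ n t - f t)) C) => //.
  - by move=> n; apply: aeS (fC n) => t h Dt; exact: h.
  - exact: cv.
have iM (h : R -> K) p q : Linfty lam D h -> intg lam D (fun t => part p (h t) * part q (g t)).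
  move=> Lh; have [mh [B hB]] := Linfty_part hK Lh p.
  pose b t := part p (h t) * (`|part p (h t)| <= B)%R%:R.
  have mb := measurable_trunc B mh.
  have bi : intg lam D (fun t => b t * part q (g t)).
    apply: (le_intg mD _ _ (intgZ mD `|B| (ig q))).
      exact: (measurable_funM mb (intg_meas (ig q))).
    move=> t _; rewrite !normrM normr_id ler_wpM2r// /b.
    case: (boolP (`|part p (h t)| <= B)) => hb; rewrite ?normr1 ?mulr1 ?normr0 ?mulr0//.
    exact: le_trans hb (ler_norm _).
  apply: (ae_intg mD _ _ bi); last exact: (measurable_funM mh (intg_meas (ig q))).
  by apply: aeS hB => t hC Dt; rewrite /b hC// mulr1.
have E (h : R -> K) p : Linfty lam D h -> part p (integralK lam D (fun t => h t * g t)) =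
    \int[lam]_(t in D) (part true (h t) * part p (g t)) +
    (if p then -1 else 1) * \int[lam]_(t in D) (part false (h t) * part (~~ p) (g t)).
  move=> Lh; have i2 := iM h false (~~ p) Lh.
  rewrite -(RintegralZl _ mD i2) -(RintegralD mD (iM h true p Lh) (intgZ mD _ i2)) (part_int hK).
  apply: eq_Rintegral => t _; rewrite (part_M hK); congr (_ + _).
  by case: p {i2}; rewrite ?mul1r// mulN1r mulNr.
have D0 n p q : \int[lam]_(t in D) (part p (f_ n t) * part q (g t)) =
    \int[lam]_(t in D) (part p (f_ n t - f t) * part q (g t)) +
    \int[lam]_(t in D) (part p (f t) * part q (g t)).
  apply/eqP; rewrite -subr_eq; apply/eqP.
  rewrite -(RintegralB mD (iM _ p q (Lf_ n)) (iM _ p q Lf)).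
  by apply: eq_Rintegral => t _; rewrite (partB hK) mulrBl.
have cp p : part p (integralK lam D (fun t => f_ n t * g t)) @[n --> \oo] -->
    part p (integralK lam D (fun t => f t * g t)).
  pose sg : R := if p then -1 else 1.
  have c3 : (\int[lam]_(t in D) (part true (f_ n t - f t) * part p (g t)) +
      \int[lam]_(t in D) (part true (f t) * part p (g t))) +
    sg * (\int[lam]_(t in D) (part false (f_ n t - f t) * part (~~ p) (g t)) +
      \int[lam]_(t in D) (part false (f t) * part (~~ p) (g t))) @[n --> \oo] -->
    (0 + \int[lam]_(t in D) (part true (f t) * part p (g t))) +
    sg * (0 + \int[lam]_(t in D) (part false (f t) * part (~~ p) (g t))).
    apply: cvgD; first by apply: cvgD; [exact: key|exact: cvg_cst].
    apply: cvgM; first exact: cvg_cst.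
    by apply: cvgD; [exact: key|exact: cvg_cst].
  apply: (cvg_ext2 _ _ c3) => [n|]; first by rewrite (E _ p (Lf_ n)) !D0.
  by rewrite (E _ p Lf) !add0r.
by apply/(cvgK hK); split; [exact: (cp true)|exact: (cp false)].
Qed.

End WeakStar.

(** The uniform bound on g_n lets convergence to 0 pass to norm limits of the tests, which is the
    closure condition of the density principles. *)
Lemma weak_closed (R : realType) (V : zmodType) (sc : R -> V -> V) (dot : V -> V -> R)
  (S : set V) (H : semi_hilbert sc dot S) (g_ h_ : nat -> V) (h : V) (B : R) :
  (forall n, S (g_ n)) -> (forall n, dot (g_ n) (g_ n) <= B) ->
  (forall m, S (h_ m)) -> S h -> dot (h_ m - h) (h_ m - h) @[m --> \oo] --> 0 ->
  (forall m, dot (g_ n) (h_ m) @[n --> \oo] --> 0) ->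
  dot (g_ n) h @[n --> \oo] --> 0.
Proof.
move=> Sg gB Sh_ Sh hh gh; apply/cvgrPdist_lt => e e0.
have B0 : 0 <= B := le_trans (sh_ge0 H (Sg 0%N)) (gB 0%N).
have B1 : 0 < B + 1 by rewrite ltr_wpDl.
(* Chosen so that Cauchy-Schwarz with <g_n, g_n> <= B gives |<g_n, h_m - h>| <= e / 2. *)
have d0 : 0 < (e / 2) ^+ 2 / (B + 1) by rewrite divr_gt0// exprn_gt0// divr_gt0.
have /cvgrPdist_lt/(_ _ d0)[m _ /(_ m (leqnn m)) /=] := hh.
have SB := shB H (Sh_ m) Sh.
rewrite sub0r normrN ger0_norm ?(sh_ge0 H)// ltr_pdivlMr// => hm.
have e2 : 0 < e / 2 by rewrite divr_gt0.
have /cvgrPdist_lt/(_ _ e2)[N _ NP] := gh m; exists N => // n /NP /=.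
rewrite !sub0r !normrN => h1.
have -> : dot (g_ n) h = dot (g_ n) (h_ m) - dot (g_ n) (h_ m - h).
  by rewrite (linear_onB H (dot_linr H (Sg n)) (Sh_ m) Sh) opprB addrC subrK.
apply: le_lt_trans (ler_normB _ _) _; rewrite [ltRHS](splitr e); apply: ltr_leD => //.
rewrite -(@ler_pXn2r _ 2)// ?nnegrE ?(ltW e2)// real_normK ?num_real//.
apply: le_trans (dot_CS H (Sg n) SB) _; apply: le_trans (ltW hm); rewrite mulrC.
by rewrite ler_wpM2l ?(sh_ge0 H)// (le_trans (gB n))// lerDl.
Qed.

(** * Sufficiency of weak-star convergence *)

Section WeakProducts.
Variable R : realType.
Local Notation lam := (@lebesgue_measure R).
Local Notation TR := (measurableTypeR R).
Local Notation mu2 := (lebesgue2 R).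
Variable Om : set (R * R).
Hypotheses (Om_open : open Om) (Om_bounded : bounded_set Om).
Local Notation D := (fst @` Om).
Local Notation sq := (sqint mu2 Om).
Local Notation sq1 := (sqint lam D).
Local Notation bdd := (@bdd R Om).
Local Notation wk0 := (@wk0 R Om).

Let mOm : @measurable _ (TR * TR)%type Om.
Proof. exact: open2_measurable. Qed.

Let mD : @measurable _ TR D.
Proof. exact: measurable_fstD. Qed.

Let one1 : sq1 (fun=> 1).
Proof. by apply: (@bounded_sqint1 R Om Om_open Om_bounded _ 1) => // t _; rewrite normr1. Qed.

Lemma wk0_dense g_ : bdd g_ ->
  (forall a b c d k : R, `[a, b] `*` `[c, d] `<=` Om -> 0 < k ->
    ip mu2 Om (g_ n) (tensor (bumpf a b k) (bumpf c d k)) @[n --> \oo] --> 0) -> wk0 g_.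
Proof.
move=> [sg [B gB]] gT; have H := sqint_hilbert mu2 mOm.
pose P := [set h | sq h /\ ip mu2 Om (g_ n) h @[n --> \oo] --> 0].
have : [set f | sq f] `<=` P.
  apply: test_dense => //.
  - by move=> f [].
  - split; first exact: sqint0.
    apply: (@cvg_ext _ (fun=> 0)); last exact: cvg_cst.
    by move=> n; rewrite /ip; under eq_Rintegral do rewrite mulr0; rewrite Rintegral0.
  - move=> f f' [sf cf] [sf' cf']; split; first exact: (sqintD mOm sf sf').
    apply: (cvg_ext2 _ _ (cvgD cf cf')) => [n|]; last by rewrite addr0.
    by rewrite [RHS](dot_linr H (sg n)).1.
  - move=> r f [sf cf]; split; first exact: (sqintZ mOm r sf).
    have c : r * ip mu2 Om (g_ n) f @[n --> \oo] --> r * 0 by apply: cvgM => //; exact: cvg_cst.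
    apply: (cvg_ext2 _ _ c) => [n|]; last by rewrite mulr0.
    by rewrite [RHS](dot_linr H (sg n)).2.
  - move=> f_ f Pf sf ff; split=> //.
    apply: (@weak_closed R _ _ _ _ H g_ f_ f B sg gB _ sf ff) => m; first exact: (Pf m).1.
    exact: (Pf m).2.
  - move=> a b c d k rO k0; split; last exact: gT.
    by apply: rtest_ip => //; apply: rtest_tensor rO _ _; exact: bump_supported.
by move=> h f /h[].
Qed.

Lemma bdd_cst r : sq r -> bdd (fun=> r).
Proof. by move=> sr; split=> //; exists (ip mu2 Om r r). Qed.

Lemma bddN g_ : bdd g_ -> bdd (fun n x => - g_ n x).
Proof.
move=> [sg [B gB]]; split; first by move=> n; exact: sqintN.
exists B => n; apply: le_trans (gB n); rewrite le_eqVlt; apply/orP; left; apply/eqP.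
by apply: eq_Rintegral => x _; rewrite mulrNN.
Qed.

Lemma wk0_ext f_ g_ : (forall n, measurable_fun Om (f_ n : TR * TR -> TR)) ->
  (forall n, measurable_fun Om (g_ n : TR * TR -> TR)) ->
  (forall n, {ae mu2, forall x, Om x -> f_ n x = g_ n x}) -> wk0 f_ -> wk0 g_.
Proof.
move=> mf mg fg f0 h sh; apply: (cvg_ext _ (f0 h sh)) => n.
have e : {ae mu2, forall x, Om x -> h x = h x} by apply: aeW.
exact (ae_ip mOm (fg n) e (mf n) (mg n) sh.1 sh.1).
Qed.

Section Multiplier.
Variables (th : nat -> R -> R) (C : R).
Hypotheses (mth : forall n, measurable_fun D (th n : TR -> TR)).
Hypothesis (thC : forall n, {ae lam, forall t, D t -> `|th n t| <= C}).

Lemma multiplier_sq1 n : sq1 (th n).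
Proof.
have := bounded_part_sq1 Om_open (mth n) (thC n) one1; congr sqint.
by apply/funext => t; rewrite mulr1.
Qed.

Lemma multiplier_ip_le n : ip lam D (th n) (th n) <= C ^+ 2 * ip lam D (fun=> 1) (fun=> 1).
Proof.
have [] // := sqint_le mD one1 (mth n) (sqr_ge0 C).
apply: aeS (thC n) => t h Dt; rewrite expr1n mulr1 -real_normK ?num_real//.
by rewrite lerXn2r ?nnegrE ?h// (le_trans _ (h Dt)).
Qed.

Lemma multiplier_meas n : measurable_fun Om (fun x : TR * TR => th n x.1).
Proof. exact: meas_fst. Qed.

Lemma multiplier_le n : {ae mu2, forall x, Om x -> `|th n x.1| <= C}.
Proof.
by apply: aeS (ae_fst_comp (thC n)) => x h Ox; apply: h; exists x.
Qed.

Lemma bdd_multiplier g_ : bdd g_ -> bdd (fun n x => th n x.1 * g_ n x).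
Proof.
move=> [sg [B gB]].
have s n : sq (fun x => th n x.1 * g_ n x).
  exact: (sqint_aeM mOm (multiplier_meas n) (multiplier_le n) (sg n)).
split=> //; exists (C ^+ 2 * B) => n.
apply: (@le_trans _ _ (C ^+ 2 * ip mu2 Om (g_ n) (g_ n))); last by rewrite ler_wpM2l ?sqr_ge0.
have [] // := sqint_le mOm (sg n) (s n).1 (sqr_ge0 C).
apply: aeS (multiplier_le n) => x h Ox; rewrite exprMn ler_wpM2r ?sqr_ge0//.
by rewrite -real_normK ?num_real// lerXn2r ?nnegrE ?h// (le_trans _ (h Ox)).
Qed.

Lemma ip_multiplier n g psi : ip mu2 Om (fun x => th n x.1 * g x) psi =
  ip mu2 Om (fun x => g x * psi x) (fun x => th n x.1).
Proof. by apply: eq_Rintegral => x _; ring. Qed.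

Hypothesis th0 : forall g, sq1 g -> ip lam D (th n) g @[n --> \oo] --> 0.

(** On tensor test functions the pairing factorises, which reduces the claim to the hypothesis in
    one variable. *)
Lemma wk0_fst : wk0 (fun n x => th n x.1).
Proof.
have one2 := sqint1 Om_open Om_bounded.
have b : bdd (fun n x => th n x.1).
  have [s [B sB]] := bdd_multiplier (bdd_cst one2).
  split; [move=> n; move: (s n)|exists B => n; move: (sB n)];
  by rewrite (_ : (fun x => th n x.1 * 1) = (fun x => th n x.1))//; apply/funext => x; rewrite mulr1.
apply: wk0_dense b _ => a b c d k rO k0.
have sa := bump_supported a b k0; have sc := bump_supported c d k0.
have c1 := th0 (supported_sqint1 Om_open Om_bounded sa).
have c2 : ip lam D (th n) (bumpf a b k) * \int[lam]_y bumpf c d k y @[n --> \oo] -->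
   0 * \int[lam]_y bumpf c d k y by apply: cvgM => //; exact: cvg_cst.
apply: (cvg_ext2 _ _ c2) => [n|]; last by rewrite mul0r.
rewrite [RHS]ipC (Rint_fst_tensor Om_open Om_bounded rO sa sc (multiplier_sq1 n)).
by rewrite (ipC lam).
Qed.

(** d_2 is moved to the test function, leaving u_n, to which the div-curl argument applies with Z =
    0 and W = - d_1 u_n: its hypothesis is then the definition of the weak derivative d_1. *)
Lemma wk0_mul_d2 u g0 g1 : bdd u -> bdd g0 -> bdd g1 ->
  (forall n, weak_d Om 0 (u n) (g0 n)) -> (forall n, weak_d Om 1 (u n) (g1 n)) ->
  wk0 (fun n x => th n x.1 * g1 n x).
Proof.
move=> bu b0 b1 d0 d1; apply: wk0_dense; first exact: bdd_multiplier.
move=> a b c d k rO k0.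
have sa := bump_supported a b k0; have sc := bump_supported c d k0.
have bz : bdd (fun _ : nat => fun=> 0 : R) by apply: bdd_cst; exact: sqint0.
have hdiv n psi : rtest Om psi -> ip mu2 Om (u n) (fun x => 'D_(unit_vec R 0) psi x) +
    ip mu2 Om (fun=> 0) (fun x => 'D_(unit_vec R 1) psi x) = ip mu2 Om (fun x => - g0 n x) psi.
  move=> tp; have -> : ip mu2 Om (fun=> 0) (fun x => 'D_(unit_vec R 1) psi x) = 0.
    by rewrite -[RHS](Rintegral0 mu2 Om); apply: eq_Rintegral => x _; rewrite mul0r.
  rewrite addr0 [LHS](d0 n psi tp) -(RintN mOm (sqintM mOm (b0.1 n) (rtest_ip Om_open Om_bounded tp))).
  by apply: eq_Rintegral => x _; rewrite mulNr.
have cv := fst_div_cvg Om_open Om_bounded rO sa (supported_derive sc) bu bz (bddN b0) hdiv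
   multiplier_sq1 multiplier_ip_le (or_introl th0).
have cvN : - ip mu2 Om (fun x => u n x * tensor (bumpf a b k) (derive1 (bumpf c d k)) x)
    (fun x => th n x.1) @[n --> \oo] --> - (0 : R) by apply: cvgN; exact: cv.
apply: (cvg_ext2 _ _ cvN) => [n|]; last by rewrite oppr0.
rewrite ip_multiplier.
by rewrite (fst_ibp Om_open Om_bounded rO sa sc (bu.1 n) (b1.1 n) (d1 n) (multiplier_sq1 n)).
Qed.

(** q_n has the same divergence as the fixed field r, so q_n - r is divergence free and the div-curl
    argument applies with W = 0. The remaining theta_n r_0 tends to 0 weakly because r_0 is
    fixed. *)
Lemma wk0_mul_div q0 q1 r0 r1 : bdd q0 -> bdd q1 -> sq r0 -> sq r1 ->
  (forall n psi, rtest Om psi ->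
    ip mu2 Om (q0 n) (fun x => 'D_(unit_vec R 0) psi x) +
    ip mu2 Om (q1 n) (fun x => 'D_(unit_vec R 1) psi x) =
    ip mu2 Om r0 (fun x => 'D_(unit_vec R 0) psi x) +
    ip mu2 Om r1 (fun x => 'D_(unit_vec R 1) psi x)) ->
  wk0 (fun n x => th n x.1 * q0 n x).
Proof.
move=> b0 b1 s0 s1 hd; apply: wk0_dense; first exact: bdd_multiplier.
move=> a b c d k rO k0.
have sa := bump_supported a b k0; have sc := bump_supported c d k0.
have bz : bdd (fun _ : nat => fun=> 0 : R) by apply: bdd_cst; exact: sqint0.
have tT := rtest_tensor rO sa sc.
have sT := rtest_ip Om_open Om_bounded tT.
have sd i psi : rtest Om psi -> sq (fun x => 'D_(unit_vec R i) psi x).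
  by move=> tp; apply: rtest_ip => //; exact: rtest_derive.
have hdiv n psi : rtest Om psi ->
    ip mu2 Om (fun x => q0 n x - r0 x) (fun x => 'D_(unit_vec R 0) psi x) +
    ip mu2 Om (fun x => q1 n x - r1 x) (fun x => 'D_(unit_vec R 1) psi x) = ip mu2 Om (fun=> 0) psi.
  move=> tp; rewrite (ipBl mOm (b0.1 n) s0 (sd 0 _ tp)) (ipBl mOm (b1.1 n) s1 (sd 1 _ tp)).
  have -> : ip mu2 Om (fun=> 0) psi = 0.
    by rewrite -[RHS](Rintegral0 mu2 Om); apply: eq_Rintegral => x _; rewrite mul0r.
  have := hd n psi tp; move: (ip _ _ _ _) (ip _ _ _ _) (ip _ _ _ _) (ip _ _ _ _) => x y z w h; lra.
have cv := fst_div_cvg Om_open Om_bounded rO sa sc (bdd_sub Om_open b0 (bdd_cst s0)) (bdd_sub Om_open b1 (bdd_cst s1))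
   bz hdiv multiplier_sq1 multiplier_ip_le (or_introl th0).
have sr0T : sq (fun x => r0 x * tensor (bumpf a b k) (bumpf c d k) x) by exact: rtest_sqintM.
have cv2 := wk0_fst sr0T.
have c3 : ip mu2 Om (fun x => (q0 n x - r0 x) * tensor (bumpf a b k) (bumpf c d k) x) (fun x => th n x.1) +
   ip mu2 Om (fun x => th n x.1) (fun x => r0 x * tensor (bumpf a b k) (bumpf c d k) x) @[n --> \oo] --> (0 + 0 : R).
  by apply: cvgD; [exact: cv|exact: cv2].
apply: (cvg_ext2 _ _ c3) => [n|]; last by rewrite addr0.
rewrite ip_multiplier [X in _ + X]ipC.
have [C' [C'0 sF]] : exists C' : R, 0 < C' /\ forall th, sq1 th -> sq (fun x => th x.1).
  by have [C' C'0 sF] := sqint_fst Om_open Om_bounded; exists C'; split=> // t /sF[].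
have sth := sF _ (multiplier_sq1 n).
have sq0 : sq (fun x => (q0 n x - r0 x) * tensor (bumpf a b k) (bumpf c d k) x).
  by apply: rtest_sqintM => //; exact: (sqintB mOm (b0.1 n) s0).
rewrite -(ipDl mOm sq0 sr0T sth); apply: eq_Rintegral => x _; ring.
Qed.

End Multiplier.
End WeakProducts.

Lemma sum2E (V : nmodType) (F : 'I_2 -> V) : \sum_i F i = F 0 + F 1.
Proof. by rewrite big_ord_recl big_ord1; congr (_ + F _); exact: val_inj. Qed.

Lemma I2P (i : 'I_2) : i = 0 \/ i = 1.
Proof. by case: (unliftP ord0 i) => [j ->|->]; [right; rewrite (ord1 j); exact: val_inj|left]. Qed.

(** * Fluxes of stratified coefficients *)

Section Stratified.
Variables (R : realType) (K : scalar_field R).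
Hypothesis hK : K = real_scalars R \/ K = complex_scalars R.
Local Notation lam := (@lebesgue_measure R).
Local Notation TR := (measurableTypeR R).
Local Notation mu2 := (lebesgue2 R).
Variable Om : set (R * R).
Hypotheses (Om_open : open Om) (Om_bounded : bounded_set Om).
Local Notation D := (fst @` Om).
Local Notation sq1 := (sqint lam D).
Local Notation bdd := (@bdd R Om).
Local Notation wk0 := (@wk0 R Om).
Local Notation h1dot := (@h1dot R K Om).
Local Notation H1 := (@H1 R K Om).
Local Notation H10 := (@H10 R K Om).

Let mOm : @measurable _ (TR * TR)%type Om.
Proof. exact: open2_measurable. Qed.

Let mD : @measurable _ TR D.
Proof. exact: measurable_fstD. Qed.

Lemma wk0N f_ : bdd f_ -> wk0 f_ -> wk0 (fun n x => - f_ n x).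
Proof.
move=> [sf _] f0 h sh.
have c : - ip mu2 Om (f_ n) h @[n --> \oo] --> - (0 : R) by apply: cvgN; exact: f0.
apply: (cvg_ext2 _ _ c) => [n|]; last by rewrite oppr0.
rewrite -(RintN mOm (sqintM mOm (sf n) sh)); apply: eq_Rintegral => x _; by rewrite mulNr.
Qed.

Lemma wk0D f_ g_ : bdd f_ -> bdd g_ -> wk0 f_ -> wk0 g_ -> wk0 (fun n x => f_ n x + g_ n x).
Proof.
move=> bf bg f0 g0.
have := wk0_sub Om_open bf (bddN Om_open bg) f0 (wk0N bg g0); congr wk0.
by apply/funext => n; apply/funext => x; rewrite opprK.
Qed.

Lemma bddD f_ g_ : bdd f_ -> bdd g_ -> bdd (fun n x => f_ n x + g_ n x).
Proof.
move=> bf bg; have := bdd_sub Om_open bf (bddN Om_open bg); congr bdd.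
by apply/funext => n; apply/funext => x; rewrite opprK.
Qed.

Lemma wk0_partM (k z : nat -> R * R -> K) p :
  (forall q q', bdd (fun n x => part q (k n x) * part q' (z n x))) ->
  (forall q q', wk0 (fun n x => part q (k n x) * part q' (z n x))) ->
  bdd (fun n x => part p (k n x * z n x)) /\ wk0 (fun n x => part p (k n x * z n x)).
Proof.
move=> bb ww; have E : (fun n x => part p (k n x * z n x)) = fun n x =>
    part true (k n x) * part p (z n x) +
    (if p then - (part false (k n x) * part (~~ p) (z n x)) else part false (k n x) * part (~~ p) (z n x)).
  by apply/funext => n; apply/funext => x; rewrite (part_M hK); case: (p); rewrite ?mulNr.
rewrite E; case: p {E}; split.
- exact: (bddD (bb true true) (bddN Om_open (bb false false))).
- exact: (wk0D (bb true true) (bddN Om_open (bb false false)) (ww true true)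
    (wk0N (bb false false) (ww false false))).
- exact: (bddD (bb true false) (bb false true)).
- exact: (wk0D (bb true false) (bb false true) (ww true false) (ww false true)).
Qed.

Lemma part_mul_le (x y : K) (A B : R) p : (forall q, `|part q x| <= A) ->
  (forall q, `|part q y| <= B) -> `|part p (x * y)| <= 2 * (A * B).
Proof.
move=> hx hy; rewrite (part_M hK); apply: le_trans (ler_normD _ _) _.
have h q q' : `|part q x * part q' y| <= A * B by rewrite normrM ler_pM.
have h2 : `|(if p then - imK x else imK x) * part (~~ p) y| <= A * B.
  by have := h false (~~ p); case: (p); rewrite /= ?mulNr ?normrN.
have := h true p; rewrite mulr_natl mulr2n => h1; exact: lerD.
Qed.

Lemma measurable_partM (f g : R -> K) :
  (forall q, measurable_fun D (fun t => part q (f t) : TR)) ->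
  (forall q, measurable_fun D (fun t => part q (g t) : TR)) ->
  forall p, measurable_fun D (fun t => part p (f t * g t) : TR).
Proof.
move=> mf mg p.
have h q q' := measurable_funM (mf q) (mg q').
have := measurable_funD (h true p)
  (if p as b return measurable_fun D (fun t => (if b then - imK (f t) else imK (f t)) * part (~~ p) (g t) : TR)
   then measurable_funM (measurable_funN (mf false)) (mg (~~ p)) else h false (~~ p)).
by congr measurable_fun; apply/funext => t; rewrite (part_M hK).
Qed.

Lemma measurable_partB (f g : R -> K) :
  (forall q, measurable_fun D (fun t => part q (f t) : TR)) ->
  (forall q, measurable_fun D (fun t => part q (g t) : TR)) ->
  forall p, measurable_fun D (fun t => part p (f t - g t) : TR).
Proof.
move=> mf mg p; have := measurable_funB (mf p) (mg p).
by congr measurable_fun; apply/funext => t; rewrite /= (partB hK).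
Qed.

Lemma weak_star_diff (f_ : nat -> R -> K) f h p g : weak_star_cvg lam D f_ f ->
  Linfty lam D h -> sq1 g ->
  ip lam D (fun t => part p ((f_ n t - f t) * h t)) g @[n --> \oo] --> 0.
Proof.
move=> cv Lh sg; have [Lf_ Lf _] := cv.
have sM k : Linfty lam D k -> sq1 (fun t => part p (k t * h t)).
  move=> Lk; have m q := (Linfty_part hK Lk q).1.
  have sh q := Linfty_sq1 hK Om_open Om_bounded q Lh.
  have s q q' : sq1 (fun t => part q (k t) * part q' (h t)).
    by have [mk [C hC]] := Linfty_part hK Lk q; exact: (sqint_aeM mD mk hC (sh q')).
  case: (p).
    have := sqintB mD (s true true) (s false false); congr sqint.
    by apply/funext => t; rewrite /= reK_M.
  have := sqintD mD (s true false) (s false true); congr sqint.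
  by apply/funext => t; rewrite /= imK_M.
have c : ip lam D (fun t => part p (f_ n t * h t)) g - ip lam D (fun t => part p (f t * h t)) g
    @[n --> \oo] --> ip lam D (fun t => part p (f t * h t)) g - ip lam D (fun t => part p (f t * h t)) g.
  by apply: cvgB; [exact: weak_star_test|exact: cvg_cst].
apply: (cvg_ext2 _ _ c) => [n|]; last by rewrite subrr.
rewrite -(ipBl mD (sM _ (Lf_ n)) (sM _ Lf) sg); apply: eq_Rintegral => t _.
by rewrite -(partB hK) -mulrBl.
Qed.

Lemma vcomp_ip_le u p k : ip mu2 Om (vcomp Om p k u) (vcomp Om p k u) <= h1dot u u.
Proof. exact: (dot4_comp_le mu2 Om (fun p k => vcomp Om p k u) p k). Qed.

Lemma bdd_vcomp u_ M p k : (forall n, H1 (u_ n)) -> (forall n, h1dot (u_ n) (u_ n) <= M) ->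
  bdd (fun n => vcomp Om p k (u_ n)).
Proof.
move=> Hu uM; split; first by move=> n; exact: vcomp_sqint.
by exists M => n; apply: le_trans (uM n); exact: vcomp_ip_le.
Qed.

Lemma bdd_cu u_ M p : (forall n, H1 (u_ n)) -> (forall n, h1dot (u_ n) (u_ n) <= M) ->
  bdd (fun n => cu p (u_ n)).
Proof.
move=> Hu uM; have := bdd_vcomp p ord0 Hu uM; congr bdd.
by apply/funext => n; rewrite /vcomp unlift_none.
Qed.

Lemma bdd_cg u_ M p i : (forall n, H1 (u_ n)) -> (forall n, h1dot (u_ n) (u_ n) <= M) ->
  bdd (fun n => cg Om p i (u_ n)).
Proof.
move=> Hu uM; have := bdd_vcomp p (lift ord0 i) Hu uM; congr bdd.
by apply/funext => n; rewrite /vcomp liftK.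
Qed.

Section Coefficients.
Variables (alpha beta : R) (a_ : nat -> R * R -> 'M[K]_2).
Variables (al_ : nat -> R -> K) (ah am : R -> K).
Hypotheses (alpha_gt0 : 0 < alpha) (beta_gt0 : 0 < beta).
Hypothesis (a_M : forall n, coef_class alpha beta Om (a_ n)).
Hypothesis (Lal : forall n, Linfty lam D (al_ n)).
Hypotheses (Lah : Linfty lam D ah) (Lam : Linfty lam D am).
Hypothesis a_strat : forall n, {ae mu2, forall x, Om x -> a_ n x = (al_ n x.1)%:M}.

Definition adiag (x : R * R) : 'M[K]_2 :=
  diag_mx (\row_(i < 2) (if i == 0 then ah x.1 else am x.1)).

Lemma bdd_fl u_ M p i : (forall n, H1 (u_ n)) -> (forall n, h1dot (u_ n) (u_ n) <= M) ->
  bdd (fun n => fl Om (a_ n) p i (u_ n)).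
Proof.
move=> Hu uM; have sf n q j := fl_sqint hK Om_open Om_bounded (a_M n) q j (Hu n).
split; first by move=> n; exact: sf.
exists (beta ^+ 2 * M) => n.
apply: le_trans (dot4_comp_le mu2 Om (fun q j => fl Om (a_ n) q j (u_ n)) p i) _.
apply: le_trans (flux_bound hK Om_open Om_bounded beta_gt0 (a_M n) (Hu n)) _.
rewrite ler_wpM2l ?sqr_ge0//; apply: le_trans (uM n); exact: energy_le.
Qed.

(** Membership in the class holds almost everywhere in the plane and here involves x_1 only, so it
    descends to the projection. *)
Lemma strat_disc n : {ae lam, forall t, D t -> in_disc alpha beta (al_ n t)}.
Proof.
apply: (ae_fst Om_open); have [_ h1 h2] := a_M n.
have h3 : {ae mu2, forall x, Om x -> re_ge (a_ n x) alpha /\ re_ge (invmx (a_ n x)) beta^-1}.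
  by apply: aeS2 h1 h2 => x g1 g2 Ox; split; [exact: g1|exact: (g2 Ox).2].
apply: aeS2 h3 (a_strat n) => x h e Ox; have [] := h Ox; rewrite e//.
rewrite invmx_scalar -!diag_const_mx !(re_ge_diag hK) => /(_ 0) + /(_ 0).
by rewrite !mxE => r1 r2; apply/(in_discP hK) => //; split.
Qed.

Lemma adiag_coef_class : {ae lam, forall t, D t -> in_disc alpha beta (ah t)} ->
  {ae lam, forall t, D t -> in_disc alpha beta (am t)} -> coef_class alpha beta Om adiag.
Proof.
move=> /ae_fst_comp dh /ae_fst_comp dm.
have Lfst (f : R -> K) : Linfty lam D f -> Linfty mu2 Om (fun x => f x.1).
  move=> [[mr mi] [C /ae_fst_comp hC]]; split; first by split; [exact (meas_fst Om_open mr)|exact (meas_fst Om_open mi)].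
  by exists C; apply: aeS hC => x h Ox; apply: h; exists x.
have L0 : Linfty mu2 Om (fun=> 0 : K).
  split; first by split; exact: measurable_cst.
  by exists 0; apply: aeW => x _; rewrite absKE// reK0// imK0// expr0n addr0 sqrtr0.
have disc : {ae mu2, forall x, Om x -> forall i : 'I_2,
    in_disc alpha beta ((\row_(i < 2) (if i == 0 then ah x.1 else am x.1)) 0 i)}.
  apply: aeS2 dh dm => x h1 h2 Ox i; have Dx : D x.1 by exists x.
  by rewrite mxE; case: ifP => _; [exact: h1|exact: h2].
split.
- move=> i j; rewrite (_ : (fun x => adiag x i j) = fun x =>
    if i == j then (if j == 0 then ah x.1 else am x.1) else 0); last first.
    by apply/funext => x; rewrite !mxE; case: (eqVneq i j) => [->|_]; rewrite ?mulr1n ?mulr0n.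
  by case: (i == j) => //; case: (j == 0); exact: Lfst.
- apply: aeS disc => x h Ox; apply/(re_ge_diag hK) => i.
  by have [] := h Ox i.
- apply: aeS disc => x h Ox.
  have d0 i : (\row_(i < 2) (if i == 0 then ah x.1 else am x.1)) 0 i != 0.
    by apply: (reK_neq0 hK); apply: lt_le_trans alpha_gt0 _; have [] := h Ox i.
  have [ud ->] := invmx_diag d0; split=> //; apply/(re_ge_diag hK) => i.
  by rewrite mxE; have /(in_discP hK _ alpha_gt0 beta_gt0)[_] := h Ox i.
Qed.

Lemma adiag_disc : coef_class alpha beta Om adiag ->
  {ae lam, forall t, D t -> in_disc alpha beta (ah t)} /\
  {ae lam, forall t, D t -> in_disc alpha beta (am t)}.
Proof.
move=> [_ h1 h2].
have h3 : {ae mu2, forall x, Om x -> in_disc alpha beta (ah x.1) /\ in_disc alpha beta (am x.1)}.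
  apply: aeS2 h1 h2 => x g1 g2 Ox.
  have /(re_ge_diag hK) r1 := g1 Ox; have [_ r2] := g2 Ox.
  have d0 i : (\row_(i < 2) (if i == 0 then ah x.1 else am x.1)) 0 i != 0.
    by apply: (reK_neq0 hK); apply: lt_le_trans alpha_gt0 _; exact: r1.
  move: r2; rewrite /adiag (invmx_diag d0).2 (re_ge_diag hK) => r2.
  have := r1 0; have := r1 (lift ord0 ord0); have := r2 0; have := r2 (lift ord0 ord0).
  rewrite !mxE /= => e1 e2 e3 e4.
  by split; apply/(in_discP hK) => //; split.
by split; apply: (ae_fst Om_open); apply: aeS h3 => x h Ox; have [] := h Ox.
Qed.

Lemma fl_strat n p i u : {ae mu2, forall x, Om x ->
  fl Om (a_ n) p i u x = part p (al_ n x.1 * wgrad Om u x i 0)}.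
Proof.
apply: aeS (a_strat n) => x e Ox.
by rewrite /fl /flux e// mul_scalar_mx mxE.
Qed.

Lemma fl_adiag p i u x : fl Om adiag p i u x =
  part p ((if i == 0 then ah x.1 else am x.1) * wgrad Om u x i 0).
Proof. by rewrite /fl /flux mul_diag_mx !mxE. Qed.

Lemma meas_fl n p i u : H1 u -> measurable_fun Om (fl Om (a_ n) p i u : TR * TR -> TR).
Proof. by move=> Hu; exact: (fl_sqint hK Om_open Om_bounded (a_M n) p i Hu).1. Qed.

Section WeakStarConvergence.
Hypothesis cvh : weak_star_cvg lam D (fun n t => (al_ n t)^-1) (fun t => (ah t)^-1).
Hypothesis cvm : weak_star_cvg lam D al_ am.

(** The reciprocals of alpha_n lie in the disc for (1/beta, 1/alpha), so does their limit, and
    inversion leads back. *)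
Lemma ah_disc : {ae lam, forall t, D t -> in_disc alpha beta (ah t)}.
Proof.
have dV n : {ae lam, forall t, D t -> in_disc beta^-1 alpha^-1 (al_ n t)^-1}.
  by apply: aeS (strat_disc n) => t h Dt; apply: in_discV => //; exact: h.
apply: aeS (in_disc_weak_star hK Om_open Om_bounded cvh dV) => t h Dt.
have := in_discV hK _ _ (h Dt); rewrite !invrK; apply; rewrite invr_gt0//.
Qed.

Lemma am_disc : {ae lam, forall t, D t -> in_disc alpha beta (am t)}.
Proof. exact: (in_disc_weak_star hK Om_open Om_bounded cvm strat_disc). Qed.

Lemma adiag_M : coef_class alpha beta Om adiag.
Proof. exact: adiag_coef_class ah_disc am_disc. Qed.

(** The factor 1 brings the difference into the form (f_n - f) h of [weak_star_diff]. *)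
Lemma multiplier_m q n : measurable_fun D (fun t => part q ((al_ n t - am t) * 1) : TR) /\
  {ae lam, forall t, D t -> `|part q ((al_ n t - am t) * 1)| <= beta + beta}.
Proof.
have ml p := (Linfty_part hK (Lal n) p).1; have mm p := (Linfty_part hK Lam p).1.
split; first by under eq_fun do rewrite mulr1; exact: measurable_partB.
apply: aeS2 (strat_disc n) am_disc => t h1 h2 Dt; rewrite mulr1 (partB hK).
apply: le_trans (ler_normB _ _) _.
by apply: lerD; [exact: (in_disc_part q alpha_gt0 beta_gt0 (h1 Dt))|exact: (in_disc_part q alpha_gt0 beta_gt0 (h2 Dt))].
Qed.

Lemma multiplier_h q n :
  measurable_fun D (fun t => part q (((al_ n t)^-1 - (ah t)^-1) * ah t) : TR) /\
  {ae lam, forall t, D t -> `|part q (((al_ n t)^-1 - (ah t)^-1) * ah t)| <=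
     2 * ((alpha^-1 + alpha^-1) * beta)}.
Proof.
have ml p := (Linfty_part hK (Lal n) p).1; have mh p := (Linfty_part hK Lah p).1.
split.
  apply: measurable_partM => //; apply: measurable_partB; exact: measurable_partV.
apply: aeS2 (strat_disc n) ah_disc => t h1 h2 Dt; apply: part_mul_le => p.
  rewrite (partB hK); apply: le_trans (ler_normB _ _) _.
  have i1 := in_discV hK alpha_gt0 beta_gt0 (h1 Dt).
  have i2 := in_discV hK alpha_gt0 beta_gt0 (h2 Dt).
  have a0 : 0 < alpha^-1 by rewrite invr_gt0.
  have b0 : 0 < beta^-1 by rewrite invr_gt0.
  by apply: lerD; [exact: (in_disc_part p b0 a0 i1)|exact: (in_disc_part p b0 a0 i2)].
exact: (in_disc_part p alpha_gt0 beta_gt0 (h2 Dt)).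
Qed.

(** The limit coefficient acts on grad u_n, so that no limit of u_n has to be known. In the first
    component alpha_n d_1 u_n - alpha_h d_1 u_n = - (1/alpha_n - 1/alpha_h) alpha_h q_n^1, the
    product of a weakly null function of x_1 with a component of a field of fixed divergence. *)
Lemma flux_defect u_ u M : (forall n, H10 (u_ n)) -> (forall n, h1dot (u_ n) (u_ n) <= M) ->
  H10 u -> (forall n v, H10 v -> Bform Om (a_ n) (u_ n) v = Bform Om adiag u v) ->
  forall p i, wk0 (fun n x => fl Om (a_ n) p i (u_ n) x - fl Om adiag p i (u_ n) x).
Proof.
move=> Hu_ uM Hu eqB p i; have H1u_ n := H10_H1 (Hu_ n); have H1u := H10_H1 Hu.
have bc q := bdd_cu q H1u_ uM; have bg q j := bdd_cg q j H1u_ uM.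
have bf q j := bdd_fl q j H1u_ uM.
have wd n q j : weak_d Om j (cu q (u_ n)) (cg Om q j (u_ n)).
  by have [_ _] := H1_parts hK Om_open Om_bounded (H1u_ n); exact.
have sa q j := fl_sqint hK Om_open Om_bounded adiag_M q j H1u.
have hdiv q n psi : rtest Om psi ->
    ip mu2 Om (fl Om (a_ n) q 0 (u_ n)) (fun x => 'D_(unit_vec R 0) psi x) +
    ip mu2 Om (fl Om (a_ n) q 1 (u_ n)) (fun x => 'D_(unit_vec R 1) psi x) =
    ip mu2 Om (fl Om adiag q 0 u) (fun x => 'D_(unit_vec R 0) psi x) +
    ip mu2 Om (fl Om adiag q 1 u) (fun x => 'D_(unit_vec R 1) psi x).
  move=> tp; have [phi Hphi h] := Bform_rtest hK Om_open Om_bounded q tp.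
  have := eqB n phi Hphi; rewrite (h _ _ _ _ (a_M n) (H1u_ n)) (h _ _ _ _ adiag_M H1u).
  pose S (b : R * R -> 'M[K]_2) (w : R * R -> K^o) i := ip mu2 Om (fl Om b q i w) (fun x => 'D_(unit_vec R i) psi x).
  by move=> e; exact (etrans (esym (sum2E (S (a_ n) (u_ n)))) (etrans e (sum2E (S adiag u)))).
have m1 n q j := meas_fl n q j (H1u_ n).
have m2 n q j := (fl_sqint hK Om_open Om_bounded adiag_M q j (H1u_ n)).1.
have md n q j : measurable_fun Om (fun x : TR * TR => fl Om (a_ n) q j (u_ n) x - fl Om adiag q j (u_ n) x).
  exact: (measurable_funB (m1 n q j) (m2 n q j)).
have [->|->] := I2P i; last first.
  pose k n (x : R * R) : K := (al_ n x.1 - am x.1) * 1; pose z n (x : R * R) : K := wgrad Om (u_ n) x 1 0.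
  have bb q q' : bdd (fun n x => part q (k n x) * part q' (z n x)).
    exact: (bdd_multiplier Om_open (fun n => (multiplier_m q n).1) (fun n => (multiplier_m q n).2) (bg q' 1)).
  have ww q q' : wk0 (fun n x => part q (k n x) * part q' (z n x)).
    apply: (wk0_mul_d2 Om_open Om_bounded (fun n => (multiplier_m q n).1) (fun n => (multiplier_m q n).2)
      _ (bc q') (bg q' 0) (bg q' 1) (fun n => wd n q' 0) (fun n => wd n q' 1)).
    by move=> g sg; exact (weak_star_diff q cvm (Linfty1 hK Om) sg).
  have [bk wk] := wk0_partM p bb ww.
  apply: (wk0_ext Om_open (fun n => (bk.1 n).1) (fun n => md n p 1) _ wk) => n.
  apply: aeS (fl_strat n p 1 (u_ n)) => x e Ox.
  by rewrite e// fl_adiag /= -(partB hK) /k mulr1 -mulrBl.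
pose k n (x : R * R) : K := ((al_ n x.1)^-1 - (ah x.1)^-1) * ah x.1; pose z n (x : R * R) : K := flux Om (a_ n) (u_ n) x 0 0.
have bb q q' : bdd (fun n x => part q (k n x) * part q' (z n x)).
  exact: (bdd_multiplier Om_open (fun n => (multiplier_h q n).1) (fun n => (multiplier_h q n).2) (bf q' 0)).
have ww q q' : wk0 (fun n x => part q (k n x) * part q' (z n x)).
  apply: (wk0_mul_div Om_open Om_bounded (fun n => (multiplier_h q n).1) (fun n => (multiplier_h q n).2)
    _ (bf q' 0) (bf q' 1) (sa q' 0) (sa q' 1) (hdiv q')).
  by move=> g sg; exact (weak_star_diff q cvh Lah sg).
have [bk wk] := wk0_partM p bb ww.
have mk n : measurable_fun Om (fun x : TR * TR => - part p (k n x * z n x)).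
  exact: measurable_funN (bk.1 n).1.
apply: (wk0_ext Om_open mk (fun n => md n p 0) _ (wk0N bk wk)) => n.
have ne : {ae mu2, forall x, Om x -> al_ n x.1 != 0 /\ ah x.1 != 0}.
  apply: aeS2 (ae_fst_comp (strat_disc n)) (ae_fst_comp ah_disc) => x h1 h2 Ox.
  have Dx : D x.1 by exists x.
  by split; apply: (reK_neq0 hK); apply: lt_le_trans alpha_gt0 _; [have [] := h1 Dx|have [] := h2 Dx].
apply: aeS2 (a_strat n) ne => x e h Ox; have [l0 h0] := h Ox.
rewrite fl_adiag /= /k /z /fl /flux e// mul_scalar_mx mxE -(partB hK).
have -> : ((al_ n x.1)^-1 - (ah x.1)^-1) * ah x.1 * (al_ n x.1 * wgrad Om (u_ n) x 0 0) =
   ah x.1 * wgrad Om (u_ n) x 0 0 - al_ n x.1 * wgrad Om (u_ n) x 0 0.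
  by field; rewrite ?l0 ?h0.
by rewrite !(partB hK) opprB.
Qed.

Lemma weak_star_H_converges : H_converges alpha beta Om a_ adiag.
Proof.
split; [exact: a_M|exact: adiag_M|move=> f Hf u_ u Su_ Su].
have Pn n := (solvesP hK Om_open Om_bounded (a_M n) (u_ n) Hf).1 (Su_ n).
have [Hu Bu] := (solvesP hK Om_open Om_bounded adiag_M u Hf).1 Su.
have Hu_ n := (Pn n).1.
have eqB n v : H10 v -> Bform Om (a_ n) (u_ n) v = Bform Om adiag u v.
  by move=> Hv; rewrite (Bu v Hv); exact: (Pn n).2.
have [ll [B B0 lB]] := dual_parts hK Om_open Om_bounded true Hf.
have [C C0 CP] := apriori hK Om_open Om_bounded.
have uM n : h1dot (u_ n) (u_ n) <= alpha ^- 2 * (C * B).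
  rewrite ler_pdivlMl ?exprn_gt0//.
  exact: (CP alpha beta (a_ n) (u_ n) (part true (f (u_ n))) B alpha_gt0 B0 (a_M n) (Hu_ n)
    ((Pn n).2 _ (Hu_ n)) (lB _ (Hu_ n))).
have wdef := flux_defect Hu_ uM Hu eqB.
have sfn n p i := fl_sqint hK Om_open Om_bounded (a_M n) p i (H10_H1 (Hu_ n)).
have sfa n p i := fl_sqint hK Om_open Om_bounded adiag_M p i (H10_H1 (Hu_ n)).
have sfu p i := fl_sqint hK Om_open Om_bounded adiag_M p i (H10_H1 Hu).
pose df n p i x := fl Om (a_ n) p i (u_ n) x - fl Om adiag p i (u_ n) x.
(* The equations give B_(a_n)(u_n, v) = B_a(u, v), and the flux defect is weakly null, so B_a(u_n,
   v) tends to B_a(u, v). *)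
have cB v : H10 v -> Bform Om adiag (u_ n) v @[n --> \oo] --> Bform Om adiag u v.
  move=> Hv; have [_ sg _] := H1_parts hK Om_open Om_bounded (H10_H1 Hv).
  have c0 : \sum_(p : bool) \sum_(i < 2) ip mu2 Om (df n p i) (cg Om p i v) @[n --> \oo] -->
      \sum_(p : bool) \sum_(i < 2) (0 : R).
    by apply: cvg_bigsum => p; apply: cvg_bigsum => i; exact: wdef.
  have c1 : Bform Om adiag u v - \sum_(p : bool) \sum_(i < 2) ip mu2 Om (df n p i) (cg Om p i v)
     @[n --> \oo] --> Bform Om adiag u v - \sum_(p : bool) \sum_(i < 2) (0 : R).
    by apply: cvgB; [exact: cvg_cst|exact: c0].
  apply: (cvg_ext2 _ _ c1) => [n|]; last by rewrite big1 ?subr0// => p _; rewrite big1.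
  rewrite -(eqB n v Hv) /Bform /dot4 -sumrB; apply: eq_bigr => p _.
  rewrite -sumrB; apply: eq_bigr => i _.
  by rewrite (ipBl mOm (sfn n p i) (sfa n p i) (sg p i)) opprB addrC subrK.
have wl l E := Bform_weak_limit hK Om_open Om_bounded alpha_gt0 beta_gt0 adiag_M Hu_ Hu cB (l := l) (D := E).
split; first exact: (weak_cvg_H10 hK Om_open Om_bounded wl).
apply: (weak_cvg_L2v hK Om_open).
- by move=> n; apply/(L2vP hK Om_open) => p i; exact: sfn.
- by apply/(L2vP hK Om_open) => p i; exact: sfu.
(* The flux is the defect plus a grad u_n, and w |-> a grad w is bounded on H^1_0, so the second
   term inherits the weak convergence of u_n. *)
move=> p i g sg; have cl : ip mu2 Om (fl Om adiag p i (u_ n)) g @[n --> \oo] --> ip mu2 Om (fl Om adiag p i u) g.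
  apply: (wl (fun w => ip mu2 Om (fl Om adiag p i w) g) (beta ^+ 2 * ip mu2 Om g g)).
    by apply: linear_onS (ip_fl_lin hK Om_open Om_bounded adiag_M p i sg) => w [].
  move=> w Hw; have sw q j := fl_sqint hK Om_open Om_bounded adiag_M q j (H10_H1 Hw).
  apply: le_trans (dot_CS (sqint_hilbert mu2 mOm) (sw p i) sg) _.
  rewrite mulrAC ler_wpM2r ?ip_ge0//.
  apply: le_trans (dot4_comp_le mu2 Om (fun q j => fl Om adiag q j w) p i) _.
  apply: le_trans (flux_bound hK Om_open Om_bounded beta_gt0 adiag_M (H10_H1 Hw)) _.
  by rewrite ler_wpM2l ?sqr_ge0// energy_le.
have c2 : ip mu2 Om (df n p i) g + ip mu2 Om (fl Om adiag p i (u_ n)) g @[n --> \oo] -->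
    0 + ip mu2 Om (fl Om adiag p i u) g by apply: cvgD; [exact: wdef|exact: cl].
apply: (cvg_ext2 _ _ c2) => [n|]; last by rewrite add0r ipC.
by rewrite (ipBl mOm (sfn n p i) (sfa n p i) sg) subrK ipC.
Qed.

End WeakStarConvergence.
End Coefficients.
End Stratified.

Lemma ler_mul_third (R : realFieldType) (b x y z : R) : 0 <= b -> 0 <= x -> z <= 2 * y ->
  b * (x * (y + z)) <= b * (x * (3 * y)).
Proof. by move=> b0 x0 zy; rewrite ler_wpM2l// ler_wpM2l//; lra. Qed.

(** * Necessity of weak-star convergence *)

Section BumpMoments.
Variable R : realType.
Local Notation lam := (@lebesgue_measure R).
Local Notation TR := (measurableTypeR R).

Lemma bump_int_gt0 (c d k : R) : c < d -> 0 < k -> 0 < \int[lam]_t bumpf c d k t.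
Proof.
move=> cd k0; have ib := supported_intg (bump_supported c d k0).
rewrite lt_def Rintegral_ge0 ?andbT; last by move=> t _; exact: bump_ge0.
apply/eqP => I0; have /= := Rint_eq0 measurableT ib (fun t _ => bump_ge0 c d k t) I0.
move=> b0; have m1 : measurable_fun setT (\1_(`]c, d[%classic) : TR -> TR).
  by apply: measurable_indic; exact: measurable_itv.
have : \int[lam]_t (\1_(`]c, d[%classic) t : R) = \int[lam]_t (0 : R).
  apply: (ae_Rint measurableT) => //; apply: aeS b0 => t h _; rewrite indicE.
  case: (boolP (t \in _)) => //; rewrite inE /= in_itv/= => /(bump_gt0 k0).
  by rewrite h// ltxx.
by rewrite Rint_indic_itv// Rintegral0 => /eqP; rewrite subr_eq0 gt_eqF.
Qed.

Lemma supported_idM a b (f : R -> R) : supported a b f -> supported a b (fun t => t * f t).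
Proof. by move=> sf; exact: (supported_mul sf (@smooth1_id R)). Qed.

Lemma derive1_idM a b (f : R -> R) t : supported a b f ->
  derive1 (fun t => t * f t) t * f t - derive1 f t * (t * f t) = f t * f t.
Proof.
move=> [sf _]; have df := smooth1_is_derive1 t sf.
rewrite [derive1 (fun t => t * f t) t]derive1E derive_val /GRing.scale /=; ring.
Qed.

End BumpMoments.

Lemma subD_eq0 (V : zmodType) (a b c d : V) : a + b = c + d -> a - c + (b - d) = 0.
Proof. by move=> e; rewrite addrACA -opprD e subrr. Qed.

Section Necessity.
Variables (R : realType) (K : scalar_field R).
Hypothesis hK : K = real_scalars R \/ K = complex_scalars R.
Local Notation lam := (@lebesgue_measure R).
Local Notation TR := (measurableTypeR R).
Local Notation mu2 := (lebesgue2 R).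
Variable Om : set (R * R).
Hypotheses (Om_open : open Om) (Om_bounded : bounded_set Om).
Local Notation D := (fst @` Om).
Local Notation sq := (sqint mu2 Om).
Local Notation sq1 := (sqint lam D).
Local Notation bdd := (@bdd R Om).
Local Notation wk0 := (@wk0 R Om).
Local Notation h1dot := (@h1dot R K Om).
Local Notation H1 := (@H1 R K Om).
Local Notation H10 := (@H10 R K Om).
Local Notation Hm1 := (@Hm1 R K Om).

Let mOm : @measurable _ (TR * TR)%type Om.
Proof. exact: open2_measurable. Qed.

Let mD : @measurable _ TR D.
Proof. exact: measurable_fstD. Qed.

Lemma multiplier_dense (th : nat -> R -> R) (C : R) :
  (forall n, measurable_fun D (th n : TR -> TR)) ->
  (forall n, {ae lam, forall t, D t -> `|th n t| <= C}) ->
  (forall a b c d k : R, c < d -> `[a, b] `*` `[c, d] `<=` Om -> 0 < k ->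
    ip lam D (th n) (bumpf a b k) @[n --> \oo] --> 0) ->
  forall g, sq1 g -> ip lam D (th n) g @[n --> \oo] --> 0.
Proof.
move=> mth thC thb.
have sth n := multiplier_sq1 Om_open Om_bounded mth thC n.
have thB n := multiplier_ip_le Om_open Om_bounded mth thC n.
have H := sqint_hilbert lam mD.
pose P := [set h | sq1 h /\ ip lam D (th n) h @[n --> \oo] --> 0].
have : [set f | sq1 f] `<=` P.
  apply: test_dense1 => //.
  - by move=> f [].
  - split; first exact: sqint0.
    apply: (@cvg_ext _ (fun=> 0)); last exact: cvg_cst.
    by move=> n; rewrite /ip; under eq_Rintegral do rewrite mulr0; rewrite Rintegral0.
  - move=> f f' [sf cf] [sf' cf']; split; first exact: (sqintD mD sf sf').
    apply: (cvg_ext2 _ _ (cvgD cf cf')) => [n|]; last by rewrite addr0.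
    by rewrite [RHS](dot_linr H (sth n)).1.
  - move=> r f [sf cf]; split; first exact: (sqintZ mD r sf).
    have c : r * ip lam D (th n) f @[n --> \oo] --> r * 0 by apply: cvgM => //; exact: cvg_cst.
    apply: (cvg_ext2 _ _ c) => [n|]; last by rewrite mulr0.
    by rewrite [RHS](dot_linr H (sth n)).2.
  - move=> f_ f Pf sf ff; split=> //.
    apply: (@weak_closed R _ _ _ _ H th f_ f _ sth thB _ sf ff) => m; first exact: (Pf m).1.
    exact: (Pf m).2.
  - move=> a b c d k cd rO k0; split; last exact: (thb a b c d k cd rO k0).
    exact: supported_sqint1 (bump_supported a b k0).
by move=> h g /h[].
Qed.

Lemma wk0_of_cvg (f_ : nat -> R * R -> R) f : (forall n, sq (f_ n)) -> sq f ->
  (forall g, sq g -> ip mu2 Om (f_ n) g @[n --> \oo] --> ip mu2 Om f g) ->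
  wk0 (fun n x => f_ n x - f x).
Proof.
move=> sf_ sf cv g sg.
have c : ip mu2 Om (f_ n) g - ip mu2 Om f g @[n --> \oo] --> ip mu2 Om f g - ip mu2 Om f g.
  by apply: cvgB; [exact: cv|exact: cvg_cst].
apply: (cvg_ext2 _ _ c) => [n|]; last by rewrite subrr.
by rewrite (ipBl mOm (sf_ n) sf sg).
Qed.

Lemma scK_split c (u : R * R -> K^o) : scK c u = scR (reK c) u + scR (imK c) (scK (imag_unit K) u).
Proof.
apply/funext => x; apply: (part_eq hK) => p; rewrite (partD hK) /scR /scK !(part_Mr hK).
rewrite !(part_M hK) /imag_unit; case: p; rewrite /= reK_mk// imK_mkE// mulr1.
  by rewrite {1}(imK_chi hK c); ring.
by rewrite {1}(imK_chi hK c); ring.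
Qed.

(** This is i^2 = -1 for the complex scalars and 0 = 0 for the real ones. *)
Lemma scK_imag2 (u : R * R -> K^o) : scK (imag_unit K) (scK (imag_unit K) u) = scR (- chiK K) u.
Proof.
apply/funext => x; apply: (part_eq hK) => p; rewrite /scR /scK (part_Mr hK).
have i1 : imK (imag_unit K) = chiK K by [].
have i0 : reK (imag_unit K) = 0 by rewrite reK_mk.
have c2 : chiK K * chiK K = chiK K by rewrite -imK_chi.
rewrite (part_M hK) /= i0 i1 mul0r add0r; case: p; rewrite /= ?reK_M// ?imK_M// i0 i1.
  by rewrite mul0r add0r mulNr mulrA c2 mulNr.
by rewrite mul0r sub0r mulrN mulrA c2 mulNr.
Qed.

(** [Bform] only records real parts; linearity over K is recovered from the behaviour under
    multiplication by i. *)
Lemma form_dual alpha beta a v : 0 < beta -> coef_class alpha beta Om a -> H1 v ->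
  Hm1 (fun phi => L2v_dot mu2 Om (flux Om a v) (wgrad Om phi)).
Proof.
move=> b0 aM Hv; set f := fun phi => _.
have re phi : H1 phi -> reK (f phi) = Bform Om a v phi.
  by move=> Hp; exact: (reK_flux_dot hK Om_open Om_bounded aM Hv Hp).
have im phi : H1 phi -> imK (f phi) = - Bform Om a v (scK (imag_unit K) phi).
  by move=> Hp; exact: (imK_flux_dot hK Om_open Om_bounded aM Hv Hp).
clearbody f.
have HZ c phi : H1 phi -> H1 (scK c phi) by move=> Hp; exact: (H1_Z hK Om_open Om_bounded c Hp).1.
have HR c phi : H1 phi -> H1 (scR c phi) by exact: HZ.
have BD phi psi : H1 phi -> H1 psi -> Bform Om a v (phi + psi) = Bform Om a v phi + Bform Om a v psi.
  exact: (Bform_linr hK Om_open Om_bounded aM Hv).1.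
have BR c phi : H1 phi -> Bform Om a v (scR c phi) = c * Bform Om a v phi.
  exact: (Bform_linr hK Om_open Om_bounded aM Hv).2.
have BZ c phi : H1 phi -> Bform Om a v (scK c phi) =
    reK c * Bform Om a v phi + imK c * Bform Om a v (scK (imag_unit K) phi).
  move=> Hp; have h1 := HR (reK c) phi Hp; have h2 := HZ (imag_unit K) phi Hp.
  by rewrite scK_split (BD _ _ h1 (HR (imK c) _ h2)) !BR.
split=> [c u w [Hu _] [Hw _]|].
  have Hcu := HZ c u Hu; have Hcuw : H1 (scK c u + w) by exact: H1_add.
  rewrite [X in f X](_ : _ = scK c u + w); last by apply/funext.
  apply: (K_eqP hK).
    rewrite (re _ Hcuw) (BD _ _ Hcu Hw) (BZ _ _ Hu) (reK_D hK) (reK_M hK) (re _ Hu) (re _ Hw) (im _ Hu).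
    move: (Bform Om a v u) (Bform Om a v (scK (imag_unit K) u)) (Bform Om a v w) (reK c) (imK c).
    by move=> *; ring.
  rewrite (im _ Hcuw) (imK_D hK) (imK_M hK) (im _ Hu) (im _ Hw) (re _ Hu).
  have -> : scK (imag_unit K) (scK c u + w) = scK c (scK (imag_unit K) u) + scK (imag_unit K) w.
    by apply/funext => x; rewrite /scK mulrDr mulrCA.
  have Hiu := HZ (imag_unit K) _ Hu; have Hiw := HZ (imag_unit K) _ Hw.
  rewrite (BD _ _ (HZ c _ Hiu) Hiw) (BZ _ _ Hiu) scK_imag2 (BR _ _ Hu).
  rewrite {2}(imK_chi hK c).
  move: (Bform Om a v u) (Bform Om a v (scK (imag_unit K) u)) (Bform Om a v (scK (imag_unit K) w)).
  by move: (reK c) (imK c) (chiK K) => *; ring.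
(* The real part contributes beta^2 |v|^2 |phi|^2, and the imaginary part, tested with i phi, at
   most twice that by [h1dot_scK_le]. *)
exists (Num.sqrt (3 * beta ^+ 2 * h1dot v v)) => phi [Hp _].
rewrite -(@ler_pXn2r _ 2)// ?nnegrE ?absK_ge0//; last by rewrite mulr_ge0 ?sqrtr_ge0// H1norm_ge0.
rewrite exprMn sqr_sqrtr; last by rewrite mulr_ge0 ?h1dot_ge0// mulr_ge0// sqr_ge0.
rewrite (H1norm_sqr hK Om_open Om_bounded Hp) (absK_sqr hK) (re _ Hp) (im _ Hp) sqrrN.
have Hip := HZ (imag_unit K) phi Hp.
have b1 := Bform_le hK Om_open Om_bounded b0 aM Hv Hp.
have b2 := Bform_le hK Om_open Om_bounded b0 aM Hv Hip.
have h2 : h1dot (scK (imag_unit K) phi) (scK (imag_unit K) phi) <= 2 * h1dot phi phi.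
  apply: le_trans (h1dot_scK_le hK Om_open Om_bounded _ Hp) _.
  rewrite ler_wpM2r ?h1dot_ge0// reK_mk// expr0n add0r -[leRHS]mulr1 ler_pM2l//.
  by case: (imK_mk hK 0 1) => e; rewrite /imag_unit e ?expr1n// expr0n.
have v0 := h1dot_ge0 Om v; have bb0 := sqr_ge0 beta.
apply: le_trans (lerD b1 b2) _; rewrite -mulrDr -mulrDr.
have -> : 3 * beta ^+ 2 * h1dot v v * h1dot phi phi = beta ^+ 2 * (h1dot v v * (3 * h1dot phi phi)).
  by move: (h1dot v v) (h1dot phi phi) => x y; ring.
exact: (ler_mul_third bb0 v0 h2).
Qed.

Section Coefficients.
Variables (alpha beta : R) (a_ : nat -> R * R -> 'M[K]_2).
Variables (al_ : nat -> R -> K) (ah am : R -> K).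
Hypotheses (alpha_gt0 : 0 < alpha) (beta_gt0 : 0 < beta).
Hypothesis (a_M : forall n, coef_class alpha beta Om (a_ n)).
Hypothesis (Lal : forall n, Linfty lam D (al_ n)).
Hypotheses (Lah : Linfty lam D ah) (Lam : Linfty lam D am).
Hypothesis a_strat : forall n, {ae mu2, forall x, Om x -> a_ n x = (al_ n x.1)%:M}.
Hypothesis Hcv : H_converges alpha beta Om a_ (adiag ah am).
Local Notation adiag := (adiag ah am).

Let aM : coef_class alpha beta Om adiag. Proof. by have [] := Hcv. Qed.

Let dl n : {ae lam, forall t, D t -> in_disc alpha beta (al_ n t)}.
Proof. exact: (strat_disc hK Om_open alpha_gt0 beta_gt0 a_M a_strat). Qed.

Let dh : {ae lam, forall t, D t -> in_disc alpha beta (ah t)}.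
Proof. exact: (adiag_disc hK Om_open alpha_gt0 beta_gt0 aM).1. Qed.

Let dm : {ae lam, forall t, D t -> in_disc alpha beta (am t)}.
Proof. exact: (adiag_disc hK Om_open alpha_gt0 beta_gt0 aM).2. Qed.

(* u_n solves the problem with right-hand side <a grad v, .>, whose solution for
   the H-limit a is v itself. *)
Lemma solutions_of_test (psi : R * R -> R) : rtest Om psi ->
  exists u_ : nat -> R * R -> K^o, exists v : R * R -> K^o,
  [/\ forall n, H10 (u_ n), H10 v, exists M, forall n, h1dot (u_ n) (u_ n) <= M,
   forall n w, H10 w -> Bform Om (a_ n) (u_ n) w = Bform Om adiag v w &
   [/\ forall p, wk0 (fun n x => cu p (u_ n) x - cu p v x),
     forall p i, wk0 (fun n x => cg Om p i (u_ n) x - cg Om p i v x),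
     forall p i, wk0 (fun n x => fl Om (a_ n) p i (u_ n) x - fl Om adiag p i v x) &
     forall p i, {ae mu2, forall x, Om x -> cg Om p i v x =
       if p then 'D_(unit_vec R i) psi x else 0}]].
Proof.
move=> tp; pose v x : K^o := mkK K (psi x) 0.
have tv : test_function Om v := mk_test_function hK tp (rtest_0 Om).
have Hv := test_H10 hK Om_open Om_bounded tv; have H1v := H10_H1 Hv.
pose f phi := L2v_dot mu2 Om (flux Om adiag v) (wgrad Om phi).
have Hf : Hm1 f := form_dual beta_gt0 aM H1v.
have /choice[u_ Su_] : forall n, exists u, solves Om (a_ n) f u.
  by move=> n; exact: (solvable hK Om_open Om_bounded alpha_gt0 beta_gt0 (a_M n) Hf).
have Sv : solves Om adiag f v by split.
have Pn n := (solvesP hK Om_open Om_bounded (a_M n) (u_ n) Hf).1 (Su_ n).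
have Hu_ n := (Pn n).1; have H1u_ n := H10_H1 (Hu_ n).
have [_ Bv] := (solvesP hK Om_open Om_bounded aM v Hf).1 Sv.
have [ll [B B0 lB]] := dual_parts hK Om_open Om_bounded true Hf.
have [C C0 CP] := apriori hK Om_open Om_bounded.
have [_ _ /(_ f Hf u_ v Su_ Sv)[wu wf]] := Hcv.
exists u_, v; split; [exact: Hu_|exact: Hv| | |].
- exists (alpha ^- 2 * (C * B)) => n; rewrite ler_pdivlMl ?exprn_gt0//.
  exact: (CP alpha beta (a_ n) (u_ n) (part true (f (u_ n))) B alpha_gt0 B0 (a_M n) (Hu_ n)
    ((Pn n).2 _ (Hu_ n)) (lB _ (Hu_ n))).
- by move=> n w Hw; rewrite (Bv w Hw); exact: (Pn n).2.
have vc p k g : sq g -> ip mu2 Om (vcomp Om p k (u_ n)) g @[n --> \oo] --> ip mu2 Om (vcomp Om p k v) g.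
  move=> sg; exact (weak_cvg_vcomp hK Om_open Om_bounded wu Hu_ Hv sg).
have cu0 p (w : R * R -> K^o) : vcomp Om p ord0 w = cu p w by rewrite /vcomp unlift_none.
have cgS p i (w : R * R -> K^o) : vcomp Om p (lift ord0 i) w = cg Om p i w by rewrite /vcomp liftK.
have vs p k w : H1 w -> sq (vcomp Om p k w) by move=> Hw; exact: vcomp_sqint.
split.
- move=> p; apply: wk0_of_cvg => [n||g sg]; rewrite -?cu0; try exact: vs.
  by apply: (cvg_ext2 _ _ (vc p ord0 g sg)) => [n|]; rewrite cu0.
- move=> p i; apply: wk0_of_cvg => [n||g sg]; rewrite -?cgS; try exact: vs.
  by apply: (cvg_ext2 _ _ (vc p (lift ord0 i) g sg)) => [n|]; rewrite cgS.
- have sfn n p i := fl_sqint hK Om_open Om_bounded (a_M n) p i (H1u_ n).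
  have sfv p i := fl_sqint hK Om_open Om_bounded aM p i H1v.
  move=> p i; apply: wk0_of_cvg => [n||g sg]; [exact: sfn|exact: sfv|].
  apply: (weak_cvg_comp hK Om_open wf _ _ sg).
    by move=> n; apply/(L2vP hK Om_open) => q j; exact: sfn.
  by apply/(L2vP hK Om_open) => q j; exact: sfv.
- move=> p i; have [_ cv] := H1_rtest hK Om_open Om_bounded tv.
  apply: aeS (cv p i) => x h Ox; rewrite h//; case: p {h}.
    by congr ('D_ _ _ _); apply/funext => y; rewrite /= reK_mk.
  transitivity ('D_(unit_vec R i) (fun _ : R * R => 0 : R) x); last exact: derive_cst.
  by congr ('D_ _ _ _); apply/funext => y; rewrite /= imK_mk0.
Qed.

Lemma partM_test_cvg (th : nat -> R -> K) (C : R) (z : nat -> R * R -> K) T p :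
  (forall q n, measurable_fun D (fun t => part q (th n t) : TR)) ->
  (forall q n, {ae lam, forall t, D t -> `|part q (th n t)| <= C}) ->
  (forall n q, sq (fun x => part q (z n x))) -> rtest Om T ->
  (forall q q', ip mu2 Om (fun x => part q' (z n x) * T x) (fun x => part q (th n x.1)) @[n --> \oo] --> 0) ->
  (forall n, sq (fun x => part p (th n x.1 * z n x))) /\
  ip mu2 Om (fun x => part p (th n x.1 * z n x)) T @[n --> \oo] --> 0.
Proof.
move=> mth thC sz tT cv.
have sT := rtest_ip Om_open Om_bounded tT.
have s n q q' : sq (fun x => part q (th n x.1) * part q' (z n x)).
  exact: (sqint_aeM mOm (multiplier_meas Om_open (mth q) n) (multiplier_le (thC q) n) (sz n q')).
pose sg : R := if p then -1 else 1.
have E n : (fun x => part p (th n x.1 * z n x)) = (fun x => part true (th n x.1) * part p (z n x) +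
    sg * (part false (th n x.1) * part (~~ p) (z n x))).
  apply/funext => x; rewrite (part_M hK) /sg; congr (_ + _).
  by case: (p); rewrite ?mul1r// mulN1r mulNr.
split=> [n|]; first by rewrite E; exact: (sqintD mOm (s n true p) (sqintZ mOm sg (s n false (~~ p)))).
have c : ip mu2 Om (fun x => part p (z n x) * T x) (fun x => part true (th n x.1)) +
    sg * ip mu2 Om (fun x => part (~~ p) (z n x) * T x) (fun x => part false (th n x.1)) @[n --> \oo] -->
    0 + sg * 0.
  by apply: cvgD; [exact: cv|apply: cvgM; [exact: cvg_cst|exact: cv]].
apply: (cvg_ext2 _ _ c) => [n|]; last by rewrite mulr0 addr0.
rewrite E (ipDl mOm (s n true p) (sqintZ mOm sg (s n false (~~ p))) sT).
rewrite (ipZl mOm sg (s n false (~~ p)) sT).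
by congr (_ + _ * _); apply: eq_Rintegral => x _; ring.
Qed.

Lemma fl_part n p i u : {ae mu2, forall x, Om x ->
  fl Om (a_ n) p i u x = part p (al_ n x.1 * wgrad Om u x i 0)}.
Proof. exact: fl_strat. Qed.

Let al_meas q n : measurable_fun D (fun t => part q (al_ n t) : TR).
Proof. exact: (Linfty_part hK (Lal n) q).1. Qed.

Let al_le q n : {ae lam, forall t, D t -> `|part q (al_ n t)| <= beta}.
Proof. by apply: aeS (dl n) => t h Dt; exact: (in_disc_part q alpha_gt0 beta_gt0 (h Dt)). Qed.

Let alV_meas q n : measurable_fun D (fun t => part q (al_ n t)^-1 : TR).
Proof. by apply: (measurable_partV hK) => p; exact: al_meas. Qed.

Let alV_le q n : {ae lam, forall t, D t -> `|part q (al_ n t)^-1| <= alpha^-1}.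
Proof.
apply: aeS (dl n) => t h Dt; have b0 : 0 < beta^-1 by rewrite invr_gt0.
have a0 : 0 < alpha^-1 by rewrite invr_gt0.
exact: (in_disc_part q b0 a0 (in_discV hK alpha_gt0 beta_gt0 (h Dt))).
Qed.

(** Two limits are subtracted: alpha_n d_2 u_n - alpha_m d_2 v tends to 0 by convergence of the
    fluxes, and alpha_n (d_2 u_n - d_2 v) tends to 0 against e k by the div-curl argument, in which
    u_n - v and its gradient are weakly null and alpha_n is merely bounded. What remains is (alpha_n
    - alpha_m) v1 v2', a product of a function of x_1 with one of x_2. *)
Lemma moment_m v1 v2 e k a b c d p : `[a, b] `*` `[c, d] `<=` Om ->
  supported a b v1 -> supported c d v2 -> supported a b e -> supported c d k ->
  ip lam D (fun t => part p (al_ n t - am t)) (fun t => v1 t * e t) *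
    \int[lam]_y (derive1 v2 y * k y) @[n --> \oo] --> 0.
Proof.
move=> rO sv1 sv2 se sk; have tp := rtest_tensor rO sv1 sv2.
have [u_ [v [Hu_ Hv [M uM] _ [wc wg wf cgv]]]] := solutions_of_test tp.
have H1u_ n := H10_H1 (Hu_ n); have H1v := H10_H1 Hv.
have tT := rtest_tensor rO se sk; have sT := rtest_ip Om_open Om_bounded tT.
have sk' := supported_derive sk.
have bd f_ f : bdd f_ -> sq f -> bdd (fun n x => f_ n x - f x).
  by move=> bf sf; exact: (bdd_sub Om_open bf (bdd_cst sf)).
have [sv sgv wv] := H1_parts hK Om_open Om_bounded H1v.
have bc q : bdd (fun n x => cu q (u_ n) x - cu q v x) by apply: bd; [exact: bdd_cu H1u_ uM|exact: sv].
have bg q i : bdd (fun n x => cg Om q i (u_ n) x - cg Om q i v x) by apply: bd; [exact: bdd_cg H1u_ uM|exact: sgv].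
have wdB n q i : weak_d Om i (fun x => cu q (u_ n) x - cu q v x) (fun x => cg Om q i (u_ n) x - cg Om q i v x).
  have [su sgu wu] := H1_parts hK Om_open Om_bounded (H1u_ n).
  have := weak_dD Om_open Om_bounded (su q) (sqintZ mOm (-1) (sv q)) (sgu q i) (sqintZ mOm (-1) (sgv q i))
    (wu q i) (weak_dZ Om_open Om_bounded (-1) (sv q) (sgv q i) (wv q i)).
  by congr weak_d; apply/funext => x; rewrite mulN1r.
have bz : bdd (fun _ : nat => fun=> 0 : R) by apply: bdd_cst; exact: sqint0.
have wz : wk0 (fun _ : nat => fun=> 0 : R).
  move=> g _; apply: (@cvg_ext _ (fun=> 0)); last exact: cvg_cst.
  by move=> n; rewrite /ip; under eq_Rintegral do rewrite mul0r; rewrite Rintegral0.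
have X q q' : ip mu2 Om (fun x => (cg Om q' 1 (u_ n) x - cg Om q' 1 v x) * tensor e k x)
    (fun x => part q (al_ n x.1)) @[n --> \oo] --> 0.
  have hdiv n psi : rtest Om psi ->
      ip mu2 Om (fun x => cu q' (u_ n) x - cu q' v x) (fun x => 'D_(unit_vec R 0) psi x) +
      ip mu2 Om (fun=> 0) (fun x => 'D_(unit_vec R 1) psi x) =
      ip mu2 Om (fun x => - (cg Om q' 0 (u_ n) x - cg Om q' 0 v x)) psi.
    move=> tps; have -> : ip mu2 Om (fun=> 0) (fun x => 'D_(unit_vec R 1) psi x) = 0.
      by rewrite /ip; under eq_Rintegral do rewrite mul0r; rewrite Rintegral0.
    rewrite addr0 [LHS](wdB n q' 0 psi tps).
    rewrite -(RintN mOm (sqintM mOm ((bg q' 0).1 n) (rtest_ip Om_open Om_bounded tps))).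
    by apply: eq_Rintegral => x _; rewrite mulNr.
  have cv := fst_div_cvg Om_open Om_bounded rO se sk' (bc q') bz (bddN Om_open (bg q' 0)) hdiv
    (multiplier_sq1 Om_open Om_bounded (al_meas q) (al_le q))
    (multiplier_ip_le Om_open Om_bounded (al_meas q) (al_le q))
    (or_intror (And3 (wc q') wz (wk0N Om_open (bg q' 0) (wg q' 0)))).
  have cvN : - ip mu2 Om (fun x => (cu q' (u_ n) x - cu q' v x) * tensor e (derive1 k) x)
    (fun x => part q (al_ n x.1)) @[n --> \oo] --> - (0 : R) by apply: cvgN; exact: cv.
  apply: (cvg_ext2 _ _ cvN) => [n|]; last by rewrite oppr0.
  by rewrite (fst_ibp Om_open Om_bounded rO se sk ((bc q').1 n) ((bg q' 1).1 n) (wdB n q' 1)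
    (multiplier_sq1 Om_open Om_bounded (al_meas q) (al_le q) n)).
pose z n (x : R * R) : K := wgrad Om (u_ n) x 1 0 - wgrad Om v x 1 0.
have zE n q : (fun x => part q (z n x)) = (fun x => cg Om q 1 (u_ n) x - cg Om q 1 v x).
  by apply/funext => x; rewrite /z (partB hK).
have sz n q : sq (fun x => part q (z n x)) by rewrite zE; exact: (bg q 1).1.
have XZ q q' : ip mu2 Om (fun x => part q' (z n x) * tensor e k x) (fun x => part q (al_ n x.1)) @[n --> \oo] --> 0.
  by apply: (cvg_ext _ (X q q')) => n; apply: eq_Rintegral => x _; rewrite /z (partB hK).
have [sY Y] := partM_test_cvg p al_meas al_le sz tT XZ.
have F := wf p 1 (tensor e k) sT.
have sfn n : sq (fl Om (a_ n) p 1 (u_ n)) by exact: (fl_sqint hK Om_open Om_bounded (a_M n)).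
have sfv : sq (fl Om adiag p 1 v) by exact: (fl_sqint hK Om_open Om_bounded aM).
have c0 : ip mu2 Om (fun x => fl Om (a_ n) p 1 (u_ n) x - fl Om adiag p 1 v x) (tensor e k) -
    ip mu2 Om (fun x => part p (al_ n x.1 * z n x)) (tensor e k) @[n --> \oo] --> 0 - (0 : R).
  by apply: cvgB; [exact: F|exact: Y].
have mdm n : measurable_fun D (fun t => part p (al_ n t - am t) : TR).
  by apply: (measurable_partB hK) => q; [exact: al_meas|exact: (Linfty_part hK Lam q).1].
have sdm n : sq1 (fun t => part p (al_ n t - am t)).
  have := sqintB mD (Linfty_sq1 hK Om_open Om_bounded p (Lal n)) (Linfty_sq1 hK Om_open Om_bounded p Lam).
  by congr sqint; apply/funext => t; rewrite (partB hK).
have sve := supported_mul se sv1.1.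
have svk := supported_mul sk (supported_derive sv2).1.
apply: (cvg_ext2 _ _ c0) => [n|]; last by rewrite subr0.
rewrite -(ipBl mOm (sqintB mOm (sfn n) sfv) (sY n) sT).
rewrite (ipC lam) -(Rint_fst_tensor Om_open Om_bounded rO sve svk (sdm n)).
have m1 := (sqintB mOm (sqintB mOm (sfn n) sfv) (sY n)).1.
have sdp : sq (fun x => 'D_(unit_vec R 1) (tensor v1 v2) x).
  by apply: rtest_ip => //; exact: rtest_derive.
have m2 := measurable_funM (meas_fst Om_open (mdm n)) sdp.1.
transitivity (ip mu2 Om (fun x => part p (al_ n x.1 - am x.1) * 'D_(unit_vec R 1) (tensor v1 v2) x) (tensor e k)).
  have e0 : {ae mu2, forall x, Om x -> tensor e k x = tensor e k x} by apply: aeW.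
  refine (ae_ip mOm _ e0 m1 m2 sT.1 sT.1).
  apply: aeS2 (fl_part n p 1 (u_ n)) (ae_all2 (fun q i => cgv q i)) => x h1 h2 Ox.
  have wv1 : wgrad Om v x 1 0 = mkK K ('D_(unit_vec R 1) (tensor v1 v2) x) 0.
    by apply: (part_eq hK) => q; rewrite (part_mk0 hK) -[LHS]/(cg Om q 1 v x) h2.
  rewrite h1// fl_adiag /= -!(partB hK) /z wv1.
  have -> (l m w y : K) : l * w - m * y - l * (w - y) = y * (l - m) by ring.
  by rewrite (part_Mr hK) mulrC.
apply: eq_Rintegral => x _; rewrite derive_tensor//= ?/tensor; [ring|exact: sv1.1|exact: sv2.1].
Qed.

Let kap_meas q n : measurable_fun D (fun t => part q ((al_ n t)^-1 * ah t - 1) : TR).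
Proof.
apply: (measurable_partB hK) => p; last exact: measurable_cst.
by apply: (measurable_partM hK) => r; [exact: alV_meas|exact: (Linfty_part hK Lah r).1].
Qed.

Let kap_le q n : {ae lam, forall t, D t -> `|part q ((al_ n t)^-1 * ah t - 1)| <=
  2 * (alpha^-1 * beta) + 1}.
Proof.
apply: aeS2 (dl n) dh => t h1 h2 Dt; rewrite (partB hK); apply: le_trans (ler_normB _ _) _.
apply: lerD; last by case: (q); rewrite /= ?reK1// ?imK1// ?normr1// normr0.
have b0 : 0 < beta^-1 by rewrite invr_gt0.
have a0 : 0 < alpha^-1 by rewrite invr_gt0.
apply: (part_mul_le hK) => r.
  exact: (in_disc_part r b0 a0 (in_discV hK alpha_gt0 beta_gt0 (h1 Dt))).
exact: (in_disc_part r alpha_gt0 beta_gt0 (h2 Dt)).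
Qed.

Let dif_meas q n : measurable_fun D (fun t => part q (al_ n t - am t) : TR).
Proof. by apply: (measurable_partB hK) => p; [exact: al_meas|exact: (Linfty_part hK Lam p).1]. Qed.

Let dif_le q n : {ae lam, forall t, D t -> `|part q (al_ n t - am t)| <= beta + beta}.
Proof.
apply: aeS2 (dl n) dm => t h1 h2 Dt; rewrite (partB hK); apply: le_trans (ler_normB _ _) _.
by apply: lerD; [exact: (in_disc_part q alpha_gt0 beta_gt0 (h1 Dt))|exact: (in_disc_part q alpha_gt0 beta_gt0 (h2 Dt))].
Qed.

(** Here d_1 u_n - d_1 v is weakly null by H-convergence, and (q_n - q)_1 / alpha_n tends to 0
    against e k by the div-curl argument, where q = a grad v and q_n - q is divergence free and
    weakly null. The difference of the two is (alpha_h / alpha_n - 1) v1' v2. *)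
Lemma moment_h v1 v2 e k a b c d p : `[a, b] `*` `[c, d] `<=` Om ->
  supported a b v1 -> supported c d v2 -> supported a b e -> supported c d k ->
  ip lam D (fun t => part p ((al_ n t)^-1 * ah t - 1)) (fun t => derive1 v1 t * e t) *
    \int[lam]_y (v2 y * k y) @[n --> \oo] --> 0.
Proof.
move=> rO sv1 sv2 se sk; have tp := rtest_tensor rO sv1 sv2.
have [u_ [v [Hu_ Hv [M uM] eqB [wc wg wf cgv]]]] := solutions_of_test tp.
have H1u_ n := H10_H1 (Hu_ n); have H1v := H10_H1 Hv.
have tT := rtest_tensor rO se sk; have sT := rtest_ip Om_open Om_bounded tT.
have sfv q i : sq (fl Om adiag q i v) by exact: (fl_sqint hK Om_open Om_bounded aM).
have bf q i : bdd (fun n x => fl Om (a_ n) q i (u_ n) x - fl Om adiag q i v x).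
  apply: (bdd_sub Om_open) (bdd_cst (sfv q i)).
  exact: (bdd_fl hK Om_open Om_bounded beta_gt0 a_M q i H1u_ uM).
have [_ sgv _] := H1_parts hK Om_open Om_bounded H1v.
have sgn n q i : sq (cg Om q i (u_ n)) by have [_ sg _] := H1_parts hK Om_open Om_bounded (H1u_ n).
have bz : bdd (fun _ : nat => fun=> 0 : R) by apply: bdd_cst; exact: sqint0.
have z0 h : ip mu2 Om (fun=> 0) h = 0.
  by rewrite /ip; under eq_Rintegral do rewrite mul0r; rewrite Rintegral0.
have wz : wk0 (fun _ : nat => fun=> 0 : R).
  by move=> g _; apply: (@cvg_ext _ (fun=> 0)); [move=> n; rewrite z0|exact: cvg_cst].
have hdiv q n psi : rtest Om psi ->
    ip mu2 Om (fun x => fl Om (a_ n) q 0 (u_ n) x - fl Om adiag q 0 v x) (fun x => 'D_(unit_vec R 0) psi x) +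
    ip mu2 Om (fun x => fl Om (a_ n) q 1 (u_ n) x - fl Om adiag q 1 v x) (fun x => 'D_(unit_vec R 1) psi x) =
    ip mu2 Om (fun=> 0) psi.
  move=> tps; have [phi Hphi h] := Bform_rtest hK Om_open Om_bounded q tps.
  have := eqB n phi Hphi; rewrite (h _ _ _ _ (a_M n) (H1u_ n)) (h _ _ _ _ aM H1v).
  pose S (b : R * R -> 'M[K]_2) (w : R * R -> K^o) i := ip mu2 Om (fl Om b q i w) (fun x => 'D_(unit_vec R i) psi x).
  have sfn i : sq (fl Om (a_ n) q i (u_ n)) by exact: (fl_sqint hK Om_open Om_bounded (a_M n)).
  have sd i : sq (fun x => 'D_(unit_vec R i) psi x) by apply: rtest_ip => //; exact: rtest_derive.
  move=> e0; have e1 : S (a_ n) (u_ n) 0 + S (a_ n) (u_ n) 1 = S adiag v 0 + S adiag v 1.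
    exact (etrans (esym (sum2E (S (a_ n) (u_ n)))) (etrans e0 (sum2E (S adiag v)))).
  rewrite z0 (ipBl mOm (sfn 0) (sfv q 0) (sd 0)) (ipBl mOm (sfn 1) (sfv q 1) (sd 1)).
  exact (subD_eq0 e1).
have X q q' : ip mu2 Om (fun x => (fl Om (a_ n) q' 0 (u_ n) x - fl Om adiag q' 0 v x) * tensor e k x)
    (fun x => part q (al_ n x.1)^-1) @[n --> \oo] --> 0.
  exact: (fst_div_cvg Om_open Om_bounded rO se sk (bf q' 0) (bf q' 1) bz (hdiv q')
    (multiplier_sq1 Om_open Om_bounded (alV_meas q) (alV_le q))
    (multiplier_ip_le Om_open Om_bounded (alV_meas q) (alV_le q))
    (or_intror (And3 (wf q' 0) (wf q' 1) wz))).
pose z n (x : R * R) : K := flux Om (a_ n) (u_ n) x 0 0 - flux Om adiag v x 0 0.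
have zE n q : (fun x => part q (z n x)) = (fun x => fl Om (a_ n) q 0 (u_ n) x - fl Om adiag q 0 v x).
  by apply/funext => x; rewrite /z (partB hK).
have sz n q : sq (fun x => part q (z n x)) by rewrite zE; exact: (bf q 0).1.
have XZ q q' : ip mu2 Om (fun x => part q' (z n x) * tensor e k x) (fun x => part q (al_ n x.1)^-1) @[n --> \oo] --> 0.
  by apply: (cvg_ext _ (X q q')) => n; apply: eq_Rintegral => x _; rewrite /z (partB hK).
have [sY Y] := partM_test_cvg p alV_meas alV_le sz tT XZ.
have F := wg p 0 (tensor e k) sT.
have c0 : ip mu2 Om (fun x => cg Om p 0 (u_ n) x - cg Om p 0 v x) (tensor e k) -
    ip mu2 Om (fun x => part p ((al_ n x.1)^-1 * z n x)) (tensor e k) @[n --> \oo] --> 0 - (0 : R).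
  by apply: cvgB; [exact: F|exact: Y].
have sdm n : sq1 (fun t => part p ((al_ n t)^-1 * ah t - 1)).
  exact: (multiplier_sq1 Om_open Om_bounded (kap_meas p) (kap_le p) n).
have sve := supported_mul se (supported_derive sv1).1.
have svk := supported_mul sk sv2.1.
apply: (cvg_ext2 _ _ c0) => [n|]; last by rewrite subr0.
rewrite -(ipBl mOm (sqintB mOm (sgn n p 0) (sgv p 0)) (sY n) sT).
rewrite (ipC lam) -(Rint_fst_tensor Om_open Om_bounded rO sve svk (sdm n)).
have m1 := (sqintB mOm (sqintB mOm (sgn n p 0) (sgv p 0)) (sY n)).1.
have sdp : sq (fun x => 'D_(unit_vec R 0) (tensor v1 v2) x).
  by apply: rtest_ip => //; exact: rtest_derive.
have m2 := measurable_funM (meas_fst Om_open (kap_meas p n)) sdp.1.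
transitivity (ip mu2 Om (fun x => part p ((al_ n x.1)^-1 * ah x.1 - 1) * 'D_(unit_vec R 0) (tensor v1 v2) x) (tensor e k)).
  have e0 : {ae mu2, forall x, Om x -> tensor e k x = tensor e k x} by apply: aeW.
  refine (ae_ip mOm _ e0 m1 m2 sT.1 sT.1).
  have nz : {ae mu2, forall x, Om x -> al_ n x.1 != 0 /\ a_ n x = (al_ n x.1)%:M}.
    apply: aeS2 (ae_fst_comp (dl n)) (a_strat n) => x h1 h2 Ox; split; last exact: h2.
    have Dx : D x.1 by exists x.
    by apply: (reK_neq0 hK); apply: lt_le_trans alpha_gt0 _; have [] := h1 Dx.
  apply: aeS2 nz (ae_all2 (fun q i => cgv q i)) => x h1 h2 Ox; have [l0 ex] := h1 Ox.
  have wv1 : wgrad Om v x 0 0 = mkK K ('D_(unit_vec R 0) (tensor v1 v2) x) 0.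
    by apply: (part_eq hK) => q; rewrite (part_mk0 hK) -[LHS]/(cg Om q 0 v x) h2.
  rewrite /cg -!(partB hK) /z /flux ex mul_scalar_mx mxE mul_diag_mx !mxE /= wv1.
  have E (l m w y : K) : l != 0 -> w - y - l^-1 * (l * w - m * y) = y * (l^-1 * m - 1).
    by move=> nl; field.
  by rewrite E// (part_Mr hK) mulrC.
apply: eq_Rintegral => x _; rewrite derive_tensor//= ?/tensor; [ring|exact: sv1.1|exact: sv2.1].
Qed.

Lemma cvg_mul_inv (x_ : nat -> R) (I : R) : I != 0 -> x_ n * I @[n --> \oo] --> 0 ->
  x_ n @[n --> \oo] --> 0.
Proof.
move=> I0 c; have c2 : x_ n * I * I^-1 @[n --> \oo] --> 0 * I^-1.
  by apply: cvgM; [exact: c|exact: cvg_cst].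
by apply: (cvg_ext2 _ _ c2) => [n|]; rewrite ?mulfK// mul0r.
Qed.

Lemma weak_dif p g : sq1 g -> ip lam D (fun t => part p (al_ n t - am t)) g @[n --> \oo] --> 0.
Proof.
move: g; apply: (multiplier_dense (dif_meas p) (dif_le p)) => a b c d k cd rO k0.
(* The square of the bump with parameter k / 2 is the bump with parameter k that is to be tested. *)
have k2 : 0 < k / 2 by rewrite divr_gt0.
have sp := bump_supported a b k2; have sc := bump_supported c d (@ltr01 R).
have sic := supported_idM sc.
(* The moments for (v2, k) = (t chi, chi) and (chi, t chi) share their first factor, and their
   second factors differ by the integral of chi^2, which is positive because c < d. *)
have m1 := moment_m p rO sp sic sp sc; have m2 := moment_m p rO sp sc sp sic.
set chi := bumpf c d 1 in sc sic m1 m2 *.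
have i1 := supported_intg (supported_mul sc (supported_derive sic).1).
have i2 := supported_intg (supported_mul sic (supported_derive sc).1).
pose I := \int[lam]_y (chi y * chi y).
have I0 : I != 0.
  rewrite gt_eqF// /I (_ : (fun y => chi y * chi y) = bumpf c d (2 * 1)).
    by apply: bump_int_gt0 => //; rewrite mulr1.
  by apply/funext => y; rewrite bump_sqr.
have E : \int[lam]_y (derive1 (fun t => t * chi t) y * chi y) -
    \int[lam]_y (derive1 chi y * (y * chi y)) = I.
  rewrite -(RintegralB measurableT i1 i2); apply: eq_Rintegral => y _.
  exact: (derive1_idM y sc).
apply: (cvg_mul_inv I0).
pose x_ n := ip lam D (fun t => part p (al_ n t - am t)) (fun t => bumpf a b (k / 2) t * bumpf a b (k / 2) t).
have cc : x_ n * \int[lam]_y (derive1 (fun t => t * chi t) y * chi y) -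
  x_ n * \int[lam]_y (derive1 chi y * (y * chi y)) @[n --> \oo] --> 0 - (0 : R).
  by apply: cvgB; [exact: m1|exact: m2].
apply: (cvg_ext2 _ _ cc) => [n|]; last by rewrite subr0.
rewrite -mulrBr E; congr (_ * _); apply: eq_Rintegral => t _; congr (_ * _).
by rewrite bump_sqr//; congr bumpf; field.
Qed.

Lemma weak_kap p g : sq1 g ->
  ip lam D (fun t => part p ((al_ n t)^-1 * ah t - 1)) g @[n --> \oo] --> 0.
Proof.
move: g; apply: (multiplier_dense (kap_meas p) (kap_le p)) => a b c d k cd rO k0.
have k2 : 0 < k / 2 by rewrite divr_gt0.
have sp := bump_supported a b k2; have sc := bump_supported c d (@ltr01 R).
have sip := supported_idM sp.
(* Now the derivative falls on v1, so the factor t is exchanged between v1 and e, and the second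
   factor is the integral of chi^2 both times. *)
have m1 := moment_h p rO sip sc sp sc; have m2 := moment_h p rO sp sc sip sc.
set psi := bumpf a b (k / 2) in sp sip m1 m2 *; set chi := bumpf c d 1 in sc m1 m2 *.
have s1 := supported_sqint1 Om_open Om_bounded (supported_mul sp (supported_derive sip).1).
have s2 := supported_sqint1 Om_open Om_bounded (supported_mul sip (supported_derive sp).1).
pose I := \int[lam]_y (chi y * chi y).
have I0 : I != 0.
  rewrite gt_eqF// /I (_ : (fun y => chi y * chi y) = bumpf c d (2 * 1)).
    by apply: bump_int_gt0 => //; rewrite mulr1.
  by apply/funext => y; rewrite bump_sqr.
apply: (cvg_mul_inv I0).
have sdm n : sq1 (fun t => part p ((al_ n t)^-1 * ah t - 1)).
  exact: (multiplier_sq1 Om_open Om_bounded (kap_meas p) (kap_le p) n).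
have cc : ip lam D (fun t => part p ((al_ n t)^-1 * ah t - 1)) (fun t => derive1 (fun t => t * psi t) t * psi t) * I -
   ip lam D (fun t => part p ((al_ n t)^-1 * ah t - 1)) (fun t => derive1 psi t * (t * psi t)) * I
   @[n --> \oo] --> 0 - (0 : R).
  by apply: cvgB; [exact: m1|exact: m2].
apply: (cvg_ext2 _ _ cc) => [n|]; last by rewrite subr0.
rewrite -mulrBl; congr (_ * _); rewrite ipC [X in _ - X]ipC -(ipBl mD s1 s2 (sdm n)) ipC.
apply: eq_Rintegral => t _; congr (_ * _); rewrite (derive1_idM t sp).
by rewrite /psi bump_sqr//; congr bumpf; field.
Qed.

Lemma H_converges_weak_star :
  [/\ {ae lam, forall t, D t -> ah t != 0},
      weak_star_cvg lam D (fun n t => (al_ n t)^-1) (fun t => (ah t)^-1)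
    & weak_star_cvg lam D al_ am].
Proof.
have a0 : 0 < alpha^-1 by rewrite invr_gt0.
have b0 : 0 < beta^-1 by rewrite invr_gt0.
have hm q := (Linfty_part hK Lah q).1.
have dhV : {ae lam, forall t, D t -> in_disc beta^-1 alpha^-1 (ah t)^-1}.
  by apply: aeS dh => t h Dt; apply: in_discV => //; exact: h.
have mhV := measurable_partV hK hm.
split.
- by apply: aeS dh => t h Dt; apply: (reK_neq0 hK); apply: lt_le_trans alpha_gt0 _; have [] := h Dt.
- have LhV : Linfty lam D (fun t => (ah t)^-1) by exact: (in_disc_Linfty hK b0 a0 mhV dhV).
  apply: (@weak_star_intro _ _ hK _ Om_open Om_bounded _ _ (alpha^-1 + alpha^-1)) => //.
  + move=> n; apply: (in_disc_Linfty hK b0 a0 (fun q => alV_meas q n)).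
    by apply: aeS (dl n) => t h Dt; apply: in_discV => //; exact: h.
  + move=> n; apply: aeS2 (dl n) dhV => t h1 h2 Dt p; rewrite (partB hK).
    apply: le_trans (ler_normB _ _) _; apply: lerD; last exact: (in_disc_part p b0 a0 (h2 Dt)).
    exact: (in_disc_part p b0 a0 (in_discV hK alpha_gt0 beta_gt0 (h1 Dt))).
  + by rewrite addr_ge0// ltW.
  + move=> p g sg.
    (* 1/alpha_n - 1/alpha_h = (alpha_h / alpha_n - 1) / alpha_h, and the bounded factor 1/alpha_h
       is absorbed into the test function. *)
    have sgh q : sq1 (fun t => part q (ah t)^-1 * g t).
      by have [m [C hC]] := Linfty_part hK LhV q; exact: (sqint_aeM mD m hC sg).
    have sdm q n : sq1 (fun t => part q ((al_ n t)^-1 * ah t - 1)).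
      exact: (multiplier_sq1 Om_open Om_bounded (kap_meas q) (kap_le q) n).
    pose s : R := if p then -1 else 1.
    have c : ip lam D (fun t => part true ((al_ n t)^-1 * ah t - 1)) (fun t => part p (ah t)^-1 * g t) +
       s * ip lam D (fun t => part false ((al_ n t)^-1 * ah t - 1)) (fun t => part (~~ p) (ah t)^-1 * g t)
       @[n --> \oo] --> 0 + s * 0.
      by apply: cvgD; [exact: weak_kap|apply: cvgM; [exact: cvg_cst|exact: weak_kap]].
    apply: (cvg_ext2 _ _ c) => [n|]; last by rewrite mulr0 addr0.
    have i1 := sqintM mD (sdm true n) (sgh p); have i2 := sqintM mD (sdm false n) (sgh (~~ p)).
    rewrite /ip -(RintegralZl _ mD i2) -(RintegralD mD i1 (intgZ mD s i2)).
    apply: (ae_Rint mD).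
    * apply: aeS dh => t h Dt.
      have h0 : ah t != 0 by apply: (reK_neq0 hK); apply: lt_le_trans alpha_gt0 _; have [] := h Dt.
      have -> : (al_ n t)^-1 - (ah t)^-1 = ((al_ n t)^-1 * ah t - 1) * (ah t)^-1.
        by rewrite mulrBl mulfK// mul1r.
      rewrite (part_M hK p _ (ah t)^-1) /s; move: (_ - 1) => k0.
      by case: (p); rewrite mulrDl mulrA ?mul1r ?mulN1r ?mulNr mulrA.
    * exact: (measurable_funD (intg_meas i1) (intg_meas (intgZ mD s i2))).
    * apply: measurable_funM; last exact: sg.1.
      by apply: (measurable_partB hK) => q; [exact: alV_meas|exact: mhV].
- apply: (@weak_star_intro _ _ hK _ Om_open Om_bounded _ _ (beta + beta)) => //.
  + move=> n; apply: aeS2 (dl n) dm => t h1 h2 Dt p; rewrite (partB hK).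
    apply: le_trans (ler_normB _ _) _.
    by apply: lerD; [exact: (in_disc_part p alpha_gt0 beta_gt0 (h1 Dt))|exact: (in_disc_part p alpha_gt0 beta_gt0 (h2 Dt))].
  + by rewrite addr_ge0// ltW.
  + by move=> p g sg; exact: weak_dif.
Qed.

End Coefficients.
End Necessity.

Theorem theorem2p1p1 (R : realType) (K : scalar_field R)
    (hK : K = real_scalars R \/ K = complex_scalars R)
    (Omega : set (R * R)) (Omega_open : open Omega)
    (Omega_bounded : bounded_set Omega)
    (alpha beta : R) (alpha_gt0 : 0 < alpha) (alpha_le_beta : alpha <= beta)
    (a_ : nat -> R * R -> 'M[K]_2)
    (a_M : forall n, coef_class alpha beta Omega (a_ n))
    (alpha_ : nat -> R -> K) (alpha_h alpha_m : R -> K)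
    (alpha_Linfty :
      forall n, Linfty (@lebesgue_measure R) (fst @` Omega) (alpha_ n))
    (alpha_h_Linfty : Linfty (@lebesgue_measure R) (fst @` Omega) alpha_h)
    (alpha_m_Linfty : Linfty (@lebesgue_measure R) (fst @` Omega) alpha_m)
    (a_stratified : forall n,
      {ae lebesgue2 R, forall x, Omega x -> a_ n x = (alpha_ n x.1)%:M}) :
  H_converges alpha beta Omega a_
    (fun x => diag_mx
      (\row_(i < 2) (if i == 0 then alpha_h x.1 else alpha_m x.1)))
  <->
  [/\ {ae @lebesgue_measure R, forall t, (fst @` Omega) t -> alpha_h t != 0},
      weak_star_cvg (@lebesgue_measure R) (fst @` Omega)
        (fun n t => (alpha_ n t)^-1) (fun t => (alpha_h t)^-1)
    & weak_star_cvg (@lebesgue_measure R) (fst @` Omega) alpha_ alpha_m].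
Proof.
have beta_gt0 : 0 < beta := lt_le_trans alpha_gt0 alpha_le_beta.
split=> [Hcv|[_ cvh cvm]].
  exact: (H_converges_weak_star hK Omega_open Omega_bounded alpha_gt0 beta_gt0 a_M
    alpha_Linfty alpha_h_Linfty alpha_m_Linfty a_stratified Hcv).
exact: (weak_star_H_converges hK Omega_open Omega_bounded alpha_gt0 beta_gt0 a_M
  alpha_Linfty alpha_h_Linfty alpha_m_Linfty a_stratified cvh cvm).
Qed.
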